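(* Let $f:(R,\mathfrak{m},k)\rightarrow (S,\mathfrak{n},l)$ be a local homomorphism of noetherian local rings, and let $M$ be a non-zero artinian $S$-module, regarded as an $R$-module via $f$, such that $\operatorname{fd}_{R}(M)\leq \operatorname{edim}(R)-\operatorname{edim}(S)$. Then the following assertions hold: (i) $M$ is a free $S$-module, i.e. $M\cong S^{\mu_{S}(M)}$. (ii) $f$ is an exceptional complete intersection map. (iii) $\operatorname{fd}_{R}(M)=\operatorname{edim}(R)-\operatorname{edim}(S)=\operatorname{fd}_{R}(S)$. In particular, if $M$ is flat as an $R$-module, then $\operatorname{edim}(R)=\operatorname{edim}(S)$ and $f$ is flat.
   Context: All rings are commutative with unity. For a local ring, the notation $(R,\mathfrak{m},k)$ records the maximal ideal $\mathfrak{m}$ and residue field $k=R/\mathfrak{m}$. A ring homomorphism $f:(R,\mathfrak{m})\to(S,\mathfrak{n})$ of local rings is local if $f(\mathfrak{m})\subseteq\mathfrak{n}$. $\operatorname{fd}$ denotes flat dimension, $\dim$ is Krull dimension, $\mu_S(M)$ is the minimal number of generators of $M$ over $S$ (that $M$ is finitely generated is part of the conclusion (i)), and $\operatorname{edim}(R)$ is the minimal number of generators of $\mathfrak{m}$. Cohen factorization: every local homomorphism $f:(R,\mathfrak{m})\to S$ of noetherian local rings admits a factorization of the composite $R\xrightarrow{f} S\to\widehat{S}$ (with $\widehat{S}$ the completion of $S$ at its maximal ideal) as $R\xrightarrow{\dot f}R'\xrightarrow{f'}\widehat{S}$, where $R'$ is a noetherian local ring, $\dot f$ and $f'$ are local,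 $\dot f$ is flat with regular closed fiber $R'/\mathfrak{m}R'$, and $f'$ is surjective. The map $f$ is a complete intersection map if there is a Cohen factorization such that $\operatorname{Ker}(f')$ is generated by a (possibly empty) regular sequence on $R'$ (this is independent of the chosen Cohen factorization). For a complete intersection map $f$ one has $\operatorname{edim}(R)-\dim(R)\leq\operatorname{edim}(S)-\dim(S)$; $f$ is an exceptional complete intersection map if it is a complete intersection map and equality holds here. *)

(* Defs.v *)
From HB Require Import structures.
From mathcomp Require Import all_boot all_order all_algebra.
From mathcomp Require Import generic_quotient.
From mathcomp Require Import boolp classical_sets constructive_ereal.

Set Implicit Arguments.
Unset Strict Implicit.
Unset Printing Implicit Defensive.

Import GRing.Theory.
Local Open Scope classical_set_scope.
Local Open Scope quotient_scope.
Local Open Scope ring_scope.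

(* Infimum in Z U {-oo, +oo} of a set of natural numbers (+oo when empty). *)
Definition inf_nat (P : nat -> Prop) : \bar int :=
  match pselect (exists n, `[< P n >]) with
  | left h => (Posz (ex_minn h))%:E
  | right _ => +oo%E
  end.

Section Submodules.
Variables (R : pzRingType) (M : lmodType R).

Definition submodule (N : set M) : Prop :=
  [/\ N 0, forall x y, N x -> N y -> N (x + y)
    & forall (a : R) x, N x -> N (a *: x)].

Definition span (A : set M) : set M :=
  [set x | forall N, submodule N -> A `<=` N -> N x].

Lemma span_submodule (A : set M) : submodule (span A).
Proof.
split=> [N [] // |x y hx hy N sN AN|a x hx N sN AN].
- by case: (sN) => _ D _; apply: D; [apply: hx|apply: hy].
- by case: (sN) => _ _ Z; apply: Z; apply: hx.
Qed.

Definition num_gens (N : set M) : \bar int :=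
  inf_nat (fun n => exists x : 'I_n -> M, N = span (range x)).

Definition artinian : Prop :=
  forall N : nat -> set M,
    (forall i, submodule (N i)) -> (forall i, N i.+1 `<=` N i) ->
    exists i, forall j, (i <= j)%N -> N j = N i.

End Submodules.

(* mu_R(M); it equals +oo when M is not finitely generated. *)
Definition mu (R : pzRingType) (M : lmodType R) : \bar int :=
  num_gens (setT : set M).

Arguments artinian {R} M.
Arguments mu {R} M.

Section Ideals.
Variable R : comPzRingType.

Definition is_ideal (I : set R) : Prop := @submodule R R^o I.

Definition idl (A : set R) : set R := @span R R^o A.

Lemma idl_ideal (A : set R) : is_ideal (idl A).
Proof. exact: span_submodule. Qed.

Definition prime_ideal (p : set R) : Prop :=
  [/\ is_ideal p, ~ p 1 & forall x y, p (x * y) -> p x \/ p y].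

Definition maximal_ideal (m : set R) : Prop :=
  [/\ is_ideal m, ~ m 1
    & forall J, is_ideal J -> ~ J 1 -> m `<=` J -> J = m].

Definition local_ring (m : set R) : Prop :=
  maximal_ideal m /\ forall J, maximal_ideal J -> J = m.

Definition noetherian_ring : Prop :=
  forall I : set R, is_ideal I -> exists s : seq R, I = idl [set` s].

Definition prime_chain (n : nat) : Prop :=
  exists p : nat -> set R,
    (forall i, (i <= n)%N -> prime_ideal (p i)) /\
    (forall i, (i < n)%N -> p i `<` p i.+1).

Definition krull_dim : \bar int :=
  if `[< exists n, prime_chain n >]
  then inf_nat (fun N => forall n, prime_chain n -> (n <= N)%N)
  else -oo%E.

(* Used with m the maximal ideal of a local ring R: this is edim(R). *)
Definition edim (m : set R) : \bar int := @num_gens R R^o m.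

Definition regular_local_ring : Prop :=
  noetherian_ring /\ exists m, local_ring m /\ edim m = krull_dim.

Definition regular_sequence (s : seq R) : Prop :=
  (forall i, (i < size s)%N -> forall y : R,
     idl [set` take i s] (s`_i * y) -> idl [set` take i s] y) /\
  ~ idl [set` s] 1.

Fixpoint ideal_pow (I : set R) (i : nat) : set R :=
  if i is j.+1
  then idl [set x | exists a b, [/\ I a, ideal_pow I j b & x = a * b]]
  else setT.

End Ideals.

Arguments noetherian_ring R : clear implicits.
Arguments krull_dim R : clear implicits.
Arguments regular_local_ring R : clear implicits.

(* The quotient ring R/(A) of R by the ideal generated by A.  The ring
   quotients of ring_quotient are restricted to proper ideals and would exclude
   the factor S/n^0 = 0 in the inverse limit below. *)
Section QuotientRing.
Variables (R : comPzRingType) (A : set R).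

Definition idl_eqv : rel R := fun x y => `[< idl A (x - y) >].

Lemma idl0 : idl A 0. Proof. by case: (idl_ideal A). Qed.
Lemma idlD x y : idl A x -> idl A y -> idl A (x + y).
Proof. by case: (idl_ideal A) => _ D _; apply: D. Qed.
Lemma idlM a x : idl A x -> idl A (a * x).
Proof. by case: (idl_ideal A) => _ _ Z; apply: (Z a x). Qed.
Lemma idlN x : idl A x -> idl A (- x).
Proof. by rewrite -mulN1r; apply: idlM. Qed.

Lemma idl_eqv_equiv : equiv_class_of idl_eqv.
Proof.
split=> [x|x y|y x z].
- by apply/asboolP; rewrite subrr; apply: idl0.
- by apply/asboolP/asboolP => /idlN; rewrite opprB.
- by move=> /asboolP h /asboolP h'; apply/asboolP; rewrite -(subrKA y); apply: idlD.
Qed.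

Canonical idl_eqv_rel := EquivRelPack idl_eqv_equiv.
Canonical idl_eqv_encModRel := defaultEncModRel idl_eqv.

Definition quot_ring : Type := {eq_quot idl_eqv}.
HB.instance Definition _ : EqQuotient R idl_eqv quot_ring :=
  EqQuotient.on quot_ring.
HB.instance Definition _ := Choice.on quot_ring.

Definition quot_pi : R -> quot_ring := \pi_quot_ring.

Lemma quot_piP x y : quot_pi x = quot_pi y <-> idl A (x - y).
Proof. by split=> [/eqmodP/asboolP|h] //; apply/eqmodP/asboolP. Qed.

Lemma quot_pi_surj (u : quot_ring) : exists x, quot_pi x = u.
Proof. by exists (repr u); rewrite /quot_pi reprK. Qed.

Definition quot_lift1 (op : R -> R) (u : quot_ring) : quot_ring :=
  quot_pi (op (repr u)).
Definition quot_lift2 (op : R -> R -> R) (u v : quot_ring) : quot_ring :=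
  quot_pi (op (repr u) (repr v)).

Lemma idl_repr x : idl A (repr (quot_pi x) - x).
Proof. by apply/quot_piP; rewrite /quot_pi reprK. Qed.

Let addE x y : quot_lift2 +%R (quot_pi x) (quot_pi y) = quot_pi (x + y).
Proof.
by apply/quot_piP; rewrite opprD addrACA; apply: idlD; apply: idl_repr.
Qed.

Let oppE x : quot_lift1 -%R (quot_pi x) = quot_pi (- x).
Proof. by apply/quot_piP; rewrite -opprD; apply: idlN; apply: idl_repr. Qed.

Let mulE x y : quot_lift2 *%R (quot_pi x) (quot_pi y) = quot_pi (x * y).
Proof.
apply/quot_piP; rewrite -(subrKA (x * repr (quot_pi y))) -mulrBl -mulrBr.
by apply: idlD; [rewrite [X in idl A X]mulrC|]; apply: idlM; apply: idl_repr.
Qed.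

Let addA : associative (quot_lift2 +%R).
Proof.
move=> u v w; have [x <-] := quot_pi_surj u; have [y <-] := quot_pi_surj v.
by have [z <-] := quot_pi_surj w; rewrite !addE addrA.
Qed.
Let addC : commutative (quot_lift2 +%R).
Proof.
move=> u v; have [x <-] := quot_pi_surj u; have [y <-] := quot_pi_surj v.
by rewrite !addE addrC.
Qed.
Let add0 : left_id (quot_pi 0) (quot_lift2 +%R).
Proof. by move=> u; have [x <-] := quot_pi_surj u; rewrite addE add0r. Qed.
Let addN : left_inverse (quot_pi 0) (quot_lift1 -%R) (quot_lift2 +%R).
Proof. by move=> u; have [x <-] := quot_pi_surj u; rewrite oppE addE addNr. Qed.

HB.instance Definition _ := GRing.isZmodule.Build quot_ring addA addC add0 addN.

Let mulA : associative (quot_lift2 *%R).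
Proof.
move=> u v w; have [x <-] := quot_pi_surj u; have [y <-] := quot_pi_surj v.
by have [z <-] := quot_pi_surj w; rewrite !mulE mulrA.
Qed.
Let mulC : commutative (quot_lift2 *%R).
Proof.
move=> u v; have [x <-] := quot_pi_surj u; have [y <-] := quot_pi_surj v.
by rewrite !mulE mulrC.
Qed.
Let mul1 : left_id (quot_pi 1) (quot_lift2 *%R).
Proof. by move=> u; have [x <-] := quot_pi_surj u; rewrite mulE mul1r. Qed.
Let mulD : left_distributive (quot_lift2 *%R) (quot_lift2 +%R).
Proof.
move=> u v w; have [x <-] := quot_pi_surj u; have [y <-] := quot_pi_surj v.
by have [z <-] := quot_pi_surj w; rewrite !(addE, mulE) mulrDl.
Qed.

HB.instance Definition _ :=
  GRing.Zmodule_isComPzRing.Build quot_ring mulA mulC mul1 mulD.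

Let quot_pi_zmod_morphism : zmod_morphism quot_pi.
Proof. by move=> x y; rewrite -addE -oppE. Qed.
HB.instance Definition _ :=
  GRing.isZmodMorphism.Build R quot_ring quot_pi quot_pi_zmod_morphism.

Let quot_pi_monoid_morphism : monoid_morphism quot_pi.
Proof. by split=> // x y; rewrite -mulE. Qed.
HB.instance Definition _ :=
  GRing.isMonoidMorphism.Build R quot_ring quot_pi quot_pi_monoid_morphism.

End QuotientRing.

(* The I-adic completion, i.e. the inverse limit of the rings S/I^i: the families
   (x_i) such that the projection S/I^(i+1) -> S/I^i sends x_(i+1) to x_i. *)
Section Completion.
Variables (S : comPzRingType) (I : set S).

Definition coherent (x : forall i, quot_ring (ideal_pow I i)) : Prop :=
  forall i, exists s : S, x i = quot_pi _ s /\ x i.+1 = quot_pi _ s.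

Record completion : Type := Completion {
  compl_proj : forall i, quot_ring (ideal_pow I i);
  compl_coherent : coherent compl_proj
}.

Lemma completionP (x y : completion) :
  (forall i, compl_proj x i = compl_proj y i) -> x = y.
Proof.
case: x y => [x cx] [y cy] /= exy.
have {exy} exy : x = y by apply: functional_extensionality_dep.
by case: y / exy cy => cy; congr Completion; apply: Prop_irrelevance.
Qed.

HB.instance Definition _ := gen_eqMixin completion.
HB.instance Definition _ := gen_choiceMixin completion.

Lemma coherent_of (s : S) : coherent (fun i => quot_pi _ s).
Proof. by move=> i; exists s. Qed.

Lemma coherent_opp x : coherent x -> coherent (fun i => - x i).
Proof. by move=> cx i; have [s [-> ->]] := cx i; exists (- s); rewrite !rmorphN. Qed.

Lemma coherent_add x y :
  coherent x -> coherent y -> coherent (fun i => x i + y i).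
Proof.
move=> cx cy i; have [s [-> ->]] := cx i; have [t [-> ->]] := cy i.
by exists (s + t); rewrite !rmorphD.
Qed.

Lemma coherent_mul x y :
  coherent x -> coherent y -> coherent (fun i => x i * y i).
Proof.
move=> cx cy i; have [s [-> ->]] := cx i; have [t [-> ->]] := cy i.
by exists (s * t); rewrite !rmorphM.
Qed.

Definition compl_of (s : S) : completion := Completion (coherent_of s).
Definition compl_opp (x : completion) : completion :=
  Completion (coherent_opp (compl_coherent x)).
Definition compl_add (x y : completion) : completion :=
  Completion (coherent_add (compl_coherent x) (compl_coherent y)).
Definition compl_mul (x y : completion) : completion :=
  Completion (coherent_mul (compl_coherent x) (compl_coherent y)).

Let addA : associative compl_add.
Proof. by move=> x y z; apply: completionP => i /=; rewrite addrA. Qed.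
Let addC : commutative compl_add.
Proof. by move=> x y; apply: completionP => i /=; rewrite addrC. Qed.
Let add0 : left_id (compl_of 0) compl_add.
Proof. by move=> x; apply: completionP => i /=; rewrite rmorph0 add0r. Qed.
Let addN : left_inverse (compl_of 0) compl_opp compl_add.
Proof. by move=> x; apply: completionP => i /=; rewrite rmorph0 addNr. Qed.

HB.instance Definition _ := GRing.isZmodule.Build completion addA addC add0 addN.

Let mulA : associative compl_mul.
Proof. by move=> x y z; apply: completionP => i /=; rewrite mulrA. Qed.
Let mulC : commutative compl_mul.
Proof. by move=> x y; apply: completionP => i /=; rewrite mulrC. Qed.
Let mul1 : left_id (compl_of 1) compl_mul.
Proof. by move=> x; apply: completionP => i /=; rewrite rmorph1 mul1r. Qed.
Let mulD : left_distributive compl_mul compl_add.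
Proof. by move=> x y z; apply: completionP => i /=; rewrite mulrDl. Qed.

HB.instance Definition _ :=
  GRing.Zmodule_isComPzRing.Build completion mulA mulC mul1 mulD.

Let compl_of_zmod_morphism : zmod_morphism compl_of.
Proof. by move=> x y; apply: completionP => i /=; rewrite rmorphB. Qed.
HB.instance Definition _ :=
  GRing.isZmodMorphism.Build S completion compl_of compl_of_zmod_morphism.

Let compl_of_monoid_morphism : monoid_morphism compl_of.
Proof. by split=> // x y; apply: completionP => i /=; rewrite rmorphM. Qed.
HB.instance Definition _ :=
  GRing.isMonoidMorphism.Build S completion compl_of compl_of_monoid_morphism.

End Completion.

(* The S-module M regarded as an R-module via f. *)
Definition restrict (R S : pzRingType) (f : {rmorphism R -> S})
  (M : lmodType S) : Type := M.

Section Restrict.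
Variables (R S : pzRingType) (f : {rmorphism R -> S}) (M : lmodType S).

HB.instance Definition _ := GRing.Zmodule.on (restrict f M).

Let scale (a : R) (x : restrict f M) : restrict f M := f a *: (x : M).

Let scaleA a b x : scale a (scale b x) = scale (a * b) x.
Proof. by rewrite /scale scalerA rmorphM. Qed.
Let scale1 : left_id 1 scale.
Proof. by move=> x; rewrite /scale rmorph1 scale1r. Qed.
Let scaleDr : right_distributive scale +%R.
Proof. by move=> a x y; apply: scalerDr. Qed.
Let scaleDl x : {morph scale^~ x : a b / a + b}.
Proof. by move=> a b; rewrite /scale rmorphD scalerDl. Qed.

HB.instance Definition _ := GRing.Zmodule_isLmodule.Build R (restrict f M)
  scaleA scale1 scaleDr scaleDl.

End Restrict.

Section Flatness.
Variable R : comPzRingType.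

(* A list of pairs (m_j, n_j) represents the element sum_j m_j (x) n_j of the
   tensor product of M and N over R; tensor_eq s t says that s and t represent
   the same element, so M (x)_R N is the set of lists modulo tensor_eq. *)
Inductive tensor_eq (M N : lmodType R) : seq (M * N) -> seq (M * N) -> Prop :=
| tensor_refl s : tensor_eq s s
| tensor_sym s t : tensor_eq s t -> tensor_eq t s
| tensor_trans s t u : tensor_eq s t -> tensor_eq t u -> tensor_eq s u
| tensor_cat s s' t t' :
    tensor_eq s s' -> tensor_eq t t' -> tensor_eq (s ++ t) (s' ++ t')
| tensor_comm s t : tensor_eq (s ++ t) (t ++ s)
| tensor_zero n : tensor_eq [:: (0, n)] [::]
| tensor_addl m m' n : tensor_eq [:: (m + m', n)] [:: (m, n); (m', n)]
| tensor_addr m n n' : tensor_eq [:: (m, n + n')] [:: (m, n); (m, n')]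
| tensor_scale (a : R) m n : tensor_eq [:: (a *: m, n)] [:: (m, a *: n)].

(* For every injective g : N -> N', the map id (x) g is injective. *)
Definition flat (M : lmodType R) : Prop :=
  forall (N N' : lmodType R) (g : {linear N -> N'}), injective g ->
  forall s t : seq (M * N),
    tensor_eq [seq (u.1, g u.2) | u <- s] [seq (u.1, g u.2) | u <- t] ->
    tensor_eq s t.

(* An exact sequence 0 -> F_n -> ... -> F_0 -> M -> 0 with all F_i flat. *)
Definition has_flat_resolution (M : lmodType R) (n : nat) : Prop :=
  exists (F : nat -> lmodType R) (e : {linear F 0 -> M})
         (d : forall i, {linear F i.+1 -> F i}),
    [/\ forall i, flat (F i),
        forall i, (n < i)%N -> forall x : F i, x = 0,
        range e = setT,
        range (d 0) = [set x | e x = 0]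
      & forall i, range (d i.+1) = [set x | d i x = 0]].

Definition flat_dim (M : lmodType R) : \bar int :=
  inf_nat (has_flat_resolution M).

End Flatness.

Definition flat_morphism (R S : comPzRingType) (f : {rmorphism R -> S}) : Prop :=
  flat (restrict f S^o).

Section CompleteIntersectionMaps.
Variables (R S : comPzRingType) (m : set R) (n : set S) (f : {rmorphism R -> S}).

Definition Cohen_factorization (R' : comPzRingType)
    (f1 : {rmorphism R -> R'}) (f2 : {rmorphism R' -> completion n}) : Prop :=
  (forall x, f2 (f1 x) = compl_of n (f x)) /\
  exists (m' : set R') (n' : set (completion n)),
    [/\ noetherian_ring R' /\ local_ring m',
        local_ring n',
        f1 @` m `<=` m' /\ f2 @` m' `<=` n',
        flat_morphism f1 /\ regular_local_ring (quot_ring (f1 @` m))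
      & range f2 = setT].

Definition complete_intersection_map : Prop :=
  exists (R' : comPzRingType)
         (f1 : {rmorphism R -> R'}) (f2 : {rmorphism R' -> completion n}),
    Cohen_factorization f1 f2 /\
    exists s : seq R', regular_sequence s /\ [set x | f2 x = 0] = idl [set` s].

Definition exceptional_complete_intersection_map : Prop :=
  complete_intersection_map /\
  (edim m - krull_dim R = edim n - krull_dim S)%E.

End CompleteIntersectionMaps.

(* Main.v *)
(* Let a = edim R, b = edim S and c = fd_R M <= a - b.  Tensor a minimal free resolution P of
   R/m over R with M and with the Koszul complex of generators y_1, ..., y_b of n.  The
   result is exact above degree a because c + b <= a, while the generators x_1, ..., x_a of m,
   acting on P by homotopies which are corrected by the Koszul part, yield a cycle of degree a
   which survives modulo n and which every y_j multiplies into a boundary.  Hence relations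
   sum_j y_j u_j = 0 in M are trivial modulo n, which for an artinian M forces M to be free, n to
   be nilpotent, and Tor_c(R/m, M) to be nonzero with c = a - b.

   As S is then artinian, S is its own completion.  A Cohen factorization is the completion R' of
   R[Y_1, ..., Y_b][X_s : s in S] modulo a maximal set of elements of the kernel of the
   evaluation which are independent modulo m and the square of the preimage of n; it is flat over
   R with R'/mR' regular of dimension b.  Nonvanishing of Tor_c also gives an R-regular sequence
   of length c in every power of m, in particular one z which f kills, so that z and powers of
   the Y_j form a regular sequence of length a in the kernel of R' -> S.  That kernel contains the
   ideal of the a elements X_i = x_i - sum_j d_ij Y_j.  The first part applied to R'/(X), which
   also acts on M with maximal ideal generated by b elements, shows that M is free over it, so
   that the kernel is (X); by depth sensitivity of the Koszul complex the X_i are a regular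
   sequence.  Counting dimensions with Krull's height theorem gives dim R = c. *)
From HB Require Import structures.
From mathcomp Require Import all_boot all_order all_algebra generic_quotient.
From mathcomp Require Import boolp classical_sets constructive_ereal.
From mathcomp Require functions.
From mathcomp Require Import zify ring.
Require Import Defs.

Set Implicit Arguments.
Unset Strict Implicit.
Unset Printing Implicit Defensive.

Import GRing.Theory.
Local Open Scope classical_set_scope.
Local Open Scope ring_scope.

(** * Submodules, noetherian modules and Nakayama's lemma *)

(** The cycle survives by minimality of the [x_k]. Write the differential of the resolution as
    [d = sum_k x_k D_k] and let [h_l] be a homotopy for [x_l]: then [sum_k x_k (D_k h_l + h_l D_k -
    delta_kl) = 0], so the brackets lie in [m]. Modulo [n] the [h_l] are like exterior
    multiplications and the [D_k] like contractions, and the product of all [h_l] cannot vanish. The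
    obstacle is that an artinian [M] need not be finitely generated, so that [M = n M] is not
    excluded at once, and then reduction modulo [n] sees nothing. In that case the argument is
    applied to the cycles of the Koszul complex of the [y_j] with coefficients in [M], in the lowest
    degree with homology; the dimension shifting that leads there costs up to [b] degrees of
    exactness, which is why resolutions are taken up to degree [a + 1 + b]. Tor and localization are
    replaced by elementary statements: flat dimension is tested on finite free complexes, flatness
    on linear equations, and facts at a prime [q] hold up to a multiplier outside [q]. *)

Lemma prefix_choice (T : Type) (Q : seq T -> T -> Prop) :
  (forall s, exists x, Q s x) ->
  exists u : nat -> T, forall n, Q (mkseq u n) (u n).
Proof.
move=> /choice[c hc]; pose p := fix p n := if n is k.+1 then rcons (p k) (c (p k)) else [::].
exists (fun n => c (p n)) => n; suff -> : mkseq (fun k => c (p k)) n = p n by apply: hc.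
by elim: n => //= n IH; rewrite /mkseq -addn1 iotaD map_cat /= -/(mkseq _ n) IH cats1.
Qed.

Lemma big_image_seq (V : nmodType) (T : Type) (s : seq T) (F : T -> V) (x0 : T) :
  \sum_(x <- s) F x = \sum_(i < size s) F (nth x0 s i).
Proof. by rewrite (big_nth x0) big_mkord. Qed.

Lemma split_l p q (i : 'I_p) : split (lshift q i) = inl i.
Proof. exact: (unsplitK (inl i)). Qed.
Lemma split_r p q (i : 'I_q) : split (rshift p i) = inr i.
Proof. exact: (unsplitK (inr i)). Qed.

Section Submodule.
Variables (R : comPzRingType) (M : lmodType R).
Implicit Types (N U W : set M) (A : set M).

Lemma submod0 N : submodule N -> N 0. Proof. by case. Qed.
Lemma submodD N x y : submodule N -> N x -> N y -> N (x + y).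
Proof. by case=> _ h _; apply: h. Qed.
Lemma submodZ N a x : submodule N -> N x -> N (a *: x).
Proof. by case=> _ _; apply. Qed.
Lemma submodN N x : submodule N -> N x -> N (- x).
Proof. by rewrite -scaleN1r => sN; apply: submodZ. Qed.
Lemma submodB N x y : submodule N -> N x -> N y -> N (x - y).
Proof. by move=> sN Nx Ny; apply: submodD => //; apply: submodN. Qed.
Lemma submod_sum N (I : Type) (r : seq I) (P : pred I) (F : I -> M) :
  submodule N -> (forall i, P i -> N (F i)) -> N (\sum_(i <- r | P i) F i).
Proof.
move=> sN NF; apply: big_ind => //; first exact: submod0.
by move=> x y; apply: submodD.
Qed.
Lemma submod_addr N x y : submodule N -> N y -> N (x + y) -> N x.
Proof. by move=> sN Ny Nxy; rewrite -(addrK y x); apply: submodB. Qed.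
Lemma submod_subr N x y : submodule N -> N y -> N (x - y) -> N x.
Proof. by move=> sN Ny Nxy; rewrite -(subrK y x); apply: submodD. Qed.

Lemma submodule0 : submodule [set (0 : M)].
Proof. by split=> [|x y -> ->|a x ->] //=; rewrite ?addr0 ?scaler0. Qed.
Lemma submoduleT : submodule [set: M]. Proof. by []. Qed.
Lemma submoduleI U W : submodule U -> submodule W -> submodule (U `&` W).
Proof.
move=> sU sW; split; first by split; apply: submod0.
  by move=> x y [? ?] [? ?]; split; apply: submodD.
by move=> a x [? ?]; split; apply: submodZ.
Qed.

Lemma sub_span A : A `<=` span A.
Proof. by move=> x Ax N _; apply. Qed.
Lemma span_min A N : submodule N -> A `<=` N -> span A `<=` N.
Proof. by move=> sN AN x; apply. Qed.
Lemma span_mono A B : A `<=` B -> span A `<=` span B.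
Proof.
by move=> AB; apply: span_min; [exact: span_submodule|]; move=> x /AB; apply: sub_span.
Qed.
Lemma span_id N : submodule N -> span N = N.
Proof. by move=> sN; apply/seteqP; split; [apply: span_min|apply: sub_span]. Qed.

Lemma spanP n (x : 'I_n -> M) v :
  span (range x) v <-> exists c : 'I_n -> R, v = \sum_i c i *: x i.
Proof.
split; last first.
  move=> [c ->]; apply: (submod_sum _ (span_submodule _)) => i _.
  by apply: (submodZ _ (span_submodule _)); apply: sub_span; exists i.
apply: (@span_min (range x) [set v | exists c : 'I_n -> R, v = \sum_i c i *: x i]); first split.
- by exists (fun=> 0); rewrite big1 // => i _; rewrite scale0r.
- move=> _ _ [c ->] [d ->]; exists (fun i => c i + d i).
  by rewrite -big_split; apply: eq_bigr => i _; rewrite scalerDl.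
- move=> a _ [c ->]; exists (fun i => a * c i).
  by rewrite scaler_sumr; apply: eq_bigr => i _; rewrite scalerA.
move=> _ [i _ <-]; exists (fun j => (j == i)%:R).
by rewrite (bigD1 i) //= eqxx scale1r big1 ?addr0 // => j /negPf ->; rewrite scale0r.
Qed.

Lemma span_seqP (s : seq M) v :
  span [set` s] v <-> exists c : nat -> R, v = \sum_(i < size s) c i *: nth 0 s i.
Proof.
have -> : [set` s] = range (fun i : 'I_(size s) => nth 0 s i).
  apply/seteqP; split=> [x /= xs|_ [i _ <-]]; last exact: mem_nth.
  by move/(nthP 0): (xs) => [i hi <-]; exists (Ordinal hi).
rewrite spanP; split=> -[c ->]; last by exists (fun i => c i).
exists (fun k => if insub k is Some i then c i else 0).
by apply: eq_bigr => i _; rewrite valK.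
Qed.

Definition addm U W : set M := [set x | exists2 u, U u & exists2 w, W w & x = u + w].

Lemma submodule_addm U W : submodule U -> submodule W -> submodule (addm U W).
Proof.
move=> sU sW; split; first by exists 0; [exact: submod0|exists 0; [exact: submod0|rewrite addr0]].
  move=> _ _ [u Uu [w Ww ->]] [u' Uu' [w' Ww' ->]].
  exists (u + u'); first exact: submodD.
  by exists (w + w'); [exact: submodD|rewrite addrACA].
move=> a _ [u Uu [w Ww ->]]; exists (a *: u); first exact: submodZ.
by exists (a *: w); [exact: submodZ|rewrite scalerDr].
Qed.
Lemma addml U W : submodule W -> U `<=` addm U W.
Proof. by move=> sW u Uu; exists u => //; exists 0; [exact: submod0|rewrite addr0]. Qed.
Lemma addmr U W : submodule U -> W `<=` addm U W.
Proof. by move=> sU w Ww; exists 0; [exact: submod0|exists w => //; rewrite add0r]. Qed.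
Lemma addm_min U W N : submodule N -> U `<=` N -> W `<=` N -> addm U W `<=` N.
Proof. by move=> sN UN WN _ [u /UN ? [w /WN ? ->]]; apply: submodD. Qed.

Definition fg U := exists n (x : 'I_n -> M), U = span (range x).
Definition noeth := forall U, submodule U -> fg U.

Lemma fg_seq (s : seq M) : fg (span [set` s]).
Proof.
exists (size s), (fun i => nth 0 s i); congr span.
apply/seteqP; split=> [x /= xs|_ [i _ <-]]; last exact: mem_nth.
by move/(nthP 0): (xs) => [i hi <-]; exists (Ordinal hi).
Qed.

Lemma noeth_seq : noeth <-> forall U, submodule U -> exists s : seq M, U = span [set` s].
Proof.
split=> h U /h; last by move=> [s ->]; exact: fg_seq.
move=> [n [x ->]]; exists (codom x); congr span.
by apply/seteqP; split=> [_ [i _ <-]|y /= /codomP[i ->]]; [exact: codom_f|exists i].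
Qed.

Lemma noeth_chain (U : nat -> set M) : noeth -> (forall i, submodule (U i)) ->
  (forall i, U i `<=` U i.+1) -> exists k, forall j, U j `<=` U k.
Proof.
move=> nM sU incU.
have incU' i j : (i <= j)%N -> U i `<=` U j.
  by move=> /subnKC <-; elim: (j - i)%N => [|k IH]; rewrite ?addn0 ?addnS // => x /IH/incU.
have sV : submodule (\bigcup_i U i).
  split; first by exists 0%N => //; exact: submod0.
    move=> x y [i _ Ux] [j _ Uy]; exists (maxn i j) => //.
    by apply: submodD => //; [exact: incU' (leq_maxl _ _) _ _|exact: incU' (leq_maxr _ _) _ _].
  by move=> a x [i _ Ux]; exists i => //; exact: submodZ.
have [n [x defV]] := nM _ sV.
have /choice[r hr] : forall i, exists k, U k (x i).
  move=> i; have : (\bigcup_i U i) (x i) by rewrite defV; apply: sub_span; exists i.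
  by move=> [k _ ?]; exists k.
exists (\max_i r i) => j y Uy; have : (\bigcup_i U i) y by exists j.
rewrite defV; apply; first exact: sU.
by move=> _ [i _ <-]; apply: incU' (hr i); exact: leq_bigmax.
Qed.

Lemma noeth_max (F : set (set M)) : noeth -> (forall U, F U -> submodule U) ->
  (exists U, F U) -> exists2 U, F U & forall W, F W -> U `<=` W -> W `<=` U.
Proof.
move=> nM sF [U0 FU0]; apply: contrapT => nmax.
have step U : F U -> exists W, [/\ F W, U `<=` W & ~ (W `<=` U)].
  move=> FU; apply: contrapT => h; apply: nmax; exists U => // W FW UW.
  by apply: contrapT => nWU; apply: h; exists W.
have /choice[g hg] : forall U, exists W, F U -> [/\ F W, U `<=` W & ~ (W `<=` U)].
  by move=> U; case: (pselect (F U)) => [/step[W]|?]; [exists W|exists U].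
pose V n := iter n g U0.
have FV n : F (V n) by elim: n => //= n IH; case: (hg _ IH).
have [k hk] := noeth_chain nM (fun i => sF _ (FV i)) (fun i => (let: And3 _ h _ := hg _ (FV i) in h)).
by have [_ _] := hg _ (FV k); apply; exact: (hk k.+1).
Qed.

(* [S0] plays the role of the multiplicative set of units, or of the complement of a prime. *)
Lemma nakayama_mult (S0 I : set R) U W :
  S0 1 -> (forall s t, S0 s -> S0 t -> S0 (s * t)) ->
  (forall s a, S0 s -> I a -> S0 (s - a)) ->
  fg U -> submodule W ->
  (forall u, U u -> exists2 s, S0 s &
     exists n (a : 'I_n -> R) (v : 'I_n -> M),
       (forall i, I (a i) /\ U (v i)) /\ W (s *: u - \sum_i a i *: v i)) ->
  @submodule R R^o I ->
  exists2 s, S0 s & forall u, U u -> W (s *: u).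
Proof.
move=> S1 SM SI [n [x defU]] sW hU [I0 ID IZ].
have sU : submodule U by rewrite defU; exact: span_submodule.
have Ux i : U (x i) by rewrite defU; apply: sub_span; exists i.
(* The induction goes down from [V n], which contains [U], to [V 0], which is [W]; each generator
   that is dropped costs further factors in the multiplier from [S0]. *)
pose V k := addm W (span [set y | exists2 i : 'I_n, (i < k)%N & y = x i]).
have sV k : submodule (V k) by apply: submodule_addm => //; exact: span_submodule.
suff H k : (k <= n)%N -> exists2 s, S0 s & forall u, U u -> V (n - k)%N (s *: u).
  have [s Ss hs] := H n (leqnn _); exists s => // u /hs; rewrite subnn.
  apply: addm_min => //; apply: span_min => //.
  by move=> y [i].
elim: k => [_|k IH lkn].
  exists 1 => // u; rewrite scale1r subn0 defU; apply: span_min => // _ [i _ <-].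
  by apply: addmr => //; apply: sub_span; exists i.
have [s Ss hs] := IH (ltnW lkn).
have lt : (n - k.+1 < n)%N by lia.
pose i0 := Ordinal lt; have [t St [q [a [v [hav hW]]]]] := hU _ (Ux i0).
have sub j : V j `<=` V j.+1.
  apply: addm_min => //; first by apply: addml; exact: span_submodule.
  move=> y hy; apply: addmr => //; move: y hy; apply: span_mono => y [i lij ->].
  by exists i => //; exact: ltnW.
have e : (n - k = (n - k.+1).+1)%N by lia.
(* Modulo the next smaller [V], an [I]-multiple of an element of [V (n - k)] is an [I]-multiple of
   the single generator [x i0]. This isolates a coefficient of [x i0] of the form [s * t - c], which
   stays in [S0]. *)
have split_V c y : I c -> V (n - k)%N y ->
    exists2 c', I c' & V (n - k.+1)%N (c *: y - c' *: x i0).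
  move=> Ic; rewrite e => -[w Ww [z hz ->]].
  have [c' Ic' hc'] : exists2 c', I c' & V (n - k.+1)%N (c *: z - c' *: x i0).
    move: z hz; apply: (@span_min _ [set z | exists2 c', I c' & V (n - k.+1)%N (c *: z - c' *: x i0)]); first split.
    - by exists 0; [exact: I0|rewrite scaler0 scale0r subrr; exact: submod0].
    - move=> z z' [d Id hd] [d' Id' hd']; exists (d + d'); first exact: ID.
      by rewrite scalerDr scalerDl opprD addrACA; exact: submodD.
    - move=> b z [d Id hd]; exists (b * d); first exact: (IZ b d).
      by rewrite scalerA mulrC -scalerA -[(b * d) *: _]scalerA -scalerBr; exact: submodZ.
    move=> _ [i lti ->]; case: (eqVneq i i0) => [->|ne].
      by exists c => //; rewrite subrr; exact: submod0.
    exists 0; first exact: I0.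
    rewrite scale0r subr0; apply: submodZ => //; apply: addmr => //; apply: sub_span.
    by exists i => //; move: ne lti; rewrite -val_eqE /=; lia.
  exists c' => //; rewrite scalerDr -addrA; apply: submodD => //.
  by apply: addml; [exact: span_submodule|exact: submodZ].
have [c Ic hc] : exists2 c, I c & V (n - k.+1)%N ((s * t - c) *: x i0).
  have /choice[c hc] : forall i, exists c, I c /\ V (n - k.+1)%N (a i *: (s *: v i) - c *: x i0).
    move=> i; have [Ia Uv] := hav i.
    by have [c' ? ?] := split_V _ _ Ia (hs _ Uv); exists c'.
  exists (\sum_i c i).
    by apply: (big_ind I) => [|y z|i _]; [exact: I0|exact: ID|case: (hc i)].
  have -> : (s * t - \sum_i c i) *: x i0 = s *: (t *: x i0 - \sum_i a i *: v i)
     + \sum_i (a i *: (s *: v i) - c i *: x i0).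
    rewrite scalerBl scaler_suml scalerBr scalerA sumrB scaler_sumr.
    rewrite (_ : \sum_i s *: _ = \sum_i a i *: (s *: v i)) ?subrKA //.
    by apply: eq_bigr => i _; rewrite !scalerA mulrC.
  apply: submodD => //; last by apply: submod_sum => // i _; case: (hc i).
  by apply: addml; [exact: span_submodule|exact: submodZ].
exists ((s * t - c) * s); first exact: SM (SI _ _ (SM _ _ Ss St) Ic) Ss.
move=> u Uu; have := hs _ Uu; rewrite e -scalerA => -[w Ww [z hz ->]].
rewrite scalerDr; apply: submodD => //.
  by apply: addml; [exact: span_submodule|exact: submodZ].
move: z hz; apply: (@span_min _ [set z | V (n - k.+1)%N (((s * t - c) *: z))]); first split.
- by rewrite /= scaler0; exact: submod0.
- by move=> z z' ? ?; rewrite /= scalerDr; exact: submodD.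
- by move=> b z ?; rewrite /= scalerA mulrC -scalerA; exact: submodZ.
move=> _ [i lti ->]; case: (eqVneq i i0) => [-> //|ne].
apply: submodZ => //; apply: addmr => //; apply: sub_span.
by exists i => //; move: ne lti; rewrite -val_eqE /=; lia.
Qed.

End Submodule.
Arguments noeth {R} M.

Section Ideal.
Variable R : comPzRingType.
Implicit Types (I J m : set R).

Lemma ideal0 I : is_ideal I -> I 0. Proof. by case. Qed.
Lemma idealD I x y : is_ideal I -> I x -> I y -> I (x + y).
Proof. by case=> _ h _; apply: h. Qed.
Lemma idealM I a x : is_ideal I -> I x -> I (a * x).
Proof. by case=> _ _ h /h; exact. Qed.
Lemma idealMr I a x : is_ideal I -> I x -> I (x * a).
Proof. by rewrite mulrC; exact: idealM. Qed.
Lemma idealN I x : is_ideal I -> I x -> I (- x).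
Proof. by rewrite -mulN1r => iI; exact: idealM. Qed.
Lemma idealB I x y : is_ideal I -> I x -> I y -> I (x - y).
Proof. by move=> iI Ix Iy; apply: idealD => //; exact: idealN. Qed.
Lemma ideal_sum I (T : Type) (r : seq T) (P : pred T) (F : T -> R) :
  is_ideal I -> (forall i, P i -> I (F i)) -> I (\sum_(i <- r | P i) F i).
Proof. exact: (@submod_sum R R^o). Qed.
Lemma ideal_subr I x y : is_ideal I -> I y -> I (x - y) -> I x.
Proof. exact: (@submod_subr R R^o). Qed.
Lemma ideal_addr I x y : is_ideal I -> I y -> I (x + y) -> I x.
Proof. exact: (@submod_addr R R^o). Qed.
Lemma is_idealI (I : set R) : I 0 -> (forall x y, I x -> I y -> I (x + y)) ->
  (forall a x, I x -> I (a * x)) -> is_ideal I.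
Proof. by []. Qed.
Lemma ideal1 I x : is_ideal I -> I 1 -> I x.
Proof. by move=> iI /(idealM x iI); rewrite mulr1. Qed.

Lemma sub_idl (A : set R) : A `<=` idl A. Proof. exact: (@sub_span R R^o). Qed.
Lemma idl_min (A I : set R) : is_ideal I -> A `<=` I -> idl A `<=` I.
Proof. exact: (@span_min R R^o). Qed.
Lemma idl_mono (A B : set R) : A `<=` B -> idl A `<=` idl B.
Proof. exact: (@span_mono R R^o). Qed.
Lemma idl_seqP (s : seq R) x :
  idl [set` s] x <-> exists c : nat -> R, x = \sum_(i < size s) c i * s`_i.
Proof. exact: (@span_seqP R R^o). Qed.

Lemma noethR : noetherian_ring R <-> noeth (R^o : lmodType R).
Proof. by rewrite noeth_seq. Qed.

Lemma noeth_ideal_max (F : set (set R)) : noetherian_ring R ->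
  (forall I, F I -> is_ideal I) -> (exists I, F I) ->
  exists2 I, F I & forall J, F J -> I `<=` J -> J `<=` I.
Proof. by move=> /noethR; exact: noeth_max. Qed.

(** Locality elementwise: whatever lies outside [m] is invertible. This form can be checked by
    computation in quotients and completions. *)
Definition locr m := [/\ is_ideal m, ~ m 1 & forall x, ~ m x -> exists y, x * y = 1].

Lemma is_ideal_principal_add I x : is_ideal I ->
  is_ideal [set y | exists2 i, I i & exists a, y = i + a * x].
Proof.
move=> iI; apply: is_idealI.
- by exists 0; [exact: ideal0|exists 0; rewrite mul0r addr0].
- move=> _ _ [i Ii [a ->]] [j Ij [b ->]]; exists (i + j); first exact: idealD.
  by exists (a + b); rewrite mulrDl addrACA.
- move=> c _ [i Ii [a ->]]; exists (c * i); first exact: idealM.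
  by exists (c * a); rewrite mulrDr mulrA.
Qed.

Lemma local_locr m : noetherian_ring R -> local_ring m -> locr m.
Proof.
move=> nR [[im n1 mmax] uniq]; split=> // x nmx.
pose J := idl [set x]; apply: contrapT => nu.
have iJ : is_ideal J by exact: idl_ideal.
have J1 : ~ J 1.
  move=> J1; apply: nu; have := @spanP R R^o 1 (fun=> x) 1.
  have -> : range (fun _ : 'I_1 => x) = [set x].
    by apply/seteqP; split=> [_ [i _ <-]|y ->] //; exists ord0.
  move=> /iffLR /(_ J1)[c]; rewrite big_ord1 => e; exists (c ord0).
  by rewrite mulrC -[RHS]/(1 : R^o) e.
have [K [iK K1 JK] Kmax] := @noeth_ideal_max
  [set K | [/\ is_ideal K, ~ K 1 & J `<=` K]] nR (fun _ h => let: And3 a _ _ := h in a)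
  (ex_intro _ J (And3 iJ J1 (fun _ h => h))).
apply: nmx; rewrite -(uniq K); first by apply: JK; exact: sub_idl.
split=> // L iL L1 KL; apply/seteqP; split=> //.
by apply: Kmax => //; split=> // y /JK; exact: KL.
Qed.

Lemma locr_local m : locr m -> local_ring m.
Proof.
move=> [im n1 mu].
have H J : is_ideal J -> ~ J 1 -> J `<=` m.
  move=> iJ J1 x Jx; apply: contrapT => /mu[y xy1]; apply: J1.
  by rewrite -xy1; exact: idealMr.
split; first by split=> // J iJ J1 mJ; apply/seteqP; split=> //; exact: H.
by move=> J [iJ J1 Jmax]; rewrite (Jmax m) //; exact: H.
Qed.

Lemma locr_prime m : locr m -> prime_ideal m.
Proof.
move=> [im n1 mu]; split=> // x y mxy; case: (pselect (m x)) => [?|/mu[z xz]]; first by left.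
by right; rewrite -(mul1r y) -xz mulrAC; exact: idealMr.
Qed.

Lemma locr_unit m x a : locr m -> m a -> (exists y, x * y = 1) -> exists y, (x - a) * y = 1.
Proof.
move=> [im n1 mu] ma [y xy]; apply: mu => mxa; apply: n1; rewrite -xy.
by apply: idealMr => //; exact: ideal_subr mxa.
Qed.

Lemma nakayama (M : lmodType R) m (U W : set M) : locr m -> fg U -> submodule W ->
  (forall u, U u -> exists n (a : 'I_n -> R) (v : 'I_n -> M),
     (forall i, m (a i) /\ U (v i)) /\ W (u - \sum_i a i *: v i)) ->
  U `<=` W.
Proof.
move=> lm fU sW h.
have im : is_ideal m by case: lm.
have [|s t [b eb] [b' eb']|s a su ma|u /h h'|s [b sb] hs u /hs] :=
  @nakayama_mult R M [set s | exists b, s * b = 1] m U W _ _ _ fU sW _ im.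
- by exists 1; rewrite mulr1.
- by exists (b * b'); rewrite mulrACA eb eb' mulr1.
- exact: (locr_unit lm ma su).
- by exists 1; [exists 1; rewrite mulr1|rewrite scale1r].
by move=> /(submodZ b sW); rewrite scalerA mulrC sb scale1r.
Qed.

End Ideal.

Section NoethFree.
Variables (R : comPzRingType) (nR : noetherian_ring R).

(** Induction on the number of coordinates that may be nonzero: the values at the last of them form
    an ideal, and the vectors where it vanishes form a submodule with one coordinate less. *)
Lemma noeth_ffun n : noeth ({ffun 'I_n -> R^o} : lmodType R).
Proof.
move=> U sU.
suff H k : forall W : set {ffun 'I_n -> R^o}, submodule W -> W `<=` U ->
    (forall w, W w -> forall i : 'I_n, (k <= i)%N -> w i = 0) -> fg W.
  by apply: (H n) => // w _ i; rewrite leqNgt ltn_ord.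
elim: k => [W sW WU W0|k IH W sW WU W0].
  exists 0%N, (fun=> 0); apply/seteqP; split=> [w Ww|w]; last first.
    by move=> /spanP[c ->]; rewrite big_ord0; exact: submod0.
  have -> : w = 0 by apply/ffunP => i; rewrite ffunE (W0 _ Ww).
  exact: (submod0 (span_submodule _)).
case: (ltnP k n) => [lkn|lnk]; last first.
  by apply: IH => // w Ww i lki; have := ltn_ord i; rewrite ltnNge (leq_trans lnk lki).
pose i0 := Ordinal lkn.
pose L : set R := [set a | exists2 w, W w & w i0 = a].
have iL : is_ideal L.
  apply: is_idealI; first by exists 0; [exact: submod0|rewrite ffunE].
    by move=> _ _ [w Ww <-] [v Wv <-]; exists (w + v); [exact: submodD|rewrite ffunE].
  by move=> a _ [w Ww <-]; exists (a *: w); [exact: submodZ|rewrite ffunE].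
have [p [x defL]] := iffLR (@noethR R) nR L iL.
have /choice[y hy] : forall i, exists w, W w /\ w i0 = x i.
  by move=> i; have : L (x i) by [rewrite defL; apply: sub_span; exists i]; move=> [w ? ?]; exists w.
pose W' := W `&` [set w : {ffun 'I_n -> R^o} | w i0 = 0].
have sW' : submodule W'.
  apply: submoduleI => //; split=> /= [|v w|a v]; rewrite !ffunE //.
    by move=> -> ->; rewrite addr0.
  by move=> ->; rewrite scaler0.
have [|w [Ww w0] i lki|q [z defW']] := IH W' sW'; first by move=> w [/WU].
  case: (ltngtP k i) lki => // [lki _|eki _]; first exact: (W0 w).
  by rewrite -w0; congr (w _); apply: val_inj.
exists (p + q)%N, (fun i => match split i with inl j => y j | inr j => z j end).
apply/seteqP; split=> [w Ww|]; last first.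
  apply: span_min => // _ [i _ <-]; case: split => j; first by case: (hy j).
  suff [] : W' (z j) by [].
  by rewrite defW'; apply: sub_span; exists j.
have /spanP[c hc] : span (range x) (w i0) by rewrite -defL; exists w.
have : W' (w - \sum_i c i *: y i).
  split; last by rewrite /= !ffunE hc sum_ffunE -sumrB big1 // => i _; rewrite !ffunE (hy i).2 subrr.
  by apply: submodB => //; apply: submod_sum => // i _; apply: submodZ => //; case: (hy i).
rewrite defW' => /spanP[d hd]; apply/spanP.
exists (fun i => match split i with inl j => c j | inr j => d j end).
rewrite big_split_ord -[LHS](subrK (\sum_i c i *: y i)) hd addrC; congr (_ + _).
  by apply: eq_bigr => i _; rewrite split_l.
by apply: eq_bigr => i _; rewrite split_r.
Qed.

End NoethFree.

(** * The equational criterion of flatness *)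

Section Act.
Variables (R : comPzRingType) (M : lmodType R).

(** The map of free modules given by [D], with vectors written as rows, tensored with [M]. *)
Definition act p q (v : {ffun 'I_p -> M}) (D : 'M[R]_(p, q)) : {ffun 'I_q -> M} :=
  [ffun j => \sum_i D i j *: v i].

Lemma actM p q r v (D : 'M_(p, q)) (E : 'M_(q, r)) : act v (D *m E) = act (act v D) E.
Proof.
apply/ffunP => k; rewrite !ffunE; under eq_bigr do rewrite mxE scaler_suml.
rewrite exchange_big; apply: eq_bigr => j _; rewrite ffunE scaler_sumr.
by apply: eq_bigr => i _; rewrite scalerA mulrC.
Qed.
Lemma actDl p q v w (D : 'M_(p, q)) : act (v + w) D = act v D + act w D.
Proof.
apply/ffunP => k; rewrite !ffunE -big_split; apply: eq_bigr => i _.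
by rewrite ffunE scalerDr.
Qed.
Lemma act0l p q (D : 'M_(p, q)) : act 0 D = 0.
Proof. by apply/ffunP => k; rewrite !ffunE big1 // => i _; rewrite ffunE scaler0. Qed.
Lemma actNl p q v (D : 'M_(p, q)) : act (- v) D = - act v D.
Proof.
apply/ffunP => k; rewrite !ffunE -sumrN; apply: eq_bigr => i _.
by rewrite ffunE scalerN.
Qed.
Lemma actBl p q v w (D : 'M_(p, q)) : act (v - w) D = act v D - act w D.
Proof. by rewrite actDl actNl. Qed.
Lemma actZl p q a v (D : 'M_(p, q)) : act (a *: v) D = a *: act v D.
Proof.
apply/ffunP => k; rewrite !ffunE scaler_sumr; apply: eq_bigr => i _.
by rewrite ffunE !scalerA mulrC.
Qed.
Lemma act_suml p q (I : Type) (r : seq I) (P : pred I) F (D : 'M_(p, q)) :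
  act (\sum_(i <- r | P i) F i) D = \sum_(i <- r | P i) act (F i) D.
Proof. by apply: (big_morph (fun v => act v D)) => [v w|]; rewrite ?actDl ?act0l. Qed.
Lemma actDr p q v (D E : 'M_(p, q)) : act v (D + E) = act v D + act v E.
Proof.
apply/ffunP => k; rewrite !ffunE -big_split; apply: eq_bigr => i _.
by rewrite mxE scalerDl.
Qed.
Lemma actNr p q v (D : 'M_(p, q)) : act v (- D) = - act v D.
Proof.
apply/ffunP => k; rewrite !ffunE -sumrN; apply: eq_bigr => i _.
by rewrite mxE scaleNr.
Qed.
Lemma actBr p q v (D E : 'M_(p, q)) : act v (D - E) = act v D - act v E.
Proof. by rewrite actDr actNr. Qed.
Lemma act0r p q v : act v (0 : 'M_(p, q)) = 0.
Proof. by apply/ffunP => k; rewrite !ffunE big1 // => i _; rewrite mxE scale0r. Qed.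
Lemma act_scalar p v a : act v (a%:M : 'M_p) = a *: v.
Proof.
apply/ffunP => k; rewrite !ffunE (bigD1 k) //= mxE eqxx big1 ?addr0 // => i ne.
by rewrite mxE (negPf ne) scale0r.
Qed.
Lemma act1 p v : act v (1%:M : 'M_p) = v. Proof. by rewrite act_scalar scale1r. Qed.

Definition tens p (x : M) (r : 'rV[R]_p) : {ffun 'I_p -> M} := [ffun i => r 0 i *: x].

Lemma act_tens p q x r (D : 'M_(p, q)) : act (tens x r) D = tens x (r *m D).
Proof.
apply/ffunP => k; rewrite !ffunE mxE scaler_suml.
by apply: eq_bigr => i _; rewrite ffunE scalerA mulrC.
Qed.
Lemma tensDl p x y (r : 'rV_p) : tens (x + y) r = tens x r + tens y r.
Proof. by apply/ffunP => k; rewrite !ffunE scalerDr. Qed.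
Lemma tensZ p a x (r : 'rV_p) : tens (a *: x) r = tens x (a *: r).
Proof. by apply/ffunP => k; rewrite !ffunE mxE scalerA mulrC. Qed.
Lemma tens0l p (r : 'rV_p) : tens 0 r = 0.
Proof. by apply/ffunP => k; rewrite !ffunE scaler0. Qed.
Lemma tens_suml p (I : Type) (s : seq I) (P : pred I) F (r : 'rV_p) :
  tens (\sum_(i <- s | P i) F i) r = \sum_(i <- s | P i) tens (F i) r.
Proof. by apply: (big_morph (fun v => tens v r)) => [v w|]; rewrite ?tensDl ?tens0l. Qed.

Lemma act_in (U : set M) p q (v : {ffun 'I_p -> M}) (D : 'M_(p, q)) :
  submodule U -> (forall i, U (v i)) -> forall j, U (act v D j).
Proof. by move=> sU Uv j; rewrite ffunE; apply: submod_sum => // i _; exact: submodZ. Qed.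

End Act.

Lemma act_linear (R : comPzRingType) (M N : lmodType R) (g : {linear M -> N}) p q v (D : 'M_(p, q)) :
  [ffun j => g (act v D j)] = act [ffun i => g (v i)] D.
Proof.
apply/ffunP => k; rewrite !ffunE linear_sum; apply: eq_bigr => i _.
by rewrite linearZ ffunE.
Qed.

Section SubmoduleType.
Variables (R : comPzRingType) (M : lmodType R) (N : set M) (sN : submodule N).

(** The proof that [N] is a submodule is an argument of the type, so that the module structure below
    can be attached to it. *)
Definition submt of submodule N : Type := {x : M | `[< N x >]}.
Local Notation T := (submt sN).

Definition smk (x : M) (Nx : N x) : T := exist _ x (asboolT Nx).
Definition smval (u : T) : M := proj1_sig u.
Lemma smval_in (u : T) : N (smval u). Proof. by case: u => x /= /asboolP. Qed.
Lemma smval_inj : injective smval. Proof. exact: val_inj. Qed.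

HB.instance Definition _ := Choice.on T.

Let s0 : T := smk (submod0 sN).
Let sD (u v : T) : T := smk (submodD sN (smval_in u) (smval_in v)).
Let sO (u : T) : T := smk (submodN sN (smval_in u)).
Let sZ (a : R) (u : T) : T := smk (submodZ a sN (smval_in u)).
Let sA : associative sD. Proof. by move=> u v w; apply: smval_inj; apply: addrA. Qed.
Let sC : commutative sD. Proof. by move=> u v; apply: smval_inj; apply: addrC. Qed.
Let s0D : left_id s0 sD. Proof. by move=> u; apply: smval_inj; apply: add0r. Qed.
Let sND : left_inverse s0 sO sD. Proof. by move=> u; apply: smval_inj; apply: addNr. Qed.
HB.instance Definition _ := GRing.isZmodule.Build T sA sC s0D sND.
Let sZA a b x : sZ a (sZ b x) = sZ (a * b) x.
Proof. by apply: smval_inj; apply: scalerA. Qed.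
Let sZ1 : left_id 1 sZ. Proof. by move=> u; apply: smval_inj; apply: scale1r. Qed.
Let sZDr : right_distributive sZ +%R.
Proof. by move=> a u v; apply: smval_inj; apply: scalerDr. Qed.
Let sZDl x : {morph sZ^~ x : a b / a + b}.
Proof. by move=> a b; apply: smval_inj; apply: scalerDl. Qed.
HB.instance Definition _ := GRing.Zmodule_isLmodule.Build R T sZA sZ1 sZDr sZDl.

Let smval_linear : linear smval. Proof. by []. Qed.
HB.instance Definition _ := GRing.isLinear.Build R T M *:%R smval smval_linear.

End SubmoduleType.

Section Flat.
Variables (R : comPzRingType).

(* Every linear relation between elements of [M] is a consequence of relations in [R]. *)
Definition eqflat (M : lmodType R) := forall n k (A : 'M[R]_(n, k)) (x : {ffun 'I_n -> M}),
  act x A = 0 -> exists q (b : 'M[R]_(q, n)) (y : {ffun 'I_q -> M}), b *m A = 0 /\ x = act y b.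

Variable M : lmodType R.

(* The element of the free module on the set [N] represented by a list. *)
Definition tot (N : lmodType R) (s : seq (M * N)) (n : N) : M := \sum_(u <- s | u.2 == n) u.1.

Lemma tot_cat (N : lmodType R) (s t : seq (M * N)) n : tot (s ++ t) n = tot s n + tot t n.
Proof. by rewrite /tot big_cat. Qed.
Lemma tot2 (N : lmodType R) u v (n : N) : tot [:: u; v] n = tot [:: u] n + tot [:: v] n.
Proof. exact: (tot_cat [:: u] [:: v]). Qed.
Lemma tot1 (N : lmodType R) m (n' n : N) : tot [:: (m, n')] n = if n' == n then m else 0.
Proof. by rewrite /tot big_mkcond big_seq1. Qed.

(* The relations imposed in the tensor product: combinations of the [m \otimes r] for [r] a
   relation among elements of [N]. *)
Definition trel (N : lmodType R) (h : N -> M) := exists l : seq (M * seq (R * N)),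
  (forall u, u \in l -> \sum_(e <- u.2) e.1 *: e.2 = 0) /\
  forall n, h n = \sum_(u <- l) \sum_(e <- u.2 | e.2 == n) e.1 *: u.1.

Lemma trelD (N : lmodType R) (h h' : N -> M) : trel h -> trel h' -> trel (fun n => h n + h' n).
Proof.
move=> [l [hl e]] [l' [hl' e']]; exists (l ++ l'); split.
  by move=> u; rewrite mem_cat => /orP[/hl|/hl'].
by move=> n; rewrite big_cat e e'.
Qed.
Lemma trelN (N : lmodType R) (h : N -> M) : trel h -> trel (fun n => - h n).
Proof.
move=> [l [hl e]]; exists [seq (- u.1, u.2) | u <- l]; split.
  by move=> _ /mapP[u /hl ? ->].
move=> n; rewrite big_map e -sumrN; apply: eq_bigr => u _; rewrite -sumrN.
by apply: eq_bigr => c _; rewrite scalerN.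
Qed.
Lemma trel1 (N : lmodType R) m (l : seq (R * N)) (h : N -> M) : \sum_(e <- l) e.1 *: e.2 = 0 ->
  (forall n, h n = \sum_(e <- l | e.2 == n) e.1 *: m) -> trel h.
Proof.
move=> hl e; exists [:: (m, l)]; split; first by move=> u; rewrite inE => /eqP ->.
by move=> n; rewrite big_seq1 e.
Qed.
Lemma trel0 (N : lmodType R) : trel (fun _ : N => 0).
Proof. by exists [::]; split=> // n; rewrite big_nil. Qed.

(** Soundness of the defining relations: an equality in the tensor product, given by an inductive
    relation without normal forms, is turned into finitely many explicit relations among elements of
    [N]. *)
Lemma tensor_eq_trel (N : lmodType R) (s t : seq (M * N)) : tensor_eq s t -> trel (fun n => tot s n - tot t n).
Proof.
elim=> {s t} [s|s t _ IH|s t u _ IH _ IH'|s s' t t' _ IH _ IH'|s t|n|m m' n|m n n'|a m n].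
- by under eq_fun do rewrite subrr; exact: trel0.
- have := trelN IH; congr trel; apply: functional_extensionality_dep => n.
  by rewrite opprB.
- have := trelD IH IH'; congr trel; apply: functional_extensionality_dep => n.
  by rewrite subrKA.
- have := trelD IH IH'; congr trel; apply: functional_extensionality_dep => n.
  by rewrite !tot_cat addrACA opprD.
- have := trel0 N; congr trel; apply: functional_extensionality_dep => n.
  by rewrite !tot_cat [tot t n + _]addrC subrr.
- have := trel0 N; congr trel; apply: functional_extensionality_dep => k.
  by rewrite tot1 if_same /tot big_nil subr0.
- have := trel0 N; congr trel; apply: functional_extensionality_dep => k.
  by rewrite tot2 !tot1; case: eqP => _; rewrite ?subrr // !addr0 subrr.
- apply: (@trel1 N m [:: (1, n + n'); (-1, n); (-1, n')]).
    by rewrite !big_cons big_nil !scaleN1r scale1r addr0 addrACA !subrr addr0.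
  move=> k; rewrite tot2 !tot1 big_mkcond !big_cons big_nil /= !scaleN1r scale1r addr0 opprD.
  by case: eqP; case: eqP; case: eqP; rewrite ?oppr0.
- apply: (@trel1 N m [:: (a, n); (-1, a *: n)]).
    by rewrite !big_cons big_nil scaleN1r addr0 subrr.
  move=> k; rewrite !tot1 big_mkcond !big_cons big_nil /= scaleN1r addr0.
  by case: eqP; case: eqP; rewrite ?oppr0.
Qed.

Lemma flatten1 (I T : Type) (r : seq I) (F : I -> T) :
  flatten [seq [:: F i] | i <- r] = [seq F i | i <- r].
Proof. by elim: r => //= i r ->. Qed.

Section TensorLists.
Variable N : lmodType R.
Implicit Types (s t : seq (M * N)).
Local Notation "s ~~ t" := (@tensor_eq R M N s t) (at level 70).

Lemma te_flatten (I : eqType) (r : seq I) (F G : I -> seq (M * N)) :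
  (forall i, i \in r -> F i ~~ G i) ->
  flatten [seq F i | i <- r] ~~ flatten [seq G i | i <- r].
Proof.
elim: r => [_|i r IH h] /=; first exact: tensor_refl.
apply: tensor_cat; first by apply: h; rewrite mem_head.
by apply: IH => j jr; apply: h; rewrite inE jr orbT.
Qed.
Lemma te_nil (I : eqType) (r : seq I) (F : I -> seq (M * N)) :
  (forall i, i \in r -> F i ~~ [::]) -> flatten [seq F i | i <- r] ~~ [::].
Proof.
move=> /te_flatten h; apply: tensor_trans h _.
by elim: r => [|i r IH] /=; [exact: tensor_refl|].
Qed.
Lemma te_split (I : Type) (r : seq I) (F G : I -> seq (M * N)) :
  flatten [seq F i ++ G i | i <- r] ~~ flatten [seq F i | i <- r] ++ flatten [seq G i | i <- r].
Proof.
elim: r => [|i r IH] /=; first exact: tensor_refl.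
rewrite -!catA; apply: tensor_cat; first exact: tensor_refl.
apply: (tensor_trans (tensor_cat (tensor_refl _) IH)); rewrite !catA; apply: tensor_cat; last exact: tensor_refl.
exact: tensor_comm.
Qed.
Lemma te_exchange (I J : Type) (r : seq I) (r' : seq J) (F : I -> J -> M * N) :
  flatten [seq [seq F i j | j <- r'] | i <- r] ~~ flatten [seq [seq F i j | i <- r] | j <- r'].
Proof.
elim: r => [|i r IH] /=; first by elim: r' => [|j r' IH] /=; [exact: tensor_refl|].
apply: (tensor_trans (tensor_cat (tensor_refl _) IH)); apply: tensor_sym.
apply: (tensor_trans (te_split r' (fun j => [:: F i j]) (fun j => [seq F i j | i <- r]))).
by apply: tensor_cat; [rewrite flatten1|]; exact: tensor_refl.
Qed.
Lemma te_suml (I : Type) (r : seq I) (F : I -> M) n :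
  [:: (\sum_(i <- r) F i, n)] ~~ [seq (F i, n) | i <- r].
Proof.
elim: r => [|i r IH] /=; first by rewrite big_nil; exact: tensor_zero.
rewrite big_cons; apply: tensor_trans (tensor_addl _ _ _) _.
exact: (tensor_cat (tensor_refl [:: (F i, n)]) IH).
Qed.
Lemma te_zeror m : [:: (m, 0 : N)] ~~ [::].
Proof.
rewrite -(scale0r (0 : N)); apply: tensor_trans (tensor_sym (tensor_scale _ _ _)) _.
by rewrite scale0r; exact: tensor_zero.
Qed.
Lemma te_sumr (I : Type) (r : seq I) (F : I -> N) m :
  [:: (m, \sum_(i <- r) F i)] ~~ [seq (m, F i) | i <- r].
Proof.
elim: r => [|i r IH] /=; first by rewrite big_nil; exact: te_zeror.
rewrite big_cons; apply: tensor_trans (tensor_addr _ _ _) _.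
exact: (tensor_cat (tensor_refl [:: (m, F i)]) IH).
Qed.

(** Collecting terms by their second factor brings a list to a form that its total determines. *)
Lemma te_tot s (ws : seq N) : uniq ws -> {subset [seq u.2 | u <- s] <= ws} ->
  s ~~ [seq (tot s n, n) | n <- ws].
Proof.
move=> uws; elim: s => [_|[m n] s IH sub].
  rewrite -flatten1; apply: tensor_sym; apply: te_nil => n _.
  by rewrite /tot big_nil; exact: tensor_zero.
have [nws sub'] : n \in ws /\ {subset [seq u.2 | u <- s] <= ws}.
  by split=> [|k ks]; apply: sub; rewrite inE ?eqxx ?ks ?orbT.
have {IH} := tensor_cat (tensor_refl [:: (m, n)]) (IH sub'); move/tensor_trans; apply.
apply: tensor_sym; rewrite -flatten1.
apply: (tensor_trans (te_flatten (G := fun k => [:: (tot [:: (m, n)] k, k)] ++ [:: (tot s k, k)]) _)).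
  by move=> k _; rewrite (tot_cat [:: (m, n)] s k); exact: tensor_addl.
apply: (tensor_trans (te_split _ _ _)); rewrite !flatten1.
apply: tensor_cat; last exact: tensor_refl.
elim: ws uws nws {sub sub'} => //= k ws IH /andP[kws uws]; rewrite inE => /predU1P[->|nws].
  rewrite tot1 eqxx; apply: (@tensor_cat _ _ _ [:: _] [:: _] _ [::]); first exact: tensor_refl.
  rewrite -flatten1; apply: te_nil => j jws; rewrite tot1; case: eqP jws kws => [->|_ _ _].
    by move=> ->.
  exact: tensor_zero.
rewrite tot1; case: eqP nws kws => [->|_ nws _]; first by move=> ->.
apply: (@tensor_cat _ _ _ [:: _] [::]); first exact: tensor_zero.
exact: IH.
Qed.

Lemma te_sub s t : s ++ [seq (- u.1, u.2) | u <- t] ~~ [::] -> s ~~ t.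
Proof.
have H : [seq (- u.1, u.2) | u <- t] ++ t ~~ [::].
  elim: t => [|[m n] t IH] /=; first exact: tensor_refl.
  rewrite -cat1s; apply: tensor_trans (tensor_cat (tensor_refl _) (tensor_comm _ _)) _ => /=.
  apply: (@tensor_cat _ _ _ [:: _; _] [::] _ [::]); last first.
    by apply: tensor_trans IH; exact: tensor_comm.
  by apply: tensor_trans (tensor_sym (tensor_addl _ _ _)) _; rewrite addNr; exact: tensor_zero.
move=> h; apply: (@tensor_trans _ _ _ _ (s ++ [seq (- u.1, u.2) | u <- t] ++ t)).
  by rewrite -{1}[s]cats0; apply: tensor_cat; [exact: tensor_refl|exact: tensor_sym].
by rewrite catA; apply: (@tensor_cat _ _ _ _ [::] t t) => //; exact: tensor_refl.
Qed.

End TensorLists.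

Lemma tot_partition (V : nmodType) (T K : eqType) (s : seq T) (k : T -> K) (ws : seq K) (F : T -> V) :
  uniq ws -> {subset [seq k u | u <- s] <= ws} ->
  \sum_(u <- s) F u = \sum_(n <- ws) \sum_(u <- s | k u == n) F u.
Proof.
move=> uws sub; rewrite (exchange_big_dep xpredT) //=; rewrite !big_seq; apply: eq_bigr => u us.
under eq_bigl do rewrite eq_sym; rewrite -big_filter filter_pred1_uniq ?big_seq1 //.
by apply: sub; exact: map_f.
Qed.

End Flat.

(** An equality of the images amounts to finitely many relations in [N']. Elements of [N'] that are
    not images of second factors have total coefficient zero, which is a linear system on elements
    of [M]. Solving it by [eqflat] leaves relations among the images [g n], and injectivity carries
    these back to [N]. *)
Lemma eqflat_flat (R : comPzRingType) (M : lmodType R) : eqflat M -> flat M.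
Proof.
move=> fM N N' g gI s t; set gs := map _ s => /tensor_eq_trel[l [hl el]].
apply: te_sub; set w := s ++ _.
have {}el n' : \sum_(u <- w | g u.2 == n') u.1 =
    \sum_(u <- l) \sum_(e <- u.2 | e.2 == n') e.1 *: u.1.
  rewrite -el /tot /w big_cat !big_map /=; congr (_ + _).
  by rewrite -sumrN.
pose ws := undup [seq u.2 | u <- w].
pose ks := undup ([seq g n | n <- ws] ++ flatten [seq [seq e.2 | e <- u.2] | u <- l]).
pose u0 : M * seq (R * N') := (0, [::]).
pose y : {ffun 'I_(size l) -> M} := [ffun j : 'I__ => (nth u0 l j).1].
pose b n' (j : 'I_(size l)) : R := \sum_(e <- (nth u0 l j).2 | e.2 == n') e.1.
have hw n' : \sum_(u <- w | g u.2 == n') u.1 = \sum_j b n' j *: y j.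
  rewrite el (big_image_seq _ _ u0); apply: eq_bigr => j _.
  by rewrite ffunE scaler_suml.
have hb j : \sum_(n' <- ks) b n' j *: n' = 0.
  rewrite -[RHS](hl (nth u0 l j)) ?mem_nth // (tot_partition (ws := ks) (k := snd)) ?undup_uniq //.
    by apply: eq_bigr => n' _; rewrite scaler_suml; apply: eq_bigr => e /eqP ->.
  move=> n' hn'; rewrite mem_undup mem_cat; apply/orP; right.
  by apply/flattenP; exists [seq e.2 | e <- (nth u0 l j).2] => //; apply: map_f; exact: mem_nth.
pose A : 'M[R]_(size l, size ks) :=
  \matrix_(j, k) if nth 0 ks k \in [seq g n | n <- ws] then 0 else b (nth 0 ks k) j.
have yA : act y A = 0.
  apply/ffunP => k; rewrite !ffunE.
  case: (boolP (nth 0 ks k \in [seq g n | n <- ws])) => [kin|knin]; last first.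
    under eq_bigr do rewrite mxE (negPf knin).
    rewrite -hw big_seq_cond big1 // => u /andP[uw /eqP e].
    by case/negP: knin; rewrite -e; apply: map_f; rewrite mem_undup; exact: map_f.
  by rewrite big1 // => j _; rewrite mxE kin scale0r.
have [q [c [z [cA ey]]]] := fM _ _ _ _ yA.
pose B (i : 'I_q) (n : N) := \sum_j c i j * b (g n) j.
have hB i : \sum_(n <- ws) B i n *: n = 0.
  refine (gI _ _ _); rewrite linear0 linear_sum /=.
  transitivity (\sum_(n' <- ks) (\sum_j c i j * b n' j) *: n'); last first.
    under eq_bigr do rewrite scaler_suml; rewrite exchange_big /= big1 // => j _.
    by under eq_bigr do rewrite -scalerA; rewrite -scaler_sumr hb scaler0.
  rewrite [RHS](bigID (mem [seq g n | n <- ws])) /= [X in _ = _ + X]big1_seq ?addr0; last first.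
    move=> n' /andP[nin n'ks]; move/(nthP 0): n'ks => [k hk ek].
    move/matrixP: cA => /(_ i (Ordinal hk)); rewrite !mxE => cA.
    suff -> : \sum_j c i j * b n' j = 0 by rewrite scale0r.
    by rewrite -[RHS]cA; apply: eq_bigr => j _; rewrite mxE /= ek (negPf nin).
  rewrite -[RHS]big_filter.
  rewrite [RHS](perm_big [seq g n | n <- ws]); last first.
    apply: uniq_perm; [by rewrite filter_uniq ?undup_uniq|by rewrite (map_inj_uniq gI) undup_uniq|].
    move=> n'; rewrite mem_filter andb_idr // => h; rewrite mem_undup mem_cat h //.
  by rewrite big_map; apply: eq_bigr => n _; rewrite linearZ.
have totE n : tot w n = \sum_i B i n *: z i.
  have -> : tot w n = \sum_(u <- w | g u.2 == g n) u.1.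
    by apply: eq_bigl => u; rewrite (inj_eq gI).
  rewrite hw ey; under eq_bigr do rewrite ffunE scaler_sumr; rewrite exchange_big; apply: eq_bigr => i _.
  by rewrite scaler_suml; apply: eq_bigr => j _; rewrite scalerA mulrC.
apply: (tensor_trans (te_tot (ws := ws) (undup_uniq _) _)); first by move=> n; rewrite mem_undup.
rewrite -flatten1.
apply: (tensor_trans (te_flatten (G := fun n => [seq (z i, B i n *: n) | i <- index_enum 'I_q]) _)).
  move=> n _; rewrite totE.
  apply: tensor_trans (te_suml _ _ _) _; rewrite -flatten1 -[X in tensor_eq _ X]flatten1.
  by apply: te_flatten => i _; exact: tensor_scale.
apply: (tensor_trans (te_exchange _ _ _)); apply: te_nil => i _.
apply: tensor_trans (tensor_sym (te_sumr _ _ _)) _.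
by rewrite hB; exact: te_zeror.
Qed.

(** Flatness is tested on the inclusion of the row space of [A] in the free module: [x A = 0] says
    that the sum of the [x_i] tensor row [i] dies in the larger tensor product, hence already over
    the row space. *)
Lemma flat_eqflat (R : comPzRingType) (M : lmodType R) : flat M -> eqflat M.
Proof.
move=> fM n k A x xA.
pose N := [set r : 'rV[R]_k | exists t : 'rV[R]_n, r = t *m A].
have sN : submodule N.
  split; first by exists 0; rewrite mul0mx.
    by move=> _ _ [t ->] [u ->]; exists (t + u); rewrite mulmxDl.
  by move=> a _ [t ->]; exists (a *: t); rewrite -scalemxAl.
have NA i : N (row i A) by exists (delta_mx 0 i); rewrite -rowE.
pose s := [seq (x i, smk sN (NA i)) | i <- index_enum 'I_n].
have /(fM _ _ (@smval R _ N sN) (@smval_inj R _ N sN) s [::]) : tensor_eq [seq (u.1, smval u.2) | u <- s] [::].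
  rewrite -map_comp /= -flatten1.
  apply: (tensor_trans (te_flatten (G := fun i => [seq (A i j *: x i, delta_mx 0 j : 'rV[R]_k) | j <- index_enum 'I_k]) _)).
    move=> i _ /=; rewrite [row i A]row_sum_delta.
    apply: tensor_trans (te_sumr _ _ _) _; rewrite -flatten1 -[X in tensor_eq _ X]flatten1.
    by apply: te_flatten => j _; rewrite mxE; apply: tensor_sym; exact: tensor_scale.
  apply: (tensor_trans (te_exchange _ _ _)); apply: te_nil => j _.
  apply: tensor_trans (tensor_sym (te_suml _ _ _)) _.
  have -> : \sum_i A i j *: x i = 0 by move/ffunP: xA => /(_ j); rewrite !ffunE.
  exact: tensor_zero.
move=> /tensor_eq_trel[l [hl el]].
have /choice[rho hr] : forall u : submt sN, exists t : 'rV[R]_n, smval u = t *m A.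
  by move=> u; exact: (smval_in u).
pose u0 : M * seq (R * submt sN) := (0, [::]).
(* The rows of [b] are of two sorts, both killed by [A]: lifts of the relations in the row space
   listed by [l], and differences between a basis vector and the lift that [rho] chooses for its row
   of [A]. *)
pose b := col_mx (\matrix_(j < size l) \sum_(e <- (nth u0 l j).2) e.1 *: rho e.2)
                 (\matrix_(i < n) (delta_mx 0 i - rho (smk sN (NA i)))).
pose y : {ffun 'I_(size l + n) -> M} :=
  [ffun j => match split j with inl j => (nth u0 l j).1 | inr i => x i end].
exists (size l + n)%N, b, y; split.
  rewrite mul_col_mx -[RHS]col_mx0; congr col_mx; apply/row_matrixP => i.
    rewrite row_mul rowK row0 mulmx_suml.
    under eq_bigr do rewrite -scalemxAl -hr -linearZ.
    by rewrite -linear_sum hl ?mem_nth.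
  by rewrite row_mul rowK row0 mulmxBl -hr -rowE /= subrr.
have H (F : submt sN -> R) : \sum_i F (smk sN (NA i)) *: x i =
    \sum_(u <- l) \sum_(e <- u.2) (e.1 * F e.2) *: u.1.
  pose ws := undup ([seq u.2 | u <- s] ++ flatten [seq [seq e.2 | e <- u.2] | u <- l]).
  have -> : \sum_i F (smk sN (NA i)) *: x i = \sum_(u <- s) F u.2 *: u.1 by rewrite big_map.
  rewrite (tot_partition (ws := ws) (k := snd)) ?undup_uniq //; last first.
    by move=> v hv; rewrite mem_undup mem_cat hv.
  transitivity (\sum_(v <- ws) \sum_(u <- l) \sum_(e <- u.2 | e.2 == v) (e.1 * F e.2) *: u.1).
    apply: eq_bigr => v _; have := el v; rewrite {2}/tot big_nil subr0 /tot => e.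
    under eq_bigr => u /eqP -> do [].
    rewrite -scaler_sumr e scaler_sumr; apply: eq_bigr => u _; rewrite scaler_sumr.
    by apply: eq_bigr => c /eqP ->; rewrite scalerA mulrC.
  rewrite exchange_big !big_seq; apply: eq_bigr => u ul.
  rewrite [RHS](tot_partition (ws := ws) (k := snd)) ?undup_uniq //.
  move=> v hv; rewrite mem_undup mem_cat; apply/orP; right.
  by apply/flattenP; exists [seq e.2 | e <- u.2] => //; exact: map_f.
apply/ffunP => k'; rewrite ffunE big_split_ord /=.
under eq_bigr do rewrite ffunE split_l col_mxEu mxE.
under [X in _ = _ + X]eq_bigr do rewrite ffunE split_r col_mxEd !mxE.
have -> : \sum_(i < size l) (\sum_(e <- (nth u0 l i).2) e.1 *: rho e.2) 0 k' *: (nth u0 l i).1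
    = \sum_i rho (smk sN (NA i)) 0 k' *: x i.
  rewrite (H (fun v => rho v 0 k')) (big_image_seq _ _ u0); apply: eq_bigr => i _.
  by rewrite summxE scaler_suml; apply: eq_bigr => e _; rewrite mxE.
rewrite -big_split /= (bigD1 k') //= !eqxx big1 ?addr0 => [|i ne].
  by rewrite -scalerDl addrCA subrr addr0 scale1r.
by rewrite eq_sym (negPf ne) -scalerDl addrCA subrr addr0 scale0r.
Qed.

(** * Complexes of finite free modules and flat dimension *)

Section Fcat.
Variables (V : Type) (p q : nat).
Definition fl (v : {ffun 'I_(p + q) -> V}) : {ffun 'I_p -> V} := [ffun i => v (lshift q i)].
Definition fr (v : {ffun 'I_(p + q) -> V}) : {ffun 'I_q -> V} := [ffun i => v (rshift p i)].
Definition fcat (u : {ffun 'I_p -> V}) (v : {ffun 'I_q -> V}) : {ffun 'I_(p + q) -> V} :=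
  [ffun i => match split i with inl j => u j | inr j => v j end].
Lemma fl_cat u v : fl (fcat u v) = u.
Proof. by apply/ffunP => i; rewrite !ffunE split_l. Qed.
Lemma fr_cat u v : fr (fcat u v) = v.
Proof. by apply/ffunP => i; rewrite !ffunE split_r. Qed.
Lemma flr_all (W : V -> Prop) v : (forall i, W (fl v i)) -> (forall i, W (fr v i)) -> forall i, W (v i).
Proof.
by move=> hl hr i; case: (split_ordP i) => j ->; [have := hl j|have := hr j]; rewrite ffunE.
Qed.
Lemma flr_eq v w : fl v = fl w -> fr v = fr w -> v = w.
Proof.
move=> /ffunP el /ffunP er; apply/ffunP => i.
by case: (split_ordP i) => j ->; [have := el j|have := er j]; rewrite !ffunE.
Qed.
End Fcat.

Section FcatAct.
Variables (R : comPzRingType) (M : lmodType R) (p q r s : nat).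
Implicit Types (v : {ffun 'I_(p + q) -> M}).
Lemma flB v w : fl (v - w) = fl v - fl w. Proof. by apply/ffunP => i; rewrite !ffunE. Qed.
Lemma frB v w : fr (v - w) = fr v - fr w. Proof. by apply/ffunP => i; rewrite !ffunE. Qed.
Lemma fl_act v (A : 'M[R]_(p, r)) (B : 'M_(p, s)) (C : 'M_(q, r)) (D : 'M_(q, s)) :
  fl (act v (block_mx A B C D)) = act (fl v) A + act (fr v) C.
Proof.
apply/ffunP => i; rewrite !ffunE big_split_ord; congr (_ + _); apply: eq_bigr => j _.
  by rewrite ffunE block_mxEul.
by rewrite ffunE block_mxEdl.
Qed.
Lemma fr_act v (A : 'M[R]_(p, r)) (B : 'M_(p, s)) (C : 'M_(q, r)) (D : 'M_(q, s)) :
  fr (act v (block_mx A B C D)) = act (fl v) B + act (fr v) D.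
Proof.
apply/ffunP => i; rewrite !ffunE big_split_ord; congr (_ + _); apply: eq_bigr => j _.
  by rewrite ffunE block_mxEur.
by rewrite ffunE block_mxEdr.
Qed.
End FcatAct.

(* A complex of finite free modules, as one matrix [df] acting on row vectors and lowering the
   degree [dg] of the basis vectors by one. *)
Record cpx (R : comPzRingType) := Cpx { rk : nat; dg : 'I_rk -> nat; df : 'M[R]_rk }.

Section Complex.
Variables (R : comPzRingType).
Implicit Types (C D : cpx R).

Definition okc C := df C *m df C = 0 /\ forall s t, dg s <> (dg t).+1 -> df C s t = 0.

Definition hmg C (V : zmodType) i (v : {ffun 'I_(rk C) -> V}) := forall t, dg t <> i -> v t = 0.
Definition hproj C (V : zmodType) i (v : {ffun 'I_(rk C) -> V}) : {ffun 'I_(rk C) -> V} :=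
  [ffun t => if dg t == i then v t else 0].

Lemma hmg_hproj C (V : zmodType) i (v : {ffun 'I_(rk C) -> V}) : hmg i (hproj i v).
Proof. by move=> t /eqP/negPf h; rewrite ffunE h. Qed.
Lemma hprojE C (V : zmodType) i (v : {ffun 'I_(rk C) -> V}) : hmg i v -> hproj i v = v.
Proof. by move=> h; apply/ffunP => t; rewrite ffunE; case: eqP => // /h. Qed.
Lemma hmgD C (V : zmodType) i (v w : {ffun 'I_(rk C) -> V}) : hmg i v -> hmg i w -> hmg i (v + w).
Proof. by move=> hv hw t ht; rewrite ffunE hv // hw // addr0. Qed.
Lemma hmgN C (V : zmodType) i (v : {ffun 'I_(rk C) -> V}) : hmg i v -> hmg i (- v).
Proof. by move=> hv t ht; rewrite ffunE hv // oppr0. Qed.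
Lemma hmgB C (V : zmodType) i (v w : {ffun 'I_(rk C) -> V}) : hmg i v -> hmg i w -> hmg i (v - w).
Proof. by move=> hv hw; apply: hmgD => //; exact: hmgN. Qed.

Lemma act_hproj C (M : lmodType R) i (v : {ffun 'I_(rk C) -> M}) : okc C ->
  act (hproj i.+1 v) (df C) = hproj i (act v (df C)).
Proof.
move=> [_ hd]; apply/ffunP => t; rewrite !ffunE; case: eqP => [<-|ne]; last first.
  rewrite big1 // => s _; rewrite ffunE; case: eqP => [e|_]; last by rewrite scaler0.
  by rewrite hd ?scale0r // e => -[] /esym.
apply: eq_bigr => s _; rewrite ffunE; case: eqP => // ne.
by rewrite hd ?scale0r.
Qed.
Lemma hmg_act C (M : lmodType R) i (v : {ffun 'I_(rk C) -> M}) : okc C -> hmg i.+1 v ->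
  hmg i (act v (df C)).
Proof. by move=> oC /hprojE <-; rewrite act_hproj //; exact: hmg_hproj. Qed.
Lemma hmg0_act C (M : lmodType R) (v : {ffun 'I_(rk C) -> M}) : okc C -> hmg 0 v ->
  act v (df C) = 0.
Proof.
move=> [_ hd] hv; apply/ffunP => t; rewrite !ffunE big1 // => s _.
case: (pselect (dg s = 0%N)) => [e|/hv ->]; last by rewrite scaler0.
by rewrite hd ?scale0r // e.
Qed.
Lemma actdd C (M : lmodType R) (v : {ffun 'I_(rk C) -> M}) : okc C -> act (act v (df C)) (df C) = 0.
Proof. by move=> [dd _]; rewrite -actM dd act0r. Qed.

(* Exactness in degree [i] of the complex tensored with the subquotient [U / W]. *)
Definition exq C (M : lmodType R) (U W : set M) i := forall v : {ffun 'I_(rk C) -> M},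
  (forall t, U (v t)) -> hmg i v -> (forall t, W (act v (df C) t)) ->
  exists w : {ffun 'I_(rk C) -> M},
    [/\ forall t, U (w t), hmg i.+1 w & forall t, W ((v - act w (df C)) t)].

Definition exact_at C (M : lmodType R) i := exq C [set: M] [set 0] i.

Lemma exact_atP C (M : lmodType R) i : exact_at C M i <->
  forall v : {ffun 'I_(rk C) -> M}, hmg i v -> act v (df C) = 0 ->
  exists2 w : {ffun 'I_(rk C) -> M}, hmg i.+1 w & v = act w (df C).
Proof.
split=> h v.
  move=> hv v0; case: (h v) => //= [t|w [_ hw e]]; first by rewrite v0 ffunE.
  by exists w => //; apply/ffunP => t; apply/eqP; rewrite -subr_eq0; move: (e t); rewrite /= !ffunE => ->.
move=> _ hv v0; case: (h v) => //= [|w hw e]; first by apply/ffunP => t; rewrite (v0 t) ffunE.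
by exists w; split=> // t; rewrite -e subrr ffunE.
Qed.

Lemma exact_flat C (F : lmodType R) i : okc C -> eqflat F -> exact_at C R^o i -> exact_at C F i.
Proof.
move=> oC fF /exact_atP exR; apply/exact_atP => v hv v0.
(* The extra columns [E] express homogeneity of degree [i], so that the relations delivered by
   flatness are homogeneous cycles over [R]. *)
pose E : 'M[R]_(rk C) := \matrix_(s, t) ((s == t) && (dg t != i))%:R.
have [q [b [y [bA ->]]]] : exists q (b : 'M[R]_(q, rk C)) y, b *m row_mx (df C) E = 0 /\ v = act y b.
  apply: fF; apply/ffunP => j; rewrite !ffunE; case: (split_ordP j) => k ->.
    have /ffunP/(_ k) := v0; rewrite !ffunE => v0k; rewrite -[RHS]v0k.
    by apply: eq_bigr => s _; rewrite row_mxEl.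
  rewrite (bigD1 k) //= big1 ?addr0 => [|s ne]; rewrite row_mxEr mxE ?eqxx ?(negPf ne) ?scale0r //.
  by case: eqP => [_|/hv ->]; rewrite ?scale0r ?scaler0.
have /choice[w hw] : forall l : 'I_q, exists w : {ffun 'I_(rk C) -> R^o},
    hmg i.+1 w /\ [ffun t => b l t : R^o] = act w (df C).
  move=> l; have [|| w ? ?] := exR [ffun t => b l t : R^o]; last by exists w.
    move=> t ht; rewrite ffunE; move/matrixP: bA => /(_ l (rshift _ t)); rewrite !mxE (bigD1 t) //=.
    rewrite row_mxEr mxE eqxx (introN eqP ht) mulr1 big1 ?addr0 // => s ne.
    by rewrite row_mxEr mxE (negPf ne) mulr0.
  apply/ffunP => t; rewrite !ffunE; move/matrixP: bA => /(_ l (lshift _ t)); rewrite !mxE => e.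
  rewrite -[RHS]e; apply: eq_bigr => s _; rewrite row_mxEl ffunE; exact: mulrC.
pose B : 'M[R]_(q, rk C) := \matrix_(l, t) w l t.
have -> : b = B *m df C.
  apply/matrixP => l t; have [_ /ffunP/(_ t)] := hw l; rewrite !ffunE => ->.
  by rewrite mxE; apply: eq_bigr => s _; rewrite mxE; exact: mulrC.
exists (act y B); last by rewrite actM.
move=> t ht; rewrite ffunE big1 // => l _; rewrite mxE.
by case: (hw l) => h _; rewrite h // scale0r.
Qed.

(** Dimension shifting along [0 -> Ker g -> F -> range g -> 0]. The image enters as a subset of [N],
    which lets the lemma be iterated along a resolution. *)
Lemma exq_shift C (F N : lmodType R) (g : {linear F -> N}) i : okc C ->
  exact_at C F i.+1 -> exq C [set x | g x = 0] [set 0] i -> exq C (range g) [set 0] i.+1.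
Proof.
move=> oC /exact_atP exF exK v vg hv v0.
have /choice[u hu] : forall t, exists x, g x = v t by move=> t; have [x _ <-] := vg t; exists x.
pose u' : {ffun 'I_(rk C) -> F} := hproj i.+1 [ffun t => u t].
have gu : [ffun t => g (u' t)] = v.
  apply/ffunP => t; rewrite !ffunE; case: eqP => [_|/hv ->]; last by rewrite linear0.
  by rewrite hu.
have hu' : hmg i.+1 u' by exact: hmg_hproj.
have [||| w [hw1 hw2 hw3]] := exK (act u' (df C)).
- by move=> t /=; have := act_linear g u' (df C); rewrite gu => /ffunP/(_ t); rewrite ffunE => ->; exact: v0.
- exact: hmg_act.
- by move=> t; rewrite actdd // ffunE.
have e : act u' (df C) = act w (df C).
  by apply/ffunP => t; apply/eqP; rewrite -subr_eq0; move: (hw3 t); rewrite /= !ffunE => ->.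
have [||z hz ez] := exF (u' - w); first exact: hmgB.
  by rewrite actBl e subrr.
exists [ffun t => g (z t)]; split; first by move=> t; rewrite ffunE; exists (z t).
  by move=> t ht; rewrite ffunE hz // linear0.
move=> t; rewrite -act_linear -ez -gu !ffunE linearB.
by have := hw1 t; rewrite /= => ->; rewrite subr0 subrr.
Qed.

Definition exact_to C i := forall s, (0 < s <= i)%N -> exact_at C R^o s.

(* The vanishing of [Tor_i(-, N)] for [i > c], tested on truncated free resolutions. *)
Definition torvan c (N : lmodType R) := forall C, okc C -> forall i, (c < i)%N ->
  exact_to C i -> exact_at C N i.

Lemma flat_res_torvan c N : has_flat_resolution N c -> torvan c N.
Proof.
move=> [F [e [d [fF F0 eT dK dd]]]] C oC i lci exC.
have exF j s : (0 < s <= i)%N -> exact_at C (F j) s.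
  by move=> hs; apply: exact_flat => //; [exact: flat_eqflat|exact: exC].
(* The induction starts at the far end: the image of [d c] is zero because [F c.+1] is, and each
   step towards [F 0] raises the degree bound by one. *)
have H k j s : (j + k = c)%N -> (s <= i)%N -> (k <= s)%N -> exq C (range (d j)) [set 0] s.
  elim: k j s => [|k IH] j s.
    rewrite addn0 => -> _ _ v hv _ _; exists 0; split=> [t|t ht|t].
    - by exists 0; rewrite ?linear0 ?ffunE.
    - by rewrite ffunE.
    rewrite act0l subr0; have [x _ <-] := hv t.
    by rewrite (F0 c.+1 _ x) ?linear0.
  case: s => // s ejk lsi lks; apply: exq_shift => //; first by apply: exF.
  rewrite -(_ : range (d j.+1) = [set x | d j x = 0]) //.
  by apply: IH => //; [rewrite addSnnS|exact: ltnW].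
rewrite /exact_at -eT; case: i lci exC exF H => // i lci exC exF H.
apply: exq_shift => //; first by apply: exF; rewrite ltnS leqnn.
by rewrite -dK; apply: (H c) => //; rewrite ?add0n.
Qed.

(** The mapping cone, with the target [D] as first summand; the sign on [df C] makes the square of
    the differential vanish. *)
Definition mcone C D (psi : 'M[R]_(rk C, rk D)) : cpx R :=
  @Cpx R (rk D + rk C)
    (fun s => match split s with inl t => dg t | inr t => (dg t).+1 end)
    (block_mx (df D) 0 psi (- df C)).

Definition chain_map C D (psi : 'M[R]_(rk C, rk D)) :=
  psi *m df D = df C *m psi /\ forall s t, dg s <> dg t -> psi s t = 0.

Lemma okc_mcone C D psi : okc C -> okc D -> @chain_map C D psi -> okc (mcone psi).
Proof.
move=> [dC hC] [dD hD] [e hp]; split.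
  rewrite /= mulmx_block dD !mul0mx !mulmx0 !addr0 add0r mulNmx e subrr mulmxN mulNmx opprK dC.
  by rewrite -[RHS]block_mx0.
move=> s t; rewrite /=; case: (split_ordP s) => s' ->; case: (split_ordP t) => t' -> /=;
  rewrite ?split_l ?split_r ?block_mxEul ?block_mxEur ?block_mxEdl ?block_mxEdr => h.
- exact: hD.
- by rewrite mxE.
- by apply: hp => e'; apply: h; rewrite e'.
- by rewrite mxE hC ?oppr0 // => e'; apply: h; rewrite e'.
Qed.

Lemma hmg_mconel C D (psi : 'M_(rk C, rk D)) (V : zmodType) i (v : {ffun 'I_(rk (mcone psi)) -> V}) :
  hmg i v -> @hmg D V i (fl v).
Proof. by move=> h t ht; rewrite ffunE h //= split_l. Qed.
Lemma hmg_mconer C D (psi : 'M_(rk C, rk D)) (V : zmodType) i (v : {ffun 'I_(rk (mcone psi)) -> V}) :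
  hmg i.+1 v -> @hmg C V i (fr v).
Proof. by move=> h t ht; rewrite ffunE h //= split_r => -[]. Qed.
Lemma hmg_mcone C D (psi : 'M_(rk C, rk D)) (V : zmodType) i
    (u : {ffun 'I_(rk D) -> V}) (v : {ffun 'I_(rk C) -> V}) :
  hmg i.+1 u -> hmg i v -> @hmg (mcone psi) V i.+1 (fcat u v).
Proof.
move=> hu hv t /=; rewrite ffunE; case: (split_ordP t) => j _ h; first exact: hu.
by apply: hv => e; apply: h; rewrite e.
Qed.

Lemma exq_mcone C D psi (M : lmodType R) (U W : set M) i : okc C -> okc D -> @chain_map C D psi ->
  submodule U -> submodule W -> exq C U W i -> exq D U W i.+1 -> exq (mcone psi) U W i.+1.
Proof.
move=> oC oD [e hp] sU sW exC exD x Ux hx Wx.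
have hl t : W ((act (fl x) (df D) + act (fr x) psi) t).
  by have := Wx (lshift _ t); rewrite -[act x _ _]/(act x _ _) -(ffunE (fun t => act x (df (mcone psi)) (lshift (rk C) t))) -/(fl _) fl_act.
have hr t : W (act (fr x) (df C) t).
  have := Wx (rshift _ t); rewrite -(ffunE (fun t => act x (df (mcone psi)) (rshift (rk D) t))) -/(fr _) fr_act.
  by rewrite act0r add0r actNr ffunE => /(submodN sW); rewrite opprK.
have [|w [Uw hw Ww]] := exC (fr x) _ (hmg_mconer hx) hr; first by move=> t; rewrite ffunE.
have Ul t : U (fl x t) by rewrite ffunE.
have [|||z [Uz hz Wz]] := exD (fl x + act w psi).
- by move=> t; rewrite ffunE; apply: submodD => //; exact: act_in.
- apply: hmgD; first exact: (hmg_mconel hx).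
  move=> t ht; rewrite ffunE big1 // => s _.
  case: (pselect (dg s = i.+1)) => [es|/hw ->]; last by rewrite scaler0.
  by rewrite hp ?scale0r // es => /esym.
- move=> t; rewrite actDl -actM e actM.
  have -> : act (act w (df C)) psi = act (fr x) psi - act (fr x - act w (df C)) psi.
    by rewrite actBl opprB addrC subrK.
  rewrite addrA ffunE; apply: submodD => //; rewrite ffunE; apply: submodN => //.
  exact: act_in.
exists (fcat z (- w)); split.
- by apply: flr_all; rewrite ?fl_cat ?fr_cat // => t; rewrite ffunE; exact: submodN.
- by apply: hmg_mcone => //; exact: hmgN.
apply: flr_all => t.
  by rewrite flB fl_act fl_cat fr_cat actNl opprD opprK addrA addrAC.
by rewrite frB fr_act fl_cat fr_cat act0r add0r actNl actNr opprK.
Qed.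

(** The Koszul step: [C] tensored with the two-term complex given by [y]. *)
Definition cone C (y : R) : cpx R := @mcone C C y%:M.

Lemma chain_scalar C y : @chain_map C C y%:M.
Proof.
split; first by rewrite scalar_mxC.
by move=> s t h; rewrite mxE; case: eqP => // e; case: h; rewrite e.
Qed.

Lemma okc_cone C y : okc C -> okc (cone C y).
Proof. by move=> oC; apply: okc_mcone => //; exact: chain_scalar. Qed.

Lemma exq_cone C y (M : lmodType R) (U W : set M) i : okc C -> submodule U -> submodule W ->
  exq C U W i -> exq C U W i.+1 -> exq (cone C y) U W i.+1.
Proof. by move=> oC sU sW; apply: exq_mcone => //; exact: chain_scalar. Qed.

(** Adjoins [q] free generators in degree [L.+1] whose boundaries are the rows of [del]. When these
    rows span the cycles of degree [L], this continues a free resolution by one step. *)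
Definition attach C L q (del : 'M[R]_(q, rk C)) : cpx R :=
  @Cpx R (rk C + q) (fun s => match split s with inl t => dg t | inr t => L.+1 end)
    (block_mx (df C) 0 del 0).

Lemma okc_ext C L q (del : 'M_(q, rk C)) : okc C -> del *m df C = 0 ->
  (forall s t, dg t <> L -> del s t = 0) -> okc (attach L del).
Proof.
move=> [dC hC] e hd; split.
  by rewrite /= mulmx_block dC !mul0mx !mulmx0 !addr0 e -[RHS]block_mx0.
move=> s t; rewrite /=; case: (split_ordP s) => s' ->; case: (split_ordP t) => t' -> /=;
  rewrite ?split_l ?split_r ?block_mxEul ?block_mxEur ?block_mxEdl ?block_mxEdr ?mxE // => h.
  exact: hC.
by apply: hd => e'; apply: h; rewrite e'.
Qed.

Lemma hmg_extl C L q (del : 'M_(q, rk C)) (V : zmodType) i (v : {ffun 'I_(rk (attach L del)) -> V}) :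
  hmg i v -> @hmg C V i (fl v).
Proof. by move=> h t ht; rewrite ffunE h //= split_l. Qed.
Lemma hmg_extr C L q (del : 'M_(q, rk C)) (V : zmodType) i (v : {ffun 'I_(rk (attach L del)) -> V}) :
  hmg i v -> i != L.+1 -> fr v = 0.
Proof. by move=> h ne; apply/ffunP => t; rewrite !ffunE h //= split_r => /esym/eqP; rewrite (negPf ne). Qed.
Lemma hmg_ext C L q (del : 'M_(q, rk C)) (V : zmodType) i
    (u : {ffun 'I_(rk C) -> V}) (v : {ffun 'I_q -> V}) :
  hmg i u -> (i != L.+1 -> v = 0) -> @hmg (attach L del) V i (fcat u v).
Proof.
move=> hu hv t /=; rewrite ffunE; case: (split_ordP t) => j _ h; first exact: hu.
by rewrite hv ?ffunE //; apply/eqP => e; apply: h; rewrite e.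
Qed.

Lemma exact_extl C L q (del : 'M_(q, rk C)) (M : lmodType R) i : (i < L)%N ->
  exact_at C M i <-> exact_at (attach L del) M i.
Proof.
move=> lti; split=> /exact_atP h; apply/exact_atP => v hv v0.
  have r0 : fr v = 0 by apply: hmg_extr hv _; lia.
  have [||w hw ew] := h (fl v); first exact: hmg_extl hv.
    by have := congr1 (@fl _ _ _) v0; rewrite fl_act r0 act0l addr0 => ->; apply/ffunP => t; rewrite !ffunE.
  exists (fcat w 0); first exact: hmg_ext.
  apply: flr_eq; rewrite ?fl_act ?fr_act fl_cat fr_cat act0l addr0 //.
  by rewrite act0r r0.
have [||w hw ew] := h (fcat v 0); first exact: hmg_ext.
  apply: flr_eq; rewrite ?fl_act ?fr_act fl_cat fr_cat act0l addr0 ?act0r ?v0;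
    by apply/ffunP => t; rewrite !ffunE.
have r0 : fr w = 0 by apply: hmg_extr hw _; lia.
exists (fl w); first exact: hmg_extl hw.
by have := congr1 (@fl _ _ _) ew; rewrite fl_cat fl_act r0 act0l addr0.
Qed.

Lemma exact_ext C L q (del : 'M_(q, rk C)) : okc C ->
  (forall v : {ffun 'I_(rk C) -> R^o}, hmg L v -> act v (df C) = 0 ->
     exists c : {ffun 'I_q -> R^o}, v = act c del) ->
  exact_at (attach L del) R^o L.
Proof.
move=> oC h; apply/exact_atP => v hv v0.
have r0 : fr v = 0 by apply: hmg_extr hv _; lia.
have [||c hc] := h (fl v); first exact: hmg_extl hv.
  by have := congr1 (@fl _ _ _) v0; rewrite fl_act r0 act0l addr0 => ->; apply/ffunP => t; rewrite !ffunE.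
exists (fcat 0 c).
  apply: hmg_ext; last by rewrite eqxx.
  by move=> t _; rewrite ffunE.
apply: flr_eq; rewrite ?fl_act ?fr_act fl_cat fr_cat act0l add0r ?act0r //.
Qed.

Lemma syzygies C L : noetherian_ring R -> okc C -> exists q (del : 'M[R]_(q, rk C)),
  [/\ del *m df C = 0, forall s t, dg t <> L -> del s t = 0
    & forall v : {ffun 'I_(rk C) -> R^o}, hmg L v -> act v (df C) = 0 ->
        exists c : {ffun 'I_q -> R^o}, v = act c del].
Proof.
move=> nR oC; pose U := [set v : {ffun 'I_(rk C) -> R^o} | hmg L v /\ act v (df C) = 0].
have sU : submodule U.
  split; first by split; [move=> t _; rewrite ffunE|rewrite act0l].
    by move=> x y [hx x0] [hy y0]; split; [exact: hmgD|rewrite actDl x0 y0 addr0].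
  move=> a x [hx x0]; split; last by rewrite actZl x0 scaler0.
  by move=> t ht; rewrite ffunE hx // scaler0.
have [q [x defU]] := noeth_ffun nR sU.
have Ux i : U (x i) by rewrite defU; apply: sub_span; exists i.
exists q, (\matrix_(i, t) x i t); split.
- apply/matrixP => i t; rewrite !mxE; have [_ /ffunP/(_ t)] := Ux i; rewrite !ffunE => e.
  by rewrite -[RHS]e; apply: eq_bigr => s _; rewrite mxE; exact: mulrC.
- by move=> s t ht; rewrite mxE; have [-> ] := Ux s.
move=> v hv v0; have : U v by [].
rewrite defU => /spanP[c ->]; exists [ffun i => c i]; apply/ffunP => t.
rewrite sum_ffunE ffunE; apply: eq_bigr => i _; rewrite !ffunE mxE; exact: mulrC.
Qed.

End Complex.

Section FreeModule.
Variables (R : comPzRingType) (N : lmodType R).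
Import functions.
Local Notation Fun := (N -> R^o).

Definition finsup : set Fun :=
  [set phi | exists s : seq N, forall n, phi n != 0 -> n \in s].

Lemma submodule_finsup : submodule finsup.
Proof.
split; first by exists [::] => n; rewrite eqxx.
  move=> p q [s hs] [t ht]; exists (s ++ t) => n h; rewrite mem_cat.
  case: (eqVneq (p n) 0) => [p0|/hs -> //]; case: (eqVneq (q n) 0) => [q0|/ht ->]; last by rewrite orbT.
  by move: h; rewrite -[(p + q) n]/(p n + q n) p0 q0 addr0 eqxx.
move=> a p [s hs]; exists s => n h; apply: hs; apply: contra_neq h => p0.
by rewrite -[(a *: p) n]/(a * p n) p0 mulr0.
Qed.

Local Notation Free := (submt submodule_finsup).

Lemma free_supp (phi : Free) : exists s : seq N, uniq s /\ forall n, smval phi n != 0 -> n \in s.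
Proof.
by have [s hs] := smval_in phi; exists (undup s); rewrite undup_uniq; split=> // n /hs; rewrite mem_undup.
Qed.

Definition supp (phi : Free) := projT1 (cid (free_supp phi)).
Definition free_eval (phi : Free) : N := \sum_(n <- supp phi) smval phi n *: n.

Lemma free_evalE (phi : Free) (s : seq N) : uniq s -> (forall n, smval phi n != 0 -> n \in s) ->
  free_eval phi = \sum_(n <- s) smval phi n *: n.
Proof.
rewrite /free_eval /supp; case: cid => t /= [ut ht] us hs.
have H r : \sum_(n <- r) smval phi n *: n = \sum_(n <- [seq n <- r | smval phi n != 0]) smval phi n *: n.
  rewrite big_filter [LHS](bigID (fun n => smval phi n != 0)) /= [X in _ + X]big1 ?addr0 // => n.
  by rewrite negbK => /eqP ->; rewrite scale0r.
rewrite H [RHS]H; apply: perm_big; apply: uniq_perm; rewrite ?filter_uniq // => n.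
by rewrite !mem_filter; case: eqP => //= /eqP h; rewrite hs ?ht.
Qed.

Let smvalE a (p q : Free) n : smval (a *: p + q) n = a * smval p n + smval q n.
Proof. by []. Qed.

Let free_eval_linear : linear free_eval.
Proof.
move=> a p q; have [s [us hs]] := free_supp p; have [t [ut ht]] := free_supp q.
pose r := undup (s ++ t).
have hr (n : N) : (n \in s) || (n \in t) -> n \in r by rewrite mem_undup mem_cat.
rewrite !(@free_evalE _ r) ?undup_uniq //.
- rewrite scaler_sumr -big_split; apply: eq_bigr => n _.
  by rewrite smvalE scalerDl scalerA.
- by move=> n /ht h; apply: hr; rewrite h orbT.
- by move=> n /hs h; apply: hr; rewrite h.
move=> n h; apply: hr; case: (eqVneq (smval p n) 0) => [p0|/hs -> //].
case: (eqVneq (smval q n) 0) => [q0|/ht ->]; last by rewrite orbT.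
by move: h; rewrite smvalE p0 q0 mulr0 addr0 eqxx.
Qed.
HB.instance Definition _ := GRing.isLinear.Build R Free N *:%R free_eval free_eval_linear.

Lemma finsup_delta (n : N) : finsup (fun k => (k == n)%:R).
Proof. by exists [:: n] => k; rewrite inE; case: (eqVneq k n) => //= _; rewrite eqxx. Qed.
Definition free_delta n : Free := smk submodule_finsup (finsup_delta n).

Lemma free_eval_surj n : free_eval (free_delta n) = n.
Proof.
rewrite (@free_evalE _ [:: n]) //= ?big_seq1 /= ?eqxx ?scale1r // => k.
by rewrite inE; case: (eqVneq k n) => //= _; rewrite eqxx.
Qed.

Lemma eqflat_free : eqflat Free.
Proof.
move=> n k A x xA.
have /choice[s hs] : forall i, exists s : seq N, uniq s /\ forall n, smval (x i) n != 0 -> n \in s.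
  by move=> i; exact: free_supp.
pose r := undup (flatten [seq s i | i <- enum 'I_n]).
have hr i t : smval (x i) t != 0 -> t \in r.
  move=> /(hs i).2 h; rewrite mem_undup; apply/flattenP; exists (s i) => //.
  by apply: map_f; rewrite mem_enum.
exists (size r), (\matrix_(l, i) smval (x i) (nth 0 r l)), [ffun l : 'I__ => free_delta (nth 0 r l)]; split.
  apply/matrixP => l j; rewrite !mxE; have /ffunP/(_ j) := xA; rewrite !ffunE.
  move=> /(congr1 (fun u : Free => smval u (nth 0 r l))); rewrite linear_sum /= => e.
  rewrite -[RHS]e fct_sumE; apply: eq_bigr => i _; rewrite mxE; exact: mulrC.
apply/ffunP => i; rewrite ffunE; apply: smval_inj; rewrite linear_sum /=; apply: functional_extensionality_dep => t.
rewrite fct_sumE; under eq_bigr => l _ do rewrite mxE ffunE.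
case: (boolP (t \in r)) => [/(nthP 0)[l hl el]|ntr].
  rewrite (bigD1 (Ordinal hl)) //= big1 ?addr0.
    by rewrite -[RHS]/(smval (x i) _ * (t == _)%:R) el eqxx mulr1.
  move=> j ne; rewrite -[LHS]/(smval (x i) _ * (t == _)%:R) -el nth_uniq ?undup_uniq //.
  by rewrite eq_sym -val_eqE /= in ne; rewrite (negPf ne) mulr0.
rewrite big1 => [|l _].
  by apply/eqP; apply: contraNT ntr => h; exact: (hr i).
rewrite -[LHS]/(smval (x i) _ * (t == _)%:R); case: eqP => [e|]; rewrite ?mulr0 //.
by case/negP: ntr; rewrite e mem_nth.
Qed.

End FreeModule.

Section TorvanFlat.
Variables (R : comPzRingType) (nR : noetherian_ring R).

(** The matrix [A] becomes the differential from degree 1 to degree 0 of a complex, and its syzygies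
    are attached in degree 2. Exactness in degree 1 with coefficients in [N] is then the equational
    criterion. *)
Lemma torvan0_eqflat (N : lmodType R) : torvan 0 N -> eqflat N.
Proof.
move=> tv n k A x xA.
pose C0 : cpx R := @Cpx R k (fun=> 0%N) 0.
have ok0 : okc C0 by split; [rewrite mulmx0|move=> s t _; rewrite mxE].
pose C1 := @attach R C0 0 n A.
have ok1 : okc C1 by apply: okc_ext => //; rewrite mulmx0.
have [q [del [e h1 h2]]] := @syzygies R C1 1 nR ok1.
pose C2 := @attach R C1 1 q del.
have ok2 : okc C2 by exact: okc_ext.
have /(tv C2 ok2 1%N isT)/exact_atP tv1 : exact_to C2 1.
  by move=> s hs; have -> : s = 1%N by [lia]; exact: exact_ext.
have [||w hw] := tv1 (fcat (fcat (0 : {ffun 'I_k -> N}) x : {ffun 'I_(rk C1) -> N}) (0 : {ffun 'I_q -> N})).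
- apply: hmg_ext => //; apply: hmg_ext => [t _|//]; by rewrite ffunE.
- apply: flr_eq; rewrite ?fl_act ?fr_act !fl_cat !fr_cat ?act0l ?act0r !addr0; last first.
    by apply/ffunP => t; rewrite !ffunE.
  apply: flr_eq; rewrite ?fl_act ?fr_act !fl_cat !fr_cat ?act0l ?act0r ?add0r ?xA;
    by apply/ffunP => t; rewrite !ffunE.
move=> /(congr1 (@fl _ _ _)); rewrite fl_cat fl_act.
have -> : fl w = 0.
  apply/ffunP => t; rewrite [RHS]ffunE; apply: (hmg_extl hw).
  by rewrite /=; case: (@split_ordP k n t).
rewrite act0l add0r => ew.
exists q, (rsubmx (del : 'M_(q, k + n))), (fr w); split.
  have : (del : 'M_(q, k + n)) *m (@block_mx _ k n k n 0 0 A 0) = 0 by exact: e.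
  rewrite -{1}[del : 'M_(q, k + n)]hsubmxK mul_row_block !mulmx0 add0r => /(congr1 (@lsubmx _ _ _ _)).
  by rewrite row_mxKl linear0.
apply/ffunP => t; have /ffunP/(_ (rshift k t)) := ew; rewrite !ffunE split_r => ->.
by apply: eq_bigr => s _; rewrite mxE.
Qed.

Lemma submodule_ker (F N : lmodType R) (g : {linear F -> N}) : submodule [set x | g x = 0].
Proof.
split=> [|x y|a x] /=; first by rewrite linear0.
  by rewrite linearD => -> ->; rewrite addr0.
by rewrite linearZ_LR => ->; rewrite scaler0.
Qed.

(** The connecting map: a cycle with entries in the kernel is the boundary of some [w] over [F]; the
    image of [w] in [N] is a cycle one degree higher, and bounding it there corrects [w]. Exactness
    over [R] is wanted one degree beyond what is given, whence the syzygies attached in degree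
    [i.+2]. *)
Lemma torvan_ker c (F N : lmodType R) (g : {linear F -> N}) : eqflat F -> range g = setT ->
  torvan c.+1 N -> torvan c (submt (submodule_ker g)).
Proof.
move=> fF gT tv C oC i lci exC; apply/exact_atP => v hv v0.
have i0 : (0 < i)%N by lia.
have exF s : (0 < s <= i)%N -> exact_at C F s by move=> hs; apply: exact_flat => //; exact: exC.
have /exact_atP exFi := exF i (introT andP (conj i0 (leqnn i))).
pose v' : {ffun 'I_(rk C) -> F} := [ffun t => smval (v t)].
have v'0 : act v' (df C) = 0.
  rewrite /v' -(act_linear (@smval R F _ (submodule_ker g))) v0.
  by apply/ffunP => t; rewrite !ffunE.
have [|w hw ew] := exFi v' _ v'0; first by move=> t ht; rewrite ffunE hv.
have [q [del [e h1 h2]]] := @syzygies R C i.+1 nR oC.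
pose C' := attach i.+1 del.
have oC' : okc C' by exact: okc_ext.
have exC' : exact_to C' i.+1.
  move=> s hs; case: (ltnP s i.+1) => [lt|ge].
    by apply: (iffLR (@exact_extl _ C i.+1 q del R^o s lt)); apply: exC; lia.
  have -> : s = i.+1 by [lia]; exact: exact_ext.
have /exact_atP tvN := tv C' oC' i.+1 lci exC'.
have gw0 : act [ffun t => g (w t)] (df C) = 0.
  rewrite -act_linear -ew; apply/ffunP => t; rewrite !ffunE; exact: (smval_in (v t)).
have [||u hu eu] := tvN (fcat [ffun t => g (w t)] (0 : {ffun 'I_q -> N})).
- by apply: hmg_ext => // t ht; rewrite ffunE hw // linear0.
- apply: flr_eq; rewrite ?fl_act ?fr_act fl_cat fr_cat ?act0l ?act0r ?addr0 ?gw0;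
    by apply/ffunP => t; rewrite !ffunE.
have /choice[u' hu'] : forall t, exists y, g y = u t.
  by move=> t; have : range g (u t) by [rewrite gT]; move=> [y _ ?]; exists y.
pose U : {ffun 'I_(rk C') -> F} := hproj i.+2 [ffun t => u' t].
have gU : [ffun t => g (U t)] = u.
  by apply/ffunP => t; rewrite !ffunE; case: eqP => [_|/hu ->]; rewrite ?hu' ?linear0.
have hU : hmg i.+2 U by exact: hmg_hproj.
pose z := w - fl (act U (df C')).
have hz : hmg i.+1 z.
  by apply: hmgB => //; apply: (@hmg_extl _ _ _ _ del); exact: hmg_act.
have gz t : g (z t) = 0.
  have -> : z t = w t - act U (df C') (lshift q t) by rewrite /z !ffunE.
  have e1 : g (w t) = act u (df C') (lshift q t) by rewrite -eu ffunE split_l ffunE.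
  by rewrite linearB e1 -gU -act_linear ffunE subrr.
exists [ffun t => smk (submodule_ker g) (gz t)].
  by move=> t ht; apply: smval_inj; rewrite ffunE /= hz.
apply/ffunP => t; apply: smval_inj.
have := act_linear (@smval R F _ (submodule_ker g)) [ffun t => smk (submodule_ker g) (gz t)] (df C).
move=> /ffunP/(_ t); rewrite ffunE => ->.
have -> : [ffun i0 => smval ([ffun t => smk (submodule_ker g) (gz t)] i0)] = z.
  by apply/ffunP => s; rewrite !ffunE.
rewrite -[LHS](ffunE (fun t => smval (v t))) -/v' ew /z actBl.
have -> : act (fl (act U (df C'))) (df C) = 0.
  have := actdd U oC'; move=> /(congr1 (@fl _ _ _)); rewrite {1}fl_act.
  have -> : fr (act U (df C')) = 0 by rewrite fr_act !act0r addr0.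
  by rewrite act0l addr0 => ->; apply/ffunP => s; rewrite !ffunE.
by rewrite subr0.
Qed.

Lemma flat_res0 (N : lmodType R) : eqflat N -> has_flat_resolution N 0.
Proof.
move=> fN; have f0 : eqflat ('rV[R]_0 : lmodType R).
  move=> n k A x _; exists 0%N, 0, 0; rewrite mul0mx; split=> //.
  by apply/ffunP => i; rewrite [LHS]thinmx0 [RHS]thinmx0.
pose F i : lmodType R := if i is 0 then N else 'rV[R]_0.
pose d i : {linear F i.+1 -> F i} := \0.
exists F, idfun, d; split=> //.
- by case=> [|i]; exact: eqflat_flat.
- by case=> // i _ x; exact: thinmx0.
- by apply/seteqP; split=> // x _; exists x.
- apply/seteqP; split=> [_ [x _ <-] //|x /= ->]; by exists 0.
move=> i; apply/seteqP; split=> [_ [x _ <-] //|x /= _]; exists 0 => //.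
by rewrite [LHS]thinmx0 [RHS]thinmx0.
Qed.

Lemma flat_resS c (F N : lmodType R) (g : {linear F -> N}) : eqflat F -> range g = setT ->
  has_flat_resolution (submt (submodule_ker g)) c -> has_flat_resolution N c.+1.
Proof.
move=> fF gT [F' [e [d [fF' F'0 eT dK dd]]]].
pose G i : lmodType R := if i is j.+1 then F' j else F.
pose e0 : {linear F' 0 -> F} := @smval R F _ (submodule_ker g) \o e.
pose D i : {linear G i.+1 -> G i} :=
  match i return {linear G i.+1 -> G i} with 0 => e0 | j.+1 => d j end.
exists G, g, D; split=> //.
- by case=> [|i]; [exact: eqflat_flat|exact: fF'].
- by case=> // i lci x; apply: F'0.
- apply/seteqP; split=> [_ [x _ <-]|x gx]; first exact: (smval_in (e x)).
  have : range e (smk (submodule_ker g) gx) by rewrite eT.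
  by move=> [y _ ey]; exists y => //=; rewrite ey.
case=> [|i] /=; last exact: dd.
rewrite dK; apply/seteqP; split=> x /=; first by move=> ->.
by move=> h; apply: smval_inj.
Qed.

(** Converse of [flat_res_torvan]. Flat dimension at most [c] is thus a condition on finite free
    complexes, which passes to retracts and to restrictions along another ring map. *)
Lemma torvan_flat_res c (N : lmodType R) : torvan c N -> has_flat_resolution N c.
Proof.
elim: c N => [|c IH] N tv; first exact/flat_res0/torvan0_eqflat.
have sT : range (@free_eval R N) = setT.
  by apply/seteqP; split=> // n _; exists (free_delta n) => //; exact: free_eval_surj.
apply: (@flat_resS _ (submt (@submodule_finsup R N)) N (@free_eval R N)) => //; first exact: eqflat_free.
by apply: IH; apply: torvan_ker => //; exact: eqflat_free.
Qed.

End TorvanFlat.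

(** * Minimal free resolutions over a local ring *)

Lemma inf_natP (P : nat -> Prop) n0 : P n0 ->
  exists n, [/\ P n, inf_nat P = (Posz n)%:E & forall k, P k -> (n <= k)%N].
Proof.
move=> Pn0; rewrite /inf_nat; case: pselect => [h|[]]; last by exists n0; apply/asboolP.
by exists (ex_minn h); case: ex_minnP => n /asboolP Pn nmin; split=> // k Pk; apply: nmin; apply/asboolP.
Qed.

Section MinimalGenerators.
Variables (R : comPzRingType) (m : set R) (lm : locr m) (M : lmodType R).

Lemma mingen (U : set M) : fg U -> exists n (x : 'I_n -> M),
  [/\ U = span (range x), num_gens U = (Posz n)%:E
    & forall c : 'I_n -> R, \sum_i c i *: x i = 0 -> forall i, m (c i)].
Proof.
move=> [n0 hn0]; have [n [[x defU] en nmin]] :=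
  @inf_natP (fun n => exists x : 'I_n -> M, U = span (range x)) n0 hn0.
exists n, x; split=> // c c0 i; apply: contrapT => nmi.
have [_ _ /(_ _ nmi)[d cd]] := lm.
case: n => [|n] in x defU en nmin c c0 i nmi cd *; first by case: (i).
suff /nmin : exists z : 'I_n -> M, U = span (range z) by rewrite ltnn.
exists (x \o lift i); rewrite defU; apply/seteqP; split; last first.
  by apply: span_mono => _ [j _ <-]; exists (lift i j).
apply: span_min; first exact: span_submodule.
move=> _ [j _ <-]; case: (unliftP i j) => [k ->|->]; first by apply: sub_span; exists k.
apply/spanP; exists (fun k => - d * c (lift i k)); under eq_bigr do rewrite -scalerA.
rewrite -scaler_sumr; move: c0; rewrite (bigD1_ord i) //= => /eqP; rewrite addr_eq0 => /eqP e.
by rewrite -[LHS]scale1r -cd mulrC -scalerA e scaleNr scalerN.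
Qed.

End MinimalGenerators.

Lemma delta_mulmx (R : pzSemiRingType) p q (i : 'I_p) (A : 'M[R]_(p, q)) j :
  ((delta_mx 0 i : 'rV_p) *m A) 0 j = A i j.
Proof. by rewrite -rowE mxE. Qed.

Lemma mx_block_all (T : Type) (Q : T -> Prop) p q r s (A : 'M[T]_(p, q))
    (B : 'M_(p, s)) (C : 'M[T]_(r, q)) (D : 'M_(r, s)) :
  (forall i j, Q (A i j)) -> (forall i j, Q (B i j)) -> (forall i j, Q (C i j)) ->
  (forall i j, Q (D i j)) -> forall i j, Q (block_mx A B C D i j).
Proof.
move=> hA hB hC hD i j; case: (split_ordP i) => i' ->; case: (split_ordP j) => j' ->.
- by rewrite block_mxEul. - by rewrite block_mxEur. - by rewrite block_mxEdl. - by rewrite block_mxEdr.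
Qed.

Lemma act_ext (R : comPzRingType) (M : lmodType R) (C : cpx R) L q (del : 'M[R]_(q, rk C))
    (u : {ffun 'I_(rk C) -> M}) (v : {ffun 'I_q -> M}) :
  act (fcat u v : {ffun 'I_(rk (attach L del)) -> M}) (df (attach L del)) = fcat (act u (df C) + act v del) 0.
Proof.
by apply: flr_eq; rewrite ?fl_act ?fr_act !fl_cat !fr_cat // !act0r addr0.
Qed.

Section MinimalResolution.
Variables (R : comPzRingType) (m : set R) (nR : noetherian_ring R) (lm : locr m).
Variables (a : nat) (x : 'I_a -> R).
Hypothesis mx : m = idl (range x).
Hypothesis xmin : forall c : 'I_a -> R, \sum_i c i * x i = 0 -> forall i, m (c i).

Let im : is_ideal m. Proof. by case: lm. Qed.

(** A minimal free resolution of [R / m], correct up to degree [L]. The last clause, together with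
    the entries in [m], says that the zeroth homology, generated by [o], is [R / m]. *)
Definition minres (L : nat) (C : cpx R) (o : 'I_(rk C)) :=
  [/\ okc C, forall t, dg t = 0%N <-> t = o, forall s t, m (df C s t), exact_to C L
    & forall r, m r -> exists2 w : {ffun 'I_(rk C) -> R^o}, hmg 1 w &
        forall t, act w (df C) t = r * (t == o)%:R].

Lemma minres_exists L : exists (C : cpx R) (o : 'I_(rk C)), minres L o.
Proof.
(* Two facts are added for the induction: degrees stop at [L.+1], and cycles of that top degree have
   entries in [m]. The second makes the next differential minimal. *)
suff [C [o [h1 _ _]]] : exists (C : cpx R) (o : 'I_(rk C)), [/\ minres L o,
   forall t : 'I_(rk C), (dg t <= L.+1)%N &
   forall v : {ffun 'I_(rk C) -> R^o}, hmg L.+1 v -> act v (df C) = 0 -> forall t, m (v t)].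
  by exists C, o.
elim: L => [|L [C [o [[oC dg0 dm exC im1] dgL hm]]]].
  pose C0 : cpx R := @Cpx R 1 (fun=> 0%N) 0.
  have ok0 : okc C0 by split; [rewrite mulmx0|move=> s t _; rewrite mxE].
  pose del : 'M[R]_(a, 1) := \matrix_(i, _) x i.
  have actd (v : {ffun 'I_(1 + a) -> R^o}) t :
      act v (df (@attach R C0 0 a del)) t = (\sum_i v (rshift 1 i) * x i) * (t == lshift a ord0)%:R.
    rewrite ffunE big_split_ord big_ord1 /=; case: (split_ordP t) => j ->; last first.
      rewrite eq_rlshift mulr0 block_mxEur mxE scale0r add0r big1 // => i _.
      by rewrite block_mxEdr mxE scale0r.
    rewrite !ord1 eqxx mulr1 block_mxEul mxE scale0r add0r; apply: eq_bigr => i _.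
    by rewrite block_mxEdl mxE; exact: mulrC.
  exists (@attach R C0 0 a del), (lshift a ord0); split; [split|..].
  - by apply: okc_ext => //; rewrite mulmx0.
  - move=> t /=; split=> [|->]; last by rewrite split_l.
    by case: (split_ordP t) => j -> //; rewrite ord1.
  - apply: mx_block_all => i j; rewrite mxE; try exact: ideal0.
    by rewrite mx; apply: sub_idl; exists i.
  - by case.
  - move=> r; rewrite mx => /(@spanP R R^o)[c ->].
    exists (fcat (0 : {ffun 'I_1 -> R^o}) [ffun i => c i : R^o]).
      by move=> t; rewrite /= ffunE; case: (@split_ordP 1 a t) => j; rewrite !ffunE.
    move=> t; rewrite actd; congr (_ * _); apply: eq_bigr => i _.
    by rewrite ffunE split_r ffunE.
  - by move=> t /=; case: (@split_ordP 1 a t).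
  move=> v hv /ffunP/(_ (lshift a ord0)); rewrite actd eqxx mulr1 ffunE => /xmin v0 t.
  case: (@split_ordP 1 a t) => j e; last by rewrite e; exact: v0.
  by rewrite hv ?e /= ?split_l //; exact: ideal0.
pose U := [set v : {ffun 'I_(rk C) -> R^o} | hmg L.+1 v /\ act v (df C) = 0].
have sU : submodule U.
  split; first by split; [move=> t _; rewrite ffunE|rewrite act0l].
    by move=> u w [hu u0] [hw w0]; split; [exact: hmgD|rewrite actDl u0 w0 addr0].
  move=> c u [hu u0]; split; last by rewrite actZl u0 scaler0.
  by move=> t ht; rewrite ffunE hu // scaler0.
have [q [y [defU _ ymin]]] := mingen lm (noeth_ffun nR sU).
have Uy i : U (y i) by rewrite defU; apply: sub_span; exists i.
pose del : 'M[R]_(q, rk C) := \matrix_(i, t) y i t.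
have deld : del *m df C = 0.
  apply/matrixP => i t; rewrite !mxE; have [_ /ffunP/(_ t)] := Uy i; rewrite !ffunE => e.
  by rewrite -[RHS]e; apply: eq_bigr => s _; rewrite mxE; exact: mulrC.
have delh s t : dg t <> L.+1 -> del s t = 0 by move=> ht; rewrite mxE; have [-> ] := Uy s.
have actdel (c : {ffun 'I_q -> R^o}) : act c del = \sum_i (c i : R) *: y i.
  apply/ffunP => t; rewrite ffunE sum_ffunE; apply: eq_bigr => i _; rewrite mxE ffunE; exact: mulrC.
exists (attach L.+1 del), (lshift q o); split; [split|..].
- exact: okc_ext.
- move=> t /=; split=> [|->]; last by rewrite split_l; apply/dg0.
  by case: (split_ordP t) => j -> // /dg0 ->.
- apply: mx_block_all => i j //; rewrite ?mxE; try exact: (ideal0 im).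
  by have [h1 h2] := Uy i; exact: hm.
- move=> s hs; case: (ltnP s L.+1) => [lt|ge].
    by apply: (iffLR (@exact_extl _ C L.+1 q del R^o s lt)); apply: exC; lia.
  have -> : s = L.+1 by lia.
  apply: exact_ext => // v hv v0; have : U v by [].
  by rewrite defU => /spanP[c ->]; exists [ffun i => c i]; rewrite actdel; apply: eq_bigr => i _; rewrite ffunE.
- move=> r /im1[w hw ew]; exists (fcat w (0 : {ffun 'I_q -> R^o})); first exact: hmg_ext.
  move=> t; rewrite act_ext act0l addr0 ffunE; case: (split_ordP t) => j ->.
    by rewrite ew eq_lshift.
  by rewrite ffunE eq_rlshift mulr0.
- by move=> t /=; case: (split_ordP t) => j _ //; apply: leq_trans (dgL j) _.
move=> v hv v0.
have l0 : fl v = 0.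
  apply/ffunP => t; rewrite [RHS]ffunE; apply: (hmg_extl hv) => e.
  by have := dgL t; rewrite e ltnn.
have r0 : act (fr v) del = 0.
  have := congr1 (@fl _ _ _) v0; rewrite {1}fl_act l0 act0l add0r => ->.
  by apply/ffunP => s; rewrite !ffunE.
have v0r : forall i, m (fr v i) by apply: ymin; rewrite -actdel.
move=> t; case: (split_ordP t) => j ->; last by have := v0r j; rewrite ffunE.
by have /ffunP/(_ j) := l0; rewrite !ffunE => ->; exact: ideal0.
Qed.

End MinimalResolution.

Section BuildMap.
Variables (R : comPzRingType) (C D : cpx R) (k : nat) (Th : 'M[R]_(rk C, rk D)) (ep : R).
Variable Q : 'I_(rk C) -> {ffun 'I_(rk D) -> R^o} -> Prop.
Hypothesis hdC : forall s t, dg s <> (dg t).+1 -> df C s t = 0.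

Definition shift_mx (Psi : 'M[R]_(rk C, rk D)) := forall s t, dg t <> (dg s + k)%N -> Psi s t = 0.
Definition map_ok (Psi : 'M[R]_(rk C, rk D)) n := forall s, (dg s < n)%N ->
  (forall t, (Psi *m df D) s t = Th s t + ep * (df C *m Psi) s t) /\ Q s [ffun t => Psi s t].

(** A matrix raising degrees by [k] is built one degree at a time. It is used with [k = 1],
    [ep = -1] for homotopies of multiplication by an element, and with [k = 0], [ep = 1], [Th = 0]
    for chain maps; [Q] prescribes individual rows. *)
Lemma build_map n :
  (forall i Psi, (i < n)%N -> shift_mx Psi -> map_ok Psi i -> forall s, dg s = i ->
     exists rho : {ffun 'I_(rk D) -> R^o}, [/\ hmg (i + k) rho, Q s rho &
       forall t, act rho (df D) t = Th s t + ep * (df C *m Psi) s t]) ->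
  exists2 Psi, shift_mx Psi & map_ok Psi n.
Proof.
elim: n => [_|n IH h]; first by exists 0 => [s t _|s]; rewrite ?mxE.
have [|Psi sP oP] := IH; first by move=> i Psi lti; apply: h; exact: ltnW.
have /choice[rho hrho] : forall s, exists rho : {ffun 'I_(rk D) -> R^o}, dg s = n ->
    [/\ hmg (n + k) rho, Q s rho & forall t, act rho (df D) t = Th s t + ep * (df C *m Psi) s t].
  move=> s; case: (pselect (dg s = n)) => [e|]; last by exists 0.
  by have [rho ?] := h n Psi (ltnSn _) sP oP s e; exists rho.
pose Psi' := \matrix_(s, t) (if dg s == n then rho s t else Psi s t).
have dP s : (dg s <= n)%N -> forall t, (df C *m Psi') s t = (df C *m Psi) s t.
  move=> hs t; rewrite !mxE; apply: eq_bigr => u _; rewrite mxE; case: eqP => // eu.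
  by rewrite hdC ?mul0r // => e; move: hs; rewrite e eu ltnn.
exists Psi'; first move=> s t ht; rewrite ?mxE.
  by case: eqP => e; [case: (hrho s e) => -> //; rewrite -e|exact: sP].
move=> s; rewrite ltnS => les; case: (eqVneq (dg s) n) => [e|ne].
  have [h1 h2 h3] := hrho s e; split; last first.
    by congr (Q s _): h2; apply/ffunP => t; rewrite ffunE mxE e eqxx.
  move=> t; rewrite dP // -h3 ffunE mxE; apply: eq_bigr => u _; rewrite mxE e eqxx; exact: mulrC.
have lts : (dg s < n)%N by rewrite ltn_neqAle ne.
have [h1 h2] := oP s lts; split; last first.
  by congr (Q s _): h2; apply/ffunP => t; rewrite !ffunE mxE (negPf ne).
by move=> t; rewrite dP // -h1 !mxE; apply: eq_bigr => u _; rewrite mxE (negPf ne).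
Qed.

End BuildMap.

(** * Homotopies on the resolution and on its Koszul cones *)

Lemma ord_split p q (P : 'I_(p + q) -> Prop) :
  (forall i, P (lshift _ i)) -> (forall i, P (rshift _ i)) -> forall s, P s.
Proof. by move=> hl hr s; case: (split_ordP s) => i ->. Qed.

(** [h k] is a homotopy for multiplication by [x k], valid below degree [L], and [lam j] is one for
    [y j] in all degrees. By [op_dh] the [h l] act modulo [n] as exterior multiplications and the
    [D k] as the dual contractions; [o] is a vector that all contractions kill. *)
Record opers (S : comPzRingType) (n : set S) (C : cpx S) (o : 'I_(rk C)) a (x : 'I_a -> S)
    b (y : nat -> S) (h D : 'I_a -> 'M[S]_(rk C)) (lam : nat -> 'M[S]_(rk C)) L : Prop := Opers {
  op_ok : okc C;
  op_o : dg o = 0%N;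
  op_d : forall s t, n (df C s t);
  op_h : forall k s t, dg t <> (dg s).+1 -> h k s t = 0;
  op_l : forall j s t, (j < b)%N -> dg t <> (dg s).+1 -> lam j s t = 0;
  op_hd : forall k s t, (dg s < L)%N -> (h k *m df C + df C *m h k) s t = (x k)%:M s t;
  op_ld : forall j, (j < b)%N -> lam j *m df C + df C *m lam j = (y j)%:M;
  op_dh : forall k l s t, (dg s < L)%N ->
    n ((D k *m h l + h l *m D k) s t - ((k == l)%:R%:M : 'M_(rk C)) s t);
  op_dl : forall k j s t, (j < b)%N -> n ((D k *m lam j + lam j *m D k) s t);
  op_do : forall k t, D k o t = 0 }.

Section Operators.
Variables (R : comPzRingType) (m : set R) (lm : locr m).
Variables (a : nat) (x : 'I_a -> R).
Hypothesis mx : m = idl (range x).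
Hypothesis xmin : forall c : 'I_a -> R, \sum_i c i * x i = 0 -> forall i, m (c i).

(** [D k] collects the coefficients of [x k] in the entries of the differential. Substituting
    [df C = sum_k x_k D_k] in the homotopy identity for [x l] and using [xmin] puts the defect in
    [op_dh] into [m]. *)
Lemma minres_opers L C o : @minres R m L C o -> exists h D, opers m o x 0 (fun=> 0) h D (fun=> 0) L.+1.
Proof.
move=> [oC dg0 dm exC im1]; have im : is_ideal m by case: lm.
have [dC hC] := oC.
have /choice[h hh] : forall k, exists Psi, @shift_mx R C C 1 Psi /\
    @map_ok R C C (x k)%:M (-1) (fun _ _ => True) Psi L.+1.
  move=> k; have mk : m (x k) by rewrite mx; apply: sub_idl; exists k.
  have [||Psi ? ?] := @build_map R C C 1 (x k)%:M (-1) (fun _ _ => True) _ L.+1; last by exists Psi.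
    exact: hC.
  move=> i Psi lti sP oP s es.
  case: i => [|i] in lti oP es *.
    have [w hw ew] := im1 _ mk; exists w; split=> // t; rewrite ew (iffLR (dg0 s) es).
    rewrite mxE eq_sym mulr_natr [(_ *m _) _ _]mxE big1 ?mulr0 ?addr0 // => u _.
    by rewrite hC ?mul0r // -(iffLR (dg0 s) es) es.
  pose r : {ffun 'I_(rk C) -> R^o} := [ffun t => ((x k)%:M - df C *m Psi) s t : R^o].
  have hr : hmg i.+1 r.
    move=> t ht; rewrite ffunE !mxE (introF eqP) ?sub0r => [|e]; last by apply: ht; rewrite -e.
    rewrite big1 ?oppr0 // => u _; case: (pselect (dg s = (dg u).+1)) => [e|/hC ->]; last by rewrite mul0r.
    by rewrite sP ?mulr0 // addn1 -e es.
  have r0 : act r (df C) = 0.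
    apply/ffunP => t; rewrite !ffunE.
    transitivity (((x k)%:M *m df C - df C *m (Psi *m df C)) s t).
      rewrite mulmxA -mulmxBl mxE; apply: eq_bigr => u _; rewrite ffunE; exact: mulrC.
    rewrite mxE [X in _ + X]mxE; suff -> : (df C *m (Psi *m df C)) s t = ((x k)%:M *m df C) s t by rewrite subrr.
    rewrite mxE; transitivity (\sum_u df C s u * ((x k)%:M u t - (df C *m Psi) u t)).
      apply: eq_bigr => u _; case: (pselect (dg s = (dg u).+1)) => [e|/hC ->]; last by rewrite !mul0r.
      by rewrite (oP u _).1 ?mulN1r //; move: e; rewrite es => -[->].
    have e0 : \sum_u df C s u * (df C *m Psi) u t = 0.
      by have : (df C *m (df C *m Psi)) s t = 0; [rewrite mulmxA dC mul0mx mxE|rewrite mxE].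
    transitivity (\sum_u df C s u * (x k)%:M u t - \sum_u df C s u * (df C *m Psi) u t).
      by rewrite -sumrB; apply: eq_bigr => u _; rewrite mulrBr.
    by rewrite e0 subr0 -scalar_mxC [RHS]mxE.
  have [|w hw ew] := iffLR (exact_atP C R^o i.+1) (exC i.+1 _) r hr r0; first by lia.
  exists w; split=> //; first by rewrite addn1.
  by move=> t; rewrite -ew ffunE !mxE mulN1r.
(* Zero is given zero coefficients, so that [D k] kills [o], whose row in the differential is
   zero. *)
have /choice[co hco] : forall r, exists c : 'I_a -> R, m r -> r = \sum_k c k * x k /\ (r = 0 -> c = fun=> 0).
  move=> r; case: (eqVneq r 0) => [->|r0].
    by exists (fun=> 0) => _; split=> //; rewrite big1 // => i _; rewrite mul0r.
  case: (pselect (m r)) => [mr|]; last by exists (fun=> 0).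
  have := mr; rewrite mx => /(@spanP R R^o)[c ec]; exists c => _; split=> // e.
  by rewrite e eqxx in r0.
pose D k : 'M[R]_(rk C) := \matrix_(s, t) co (df C s t) k.
have dD : df C = \sum_k x k *: D k.
  apply/matrixP => s t; rewrite summxE; have [-> _] := hco _ (dm s t).
  by apply: eq_bigr => k _; rewrite !mxE mulrC.
exists h, D; split=> //; first by apply/dg0.
- by move=> k s t ht; case: (hh k) => sP _; rewrite sP // addn1.
- move=> k s t ls; case: (hh k) => sP oP.
  by rewrite mxE (oP s ls).1 mulN1r subrK.
- move=> k l s t ls; have [_ oP] := hh l; have [e _] := oP s ls.
  apply: (xmin (c := fun k => (D k *m h l + h l *m D k) s t - ((k == l)%:R%:M : 'M_(rk C)) s t)).
  under eq_bigr do rewrite mulrBl.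
  rewrite sumrB; apply/eqP; rewrite subr_eq0; apply/eqP.
  transitivity ((x l)%:M s t); last first.
    rewrite (bigD1 l) //= eqxx big1 => [|i /negPf ->]; last by rewrite mxE mul0rn mul0r.
    by rewrite !mxE addr0; case: eqP => _; rewrite ?mulr1n ?mulr0n ?mul1r ?mul0r.
  have -> : (x l)%:M s t = (df C *m h l + h l *m df C) s t by rewrite [RHS]mxE e mulN1r addrC subrK.
  rewrite dD mulmx_suml mulmx_sumr -big_split summxE; apply: eq_bigr => i _ /=.
  by rewrite -scalemxAl -scalemxAr -scalerDr [RHS]mxE mulrC.
move=> k t; rewrite mxE; have [_ ->] := hco _ (dm o t) => //.
by rewrite hC // (iffRL (dg0 o) erefl).
Qed.

End Operators.

Section Cones.
Variables (S : comPzRingType) (n : set S) (idn : is_ideal n) (a : nat) (x : 'I_a -> S) (y : nat -> S) (L : nat).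
Hypothesis ny : forall j, n (y j).

Definition dsum g (A : 'M[S]_g) : 'M[S]_(g + g) := block_mx A 0 0 (- A).

(** The old operators act on the two copies as [A] and [- A], the sign matching that of the cone
    differential. The homotopy for the new [y b] is the identity from the first copy to the shifted
    one. *)
Lemma opers_cone C o b h D lam : @opers S n C o a x b y h D lam L ->
  @opers S n (cone C (y b)) (lshift _ o) a x b.+1 y (fun k => dsum (h k)) (fun k => dsum (D k))
    (fun j => if j == b then block_mx 0 1%:M 0 0 else dsum (lam j)) L.
Proof.
case=> oC o0 dn hs ls hd ld dh dl Do.
have n0 : n 0 := ideal0 idn.
have dgl (i : 'I_(rk C)) : @dg _ (cone C (y b)) (lshift (rk C) i) = dg i by rewrite /= split_l.
have dgr (i : 'I_(rk C)) : @dg _ (cone C (y b)) (rshift (rk C) i) = (dg i).+1 by rewrite /= split_r.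
have H (A : 'M[S]_(rk C)) : (forall s t, dg t <> (dg s).+1 -> A s t = 0) ->
    forall s t, @dg _ (cone C (y b)) t <> (@dg _ (cone C (y b)) s).+1 -> dsum A s t = 0.
  move=> hA; apply: ord_split => s; apply: ord_split => t; rewrite ?dgl ?dgr => ht.
  - by rewrite block_mxEul hA. - by rewrite block_mxEur mxE. - by rewrite block_mxEdl mxE.
  by rewrite block_mxEdr mxE hA ?oppr0 // => e; apply: ht; rewrite e.
split.
- exact: okc_cone.
- by rewrite dgl.
- apply: mx_block_all => // s t; rewrite mxE //; last exact: idealN.
  by case: eqP => _; rewrite ?mulr1n ?mulr0n.
- by move=> k; exact: (H _ (hs k)).
- move=> j; case: eqP => [_|ne] s t ltj; last first.
    have lj : (j < b)%N by move: ltj ne; rewrite ltnS leq_eqVlt; case: eqP.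
    by apply: (H _ _) => s' t'; exact: ls.
  move: s t; apply: ord_split => s; apply: ord_split => t; rewrite ?dgl ?dgr => ht.
  - by rewrite block_mxEul mxE.
  - by rewrite block_mxEur mxE; case: eqP ht => // -> [].
  - by rewrite block_mxEdl mxE.
  - by rewrite block_mxEdr mxE.
- move=> k; have -> : dsum (h k) *m df (cone C (y b)) + df (cone C (y b)) *m dsum (h k) =
      block_mx (h k *m df C + df C *m h k) 0 0 (h k *m df C + df C *m h k).
    rewrite /dsum /= !mulmx_block !mul0mx !mulmx0 !addr0 !add0r !mulmxN !mulNmx !opprK.
    by rewrite add_block_mx !addr0 scalar_mxC addNr.
  apply: ord_split => s; apply: ord_split => t; rewrite ?dgl ?dgr => lts;
    rewrite ?block_mxEul ?block_mxEur ?block_mxEdl ?block_mxEdr scalar_mx_block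
      ?block_mxEul ?block_mxEur ?block_mxEdl ?block_mxEdr //.
    exact: hd.
  by apply: hd; exact: ltnW.
- move=> j; case: eqP => [-> _|ne ltj].
    rewrite /= !mulmx_block !mul0mx !mulmx0 !addr0 !add0r !mul1mx !mulmx1.
    by rewrite add_block_mx !addr0 add0r addNr -scalar_mx_block.
  have lj : (j < b)%N by move: ltj ne; rewrite ltnS leq_eqVlt; case: eqP.
  rewrite /dsum /= !mulmx_block !mul0mx !mulmx0 !addr0 !add0r !mulmxN !mulNmx !opprK.
  by rewrite add_block_mx !addr0 scalar_mxC addNr ld // -scalar_mx_block.
- move=> k l; have -> : dsum (D k) *m dsum (h l) + dsum (h l) *m dsum (D k) =
      block_mx (D k *m h l + h l *m D k) 0 0 (D k *m h l + h l *m D k).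
    rewrite /dsum /= !mulmx_block !mul0mx !mulmx0 !addr0 !add0r !mulmxN !mulNmx !opprK.
    by rewrite add_block_mx !addr0.
  apply: ord_split => s; apply: ord_split => t; rewrite ?dgl ?dgr => lts;
    rewrite ?block_mxEul ?block_mxEur ?block_mxEdl ?block_mxEdr scalar_mx_block
      ?block_mxEul ?block_mxEur ?block_mxEdl ?block_mxEdr //; rewrite ?[(0 : 'M_(_, _)) _ _]mxE ?subr0 //.
    exact: dh.
  by apply: dh; exact: ltnW.
- move=> k j; case: eqP => [-> s t _|ne s t ltj].
    rewrite /dsum !mulmx_block !mul0mx !mulmx0 !addr0 !add0r !mul1mx !mulmx1.
    by rewrite add_block_mx !addr0 subrr block_mx0 mxE.
  have lj : (j < b)%N by move: ltj ne; rewrite ltnS leq_eqVlt; case: eqP.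
  rewrite /dsum !mulmx_block !mul0mx !mulmx0 !addr0 !add0r !mulmxN !mulNmx !opprK.
  rewrite add_block_mx !addr0; move: s t; apply: mx_block_all => s t; rewrite ?[(0 : 'M_(_, _)) _ _]mxE //; exact: dl.
move=> k; apply: ord_split => t; first by rewrite block_mxEul Do.
by rewrite block_mxEur mxE.
Qed.

End Cones.

Section Omega.
Variables (S : comPzRingType) (n : set S) (idn : is_ideal n) (a b : nat) (x : 'I_a -> S) (y : nat -> S) (L : nat).
Variables (C : cpx S) (o : 'I_(rk C)) (h D : 'I_a -> 'M[S]_(rk C)) (lam : nat -> 'M[S]_(rk C)).
Hypothesis op : opers n o x b y h D lam L.
Variable c : 'I_a -> 'I_b -> S.
Hypothesis hc : forall k, x k = \sum_j c k j * y j.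

Let nrow g (v : 'rV[S]_g) := forall t, n (v 0 t).
Let nrowD g (v w : 'rV[S]_g) : nrow v -> nrow w -> nrow (v + w).
Proof. by move=> hv hw t; rewrite mxE; exact: idealD. Qed.
Let nrowN g (v : 'rV[S]_g) : nrow v -> nrow (- v).
Proof. by move=> hv t; rewrite mxE; exact: idealN. Qed.
Let nrowM g g' (v : 'rV[S]_g) (A : 'M_(g, g')) : nrow v -> nrow (v *m A).
Proof. by move=> hv t; rewrite mxE; apply: ideal_sum => // s _; exact: idealMr. Qed.

(** With [x_k = sum_j c_kj y_j], the operator [K = h_k - sum_j c_kj lam_j] anticommutes with the
    differential, since the two homotopies of [x_k] cancel. Applying the [a] operators [K] in turn
    to [o] gives the cycle [om]; contractions in the reverse order bring it back to [o] modulo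
    [n]. *)
Lemma omega_exists : (a <= L)%N -> exists (om : 'rV[S]_(rk C)) (De : 'M[S]_(rk C)),
  [/\ forall t, dg t <> a -> om 0 t = 0, om *m df C = 0
    & forall t, n ((om *m De) 0 t - (t == o)%:R)].
Proof.
case: op => oC o0 dn hs ls hd ld dh dl Do aL.
(* The third clause makes the next contraction undo exactly the last factor: modulo [n], the [D l]
   whose index has not been used kill the partial product. *)
suff H k : (k <= a)%N -> exists (om : 'rV[S]_(rk C)) (De : 'M[S]_(rk C)),
  [/\ forall t, dg t <> k -> om 0 t = 0, om *m df C = 0,
    forall l : 'I_a, (k <= l)%N -> nrow (om *m D l)
    & nrow (om *m De - delta_mx 0 o)].
  have [om [De [h1 h2 h3 h4]]] := H a (leqnn _).
  by exists om, De; split=> // t; have := h4 t; rewrite !mxE eqxx /=.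
elim: k => [_|k IH lt].
  exists (delta_mx 0 o), 1%:M; split.
  - by move=> t ht; rewrite mxE eqxx /=; case: eqP ht => // ->; rewrite o0.
  - apply/matrixP => i t; rewrite ord1 delta_mulmx mxE.
    by case: oC => _ -> //; rewrite o0.
  - by move=> l _ t; rewrite delta_mulmx Do; exact: ideal0.
  - by move=> t; rewrite mulmx1 subrr mxE; exact: ideal0.
have [om [De [h1 h2 h3 h4]]] := IH (ltnW lt); pose l0 := Ordinal lt.
pose K : 'M[S]_(rk C) := h l0 - \sum_j c l0 j *: lam j.
have ltkL : (k < L)%N := leq_trans lt aL.
have anti : om *m (K *m df C + df C *m K) = 0.
  apply/matrixP => i t; rewrite ord1 !mxE big1 // => s _.
  case: (pselect (dg s = k)) => [es|/h1 ->]; last by rewrite mul0r.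
  suff -> : (K *m df C + df C *m K) s t = 0 by rewrite mulr0.
  have -> : K *m df C + df C *m K = h l0 *m df C + df C *m h l0 - (x l0)%:M.
    have -> : (x l0)%:M = \sum_j c l0 j *: (lam j *m df C + df C *m lam j) :> 'M_(rk C).
      rewrite hc rmorph_sum /=; apply: eq_bigr => j _.
      by rewrite ld // scale_scalar_mx.
    rewrite /K mulmxBl mulmxBr addrACA -opprD; congr (_ - _).
    rewrite mulmx_suml mulmx_sumr -big_split; apply: eq_bigr => j _ /=.
    by rewrite -scalemxAl -scalemxAr -scalerDr.
  by rewrite mxE hd ?es // !mxE subrr.
have antiD l : nrow (om *m (K *m D l + D l *m K) - (l == l0)%:R *: om).
  have -> : om *m (K *m D l + D l *m K) - (l == l0)%:R *: om =
      om *m (D l *m h l0 + h l0 *m D l - (l == l0)%:R%:M) -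
      \sum_j c l0 j *: (om *m (D l *m lam j + lam j *m D l)).
    rewrite [in RHS]mulmxBr mul_mx_scalar addrAC; congr (_ - _).
    have -> : K *m D l + D l *m K = D l *m h l0 + h l0 *m D l - \sum_j c l0 j *: (D l *m lam j + lam j *m D l).
      rewrite /K mulmxBl mulmxBr addrACA -opprD [X in X - _]addrC; congr (_ - _).
      rewrite mulmx_suml mulmx_sumr -big_split; apply: eq_bigr => j _ /=.
      by rewrite -scalemxAl -scalemxAr -scalerDr addrC.
    rewrite mulmxBr mulmx_sumr; congr (_ - _); apply: eq_bigr => j _.
    by rewrite scalemxAr.
  apply: nrowD => [t|].
    rewrite mxE; apply: ideal_sum => // s _; case: (pselect (dg s = k)) => [es|/h1 ->].
      by apply: idealM => //; rewrite mxE [X in _ + X]mxE; apply: dh; rewrite es.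
    by rewrite mul0r; exact: ideal0.
  apply: nrowN => t; rewrite summxE; apply: ideal_sum => // j _; rewrite mxE; apply: idealM => //.
  by rewrite mxE; apply: ideal_sum => // s _; apply: idealM => //; exact: dl.
exists (om *m K), (D l0 *m De); split.
- move=> t ht; rewrite mxE big1 // => s _; case: (pselect (dg s = k)) => [es|/h1 ->]; last by rewrite mul0r.
  have -> : K s t = h l0 s t - \sum_j c l0 j * lam j s t.
    by rewrite /K mxE [in X in _ + X]mxE summxE; congr (_ - _); apply: eq_bigr => j _; rewrite mxE.
  rewrite hs ?es // sub0r big1 ?oppr0 ?mulr0 // => j _.
  by rewrite ls ?mulr0 ?es.
- by move: anti; rewrite mulmxDr !mulmxA h2 mul0mx addr0.
- move=> l ltl; have ne : (l == l0) = false by apply/negP => /eqP e; rewrite e /= ltnn in ltl.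
  have := antiD l; rewrite ne scale0r subr0 mulmxDr !mulmxA => hh.
  rewrite -[_ *m D l](addrK (om *m D l *m K)); apply: nrowD => //; apply: nrowN; apply: nrowM.
  by apply: h3; exact: ltnW.
have := antiD l0; rewrite eqxx scale1r mulmxDr !mulmxA => hh.
have -> : om *m K *m D l0 *m De - delta_mx 0 o =
   (om *m K *m D l0 + om *m D l0 *m K - om) *m De - om *m D l0 *m K *m De + (om *m De - delta_mx 0 o).
  by rewrite mulmxBl [in RHS]mulmxDl [X in _ = X + _]addrAC addrK subrKA.
apply: nrowD => //; apply: nrowD; first exact: nrowM.
by apply: nrowN; apply: nrowM; apply: nrowM; exact: h3.
Qed.

End Omega.

(** * Freeness of artinian modules of small flat dimension *)

Lemma ffun_subE (V : zmodType) (I : finType) (u v : {ffun I -> V}) t : (u - v) t = u t - v t.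
Proof. by rewrite !ffunE. Qed.

Definition mapc (R S : comPzRingType) (f : {rmorphism R -> S}) (C : cpx R) : cpx S :=
  @Cpx S (rk C) (@dg _ C) (map_mx f (df C)).

Section BaseChange.
Variables (R S : comPzRingType) (f : {rmorphism R -> S}).

Lemma okc_mapc C : okc C -> okc (mapc f C).
Proof.
move=> [dd hd]; split; first by rewrite /= -map_mxM dd map_mx0.
by move=> s t ht; rewrite mxE hd ?rmorph0.
Qed.

Lemma act_mapc (N : lmodType S) p q (v : {ffun 'I_p -> N}) (A : 'M[R]_(p, q)) :
  act v (map_mx f A) = @act R (restrict f N) p q v A.
Proof. by apply/ffunP => j; rewrite !ffunE; apply: eq_bigr => i _; rewrite mxE. Qed.

Lemma exact_mapc C (N : lmodType S) i :
  exact_at (mapc f C) N i <-> @exact_at R C (restrict f N) i.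
Proof.
split=> /exact_atP h; apply/exact_atP => v hv v0.
  by have [|w hw ew] := h v hv; [rewrite act_mapc|exists w => //; rewrite ew act_mapc].
by have [|w hw ew] := h v hv; [rewrite -act_mapc|exists w => //; rewrite act_mapc].
Qed.

Lemma opers_mapc (m : set R) (n : set S) C o a (x : 'I_a -> R) h D L :
  is_ideal n -> (forall r, m r -> n (f r)) ->
  @opers R m C o a x 0 (fun=> 0) h D (fun=> 0) L -> forall y,
  @opers S n (mapc f C) o a (f \o x) 0 y (fun k => map_mx f (h k)) (fun k => map_mx f (D k)) (fun=> 0) L.
Proof.
move=> idn fm [oC o0 dn hs ls hd ld dh dl Do] y; split=> //.
- exact: okc_mapc.
- by move=> s t; rewrite mxE; exact: fm.
- by move=> k s t ht; rewrite mxE hs ?rmorph0.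
- by move=> k s t lts; rewrite /= -!map_mxM -map_mxD [LHS]mxE hd // [RHS]mxE mxE raddfMn.
- move=> k l s t lts; rewrite -!map_mxM -map_mxD mxE.
  have := fm _ (dh k l s t lts); rewrite rmorphB /=.
  by rewrite [in X in n (_ - X) -> _]mxE rmorphMn /= rmorph_nat => h'; rewrite [in X in n (_ - X)]mxE.
by move=> k t; rewrite mxE Do rmorph0.
Qed.

End BaseChange.

(* A complex over [S] of which the degree [a] cycle [om] survives modulo [n], while multiplication
   by each generator [y j] of [n] on [om] is a boundary. *)
Record totc (S : comPzRingType) (n : set S) a b (y : nat -> S) (T : cpx S) : Prop := Totc {
  tc_ok : okc T;
  tc_d : forall s t, n (df T s t);
  tc_om : exists (o : 'I_(rk T)) (om : 'rV[S]_(rk T)) (De : 'M[S]_(rk T)) (lam : nat -> 'rV[S]_(rk T)),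
    [/\ forall t, dg t <> a -> om 0 t = 0, om *m df T = 0, forall t, n ((om *m De) 0 t - (t == o)%:R),
       forall j t, (j < b)%N -> dg t <> a.+1 -> lam j 0 t = 0 &
       forall j, (j < b)%N -> lam j *m df T = y j *: om] }.

(** Each of the [b] cones raises by one the degree above which there is exactness with coefficients
    in [N], so that the bound [c] becomes [c + b]. The rows [om *m lam j] are the chains with
    boundary [y j *: om]. *)
Lemma totc_exists (R S : comPzRingType) (f : {rmorphism R -> S}) (m : set R) (n : set S)
    a (x : 'I_a -> R) b (y : nat -> S) L C o :
  locr m -> m = idl (range x) -> (forall c : 'I_a -> R, \sum_i c i * x i = 0 -> forall i, m (c i)) ->
  is_ideal n -> (forall r, m r -> n (f r)) -> (forall j, n (y j)) ->
  (forall r, n r -> exists c : 'I_b -> S, r = \sum_j c j * y j) ->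
  (a <= L.+1)%N -> @minres R m L C o ->
  exists T, totc n a b y T /\ forall (N : lmodType S) c,
    (forall i, (c < i <= L)%N -> @exact_at R C (restrict f N) i) ->
    forall i, (c + b < i <= L)%N -> exact_at T N i.
Proof.
move=> lm mx xmin idn fm ny ngen aL mr.
have [h [D op0]] := minres_opers lm mx xmin mr.
have {op0} op0 := opers_mapc idn fm op0 y.
suff [T [o' [h' [D' [lam [op exT]]]]]] : exists T o' h' D' lam,
   @opers S n T o' a (f \o x) b y h' D' lam L.+1 /\ forall (N : lmodType S) c,
    (forall i, (c < i <= L)%N -> @exact_at R C (restrict f N) i) ->
    forall i, (c + b < i <= L)%N -> exact_at T N i.
  exists T; split=> //.
  have /choice[c hc] : forall k : 'I_a, exists c : 'I_b -> S, (f \o x) k = \sum_j c j * y j.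
    by move=> k; apply: ngen; apply: fm; rewrite mx; apply: sub_idl; exists k.
  have [om [De [h1 h2 h3]]] := omega_exists idn op hc aL.
  case: op => oC o0 dn hs ls hd ld dh dl Do.
  split=> //; exists o', om, De, (fun j => om *m lam j); split=> //.
    move=> j t ltj ht; rewrite mxE big1 // => s _.
    case: (pselect (dg s = a)) => [es|/h1 ->]; last by rewrite mul0r.
    by rewrite ls ?mulr0 // es.
  move=> j ltj; rewrite -mulmxA; have -> : lam j *m df T = (y j)%:M - df T *m lam j by rewrite -ld // addrK.
  by rewrite mulmxBr mul_mx_scalar mulmxA h2 mul0mx subr0.
elim: {ngen} b => [|b [T [o' [h' [D' [lam [op exT]]]]]]].
  exists (mapc f C), o, (fun k => map_mx f (h k)), (fun k => map_mx f (D k)), (fun=> 0); split=> //.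
  by move=> N c exC i; rewrite addn0 => hi; apply/exact_mapc; exact: exC.
exists (cone T (y b)), (lshift _ o'), (fun k => dsum (h' k)), (fun k => dsum (D' k)),
  (fun j => if j == b then block_mx 0 1%:M 0 0 else dsum (lam j)); split; first exact: opers_cone.
move=> N c exC [|i] hi; first by lia.
apply: exq_cone; [exact: (op_ok op)|exact: submoduleT|exact: submodule0|..]; apply: (exT N c exC); lia.
Qed.

Section YMul.
Variables (S : comPzRingType) (n : set S) (b : nat) (y : nat -> S) (M : lmodType S).
Hypothesis idn : is_ideal n.
Hypothesis ny : forall j, n (y j).
Hypothesis ngen : forall r, n r -> exists c : 'I_b -> S, r = \sum_j c j * y j.

(** The submodule [n U], written through the generators [y] so that an element is a single sum of
    [b] terms. *)
Definition ymul (U : set M) : set M :=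
  [set v | exists2 u : 'I_b -> M, forall j, U (u j) & v = \sum_(j < b) y j *: u j].

Lemma submodule_ymul U : submodule U -> submodule (ymul U).
Proof.
move=> sU; split.
- exists (fun=> 0) => [_|]; first exact: submod0.
  by rewrite big1 // => j _; rewrite scaler0.
- move=> _ _ [u Uu ->] [w Uw ->]; exists (fun j => u j + w j) => [j|]; first exact: submodD.
  by rewrite -big_split; apply: eq_bigr => j _; rewrite scalerDr.
move=> c _ [u Uu ->]; exists (fun j => c *: u j) => [j|]; first exact: submodZ.
by rewrite scaler_sumr; apply: eq_bigr => j _; rewrite !scalerA mulrC.
Qed.
Lemma ymul_sub U : submodule U -> ymul U `<=` U.
Proof. by move=> sU _ [u Uu ->]; apply: submod_sum => // j _; exact: submodZ. Qed.
Lemma ymul_mono U W : U `<=` W -> ymul U `<=` ymul W.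
Proof. by move=> UW _ [u Uu ->]; exists u => // j; exact: UW. Qed.
Lemma ymulZ U r u : submodule U -> n r -> U u -> ymul U (r *: u).
Proof.
move=> sU /ngen[c ->] Uu; exists (fun j => c j *: u) => [j|]; first exact: submodZ.
by rewrite scaler_suml; apply: eq_bigr => j _; rewrite scalerA mulrC.
Qed.

Definition ypow (U : set M) h := iter h ymul U.

Lemma submodule_ypow U h : submodule U -> submodule (ypow U h).
Proof. by move=> sU; elim: h => //= h IH; exact: submodule_ymul. Qed.
Lemma ypow_sub U h : submodule U -> ypow U h `<=` U.
Proof.
move=> sU; elim: h => //= h IH v hv; apply: IH.
exact: (ymul_sub (submodule_ypow h sU)).
Qed.
Lemma ypow_pow U h r u : submodule U -> ideal_pow n h r -> U u -> ypow U h (r *: u).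
Proof.
move=> sU; elim: h r => [|h IH] r /= hr Uu; first exact: submodZ.
move: r hr; apply: (@idl_min _ _ [set r | ymul (ypow U h) (r *: u)]); first split.
- by rewrite /= scale0r; exact: submod0 (submodule_ymul (submodule_ypow h sU)).
- by move=> r s ? ?; rewrite /= scalerDl; exact: submodD (submodule_ymul (submodule_ypow h sU)) _ _.
- by move=> r s ?; rewrite /= -scalerA; exact: submodZ (submodule_ymul (submodule_ypow h sU)) _.
move=> _ [r [s [nr hs ->]]]; rewrite /= -scalerA; apply: ymulZ => //; first exact: submodule_ypow.
exact: IH.
Qed.
Lemma ypow_span U h : submodule U ->
  ypow U h `<=` span [set v | exists r u, [/\ ideal_pow n h r, U u & v = r *: u]].
Proof.
move=> sU; elim: h => [|h IH] v /=.
  by move=> Uv; apply: sub_span; exists 1, v; rewrite scale1r.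
move=> [u hu ->]; apply: (submod_sum _ (span_submodule _)) => j _.
have := IH _ (hu j); move: (u j) => {hu}u.
apply: (@span_min _ _ _ [set w | span _ (y j *: w)]); first split.
- by rewrite /= scaler0; exact: (submod0 (span_submodule _)).
- by move=> w w' ? ?; rewrite /= scalerDr; exact: (submodD (span_submodule _)).
- by move=> c w ?; rewrite /= scalerA mulrC -scalerA; exact: (submodZ _ (span_submodule _)).
move=> _ [r [w [hr Uw ->]]]; rewrite /= scalerA; apply: sub_span; exists (y j * r), w; split=> //.
by apply: sub_idl; exists (y j), r.
Qed.

End YMul.

(** The condition is put on chains inside a subset, so that it applies to modules of cycles without
    giving them a type. *)
Definition dcc (R : comPzRingType) (M : lmodType R) (N : set M) :=
  forall U : nat -> set M, (forall i, submodule (U i)) -> (forall i, U i `<=` N) ->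
    (forall i, U i.+1 `<=` U i) -> exists i, forall j, (i <= j)%N -> U i `<=` U j.

Section CaseOne.
Variables (S : comPzRingType) (n : set S) (nS : noetherian_ring S) (ln : locr n).
Variables (a b : nat) (y : nat -> S) (M : lmodType S) (N : set M).
Hypothesis ny : forall j, n (y j).
Hypothesis ngen : forall r, n r -> exists c : 'I_b -> S, r = \sum_j c j * y j.
Hypothesis sN : submodule N.
Hypothesis dN : dcc N.

Let idn : is_ideal n. Proof. by case: ln. Qed.
Local Notation yN := (ymul b y).

(** [N / n N] is finite dimensional: for an infinite sequence with each term outside the span of the
    earlier ones modulo [n N], the spans of the tails would descend for ever. Generators in minimal
    number are then independent modulo [n]. *)
Lemma fin_gen_mod : exists r (nu : 'I_r -> M), [/\ forall i, N (nu i),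
  N `<=` addm (yN N) (span (range nu)) &
  forall c : 'I_r -> S, yN N (\sum_i c i *: nu i) -> forall i, n (c i)].
Proof.
have syN := submodule_ymul b y sN.
pose P r := exists nu : 'I_r -> M, (forall i, N (nu i)) /\ N `<=` addm (yN N) (span (range nu)).
have [r0 Pr0] : exists r, P r.
  apply: contrapT => nP.
  have H (s : seq M) : exists x, (forall z, z \in s -> N z) -> N x /\ ~ addm (yN N) (span [set` s]) x.
    case: (pselect (forall z, z \in s -> N z)) => [sN'|]; last by exists 0.
    apply: contrapT => h; apply: nP; exists (size s), (fun i => nth 0 s i); split.
      by move=> i; apply: sN'; exact: mem_nth.
    have -> : range (fun i : 'I_(size s) => nth 0 s i) = [set` s].
      apply/seteqP; split=> [_ [i _ <-]|x /= /(nthP 0)[i hi <-]]; first exact: mem_nth.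
      by exists (Ordinal hi).
    by move=> x Nx; apply: contrapT => hx; apply: h; exists x.
  have [u hu] := prefix_choice H.
  have Nu k : N (u k).
    elim/ltn_ind: k => k IH; have [] // := hu k.
    by move=> z /mapP[i]; rewrite mem_iota => hi ->; exact: IH.
  have nu_ k : ~ addm (yN N) (span [set` mkseq u k]) (u k).
    by have [] // := hu k; move=> z /mapP[i _ ->].
  pose A i := [set x | exists2 k, (i <= k)%N & x = u k].
  pose U i := addm (yN N) (span (A i)).
  have sU i : submodule (U i) by apply: submodule_addm => //; exact: span_submodule.
  have [|||i /(_ i.+1 (leqnSn i)) Ui] := dN (U := U) => //.
  - move=> i; apply: addm_min => //; first exact: ymul_sub.
    by apply: span_min => // _ [k _ ->].
  - move=> i; apply: addm_min => //; first by apply: addml; exact: span_submodule.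
    move=> x hx; apply: addmr => //; move: x hx; apply: span_mono => _ [k lik ->].
    by exists k => //; exact: ltnW.
  have [w yw [v hv e]] : U i.+1 (u i).
    by apply: Ui; apply: addmr => //; apply: sub_span; exists i.
  have [q [c ev]] : exists q (c : nat -> S), v = \sum_(k < q) c k *: u (i.+1 + k)%N.
    move: v hv {e}; apply: (@span_min _ _ _ [set v | exists q (c : nat -> S), v = \sum_(k < q) c k *: u (i.+1 + k)%N]); first split.
    - by exists 0%N, (fun=> 0); rewrite big_ord0.
    - move=> _ _ [q [c ->]] [q' [c' ->]]; exists (maxn q q').
      exists (fun k => (if (k < q)%N then c k else 0) + (if (k < q')%N then c' k else 0)).
      under [RHS]eq_bigr do rewrite scalerDl.
      rewrite [RHS]big_split /=; congr (_ + _).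
        rewrite (big_ord_widen _ (fun k => c k *: u (i.+1 + k)%N) (leq_maxl q q')) big_mkcond.
        by apply: eq_bigr => k _; case: ifP => //; rewrite scale0r.
      rewrite (big_ord_widen _ (fun k => c' k *: u (i.+1 + k)%N) (leq_maxr q q')) big_mkcond.
      by apply: eq_bigr => k _; case: ifP => //; rewrite scale0r.
    - move=> d _ [q [c ->]]; exists q, (fun k => d * c k); rewrite scaler_sumr.
      by apply: eq_bigr => k _; rewrite scalerA.
    move=> _ [k lik ->]; exists (k - i.+1).+1, (fun j => (j == k - i.+1)%N%:R).
    rewrite big_ord_recr /= eqxx scale1r subnKC // big1 ?add0r // => j _.
    by rewrite (ltn_eqF (ltn_ord j)) scale0r.
  have : yN N (u i - \sum_(k < q) c k *: u (i.+1 + k)%N) by rewrite -ev e addrK.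
  elim: q {ev} => [|q IHq].
    rewrite big_ord0 subr0 => h; apply: (nu_ i).
    by apply: addml => //; exact: span_submodule.
  rewrite big_ord_recr /= opprD addrA => h; have [_ _ nunit] := ln.
  case: (pselect (n (c q))) => [nc|/nunit[d cd]].
    apply: IHq; apply: (submod_subr syN _ h).
    exact: (ymulZ ngen sN nc (Nu _)).
  apply: (nu_ (i.+1 + q)%N).
  have su : submodule (addm (yN N) (span [set` mkseq u (i.+1 + q)])).
    by apply: submodule_addm => //; exact: span_submodule.
  have -> : u (i.+1 + q)%N = d *: (u i - \sum_(k < q) c k *: u (i.+1 + k)%N) -
      d *: (u i - \sum_(k < q) c k *: u (i.+1 + k)%N - c q *: u (i.+1 + q)%N).
    by rewrite -scalerBr opprB addrC subrK scalerA mulrC cd scale1r.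
  apply: submodB => //; last by apply: addml; [exact: span_submodule|exact: submodZ].
  apply: submodZ => //; apply: addmr => //.
  apply: (submodB (span_submodule _)); first by apply: sub_span; apply: map_f; rewrite mem_iota; lia.
  apply: (submod_sum _ (span_submodule _)) => k _; apply: (submodZ _ (span_submodule _)).
  by apply: sub_span; apply: map_f; rewrite mem_iota; have := ltn_ord k; lia.
have [r [[nu [Nnu gen]] _ rmin]] := @inf_natP P r0 Pr0.
exists r, nu; split=> // c hc i; apply: contrapT => nci.
have [_ _ /(_ _ nci)[d cd]] := ln.
case: r => [|r] in nu Nnu gen rmin c hc i nci cd *; first by case: (i).
suff /rmin : P r by rewrite ltnn.
exists (nu \o lift i); split=> [j|]; first exact: Nnu.
have sV : submodule (addm (yN N) (span (range (nu \o lift i)))) by apply: submodule_addm => //; exact: span_submodule.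
move=> v /gen; apply: addm_min => //; first by apply: addml; exact: span_submodule.
apply: span_min => // _ [j _ <-]; case: (unliftP i j) => [k ->|->].
  by apply: addmr => //; apply: sub_span; exists k.
have -> : nu i = d *: (\sum_j c j *: nu j) - \sum_k (d * c (lift i k)) *: nu (lift i k).
  rewrite (bigD1_ord i) //= scalerDr scalerA mulrC cd scale1r scaler_sumr.
  by under [X in _ = _ - X]eq_bigr do rewrite -scalerA; rewrite addrK.
apply: submodB => //; first by apply: addml; [exact: span_submodule|exact: submodZ].
by apply: addmr => //; apply/spanP; exists (fun k => d * c (lift i k)).
Qed.

Variable T : cpx S.
Hypothesis tT : totc n a b y T.

(** Let [W = n^h N] be the stable power and [Z] the relations among the [nu] modulo [W]. A relation
    [c] is written [sum_j y_j G_j]; a chain built from the [G_j] and the [lam j] is a cycle of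
    degree [a.+1], and the fact that it bounds puts [c] into [n Z]. Nakayama's lemma gives [Z = 0],
    from which both freeness and the nilpotency of [n] follow. *)
Lemma case_one : exq T N [set 0] a.+1 -> ~ (N `<=` yN N) ->
  exists r (nu : 'I_r.+1 -> M) h, [/\ forall i, N (nu i), N `<=` span (range nu),
    forall c : 'I_r.+1 -> S, \sum_i c i *: nu i = 0 -> forall i, c i = 0 &
    forall u, ideal_pow n h u -> u = 0].
Proof.
move=> exT nyN; have [r [nu [Nnu gen ind]]] := fin_gen_mod.
have [h hst] : exists h, ypow b y N h `<=` ypow b y N h.+1.
  have [i|i|i|h hh] := dN (U := ypow b y N); [exact: submodule_ypow|exact: ypow_sub| |].
    by apply: ymul_sub; exact: submodule_ypow.
  by exists h; exact: hh.
set W := ypow b y N h in hst; have sW : submodule W by exact: submodule_ypow.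
have WN : W `<=` N by exact: ypow_sub.
have genW k : N `<=` addm (ypow b y N k) (span (range nu)).
  elim: k => [|k IH]; first by apply: addml; exact: span_submodule.
  move=> v /gen[_ [u Nu ->] [s hs ->]].
  have sV : submodule (addm (ypow b y N k.+1) (span (range nu))).
    by apply: submodule_addm; [exact: submodule_ypow|exact: span_submodule].
  apply: submodD => //; last by apply: addmr => //; exact: submodule_ypow.
  have /choice[w hw] : forall j, exists w, ypow b y N k w /\ span (range nu) (u j - w).
    by move=> j; have [w ? [z ? ->]] := IH _ (Nu j); exists w; rewrite addrC addKr.
  have -> : \sum_(j < b) y j *: u j = \sum_(j < b) y j *: w j + \sum_(j < b) y j *: (u j - w j).
    by rewrite -big_split; apply: eq_bigr => j _; rewrite /= -scalerDr addrC subrK.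
  apply: submodD => //.
    by apply: addml; [exact: span_submodule|exists w => // j; case: (hw j)].
  apply: addmr; first exact: submodule_ypow.
  apply: (submod_sum _ (span_submodule _)) => j _; apply: (submodZ _ (span_submodule _)).
  by case: (hw j).
pose phi (c : {ffun 'I_r -> S^o}) : M := \sum_i (c i : S) *: nu i.
have phiD c d : phi (c + d) = phi c + phi d.
  by rewrite -big_split; apply: eq_bigr => i _; rewrite ffunE scalerDl.
have phiZ s c : phi (s *: c) = s *: phi c.
  by rewrite scaler_sumr; apply: eq_bigr => i _; rewrite ffunE -scalerA.
have phi0 : phi 0 = 0 by have := phiZ 0 0; rewrite !scale0r.
have phiN c : phi (- c) = - phi c by apply/eqP; rewrite -subr_eq0 opprK -phiD addNr phi0.
have phi_sum (I : finType) (F : I -> {ffun 'I_r -> S^o}) : phi (\sum_i F i) = \sum_i phi (F i).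
  exact: (big_morph phi phiD phi0).
have phiNn c : N (phi c) by apply: submod_sum => // i _; exact: submodZ.
pose Z := [set c | W (phi c)].
have sZ : submodule Z.
  split; first by rewrite /Z /= phi0; exact: submod0.
    by move=> c d; rewrite /Z /= phiD; exact: submodD.
  by move=> s c; rewrite /Z /= phiZ; exact: submodZ.
have Zn c : Z c -> forall i, n (c i).
  by move=> Zc; apply: ind; apply: (ymul_mono WN); exact: hst.
have Z0 : Z `<=` [set 0].
  apply: (nakayama ln); [exact: noeth_ffun|exact: submodule0|].
  move=> c Zc; case: tT => oT dn [o [om [De [lam [h1 h2 h3 h4 h5]]]]].
  have /choice[g hg] : forall i, exists g : 'I_b -> S, c i = \sum_j g j * y j.
    by move=> i; apply: ngen; exact: Zn.
  pose G (j : 'I_b) : {ffun 'I_r -> S^o} := [ffun i => g i j : S^o].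
  have cG : c = \sum_(j < b) y j *: G j.
    apply/ffunP => i; rewrite sum_ffunE hg; apply: eq_bigr => j _; rewrite !ffunE; exact: mulrC.
  have [w Ww ew] : yN W (phi c) by exact: hst.
  (* Subtracting [w j] turns the relation modulo [W] into the exact one [sum_j y_j nu'_j = 0], so
     that [V] is a cycle. *)
  pose nu' (j : 'I_b) := phi (G j) - w j.
  have Nnu' j : N (nu' j) by apply: submodB => //; exact: WN.
  have nu'0 : \sum_(j < b) y j *: nu' j = 0.
    under eq_bigr do rewrite scalerBr; rewrite sumrB -ew cG phi_sum.
    by under [X in _ - X]eq_bigr do rewrite phiZ; rewrite subrr.
  pose V := \sum_j tens (nu' j) (lam j).
  have [|||v [Nv hv ev]] := exT V.
  - move=> t; rewrite /V sum_ffunE; apply: submod_sum => // j _; rewrite ffunE; exact: submodZ.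
  - by move=> t ht; rewrite /V sum_ffunE big1 // => j _; rewrite ffunE h4 // scale0r.
  - move=> t; rewrite /V act_suml; under eq_bigr => j _ do rewrite act_tens h5 // -tensZ.
    by rewrite -tens_suml nu'0 tens0l ffunE.
  have {}ev : V = act v (df T).
    by apply/ffunP => t; apply/eqP; rewrite -subr_eq0; move: (ev t); rewrite /= !ffunE => ->.
  have /choice[be hbe] : forall t, exists be, W (v t - phi be).
    move=> t; have [w' Ww' [z /spanP[d ->] e]] := genW h _ (Nv t).
    exists [ffun i => d i]; rewrite e (_ : phi _ = \sum_i d i *: nu i) ?addrK //.
    by apply: eq_bigr => i _; rewrite ffunE.
  pose B : {ffun 'I_(rk T) -> {ffun 'I_r -> S^o}} := [ffun t => be t].
  (* The entries of [ze] lie in [Z] and its boundary is [c] tensor [om]. Applying [De] recovers [c]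
     up to the factor [1 + et], as a combination of entries of [ze] with coefficients in [n]. *)
  pose ze := \sum_j tens (G j) (lam j) - act B (df T).
  have Zze t : Z (ze t).
    rewrite /Z /= /ze ffun_subE phiD phiN sum_ffunE phi_sum [act B _ t]ffunE phi_sum.
    have evt : V t = act v (df T) t by rewrite -ev.
    rewrite sum_ffunE [RHS]ffunE in evt.
    have -> : \sum_j phi (tens (G j) (lam j) t) = \sum_j tens (nu' j) (lam j) t + \sum_(j < b) lam j 0 t *: w j.
      rewrite -big_split; apply: eq_bigr => j _ /=; rewrite !ffunE phiZ.
      by rewrite -scalerDr subrK.
    rewrite evt addrAC -sumrB; apply: submodD => //; apply: submod_sum => // s _; last exact: submodZ.
    by rewrite ffunE phiZ -scalerBr; apply: submodZ.
  have eze : act ze (df T) = tens c om.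
    rewrite /ze actBl actdd // subr0 act_suml cG tens_suml; apply: eq_bigr => j _.
    by rewrite act_tens h5 // tensZ.
  pose et := (om *m De) 0 o - 1.
  have net : n et by have := h3 o; rewrite eqxx.
  pose cf (s : 'I_(rk T)) := \sum_t De t o * df T s t.
  exists (rk T + 1)%N, (fun i => match split i with inl s => cf s | inr _ => - et end),
    (fun i => match split i with inl s => ze s | inr _ => c end); split.
    apply: ord_split => i; rewrite ?split_l ?split_r; split=> //; last exact: idealN.
    by apply: ideal_sum => // t _; exact: idealM.
  rewrite big_split_ord big_ord1 /= split_r.
  under eq_bigr do rewrite split_l.
  have : act (act ze (df T)) De o = (om *m De) 0 o *: c by rewrite eze act_tens ffunE.
  rewrite -actM ffunE => e.
  have -> : \sum_i cf i *: ze i = (om *m De) 0 o *: c.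
    rewrite -e; apply: eq_bigr => s _; congr (_ *: _); rewrite mxE.
    by apply: eq_bigr => t _; rewrite mulrC.
  by rewrite scaleNr opprD opprK addrA -{1}[c]scale1r -scalerBl -scalerDl /et addrA subrK subrr scale0r.
have r0 : (0 < r)%N.
  case: r nu Nnu gen {ind genW phi phiD phiZ phi0 phiN phi_sum phiNn Z sZ Zn Z0} => // nu Nnu gen; case: nyN => v /gen.
  apply: addm_min => //; first exact: submodule_ymul.
  by apply: span_min; [exact: submodule_ymul|move=> x [[]]].
have er : r = r.-1.+1 by rewrite prednK.
move: (r.-1) er => r' er; subst r.
have pow0 u : ideal_pow n h u -> u = 0.
  move=> hu; pose e : {ffun 'I_r'.+1 -> S^o} := [ffun i => if i == ord0 then u : S^o else 0].
  have : Z e.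
    rewrite /Z /= (_ : phi e = u *: nu ord0); first exact: (ypow_pow ngen).
    rewrite /phi (bigD1 ord0) //= ffunE eqxx big1 ?addr0 // => i /negPf ne.
    by rewrite ffunE ne scale0r.
  by move=> /Z0/ffunP/(_ ord0); rewrite !ffunE eqxx.
have W0 : W `<=` [set 0].
  move=> w /(ypow_span ny sN); apply: span_min; first exact: submodule0.
  by move=> _ [u [v [/pow0 -> _ ->]]]; rewrite /= scale0r.
exists r', nu, h; split=> //.
  by move=> v /(genW h)[w /W0 -> [z hz ->]]; rewrite add0r.
move=> c c0 i; have /Z0/ffunP/(_ i) : Z [ffun i => c i].
  rewrite /Z /= (_ : phi _ = 0); first exact: submod0.
  by rewrite -[RHS]c0; apply: eq_bigr => j _; rewrite ffunE.
by rewrite !ffunE.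
Qed.

End CaseOne.

Lemma noeth_fg (R : comPzRingType) (M : lmodType R) (V U : set M) : noetherian_ring R ->
  fg V -> submodule U -> U `<=` V -> fg U.
Proof.
move=> nR [n [x ->]] sU UV.
pose phi (c : {ffun 'I_n -> R^o}) : M := \sum_i (c i : R) *: x i.
pose Z := [set c | U (phi c)].
have sZ : submodule Z.
  split.
  - rewrite /Z /= /phi big1; first exact: submod0.
    by move=> i _; rewrite ffunE scale0r.
  - move=> c d; rewrite /Z /= => hc hd; rewrite (_ : phi _ = phi c + phi d); first exact: submodD.
    by rewrite -big_split; apply: eq_bigr => i _; rewrite ffunE scalerDl.
  move=> s c; rewrite /Z /= => hc; rewrite (_ : phi _ = s *: phi c); first exact: submodZ.
  by rewrite scaler_sumr; apply: eq_bigr => i _; rewrite ffunE -scalerA.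
have [q [z defZ]] := noeth_ffun nR sZ.
exists q, (phi \o z); apply/seteqP; split=> [u Uu|]; last first.
  apply: span_min => // _ [i _ <-]; suff : Z (z i) by [].
  by rewrite defZ; apply: sub_span; exists i.
have /spanP[c ec] := UV _ Uu; have : Z [ffun i => c i].
  rewrite /Z /= (_ : phi _ = u) // ec; apply: eq_bigr => i _; by rewrite ffunE.
rewrite defZ => /spanP[d ed]; apply/spanP; exists d; rewrite ec.
transitivity (phi [ffun i => c i]); first by apply: eq_bigr => i _; rewrite ffunE.
rewrite ed /phi; under eq_bigr do rewrite sum_ffunE scaler_suml.
rewrite exchange_big; apply: eq_bigr => i _; rewrite scaler_sumr; apply: eq_bigr => j _.
by rewrite ffunE -scalerA.
Qed.

Lemma dcc_chain (T : Type) (U : nat -> set T) : (forall i, U i.+1 `<=` U i) ->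
  forall i j, (i <= j)%N -> U j `<=` U i.
Proof.
move=> dU i j /subnKC <-; elim: (j - i)%N => [|k IH]; rewrite ?addn0 ?addnS //.
by move=> v /dU; exact: IH.
Qed.

Section Dcc.
Variables (R : comPzRingType) (M : lmodType R).

Lemma dcc_sub (N U : set M) : dcc N -> U `<=` N -> dcc U.
Proof. by move=> dN UN V sV VU decV; apply: dN => // i v /VU /UN. Qed.

Lemma dcc_ffun k (N : set M) : dcc N -> dcc [set v : {ffun 'I_k -> M} | forall t, N (v t)].
Proof.
move=> dN.
suff H p : forall U : nat -> set {ffun 'I_k -> M}, (forall i, submodule (U i)) ->
    (forall i v, U i v -> forall t, N (v t)) -> (forall i, U i.+1 `<=` U i) ->
    (forall i v, U i v -> forall t : 'I_k, (p <= t)%N -> v t = 0) ->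
    exists i, forall j, (i <= j)%N -> U i `<=` U j.
  move=> U sU UN dU; apply: (H k U sU) => // i v _ t; by rewrite leqNgt ltn_ord.
elim: p => [|p IH] U sU UN dU U0.
  exists 0%N => j _ v /U0 v0; have -> : v = 0 by apply/ffunP => t; rewrite ffunE v0.
  exact: submod0.
case: (ltnP p k) => [ltp|lekp]; last first.
  by apply: IH => // i v /U0 h t lpt; have := ltn_ord t; rewrite ltnNge (leq_trans lekp lpt).
pose t0 := Ordinal ltp.
have [|||i1 h1] := dN (fun i => [set a | exists2 v, U i v & v t0 = a]).
- move=> i; split; first by exists 0; [exact: submod0|rewrite ffunE].
    by move=> _ _ [v Uv <-] [w Uw <-]; exists (v + w); [exact: submodD|rewrite ffunE].
  by move=> a _ [v Uv <-]; exists (a *: v); [exact: submodZ|rewrite ffunE].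
- by move=> i _ [v /UN Nv <-].
- by move=> i _ [v /dU Uv <-]; exists v.
have [|||i v [Uv v0] t lpt|i2 h2] := IH (fun i => U i `&` [set v : {ffun 'I_k -> M} | v t0 = 0]).
- move=> i; apply: submoduleI => //; split=> /= [|v w|a v]; rewrite !ffunE //.
    by move=> -> ->; rewrite addr0.
  by move=> ->; rewrite scaler0.
- by move=> i v [/UN].
- by move=> i v [/dU ? ?].
- case: (eqVneq t t0) => [-> //|ne]; apply: (U0 _ _ Uv).
  by rewrite ltn_neqAle lpt andbT eq_sym -(inj_eq val_inj) in ne *.
exists (maxn i1 i2) => j; rewrite geq_max => /andP[l1 l2] v Uv.
have [w Uw ew] : exists2 w, U j w & w t0 = v t0.
  apply: (h1 j l1); exists v => //; exact: (dcc_chain dU (leq_maxl i1 i2) Uv).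
have : U j (v - w).
  have [] := h2 j l2 (v - w); last by [].
  split; last by rewrite /= ffun_subE ew subrr.
  apply: submodB => //; first exact: (dcc_chain dU (leq_maxr i1 i2) Uv).
  exact: (dcc_chain dU l2 Uw).
by apply: submod_subr.
Qed.

End Dcc.

Section CaseZero.
Variables (S : comPzRingType) (n : set S) (nS : noetherian_ring S) (ln : locr n).
Variables (a b : nat) (y : nat -> S).
Hypothesis ny : forall j, n (y j).
Hypothesis ngen : forall r, n r -> exists c : 'I_b -> S, r = \sum_j c j * y j.
Let idn : is_ideal n. Proof. by case: ln. Qed.

(** The chain of the [n^i x] stops, and it stops at zero by Nakayama's lemma, because [S x] is
    finitely generated. Its last nonzero member consists of socle elements. *)
Lemma socle_exists (M : lmodType S) (N : set M) : submodule N -> dcc N -> ~ (N `<=` [set 0]) ->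
  exists u, [/\ N u, u <> 0 & forall r, n r -> r *: u = 0].
Proof.
move=> sN dN N0; have [x Nx x0] : exists2 x, N x & x <> 0.
  by apply: contrapT => h; apply: N0 => x Nx; apply: contrapT => x0; apply: h; exists x.
pose U := ypow b y (span [set x]).
have sU i : submodule (U i) by apply: submodule_ypow; exact: span_submodule.
have UX i : U i `<=` span [set x] by apply: ypow_sub; exact: span_submodule.
have fx : fg (span [set x]).
  exists 1%N, (fun=> x); congr span; apply/seteqP; split=> [_ ->|_ [_ _ <-]] //.
  by exists ord0.
have [|||i hi] := dN U => //.
- by move=> i v /UX; apply: span_min => // _ ->.
- by move=> i; apply: ymul_sub.
have Ui0 : U i `<=` [set 0].
  apply: (nakayama ln); [exact: noeth_fg fx (sU i) (UX i)|exact: submodule0|].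
  move=> u /(hi i.+1 (leqnSn i)) [w Uw ->]; exists b, (fun j => y j), w; split; first by move=> j; split; [exact: ny|exact: Uw].
  by rewrite /= subrr.
have [j [Uj0 jmin]] : exists j, U j `<=` [set 0] /\ forall k, U k `<=` [set 0] -> (j <= k)%N.
  have ex : exists j, `[< U j `<=` [set 0] >] by exists i; apply/asboolP.
  exists (ex_minn ex); case: ex_minnP => j /asboolP Uj jm; split=> // k Uk.
  by apply: jm; apply/asboolP.
case: j Uj0 jmin => [Uj0 _|j Uj0 jmin].
  by case: x0; apply: Uj0; exact: sub_span.
have [u Uu u0] : exists2 u, U j u & u <> 0.
  apply: contrapT => h; suff /jmin : U j `<=` [set 0] by rewrite ltnn.
  by move=> u Uu; apply: contrapT => u0; apply: h; exists u.
exists u; split=> //; first by have := UX _ _ Uu; apply: span_min => // _ ->.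
by move=> r nr; apply: Uj0; apply: (ymulZ ngen).
Qed.

(** The Koszul complex of the first [b'] of the [y j]. Taking the family [x] empty, [opers_cone]
    delivers its homotopies as well. *)
Lemma koszul_exists b' : exists K o (x : 'I_0 -> S) h D lam, [/\ @opers S n K o 0 x b' y h D lam 0,
  forall t : 'I_(rk K), (dg t <= b')%N & exists t : 'I_(rk K), dg t = b'].
Proof.
elim: b' => [|k [K [o [x [h [D [lam [op dgk [t et]]]]]]]]].
  pose K : cpx S := @Cpx S 1 (fun=> 0%N) 0.
  exists K, ord0, (fun=> 0), (fun=> 0), (fun=> 0), (fun=> 0); split=> //; last by exists ord0.
  have okK : okc K by split; [rewrite mulmx0|move=> s t _; rewrite mxE].
  by split=> //; try (by case); move=> s t; rewrite ?mxE //; exact: ideal0.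
exists (cone K (y k)), (lshift _ o), x, (fun k => dsum (h k)), (fun k => dsum (D k)),
  (fun j => if j == k then block_mx 0 1%:M 0 0 else dsum (lam j)); split; first exact: opers_cone.
  apply: ord_split => i; rewrite /= ?split_l ?split_r; last exact: dgk.
  by apply: leqW; exact: dgk.
by exists (rshift _ t); rewrite /= split_r et.
Qed.

Variables (M : lmodType S) (N : set M).
Hypothesis sN : submodule N.
Hypothesis dN : dcc N.
Hypothesis N0 : ~ (N `<=` [set 0]).
Variable T : cpx S.
Hypothesis tT : totc n a b y T.
Hypothesis exT : forall i, (a < i <= a.+1 + b)%N -> exq T N [set 0] i.

Lemma act_act k g g' (W : {ffun 'I_g -> {ffun 'I_k -> M}}) (D : 'M[S]_(g, g')) (E : 'M[S]_k) :
  act [ffun s => act (W s) E] D = [ffun s => act (act W D s) E].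
Proof.
apply/ffunP => s; rewrite !ffunE act_suml; apply: eq_bigr => i _.
by rewrite ffunE actZl.
Qed.
Lemma act_coord k g g' (V : {ffun 'I_g -> {ffun 'I_k -> M}}) (D : 'M[S]_(g, g')) s t :
  act V D s t = act [ffun s => V s t] D s.
Proof. by rewrite !ffunE sum_ffunE; apply: eq_bigr => i _; rewrite !ffunE. Qed.

(** If [N = n N], the argument moves to the cycles [Z j] of the Koszul complex over [N], in the
    lowest degree [j] where they exceed the boundaries. The [y l] map these cycles to boundaries, so
    [n Z_j] is proper and [case_one] applies: [n] is nilpotent, and then [N = n N] forces
    [N = 0]. *)
Lemma not_ymul : ~ (N `<=` ymul b y N).
Proof.
move=> Ny; have [K [o [x [h [D [lam [op dgb [top etop]]]]]]]] := koszul_exists b.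
have oK := op_ok op; have oT := tc_ok tT.
pose NK (v : {ffun 'I_(rk K) -> M}) := forall t, N (v t).
pose Z j := [set v : {ffun 'I_(rk K) -> M} | [/\ NK v, hmg j v & act v (df K) = 0]].
pose Bd j := [set v : {ffun 'I_(rk K) -> M} | exists w, [/\ NK w, hmg j.+1 w & v = act w (df K)]].
have NKD v w : NK v -> NK w -> NK (v + w) by move=> hv hw t; rewrite ffunE; exact: submodD.
have NKB v w : NK v -> NK w -> NK (v - w) by move=> hv hw t; rewrite ffun_subE; exact: submodB.
have NK0 : NK 0 by move=> t; rewrite ffunE; exact: submod0.
have BdZ j : Bd j `<=` Z j.
  move=> _ [w [Nw hw ->]]; split; [exact: act_in|exact: hmg_act|exact: actdd].
have hmgZ j c (v : {ffun 'I_(rk K) -> M}) : hmg j v -> hmg j (c *: v).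
  by move=> hv t ht; rewrite ffunE hv ?scaler0.
have sZ j : submodule (Z j).
  split; first by split=> //; [move=> t _; rewrite ffunE|rewrite act0l].
    by move=> v w [h1 h2 h3] [h4 h5 h6]; split; [exact: NKD|exact: hmgD|rewrite actDl h3 h6 addr0].
  move=> c v [h1 h2 h3]; split; [|exact: hmgZ|by rewrite actZl h3 scaler0].
  by move=> t; rewrite ffunE; exact: submodZ.
have sBd j : submodule (Bd j).
  split; first by exists 0; split; rewrite ?act0l // => t _; rewrite ffunE.
    move=> _ _ [v [h1 h2 ->]] [w [h4 h5 ->]]; exists (v + w).
    by split; [exact: NKD|exact: hmgD|rewrite actDl].
  move=> c _ [v [h1 h2 ->]]; exists (c *: v); split; [|exact: hmgZ|by rewrite actZl].
  by move=> t; rewrite ffunE; exact: submodZ.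
have [u [Nu u0 nu]] := socle_exists sN dN N0.
(* A socle element placed in the top degree is a cycle but not a boundary; this shows that [j]
   exists and is at most [b]. *)
have Pb : Z b (tens u (delta_mx 0 top)) /\ ~ Bd b (tens u (delta_mx 0 top)).
  split; first split.
  - by move=> t; rewrite ffunE; exact: submodZ.
  - move=> t ht; rewrite ffunE mxE eqxx /=; case: eqP ht => [->|_ _]; first by [].
    by rewrite scale0r.
  - apply/ffunP => t; rewrite act_tens !ffunE delta_mulmx; apply: nu; exact: (op_d op).
  move=> [w [_ hw e]]; apply: u0; have /ffunP/(_ top) := e.
  rewrite ffunE mxE !eqxx scale1r => ->; have -> : w = 0.
    apply/ffunP => t; rewrite ffunE; apply: hw => et; have := dgb t; by rewrite et ltnn.
  by rewrite act0l ffunE.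
have ex : exists j, `[< exists v, Z j v /\ ~ Bd j v >] by exists b; apply/asboolP; exists (tens u (delta_mx 0 top)).
have [j [[v0 [Zv0 nBv0]] jmin]] : exists j, (exists v, Z j v /\ ~ Bd j v) /\
    forall i, (i < j)%N -> Z i `<=` Bd i.
  exists (ex_minn ex); case: ex_minnP => j /asboolP Pj jm; split=> // i lti v Zv.
  apply: contrapT => nB; have : (j <= i)%N by apply: jm; apply/asboolP; exists v.
  by rewrite leqNgt lti.
have jb : (j <= b)%N.
  rewrite leqNgt; apply/negP => ltj; have [Zb nB] := Pb.
  by apply: nB; exact: jmin ltj _ Zb.
have E i s (V : {ffun 'I_(rk T) -> {ffun 'I_(rk K) -> M}}) : (a < s <= a.+1 + b)%N ->
    (forall s', NK (V s')) -> (forall s', hmg i (V s')) -> hmg s V -> act V (df T) = 0 ->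
    exists W : {ffun 'I_(rk T) -> {ffun 'I_(rk K) -> M}},
      [/\ forall s', NK (W s'), forall s', hmg i (W s'), hmg s.+1 W & V = act W (df T)].
  move=> hs NV hV hTV V0.
  have /choice[W hW] : forall t, exists w : {ffun 'I_(rk T) -> M}, [/\ forall s', N (w s'),
      hmg s.+1 w, [ffun s' => V s' t] = act w (df T) & dg t <> i -> w = 0].
    move=> t; case: (pselect (dg t = i)) => [et|net]; last first.
      exists 0; split=> //; first by move=> s'; rewrite ffunE; exact: submod0.
        by move=> s' _; rewrite ffunE.
      by rewrite act0l; apply/ffunP => s'; rewrite !ffunE hV.
    have [|||w [Nw hw ew]] := exT hs (v := [ffun s' => V s' t]).
    - by move=> s'; rewrite ffunE; exact: NV.
    - by move=> s' hs'; rewrite ffunE hTV // ffunE.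
    - by move=> s'; rewrite -act_coord V0 !ffunE.
    exists w; split=> //; apply/ffunP => s'; apply/eqP; rewrite -subr_eq0 -ffun_subE.
    exact/eqP/ew.
  exists [ffun s' => [ffun t => W t s']]; split.
  - by move=> s' t; rewrite !ffunE; case: (hW t).
  - by move=> s' t ht; rewrite !ffunE; case: (hW t) => _ _ _ -> //; rewrite ffunE.
  - by move=> s' hs'; apply/ffunP => t; rewrite !ffunE; case: (hW t) => _ -> .
  apply/ffunP => s'; apply/ffunP => t; rewrite act_coord.
  have [_ _ /ffunP/(_ s') e _] := hW t; move: e; rewrite ffunE => ->; congr (act _ _ _).
  by apply/ffunP => s''; rewrite !ffunE.
(* Dimension shifting along [0 -> Z i.+1 -> K_i.+1 -> Z i -> 0], which is exact on the right for
   [i < j]. Each step costs one degree of exactness, whence the bound [a.+1 + (b - i)]. *)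
have exZ i s : (i <= j)%N -> (a < s <= a.+1 + (b - i))%N -> exq T (Z i) [set 0] s.
  elim: i s => [|i IH] s lij hs V ZV hV V0.
    have {}V0 : act V (df T) = 0 by apply/ffunP => t; rewrite [RHS]ffunE V0.
    have [|||W [NW hW1 hW2 eW]] := E 0%N s V _ _ _ hV V0.
    - lia.
    - by move=> s'; case: (ZV s').
    - by move=> s'; case: (ZV s').
    exists W; split=> //; last by move=> t; rewrite eW subrr ffunE.
    by move=> t; split=> //; apply: hmg0_act.
  have {}V0 : act V (df T) = 0 by apply/ffunP => t; rewrite [RHS]ffunE V0.
  have [|||W [NW hW1 hW2 eW]] := E i.+1 s V _ _ _ hV V0.
  - lia.
  - by move=> s'; case: (ZV s').
  - by move=> s'; case: (ZV s').
  pose X := [ffun s' => act (W s') (df K)].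
  have [|||||Y [ZY hY eY]] := IH s.+1 _ _ X.
  - exact: ltnW.
  - lia.
  - by move=> s'; rewrite ffunE; apply: BdZ; exists (W s').
  - by move=> s' hs'; rewrite ffunE hW2 // act0l.
  - by move=> s'; rewrite act_act -eW !ffunE; case: (ZV s') => _ _ ->.
  have /choice[Y' hY'] : forall s', exists w, [/\ NK w, hmg i.+1 w, Y s' = act w (df K) & dg s' <> s.+2 -> w = 0].
    move=> s'; case: (pselect (dg s' = s.+2)) => [es|nes].
      by have [w [h1 h2 h3]] := jmin i lij _ (ZY s'); exists w; split.
    by exists 0; split=> //; [move=> t _; rewrite ffunE|rewrite act0l hY].
  pose F := [ffun s' => Y' s'].
  have hF : hmg s.+2 F by move=> s' hs'; rewrite ffunE; case: (hY' s') => _ _ _ ->.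
  exists (W - act F (df T)); split.
  - move=> t; split.
    + rewrite ffun_subE; apply: NKB => // r; rewrite act_coord; apply: act_in => // s'.
      by rewrite !ffunE; case: (hY' s').
    + rewrite ffun_subE; apply: hmgB => // r hr; rewrite act_coord ffunE big1 // => s' _.
      by rewrite !ffunE; case: (hY' s') => _ h2 _ _; rewrite h2 // scaler0.
    have eXY : X t = act Y (df T) t.
      by apply/eqP; rewrite -subr_eq0 -ffun_subE; apply/eqP; exact: eY.
    rewrite ffun_subE actBl -[act (W t) _](ffunE (fun s' => act (W s') (df K))) -/X eXY.
    have -> : Y = [ffun s' => act (F s') (df K)].
      by apply/ffunP => s'; rewrite !ffunE; case: (hY' s').
    by rewrite act_act ffunE subrr.
  - by apply: hmgB => //; exact: hmg_act.
  by move=> t; rewrite actBl actdd // subr0 eW subrr ffunE.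
have dZ : dcc (Z j).
  refine (dcc_sub (dcc_ffun (k := rk K) dN) _) => v [h1 _ _] //.
have yZ : ymul b y (Z j) `<=` Bd j.
  move=> _ [w Zw ->]; apply: submod_sum => // l _; have [h1 h2 h3] := Zw l.
  exists (act (w l) (lam l)); split; first exact: act_in.
    move=> t ht; rewrite ffunE big1 // => s _; case: (pselect (dg s = j)) => [es|/h2 ->]; last by rewrite scaler0.
    by rewrite (op_l op) ?scale0r // es => e; apply: ht.
  rewrite -actM; have -> : lam l *m df K = (y l)%:M - df K *m lam l by rewrite -(op_ld op (ltn_ord l)) addrK.
  by rewrite actBr act_scalar actM h3 act0l subr0.
have [||r [nu' [hh [_ _ _ pow0]]]] := case_one nS ln ny ngen (sZ j) dZ tT.
- by apply: exZ => //; lia.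
- by move=> hZ; apply: nBv0; apply: yZ; exact: hZ.
apply: N0 => v Nv; have : ypow b y N hh v.
  elim: hh {pow0} v Nv => [//|hh IH] v Nv; have [w Nw ->] := Ny _ Nv.
  by exists w => // l; exact: IH.
move=> /(ypow_span ny sN); apply: span_min; first exact: submodule0.
by move=> _ [r' [v' [/pow0 -> _ ->]]]; rewrite /= scale0r.
Qed.

Theorem free_of_exact : exists r (nu : 'I_r.+1 -> M) h, [/\ forall i, N (nu i), N `<=` span (range nu),
    forall c : 'I_r.+1 -> S, \sum_i c i *: nu i = 0 -> forall i, c i = 0 &
    forall u, ideal_pow n h u -> u = 0].
Proof.
apply: (case_one nS ln ny ngen sN dN tT); last exact: not_ymul.
by apply: exT; lia.
Qed.

(** Otherwise every [v] tensor [om] would bound; as the differential has entries in [n], applying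
    [De] would put [v] into [n N]. *)
Lemma not_exact : ~ exq T N [set 0] a.
Proof.
move=> exa; apply: not_ymul => v Nv.
case: tT => oT dn [o [om [De [lam [h1 h2 h3 _ _]]]]].
have sY : submodule (ymul b y N) by exact: submodule_ymul.
have [|||w [Nw hw ew]] := exa (tens v om).
- by move=> t; rewrite ffunE; exact: submodZ.
- by move=> t ht; rewrite ffunE h1 // scale0r.
- by move=> t; rewrite act_tens h2 !ffunE mxE scale0r.
have e : tens v om = act w (df T).
  by apply/ffunP => t; apply/eqP; rewrite -subr_eq0 -ffun_subE; exact/eqP/ew.
have : ymul b y N ((om *m De) 0 o *: v).
  have -> : (om *m De) 0 o *: v = act (act w (df T)) De o by rewrite -e act_tens ffunE.
  apply: act_in => // t; rewrite ffunE; apply: submod_sum => // s _.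
  exact: (ymulZ ngen sN (dn _ _) (Nw _)).
have : ymul b y N (((om *m De) 0 o - 1) *: v).
  by apply: (ymulZ ngen sN _ Nv); have := h3 o; rewrite eqxx.
by move=> hA hB; have := submodB sY hB hA; rewrite -scalerBl opprB addrC subrK scale1r.
Qed.

End CaseZero.

(** * Regular systems in towers of polynomial rings *)

Section Saturation.
Variables (D : comPzRingType).
Implicit Types (q J : set D).

(** The preimage in [D] of the extension of [J] to the localization at [q]. *)
Definition sat q (J : set D) : set D := [set x | exists2 u, ~ q u & J (u * x)].

Lemma sat_ideal q J : prime_ideal q -> is_ideal J -> is_ideal (sat q J).
Proof.
move=> [iq q1 pq] iJ; apply: is_idealI.
- by exists 1 => //; rewrite mulr0; exact: ideal0.
- move=> x y [u qu hu] [v qv hv]; exists (u * v); first by move=> /pq[].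
  by rewrite mulrDr mulrAC -[X in _ + X]mulrA; apply: idealD => //; [exact: idealMr|exact: idealM].
- by move=> a x [u qu hu]; exists u => //; rewrite mulrCA; exact: idealM.
Qed.
Lemma sub_sat q J : ~ q 1 -> J `<=` sat q J.
Proof. by move=> q1 x Jx; exists 1; rewrite ?mul1r. Qed.
End Saturation.

Section MatrixCongruence.
Variables (D : comNzRingType).
Implicit Types (I q : set D).

Definition Imx I p r (A : 'M[D]_(p, r)) := forall i j, I (A i j).

Section Ops.
Variable I : set D.
Hypothesis iI : is_ideal I.
Lemma Imx0 p r : Imx I (0 : 'M_(p, r)). Proof. by move=> i j; rewrite mxE; exact: ideal0. Qed.
Lemma ImxD p r (A B : 'M_(p, r)) : Imx I A -> Imx I B -> Imx I (A + B).
Proof. by move=> hA hB i j; rewrite mxE; apply: idealD. Qed.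
Lemma ImxN p r (A : 'M_(p, r)) : Imx I A -> Imx I (- A).
Proof. by move=> hA i j; rewrite mxE; apply: idealN. Qed.
Lemma ImxB p r (A B : 'M_(p, r)) : Imx I A -> Imx I B -> Imx I (A - B).
Proof. by move=> hA hB; apply: ImxD => //; exact: ImxN. Qed.
Lemma ImxZ p r a (A : 'M_(p, r)) : Imx I A -> Imx I (a *: A).
Proof. by move=> hA i j; rewrite mxE; apply: idealM. Qed.
Lemma ImxMl p r s (A : 'M_(p, r)) (B : 'M_(r, s)) : Imx I A -> Imx I (A *m B).
Proof. by move=> hA i j; rewrite mxE; apply: ideal_sum => // k _; exact: idealMr. Qed.
Lemma ImxMr p r s (A : 'M_(p, r)) (B : 'M_(r, s)) : Imx I B -> Imx I (A *m B).
Proof. by move=> hB i j; rewrite mxE; apply: ideal_sum => // k _; exact: idealM. Qed.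
Lemma Imx_tr p r (A : 'M_(p, r)) : Imx I A -> Imx I A^T.
Proof. by move=> hA i j; rewrite mxE. Qed.
Lemma Imx_scal a : I a -> Imx I (a%:M : 'M_1).
Proof. by move=> Ia i j; rewrite !ord1 mxE eqxx mulr1n. Qed.
End Ops.

Lemma ImxS I J p r (A : 'M_(p, r)) : I `<=` J -> Imx I A -> Imx J A.
Proof. by move=> IJ hA i j; exact: IJ. Qed.

Lemma mx11B x (A : 'M[D]_1) : (x%:M - A) 0 0 = x - A 0 0.
Proof. by rewrite [LHS]mxE [X in X + _]mxE eqxx mulr1n [X in _ + X]mxE. Qed.

Lemma alt_form r (g : 'cV[D]_r) (E : 'M_r) : g^T *m (E - E^T) *m g = 0.
Proof.
rewrite mulmxBr mulmxBl; apply/eqP; rewrite subr_eq0; apply/eqP.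
have e (A : 'M[D]_1) : A = A^T by apply/matrixP => i j; rewrite mxE !ord1.
by rewrite [LHS]e !trmx_mul trmxK mulmxA.
Qed.

Definition gens I r (g : 'cV[D]_r) : set D := [set x | exists c : 'rV_r, Imx I (x%:M - c *m g)].
(** A trivial relation is [g^T] times an alternating matrix. Writing the latter as [E - E^T] is
    right in every characteristic. *)
Definition koszul_rel I r (g : 'cV[D]_r) (p : 'rV[D]_r) :=
  exists E : 'M_r, Imx I (p - g^T *m (E - E^T)).

(* Up to localization at [q], the system [g] is a regular system of parameters modulo [I]. *)
Record isgood I q r (g : 'cV[D]_r) : Prop := IsGood {
  good_in : Imx q g;
  good_gen : q `<=` sat q (gens I g);
  good_rel : forall p : 'rV_r, Imx I (p *m g) -> exists2 u, ~ q u & koszul_rel I g (u *: p) }.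

Lemma gens_ideal I r (g : 'cV_r) : is_ideal I -> is_ideal (gens I g).
Proof.
move=> iI; apply: is_idealI.
- by exists 0; rewrite mul0mx subr0; apply: Imx_scal => //; exact: ideal0.
- move=> x y [c hc] [d hd]; exists (c + d); rewrite mulmxDl raddfD /= opprD addrACA.
  exact: ImxD.
- move=> a x [c hc]; exists (a *: c); rewrite -scalemxAl -scale_scalar_mx -scalerBr; exact: ImxZ.
Qed.

Lemma sub_gens I r (g : 'cV_r) : I `<=` gens I g.
Proof. by move=> x Ix; exists 0; rewrite mul0mx subr0; exact: Imx_scal. Qed.
Lemma in_gens I r (g : 'cV_r) i : is_ideal I -> gens I g (g i 0).
Proof.
move=> iI; exists (delta_mx 0 i); rewrite -rowE.
have -> : (g i 0)%:M = row i g by apply/matrixP => k l; rewrite !ord1 !mxE eqxx.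
by rewrite subrr; exact: Imx0.
Qed.
Lemma koszul_relD I r (g : 'cV_r) p p' : is_ideal I ->
  koszul_rel I g p -> koszul_rel I g p' -> koszul_rel I g (p + p').
Proof.
move=> iI [E hE] [E' hE']; exists (E + E').
have -> : E + E' - (E + E')^T = (E - E^T) + (E' - E'^T) by rewrite linearD /= opprD addrACA.
rewrite mulmxDr opprD addrACA.
exact: ImxD.
Qed.
Lemma koszul_relZ I r (g : 'cV_r) a p : is_ideal I ->
  koszul_rel I g p -> koszul_rel I g (a *: p).
Proof.
move=> iI [E hE]; exists (a *: E).
by rewrite linearZ /= -scalerBr -scalemxAr -scalerBr; exact: ImxZ.
Qed.
Lemma koszul_rel_sum I q r (g : 'cV_r) n (p : 'I_n -> 'rV_r) : is_ideal I -> prime_ideal q ->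
  (forall i, exists2 u, ~ q u & koszul_rel I g (u *: p i)) ->
  exists2 u, ~ q u & forall a : 'I_n -> D, koszul_rel I g (u *: \sum_i a i *: p i).
Proof.
move=> iI [iq q1 pq]; elim: n p => [|n IH] p hp.
  exists 1 => // a; rewrite big_ord0 scaler0; exists 0.
  by rewrite trmx0 subr0 mulmx0 subr0; exact: Imx0.
have [u qu hu] := IH (fun i => p (lift ord0 i)) (fun i => hp _).
have [v qv hv] := hp ord0; exists (u * v); first by move=> /pq[].
move=> a; rewrite big_ord_recl scalerDr; apply: koszul_relD => //.
  have -> : (u * v) *: (a ord0 *: p ord0) = (u * a ord0) *: (v *: p ord0) by rewrite !scalerA mulrAC.
  exact: koszul_relZ.
by rewrite mulrC -scalerA; apply: koszul_relZ => //; exact: hu.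
Qed.

(** [A] is a change of generators invertible at [q], with inverse [A'] up to the multiplier [v]. The
    alternating matrix of a relation is transported by congruence with [A']. *)
Lemma good_change I q r (g g' : 'cV[D]_r) (A A' : 'M[D]_r) u v : is_ideal I -> prime_ideal q ->
  isgood I q g -> Imx q g' -> ~ q u -> ~ q v ->
  Imx I (u *: g' - A *m g) -> A' *m A = v%:M -> A *m A' = v%:M -> isgood I q g'.
Proof.
move=> iI pq0 [gin gen rel] g'in qu qv hA AA' A'A; have [iq q1 pq] := pq0.
have qM x y : ~ q x -> ~ q y -> ~ q (x * y) by move=> hx hy /pq[].
have vg : Imx I (v *: g - A' *m (u *: g')).
  have -> : v *: g - A' *m (u *: g') = - (A' *m (u *: g' - A *m g)).
    by rewrite mulmxBr mulmxA AA' mul_scalar_mx opprB.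
  by apply: ImxN => //; exact: ImxMr.
split=> //.
  move=> x /gen[w qw [c hc]]; exists (v * w); first exact: qM.
  exists (u *: (c *m A')).
  have -> : (v * w * x)%:M - u *: (c *m A') *m g' =
    v *: ((w * x)%:M - c *m g) + c *m (v *: g - A' *m (u *: g')).
    rewrite scalerBr mulmxBr mulmxA -!scalemxAl -!scalemxAr scale_scalar_mx mulrA.
    by rewrite addrA subrK.
  by apply: ImxD => //; [exact: ImxZ|exact: ImxMr].
move=> p hp; have [|u1 qu1 [E hE]] := rel (p *m A).
  rewrite -mulmxA (_ : A *m g = u *: g' - (u *: g' - A *m g)); last by rewrite opprB addrC subrK.
  by rewrite mulmxBr; apply: ImxB => //; [rewrite -scalemxAr; exact: ImxZ|exact: ImxMr].
exists (u1 * v * v); first exact: (qM _ _ (qM _ _ qu1 qv) qv).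
exists (u *: (A'^T *m E *m A')).
have := ImxD iI (ImxZ iI v (ImxMl iI A' hE)) (ImxMl iI ((E - E^T) *m A') (Imx_tr vg)); congr Imx.
have -> : (v *: g - A' *m (u *: g'))^T = v *: g^T - u *: (g'^T *m A'^T).
  by rewrite linearB linearZ /= trmx_mul linearZ /= -scalemxAl.
have -> : u *: (A'^T *m E *m A') - (u *: (A'^T *m E *m A'))^T = u *: (A'^T *m (E - E^T) *m A').
  by rewrite linearZ /= !trmx_mul trmxK mulmxA -scalerBr -mulmxBl -mulmxBr.
set K := E - E^T.
have e1 : (u1 *: (p *m A) - g^T *m K) *m A' = (u1 * v) *: p - g^T *m K *m A'.
  by rewrite mulmxBl -scalemxAl -(mulmxA p) A'A mul_mx_scalar scalerA.
have e2 : (v *: g^T - u *: (g'^T *m A'^T)) *m (K *m A') =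
    v *: (g^T *m K *m A') - g'^T *m (u *: (A'^T *m K *m A')).
  by rewrite mulmxBl -!scalemxAl -scalemxAr !mulmxA.
by rewrite e1 e2 scalerBr scalerA addrA subrK mulrC.
Qed.

(** The matrix [u%:M + e *m d] is [u] times the identity with row [i0] replaced by [a]. Since
    [(e d)^2] is a multiple of [e d], the matrix [a_i0 - e d] is an inverse up to the factor
    [u * a_i0]. *)
Lemma good_exchange I q r (g : 'cV[D]_r) w u (a : 'rV_r) i0 : is_ideal I -> prime_ideal q ->
  isgood I q g -> q w -> ~ q u -> Imx I ((u * w)%:M - a *m g) -> ~ q (a 0 i0) ->
  isgood I q (\col_i if i == i0 then w else g i 0).
Proof.
move=> iI pq0 gg qw qu ha qa; have [iq q1 pq] := pq0.
pose e : 'cV[D]_r := delta_mx i0 0; pose e0 : 'rV[D]_r := delta_mx 0 i0.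
have e0e : e0 *m e = 1%:M by rewrite mul_delta_mx; apply/matrixP => i j; rewrite !ord1 !mxE !eqxx.
pose d := a - u *: e0.
have de : d *m e = (a 0 i0 - u)%:M.
  rewrite mulmxBl -scalemxAl e0e scalemx1 raddfB /=; congr (_ - _).
  by apply/matrixP => i j; rewrite !ord1 -colE !mxE eqxx mulr1n.
have dE : d = a - u *: e0 by [].
move: d de dE => d de dE.
have dd : (e *m d) *m (e *m d) = (a 0 i0 - u) *: (e *m d).
  by rewrite -mulmxA (mulmxA d) de mul_scalar_mx scalemxAr.
apply: (@good_change I q r g _ (u%:M + e *m d) ((a 0 i0)%:M - e *m d) u (u * a 0 i0)) => //.
- by move=> i j; rewrite ord1 mxE; case: ifP => // _; exact: (good_in gg).
- by move=> /pq[].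
- have -> : u *: (\col_i if i == i0 then w else g i 0) - (u%:M + e *m d) *m g =
      e *m ((u * w)%:M - a *m g).
    have -> : (\col_i if i == i0 then w else g i 0) = g + e *m (w%:M - e0 *m g).
      have -> : w%:M - e0 *m g = (w - g i0 0)%:M.
        by rewrite raddfB /=; congr (_ - _); apply/matrixP => i j; rewrite !ord1 -rowE !mxE eqxx.
      apply/matrixP => i j; rewrite ord1 mul_mx_scalar !mxE eqxx andbT.
      by case: eqP => [->|_]; rewrite ?mulr1 ?mulr0 ?addr0 // addrC subrK.
    rewrite mulmxDl mul_scalar_mx scalerDr opprD addrACA subrr add0r -mulmxA.
    rewrite dE mulmxBl scalemxAr scalerBr scale_scalar_mx -mulmxBr -scalemxAl.
    by rewrite opprB addrA subrK.
  exact: ImxMr.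
- rewrite mulmxBl !mulmxDr !mul_scalar_mx mul_mx_scalar scale_scalar_mx dd -scalerDl.
  by rewrite [u + (_ - _)]addrC subrK addrK mulrC.
- rewrite mulmxBr !mulmxDl !mul_scalar_mx mul_mx_scalar scale_scalar_mx dd -scalerDl.
  by rewrite [u + (_ - _)]addrC subrK addrK.
Qed.

Lemma sum_fiber (T : finType) (P : pred T) n (jj : T -> nat) (F : T -> D) (w : nat -> D) :
  (forall i, P i -> (jj i < n)%N) ->
  \sum_(i | P i) F i * w (jj i) = \sum_(j < n) (\sum_(i | P i && (jj i == j)) F i) * w j.
Proof.
move=> hj; rewrite [RHS](eq_bigr (fun j : 'I_n => \sum_(i | P i && (jj i == j)) F i * w j)); last first.
  by move=> j _; rewrite mulr_suml.
rewrite (exchange_big_dep P) //=; last by move=> ? ? _ /andP[].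
apply: eq_bigr => i Pi; rewrite (big_pred1 (Ordinal (hj i Pi))) // => j.
by rewrite Pi /= eq_sym.
Qed.

(** Steinitz exchange over the residue field of [q], where [U] is the set of places already taken.
    If the coefficients of [w k] at all free places were in [q], the [w j] would satisfy a relation
    modulo [Q2] whose coefficient at [w k] is [u], outside [q]. *)
Lemma good_extend I q Q2 r (g : 'cV[D]_r) n (w : nat -> D) : is_ideal I -> prime_ideal q ->
  is_ideal Q2 -> I `<=` Q2 -> (forall x y, q x -> q y -> Q2 (x * y)) ->
  isgood I q g -> (forall j, (j < n)%N -> q (w j)) ->
  (forall p : nat -> D, Q2 (\sum_(j < n) p j * w j) -> forall j, (j < n)%N -> q (p j)) ->
  exists2 g' : 'cV_r, isgood I q g' & forall j, (j < n)%N -> exists i, g' i 0 = w j.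
Proof.
move=> iI pq0 iQ2 IQ2 qq gg qw ind; have [iq q1 pq] := pq0.
suff H k : (k <= n)%N -> exists (g' : 'cV_r) (U : {set 'I_r}), [/\ isgood I q g',
    forall j, (j < k)%N -> exists2 i, i \in U & g' i 0 = w j
  & forall i, i \in U -> exists2 j, (j < k)%N & g' i 0 = w j].
  have [g' [U [gg' hU _]]] := H n (leqnn n); exists g' => // j /hU[i _ <-]; by exists i.
elim: k => [|k IH] kn; first by exists g, finset.set0; split=> // i; rewrite finset.in_set0.
have [g1 [U [gg1 U1 U2]]] := IH (ltnW kn).
have [u qu [a ha]] := good_gen gg1 (qw _ kn).
have /choice[jj hjj] i : exists j, i \in U -> (j < k)%N /\ g1 i 0 = w j.
  by case iU: (i \in U); [have [j ? ?] := U2 _ iU; exists j|exists 0%N].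
have [i0 i0U qa] : exists2 i0, i0 \notin U & ~ q (a 0 i0).
  apply: contrapT => no.
  have qaU i : i \notin U -> q (a 0 i).
    by move=> iU; apply: contrapT => qai; apply: no; exists i.
  pose p j := (if j == k then u else 0) - \sum_(i in U | jj i == j) a 0 i.
  have pk : p k = u.
    rewrite /p eqxx big_pred0 ?subr0 // => i; apply/negP => /andP[/hjj[+ _] /eqP]; lia.
  have /ind/(_ _ kn) : Q2 (\sum_(j < n) p j * w j); last by rewrite pk.
  have -> : \sum_(j < n) p j * w j = (u * w k - (a *m g1) 0 0) + \sum_(i | i \notin U) a 0 i * g1 i 0.
    rewrite mxE (bigID (mem U)) /= opprD addrA addrNK.
    rewrite (eq_bigr (fun i => a 0 i * w (jj i))); last by move=> i /hjj[_ ->].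
    have hU i : i \in U -> (jj i < n)%N by move=> /hjj[? _]; lia.
    rewrite (sum_fiber (a 0) w hU) (eq_bigr (fun j : 'I_n => (if j == k :> nat then u else 0) * w j -
      (\sum_(i in U | jj i == j) a 0 i) * w j)) => [|j _]; last by rewrite -mulrBl.
    rewrite sumrB; congr (_ - _); rewrite (bigD1 (Ordinal kn)) //= eqxx big1 ?addr0 // => j.
    by rewrite -val_eqE /= => /negbTE->; rewrite mul0r.
  apply: idealD => //; first by apply: IQ2; have := ha 0 0; rewrite mx11B.
  by apply: ideal_sum => // i /qaU ?; apply: qq => //; exact: (good_in gg1).
exists (\col_i if i == i0 then w k else g1 i 0), (i0 |: U); split.
- by apply: good_exchange ha qa => //; exact: qw.
- move=> j; rewrite ltnS leq_eqVlt => /orP[/eqP->|/U1[i iU <-]].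
    by exists i0; [exact: finset.setU11|rewrite mxE eqxx].
  exists i; first exact: finset.setU1r.
  by rewrite mxE; case: eqP i0U => // <-; rewrite iU.
- move=> i; rewrite finset.in_setU1 mxE; case: eqP => [_ _|_ /= /U2[j jk ->]]; first by exists k.
  by exists j => //; exact: ltnW.
Qed.

End MatrixCongruence.

Section PolyStep.
Variables (D : comNzRingType).
Implicit Types (I q : set D) (J : set {poly D}).

Definition pcoef I : set {poly D} := [set p | forall i, I p`_i].

Lemma pcoef_ideal I : is_ideal I -> is_ideal (pcoef I).
Proof.
move=> iI; apply: is_idealI.
- by move=> i; rewrite coef0; exact: ideal0.
- by move=> x y hx hy i; rewrite coefD; exact: idealD.
- by move=> a x hx i; rewrite coefM; apply: ideal_sum => // j _; exact: idealM.
Qed.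
Lemma pcoefC I c : is_ideal I -> pcoef I c%:P <-> I c.
Proof.
move=> iI; split=> [/(_ 0%N)|Ic i]; first by rewrite coefC.
by rewrite coefC; case: ifP => // _; exact: ideal0.
Qed.
Lemma pcoefS I I' : I `<=` I' -> pcoef I `<=` pcoef I'.
Proof. by move=> h p hp i; exact: h. Qed.

Lemma Imx_polyC I p r (A : 'M[D]_(p, r)) : is_ideal I -> Imx I A -> Imx (pcoef I) (map_mx polyC A).
Proof. by move=> iI hA i j; rewrite mxE; apply/pcoefC. Qed.

Lemma poly_sumX (p : {poly D}) : p = \sum_(i < size p) 'X^i * (p`_i)%:P.
Proof.
rewrite -[LHS]coefK poly_def; apply: eq_bigr => i _.
by rewrite mulrC mul_polyC.
Qed.

Variables (I q : set D) (q' : set {poly D}).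
Hypotheses (iI : is_ideal I) (pq : prime_ideal q) (pq' : prime_ideal q').
Hypotheses (Iq : I `<=` q) (q'C : forall c, q' c%:P <-> q c).
Variables (r : nat) (g : 'cV[D]_r).
Hypothesis gg : isgood I q g.
Let G := map_mx polyC g.
Let iq : is_ideal q. Proof. by case: pq. Qed.
Let iq' : is_ideal q'. Proof. by case: pq'. Qed.
Let iI' := pcoef_ideal iI.

Lemma pcoef_sub : pcoef q `<=` q'.
Proof.
move=> p hp; rewrite [p]poly_sumX; apply: ideal_sum => // i _.
by apply: idealM => //; apply/q'C.
Qed.

Lemma poly_gen : pcoef q `<=` sat q' (gens (pcoef I) G).
Proof.
move=> p hp; rewrite [p]poly_sumX; have sI := sat_ideal pq' (gens_ideal G iI').
apply: ideal_sum => // i _; apply: idealM => //.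
have [u qu [c hc]] := good_gen gg (hp i).
exists u%:P; first by move/q'C.
exists (map_mx polyC c); rewrite -map_mxM -polyCM.
have := Imx_polyC iI hc; rewrite map_mxB; congr (Imx _ (_ - _)).
by apply/matrixP => k l; rewrite !ord1 !mxE eqxx !mulr1n.
Qed.

Lemma poly_rel (p : 'rV_r) : Imx (pcoef I) (p *m G) ->
  exists2 u, ~ q' u & koszul_rel (pcoef I) G (u *: p).
Proof.
move=> hp; pose n := (\max_(j < r) size (p 0%R j))%N.
pose pk (k : 'I_n) : 'rV[{poly D}]_r := map_mx polyC (\row_j (p 0 j)`_k).
have -> : p = \sum_(k < n) 'X^k *: pk k.
  apply/matrixP => i j; rewrite ord1 summxE -[LHS]coefK poly_def.
  rewrite (big_ord_widen n (fun k => (p 0 j)`_k *: 'X^k)); last exact: leq_bigmax.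
  rewrite [LHS]big_mkcond; apply: eq_bigr => k _; rewrite !mxE /= mulrC mul_polyC.
  by case: ltnP => // /(nth_default 0)->; rewrite scale0r.
have hk k : exists2 u, ~ q' u & koszul_rel (pcoef I) G (u *: pk k).
  have [|u qu [E hE]] := good_rel gg (p := \row_j (p 0 j)`_k).
    move=> i j; rewrite !ord1; have := hp 0 0 k; congr I.
    rewrite mxE coef_sum mxE; apply: eq_bigr => l _.
    by rewrite !mxE coefMC.
  exists u%:P; first by move/q'C.
  exists (map_mx polyC E); have := Imx_polyC iI hE; congr Imx.
  by rewrite map_mxB map_mxM map_mxB !map_trmx map_mxZ.
have [u qu hu] := koszul_rel_sum iI' pq' hk.
by exists u => //; exact: hu.
Qed.

Lemma poly_good0 : q' `<=` pcoef q -> isgood (pcoef I) q' G.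
Proof.
move=> q'q; split; last exact: poly_rel.
  by move=> i j; rewrite mxE; apply/q'C; exact: (good_in gg).
by move=> p /q'q; exact: poly_gen.
Qed.

Lemma drop_lead (p : {poly D}) : p != 0 ->
  (size (p - (lead_coef p)%:P * 'X^((size p).-1))%R < size p)%N.
Proof.
move=> p0; have sp : (0 < size p)%N by rewrite size_poly_gt0.
rewrite -[X in (_ < X)%N](prednK sp) ltnS; apply/leq_sizeP => j hj.
rewrite coefB coefCM coefXn; case: eqP => [->|jn]; first by rewrite mulr1 subrr.
by rewrite mulr0 subr0 nth_default // -(prednK sp) ltn_neqAle hj andbT eq_sym; apply/eqP.
Qed.

Lemma pcoef_primeL h p : ~ q (lead_coef h) -> pcoef q (p * h) -> pcoef q p.
Proof.
move=> qh; elim: {p}(size p) {-2}p (leqnn (size p)) => [|n IH] p.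
  by rewrite leqn0 size_poly_eq0 => /eqP-> _ i; rewrite coef0; exact: ideal0.
move=> sp hp; case: (eqVneq p 0) => [->|p0]; first by move=> i; rewrite coef0; exact: ideal0.
have ql : q (lead_coef p).
  have := hp (size p + size h).-2; rewrite -mul_lead_coef.
  by case: pq => _ _ pr /pr[].
have hX : pcoef q ((lead_coef p)%:P * 'X^((size p).-1)).
  by move=> i; rewrite coefCM; exact: idealMr.
have : pcoef q (p - (lead_coef p)%:P * 'X^((size p).-1)).
  apply: IH; first by rewrite -ltnS; exact: leq_trans (drop_lead p0) sp.
  by rewrite mulrBl; apply: (idealB (pcoef_ideal iq) hp); exact: (idealMr _ (pcoef_ideal iq) hX).
by move/(ideal_subr (pcoef_ideal iq) hX).
Qed.

(** Over the residue field of [q] polynomials in one variable form a principal ideal domain, and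
    [h], of least degree, generates the prime there. Pseudo-division by [h] takes the place of
    division, its leading coefficient being outside [q]. *)
Lemma poly_good1 h : q' h -> ~ q (lead_coef h) ->
  (forall p, q' p -> (size p < size h)%N -> pcoef q p) ->
  isgood (pcoef I) q' (col_mx G (h%:M : 'M_1)).
Proof.
move=> q'h qh hmin; have [_ q'1 pr'] := pq'; have iJ := pcoef_ideal iq.
have qM' x y : ~ q' x -> ~ q' y -> ~ q' (x * y) by move=> hx hy /pr'[].
split.
- move=> i j; rewrite !ord1; case: (split_ordP i) => k ->; rewrite ?col_mxEu ?col_mxEd mxE.
    by apply/q'C; exact: (good_in gg).
  by rewrite !ord1 eqxx mulr1n.
- move=> x q'x; have := Pdiv.ComRing.rdivp_eq h x.
  set k := Pdiv.Ring.rscalp x h; set Q := Pdiv.Ring.rdivp x h; set rm := Pdiv.Ring.rmodp x h => E.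
  have qlk : ~ q' ((lead_coef h)%:P ^+ k).
    by elim: (k) => [|j IHj]; rewrite ?expr0 // exprS; apply: qM' => //; move/q'C.
  have h0 : h != 0.
    by apply: contra_notN qh => /eqP->; rewrite lead_coef0; exact: ideal0.
  have [u qu [c hc]] : sat q' (gens (pcoef I) G) rm.
    apply: poly_gen; apply: hmin; last by rewrite Pdiv.Ring.ltn_rmodp.
    have -> : rm = (lead_coef h ^+ k) *: x - Q * h by rewrite E addrC addKr.
    apply: idealB => //; last exact: idealM.
    by rewrite -mul_polyC; exact: idealM.
  exists (u * (lead_coef h)%:P ^+ k); first exact: qM'.
  exists (row_mx c ((u * Q)%:M)).
  have -> : u * (lead_coef h)%:P ^+ k * x = u * Q * h + u * rm.
    by rewrite -mulrA -polyC_exp mul_polyC E mulrDr mulrA.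
  rewrite mul_row_col mul_scalar_mx scale_scalar_mx raddfD /=.
  by rewrite [X in X - _]addrC [X in _ - X]addrC addrKA.
- move=> p; rewrite -(hsubmxK p); set p1 := lsubmx p; set p2 := rsubmx p.
  have e2 : p2 = (p2 0 0)%:M by apply/matrixP => i j; rewrite !ord1 [RHS]mxE eqxx mulr1n.
  rewrite e2; move: (p2 0 0) => s {e2 p2}; rewrite mul_row_col mul_scalar_mx scale_scalar_mx => hp.
  (* The coefficient [s] of [h] lies in the extension of [q], modulo which [h] is not a zero
     divisor. So [s] is a combination of [g] at [q'], and subtracting trivial relations between [h]
     and [g] leaves a relation on [g] alone. *)
  have qs : pcoef q s.
    apply: (@pcoef_primeL h) => //.
    have pG : pcoef q ((p1 *m G) 0 0).
      apply: (ImxMr iJ); apply: Imx_polyC => //; exact: (good_in gg).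
    apply: (ideal_addr iJ pG); rewrite addrC.
    have := hp 0 0; rewrite mxE [X in _ + X]mxE eqxx mulr1n; exact: (pcoefS Iq).
  have [u qu [c hc]] := poly_gen qs.
  have [|v qv [E hE]] := @poly_rel (u *: p1 + h *: c).
    rewrite mulmxDl -!scalemxAl.
    have := ImxB iI' (ImxZ iI' u hp) (ImxZ iI' h hc); congr Imx.
    rewrite scalerDr scalerBr !scale_scalar_mx opprB.
    have -> : h * (u * s) = u * (s * h) by ring.
    by rewrite addrA [X in X - _]addrAC addrK.
  exists (v * u); first exact: qM'.
  exists (block_mx E (v *: c^T) 0 0).
  rewrite tr_col_mx tr_scalar_mx tr_block_mx !trmx0 opp_block_mx add_block_mx mul_row_block.
  rewrite scale_row_mx opp_row_mx add_row_mx linearZ /= trmxK !oppr0 !addr0 add0r mulmx0 addr0.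
  rewrite scale_scalar_mx.
  have -> : G^T *m (v *: c^T) = v *: (c *m G).
    by rewrite -scalemxAr -trmx_mul; congr (_ *: _); apply/matrixP => i j; rewrite mxE !ord1.
  have h1 : Imx (pcoef I) ((v * u) *: p1 - (G^T *m (E - E^T) + h%:M *m (- (v *: c)))).
    move: hE; congr Imx; rewrite mul_scalar_mx scalerN opprD opprK addrA [RHS]addrAC; congr (_ - _).
    by rewrite scalerDr !scalerA [h * v]mulrC.
  have h2 : Imx (pcoef I) ((v * u * s)%:M - v *: (c *m G)).
    by move: (ImxZ iI' v hc); congr Imx; rewrite scalerBr scale_scalar_mx mulrA.
  by move=> i j; case: (split_ordP j) => k ->; rewrite ?row_mxEl ?row_mxEr.
Qed.

Lemma poly_good : exists r' (g' : 'cV_r'), isgood (pcoef I) q' g'.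
Proof.
case: (pselect (q' `<=` pcoef q)) => [q'q|/existsNP[h0 /not_implyP[q'h0 nh0]]].
  by exists r, G; exact: poly_good0.
pose P n := `[< exists h, [/\ q' h, ~ pcoef q h & size h = n] >].
have exP : exists n, P n by exists (size h0); apply/asboolP; exists h0.
case: (ex_minnP exP) => n /asboolP[h [q'h nh sh]] hmin.
have small p : q' p -> (size p < size h)%N -> pcoef q p.
  move=> q'p sp; apply: contrapT => np.
  by have : P (size p) by [apply/asboolP; exists p]; move/hmin; lia.
exists (r + 1)%N, (col_mx G (h%:M : 'M_1)); apply: poly_good1 => // ql; apply: nh.
case: (eqVneq h 0) => [->|hn0]; first by move=> i; rewrite coef0; exact: ideal0.
have hX : pcoef q ((lead_coef h)%:P * 'X^((size h).-1)).
  by move=> i; rewrite coefCM; exact: idealMr.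
apply: (ideal_subr (pcoef_ideal iq) hX); apply: small; last exact: drop_lead.
by apply: idealB => //; exact: pcoef_sub.
Qed.

End PolyStep.

Lemma ideal_pow_ideal (B : comPzRingType) (I : set B) N : is_ideal (ideal_pow I N).
Proof. by case: N => [|N]; [|exact: idl_ideal]. Qed.

(** The last power of [m] not contained in [K] provides [v]. *)
Lemma socle_ideal (A : comPzRingType) (m K : set A) N : is_ideal K -> ideal_pow m N `<=` K -> ~ K 1 ->
  exists2 v, ~ K v & forall a, m a -> K (a * v).
Proof.
move=> iK mK K1; elim: N mK => [|N IH] mK; first by case: K1; exact: mK.
case: (pselect (ideal_pow m N `<=` K)) => [//|/existsNP[v /not_implyP[hv Kv]]].
by exists v => // a ma; apply: mK; apply: sub_idl; exists a, v.
Qed.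

Section Tower.
Variables (A : comNzRingType) (T : eqType).
Implicit Types (J m : set A) (s : seq T).

(** The polynomial ring in variables named by the list [s], iterated so that the step from [D] to
    polynomials over [D] applies to one variable at a time. *)
Fixpoint tw s : comNzRingType := if s is _ :: s' then ({poly (tw s')} : comNzRingType) else A.

Fixpoint cst s : {rmorphism A -> tw s} :=
  match s return {rmorphism A -> tw s} with
  | [::] => (idfun : {rmorphism A -> A})
  | x :: s' => (polyC \o cst s' : {rmorphism A -> {poly (tw s')}})
  end.

Fixpoint ext s J : set (tw s) :=
  match s return set (tw s) with
  | [::] => J
  | x :: s' => pcoef (@ext s' J)
  end.

Arguments ext : clear implicits.

Lemma ext_ideal s J : is_ideal J -> is_ideal (ext s J).
Proof. by move=> iJ; elim: s => [|x s IH] //=; exact: pcoef_ideal. Qed.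
Lemma ext_cst s J c : is_ideal J -> J c -> ext s J (cst s c).
Proof. by move=> iJ Jc; elim: s => [|x s IH] //=; apply/pcoefC => //; exact: ext_ideal. Qed.
Lemma ext_min s J (K : set (tw s)) : is_ideal K -> (forall c, J c -> K (cst s c)) -> ext s J `<=` K.
Proof.
elim: s K => [|x s IH] K iK hK p hp; first exact: hK.
rewrite [p]poly_sumX; apply: ideal_sum => // i _; apply: idealM => //.
apply: (IH [set c | K c%:P]) => //; apply: is_idealI => /=; first by rewrite polyC0; exact: ideal0.
  by move=> a b Ka Kb; rewrite polyCD; exact: idealD.
by move=> a b Kb; rewrite polyCM; exact: idealM.
Qed.
Lemma ext_mono s J J' : J `<=` J' -> ext s J `<=` ext s J'.
Proof. by elim: s => [|x s IH] //= h; apply: pcoefS; exact: IH. Qed.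
Lemma ext_colon s J J' a : (forall b, J (a * b) -> J' b) ->
  forall y, ext s J (cst s a * y) -> ext s J' y.
Proof.
move=> h; elim: s => [|x s IH] y /=; first exact: h.
by move=> hy i; apply: IH; have := hy i; rewrite coefCM.
Qed.
Lemma ext_mul s J J' K : is_ideal K -> (forall a b, J a -> J' b -> K (a * b)) ->
  forall x y, ext s J x -> ext s J' y -> ext s K (x * y).
Proof.
move=> iK h x y hx hy; have iK' := ext_ideal s iK.
have icol z : is_ideal [set t | ext s K (z * t)].
  apply: is_idealI => /=; first by rewrite mulr0; exact: ideal0.
    by move=> a b ? ?; rewrite mulrDr; exact: idealD.
  by move=> a b ?; rewrite mulrCA; exact: idealM.
rewrite mulrC; move: x hx; apply: ext_min; first exact: icol.
move=> c Jc /=; rewrite mulrC; move: y hy; apply: ext_min; first exact: icol.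
by move=> d J'd /=; rewrite -rmorphM; apply: ext_cst => //; exact: h.
Qed.
Lemma ext_principal s J v p : is_ideal J ->
  ext s [set y | exists2 i, J i & exists a, y = i + a * v] p ->
  exists2 j, ext s J j & exists b, p = j + b * cst s v.
Proof.
move=> iJ; move: p; apply: ext_min.
  by apply: is_ideal_principal_add; exact: ext_ideal.
move=> _ [i Ji [a ->]]; exists (cst s i); first exact: ext_cst.
by exists (cst s a); rewrite rmorphD rmorphM.
Qed.

Lemma tower_good s m (q : set (tw s)) : is_ideal m -> prime_ideal q ->
  (forall c, q (cst s c) <-> m c) -> exists r (g : 'cV_r), isgood (ext s m) q g.
Proof.
move=> im; elim: s q => [|x s IH] q pq qm.
  exists 0%N, 0; split; first by move=> [].
    by move=> y /qm my; have [_ q1 _] := pq; apply: sub_sat => //; exact: sub_gens.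
  move=> p _; exists 1; first by case: pq.
  by exists 0 => i [].
pose q0 : set (tw s) := [set c | q c%:P].
have pq0 : prime_ideal q0.
  case: pq => iq q1 pr; split; rewrite /q0 /= ?polyC1 //.
    apply: is_idealI => /=; first by rewrite polyC0; exact: ideal0.
      by move=> a b ? ?; rewrite polyCD; exact: idealD.
    by move=> a b ?; rewrite polyCM; exact: idealM.
  by move=> a b; rewrite polyCM => /pr.
have [r [g gg]] := IH q0 pq0 qm.
have mq0 : ext s m `<=` q0 by apply: ext_min; [case: pq0|move=> c /qm].
by apply: (poly_good (ext_ideal s im) pq0 pq mq0 _ gg).
Qed.

Variables (m : set A).
Hypotheses (nA : noetherian_ring A) (mm : maximal_ideal m).
Variables (s : seq T) (q : set (tw s)).
Hypotheses (pq : prime_ideal q) (qm : forall c, q (cst s c) <-> m c).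
Let im : is_ideal m. Proof. by case: mm. Qed.
Let iq : is_ideal q. Proof. by case: pq. Qed.
Let q1 : ~ q 1. Proof. by case: pq. Qed.

Lemma ext_sub_q : ext s m `<=` q.
Proof. by apply: ext_min => // c /qm. Qed.

Lemma colon_maximal J v : is_ideal J -> ~ J v -> (forall a, m a -> J (a * v)) ->
  forall b, J (v * b) -> m b.
Proof.
move=> iJ Jv hm b Jb; case: mm => _ _ mx.
suff <- : [set c | J (v * c)] = m by [].
apply: mx => /=; rewrite ?mulr1 //; last by move=> a /hm /=; rewrite mulrC.
apply: is_idealI => /=; first by rewrite mulr0; exact: ideal0.
  by move=> x y ? ?; rewrite mulrDr; exact: idealD.
by move=> a x ?; rewrite mulrCA; exact: idealM.
Qed.

Section GoodTower.
Variables (r : nat) (g : 'cV[tw s]_r).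
Hypothesis gg : isgood (ext s m) q g.

(** With [B] the tower, this says that [J B] meets [(g)] in [J (g)] at [q], that is, [J] tensor
    [B / (g)] injects into [B / (g)]. The ideal [K] grows from [J] by socle elements [v]: the
    coefficient [b] of [v] is a trivial relation modulo [m], so up to a multiplier it may be
    replaced by [e] with entries in the extension of [m], and [v e] falls back into [K]. *)
Lemma rel_lift J N (c : 'rV_r) : is_ideal J -> ideal_pow m N `<=` J ->
  Imx (ext s J) (c *m g) ->
  exists2 u, ~ q u & exists2 c' : 'rV_r, Imx (ext s J) c' & u *: (c *m g) = c' *m g.
Proof.
move=> iJ mJ.
pose C K := forall c : 'rV_r, Imx (ext s K) c -> Imx (ext s J) (c *m g) ->
  exists2 u, ~ q u & exists2 c' : 'rV_r, Imx (ext s J) c' & u *: (c *m g) = c' *m g.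
have [||K [iK JK CK] Kmax] := noeth_ideal_max nA (F := [set K | [/\ is_ideal K, J `<=` K & C K]]).
- by move=> K [].
- by exists J; split=> // d hd _; exists 1 => //; exists d; rewrite ?scale1r.
case: (pselect (K 1)) => [K1|K1].
  apply: CK => i j; apply: ideal1; first exact: ext_ideal.
  by rewrite -(rmorph1 (cst s)); exact: ext_cst.
have [v Kv hv] := socle_ideal iK (subset_trans mJ JK) K1.
case: (Kv); pose K' := [set y | exists2 i, K i & exists a, y = i + a * v].
have KK' : K `<=` K' by move=> x Kx; exists x => //; exists 0; rewrite mul0r addr0.
apply: (Kmax K') => //; last by exists 0; [exact: ideal0|exists 1; rewrite mul1r add0r].
have iK' : is_ideal K' by exact: is_ideal_principal_add.
split=> //; first exact: subset_trans KK'.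
move=> d hd hdg.
have /choice[jb hjb] k : exists jb, ext s K jb.1 /\ d 0 k = jb.1 + jb.2 * cst s v.
  by have [j hj [b hb]] := ext_principal iK (hd 0 k); exists (j, b).
pose j := \row_k (jb k).1; pose b := \row_k (jb k).2.
have hj : Imx (ext s K) j by move=> i k; rewrite mxE; case: (hjb k).
have dE : d = j + cst s v *: b.
  by apply/rowP => k; rewrite !mxE; have [_ ->] := hjb k; rewrite mulrC.
have iKe := ext_ideal s iK.
have hbg : Imx (ext s m) (b *m g).
  move=> i k; apply: (ext_colon (colon_maximal iK Kv hv)).
  have : Imx (ext s K) (d *m g - j *m g).
    by apply: ImxB => //; [move=> ? ?; apply: (ext_mono JK); exact: hdg|exact: ImxMl].
  by move=> /(_ i k); rewrite -mulmxBl dE addrC addKr -scalemxAl mxE.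
have [u qu [E hE]] := good_rel gg hbg.
set e := _ - _ in hE.
have eg : e *m g = u *: (b *m g) by rewrite mulmxBl alt_form subr0 -scalemxAl.
have [||w qw [c' hc' Ec']] := CK (u *: j + cst s v *: e).
- apply: ImxD => //; first exact: ImxZ.
  move=> i k; rewrite mxE.
  apply: (ext_mul (s := s) (J := [set y | forall a, m a -> K (a * y)]) iK _ _ (hE i k)).
    by move=> y a hy /hy; rewrite mulrC.
  apply: ext_cst => //; apply: is_idealI => /=.
  - by move=> a _; rewrite mulr0; exact: ideal0.
  - by move=> x y hx hy a ma; rewrite mulrDr; apply: idealD; [|exact: hx|exact: hy].
  - by move=> a x hx a' ma'; rewrite mulrCA; apply: idealM => //; exact: hx.
- rewrite mulmxDl -!scalemxAl eg scalerA mulrC -scalerA -scalerDr scalemxAl -mulmxDl -dE.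
  by apply: ImxZ => //; exact: ext_ideal.
exists (w * u); first by case: pq => _ _ pr /pr[].
exists c' => //; rewrite -Ec' -scalerA; congr (_ *: _).
by rewrite dE !mulmxDl -!scalemxAl eg scalerDr !scalerA mulrC.
Qed.

Lemma pow_gens N : ideal_pow q N `<=` sat q (gens (ext s (ideal_pow m N)) g).
Proof.
have iG i : is_ideal (gens (ext s (ideal_pow m i)) g).
  by apply: gens_ideal; apply: ext_ideal; exact: ideal_pow_ideal.
elim: N => [|N IH] x.
  by move=> _; apply: sub_sat => //; apply: sub_gens; elim: (s) {x} (x : tw s) => //= *.
move: x; apply: idl_min; first by apply: sat_ideal.
move=> _ [x [y [/(good_gen gg)[u qu [c hc]] /IH[v qv [d hd]] ->]]].
exists (u * v); first by case: pq => _ _ pr /pr[].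
pose e := u * x - (c *m g) 0 0; pose e' := v * y - (d *m g) 0 0.
have gin (c0 : 'rV_r) i : gens (ext s (ideal_pow m i)) g ((c0 *m g) 0 0).
  rewrite mxE; apply: ideal_sum => // j _; apply: idealM => //; apply: in_gens.
  by apply: ext_ideal; exact: ideal_pow_ideal.
have -> : u * v * (x * y) = (c *m g) 0 0 * (v * y) + (e * (d *m g) 0 0 + e * e').
  by rewrite -mulrDr /e' [_ + (_ - _)]addrC subrK /e mulrBl mulrACA addrC subrK.
apply: idealD => //; first exact: idealMr.
apply: idealD => //; first exact: idealM.
apply: sub_gens; apply: (ext_mul (J := m) (J' := ideal_pow m N)).
- exact: ideal_pow_ideal.
- by move=> a b ma hb; apply: sub_idl; exists a, b.
- by have := hc 0 0; rewrite mx11B.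
- by have := hd 0 0; rewrite mx11B.
Qed.

(** At [q], a socle element [v] of [A / J] is killed modulo [(g)] only by [q]. Applied to [J + A v],
    [rel_lift] lets the congruence be divided by [v]: it becomes [w u p = b g] modulo the extension
    of [m], and [b g] lies in [q]. *)
Lemma good_nv J N v p : is_ideal J -> ideal_pow m N `<=` J -> ~ J v -> (forall a, m a -> J (a * v)) ->
  sat q (gens (ext s J) g) (cst s v * p) -> q p.
Proof.
move=> iJ mJ Jv hv [u qu [c hc]]; have iJe := ext_ideal s iJ.
pose J' := [set y | exists2 i, J i & exists a, y = i + a * v].
have JJ' : J `<=` J' by move=> x Jx; exists x => //; exists 0; rewrite mul0r addr0.
have iJ' : is_ideal J' by exact: is_ideal_principal_add.
have iJ'e := ext_ideal s iJ'.
have hcg : Imx (ext s J') (c *m g).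
  rewrite (_ : c *m g = (u * (cst s v * p))%:M - ((u * (cst s v * p))%:M - c *m g)).
    apply: ImxB => //; last exact: ImxS (@ext_mono _ _ _ JJ') hc.
    apply: Imx_scal => //; rewrite mulrCA; apply: idealMr => //; apply: ext_cst => //.
    by exists 0; [exact: ideal0|exists 1; rewrite mul1r add0r].
  by rewrite opprB addrC subrK.
have [w qw [c' hc' Ec]] := rel_lift iJ' (subset_trans mJ JJ') hcg.
have /choice[jb hjb] k : exists jb, ext s J jb.1 /\ c' 0 k = jb.1 + jb.2 * cst s v.
  by have [j hj [b hb]] := ext_principal iJ (hc' 0 k); exists (j, b).
pose j := \row_k (jb k).1; pose b := \row_k (jb k).2.
have hj : Imx (ext s J) j by move=> i k; rewrite mxE; case: (hjb k).
have cE : c' = j + cst s v *: b.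
  by apply/rowP => k; rewrite !mxE; have [_ ->] := hjb k; rewrite mulrC.
have hm : ext s m (w * u * p - (b *m g) 0 0).
  apply: (ext_colon (colon_maximal iJ Jv hv)).
  have : Imx (ext s J) (w *: ((u * (cst s v * p))%:M - c *m g) + j *m g).
    by apply: ImxD => //; [exact: ImxZ|exact: ImxMl].
  rewrite scalerBr Ec cE mulmxDl -scalemxAl scale_scalar_mx opprD addrA addrAC subrK.
  move=> /(_ 0 0); rewrite mx11B [X in _ - X]mxE; congr (ext s J _).
  by rewrite mulrBr; congr (_ - _); ring.
have : q (w * u * p).
  apply: (ideal_subr iq _ (ext_sub_q hm)); apply: (ImxMr iq); exact: (good_in gg).
by case: pq => _ _ pr /pr[/pr[]|].
Qed.

End GoodTower.

(** The exchange lemma makes the [w j] members of a good system, and [q^N] is absorbed because at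
    [q] it lies in the extension of [m^N] plus [(g)]. *)
Theorem tower_nv n (w : nat -> tw s) J N v p : (forall j, (j < n)%N -> q (w j)) ->
  (forall c : nat -> tw s, addm (R := tw s) (M := (tw s)^o) (ext s m) (ideal_pow q 2) (\sum_(j < n) c j * w j) ->
     forall j, (j < n)%N -> q (c j)) ->
  is_ideal J -> ideal_pow m N `<=` J -> ~ J v -> (forall a, m a -> J (a * v)) ->
  addm (R := tw s) (M := (tw s)^o) (ext s J) (addm (R := tw s) (M := (tw s)^o)
    (idl [set w j | j in [set j | (j < n)%N]]) (ideal_pow q N)) (cst s v * p) -> q p.
Proof.
move=> qw ind iJ mJ Jv hv hp; have [r0 [g0 gg0]] := tower_good im pq qm.
have iem := ext_ideal s im; have iq2 := ideal_pow_ideal q 2.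
have [||g gg hg] := good_extend iem pq (submodule_addm iem iq2) _ _ gg0 qw ind.
- exact: (addml iq2).
- move=> x y qx qy; apply: (addmr iem); apply: sub_idl; exists x, y; split=> //.
  by apply: sub_idl; exists y, 1; rewrite mulr1.
have iJe := ext_ideal s iJ; have iG := gens_ideal g iJe; have iS := sat_ideal pq iG.
apply: (good_nv gg iJ mJ Jv hv); move: (cst s v * p) hp.
apply: (addm_min iS) => [x hx|]; first by apply: sub_sat => //; exact: sub_gens.
apply: (addm_min iS).
  apply: idl_min => // _ [j jn <-]; have [i <-] := hg j jn.
  by apply: sub_sat => //; exact: in_gens.
move=> x /(pow_gens gg)[u qu [c hc]]; exists u => //; exists c.
exact: ImxS (ext_mono mJ) hc.
Qed.

End Tower.

(** * Presentations by free algebras *)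

(* Polynomial rings are only available over nonzero rings. *)
Lemma comNz_ind (P : comPzRingType -> Prop) :
  (forall S : comNzRingType, P S) -> forall S : comPzRingType, (1 : S) <> 0 -> P S.
Proof.
move=> h [S [a b c d e f g i j k l]] n1.
pose S0 : comPzRingType := GRing.ComPzRing.Pack (@GRing.ComPzRing.Class S a b c d e f g i j k l).
pose nz := GRing.PzSemiRing_isNonZero.Build S0 (introN eqP n1).
pose S1 : comNzRingType := HB.pack S S0 nz.
exact: (h S1).
Qed.

Section FreeAlgebra.
Variables (A : comNzRingType) (T : Type).

(** Syntax of polynomials in an arbitrary set of variables; the use made of it has one variable for
    each element of the target ring. *)
Inductive expr : Type :=
  | Con of A | Var of T | Add of expr & expr | Opp of expr | Mul of expr & expr.
HB.instance Definition _ := gen_eqMixin expr.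
HB.instance Definition _ := gen_choiceMixin expr.

Fixpoint evalx (B : comNzRingType) (phi : A -> B) (v : T -> B) (e : expr) : B :=
  match e with
  | Con a => phi a
  | Var t => v t
  | Add e f => evalx phi v e + evalx phi v f
  | Opp e => - evalx phi v e
  | Mul e f => evalx phi v e * evalx phi v f
  end.

(* Two expressions are identified when they agree under every evaluation; the ring axioms
   and the universal property are then immediate. *)
Definition expr_eqv : rel expr := fun e f => `[< forall (B : comNzRingType) (phi : {rmorphism A -> B}) v,
  evalx phi v e = evalx phi v f >].

Lemma expr_eqv_equiv : equiv_class_of expr_eqv.
Proof.
split=> [e|e f|f e g]; first exact/asboolP.
  by apply/asboolP/asboolP => h B phi v; rewrite h.
by move=> /asboolP h /asboolP h'; apply/asboolP => B phi v; rewrite h h'.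
Qed.
Canonical expr_eqv_rel := EquivRelPack expr_eqv_equiv.
Canonical expr_eqv_encModRel := defaultEncModRel expr_eqv.
Definition freealg : Type := {eq_quot expr_eqv}%qT.
HB.instance Definition _ : EqQuotient expr expr_eqv freealg := EqQuotient.on freealg.
HB.instance Definition _ := Choice.on freealg.

Definition fpi : expr -> freealg := \pi_freealg%qT.
Definition feval (B : comNzRingType) (phi : {rmorphism A -> B}) v (x : freealg) : B :=
  evalx phi v (repr x).

Lemma fpiP e f : fpi e = fpi f <->
  forall (B : comNzRingType) (phi : {rmorphism A -> B}) v, evalx phi v e = evalx phi v f.
Proof. by split=> [/eqmodP/asboolP|h] //; apply/eqmodP/asboolP. Qed.
Lemma fpi_repr (x : freealg) : fpi (repr x) = x. Proof. exact: reprK. Qed.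
Lemma feval_pi (B : comNzRingType) (phi : {rmorphism A -> B}) v e : feval phi v (fpi e) = evalx phi v e.
Proof. by apply: (fpiP (repr (fpi e)) e).1; rewrite fpi_repr. Qed.
Lemma freealgP x y : (forall (B : comNzRingType) (phi : {rmorphism A -> B}) v,
  feval phi v x = feval phi v y) -> x = y.
Proof. by move=> h; rewrite -(fpi_repr x) -(fpi_repr y); apply/fpiP. Qed.

Definition fadd (x y : freealg) := fpi (Add (repr x) (repr y)).
Definition fopp (x : freealg) := fpi (Opp (repr x)).
Definition fmul (x y : freealg) := fpi (Mul (repr x) (repr y)).

Let faddE (B : comNzRingType) (phi : {rmorphism A -> B}) v x y :
  feval phi v (fadd x y) = feval phi v x + feval phi v y.
Proof. by rewrite feval_pi. Qed.
Let foppE (B : comNzRingType) (phi : {rmorphism A -> B}) v x :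
  feval phi v (fopp x) = - feval phi v x.
Proof. by rewrite feval_pi. Qed.
Let fmulE (B : comNzRingType) (phi : {rmorphism A -> B}) v x y :
  feval phi v (fmul x y) = feval phi v x * feval phi v y.
Proof. by rewrite feval_pi. Qed.
Let fconE (B : comNzRingType) (phi : {rmorphism A -> B}) v a :
  feval phi v (fpi (Con a)) = phi a.
Proof. by rewrite feval_pi. Qed.

Let addA : associative fadd.
Proof. by move=> x y z; apply: freealgP => B p v; rewrite !faddE addrA. Qed.
Let addC : commutative fadd.
Proof. by move=> x y; apply: freealgP => B p v; rewrite !faddE addrC. Qed.
Let add0 : left_id (fpi (Con 0)) fadd.
Proof. by move=> x; apply: freealgP => B p v; rewrite faddE fconE rmorph0 add0r. Qed.
Let addN : left_inverse (fpi (Con 0)) fopp fadd.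
Proof. by move=> x; apply: freealgP => B p v; rewrite faddE foppE fconE rmorph0 addNr. Qed.
HB.instance Definition _ := GRing.isZmodule.Build freealg addA addC add0 addN.
Let mulA : associative fmul.
Proof. by move=> x y z; apply: freealgP => B p v; rewrite !fmulE mulrA. Qed.
Let mulC : commutative fmul.
Proof. by move=> x y; apply: freealgP => B p v; rewrite !fmulE mulrC. Qed.
Let mul1 : left_id (fpi (Con 1)) fmul.
Proof. by move=> x; apply: freealgP => B p v; rewrite fmulE fconE rmorph1 mul1r. Qed.
Let mulD : left_distributive fmul fadd.
Proof. by move=> x y z; apply: freealgP => B p v; rewrite !(fmulE, faddE) mulrDl. Qed.
Let one_neq0 : fpi (Con 1) != fpi (Con 0).
Proof.
apply/eqP => /fpiP/(_ A idfun (fun=> 0)) /= /eqP.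
by rewrite oner_eq0.
Qed.
HB.instance Definition _ := GRing.Zmodule_isComNzRing.Build freealg mulA mulC mul1 mulD one_neq0.

Definition fcon (a : A) : freealg := fpi (Con a).
Definition fvar (t : T) : freealg := fpi (Var t).
Let fcon_zmod : zmod_morphism fcon.
Proof.
move=> x y; apply: freealgP => B p v.
by rewrite [RHS]faddE foppE !fconE rmorphB.
Qed.
HB.instance Definition _ := GRing.isZmodMorphism.Build A freealg fcon fcon_zmod.
Let fcon_monoid : monoid_morphism fcon.
Proof. by split=> // x y; apply: freealgP => B p v; rewrite [RHS]fmulE !fconE rmorphM. Qed.
HB.instance Definition _ := GRing.isMonoidMorphism.Build A freealg fcon fcon_monoid.

Section Eval.
Variables (B : comNzRingType) (phi : {rmorphism A -> B}) (v : T -> B).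
Let feval_zmod : zmod_morphism (feval phi v).
Proof. by move=> x y; rewrite [LHS]faddE foppE. Qed.
HB.instance Definition _ := GRing.isZmodMorphism.Build freealg B (feval phi v) feval_zmod.
Let feval_monoid : monoid_morphism (feval phi v).
Proof. by split=> [|x y]; [rewrite [LHS]fconE rmorph1|rewrite [LHS]fmulE]. Qed.
HB.instance Definition _ := GRing.isMonoidMorphism.Build freealg B (feval phi v) feval_monoid.
Lemma feval_con a : feval phi v (fcon a) = phi a. Proof. exact: feval_pi. Qed.
Lemma feval_var t : feval phi v (fvar t) = v t. Proof. exact: feval_pi. Qed.
End Eval.

Lemma freealg_ind (K : set freealg) : (forall a, K (fcon a)) -> (forall t, K (fvar t)) ->
  (forall x y, K x -> K y -> K (x + y)) -> (forall x, K x -> K (- x)) ->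
  (forall x y, K x -> K y -> K (x * y)) -> forall x, K x.
Proof.
move=> hc hv hD hN hM x; rewrite -(fpi_repr x); elim: (repr x) => {x} [a|t|e he f hf|e he|e he f hf].
- exact: hc.
- exact: hv.
- rewrite (_ : fpi (Add e f) = fpi e + fpi f); first exact: hD.
  by apply: freealgP => B p v; rewrite [RHS]faddE !feval_pi.
- rewrite (_ : fpi (Opp e) = - fpi e); first exact: hN.
  by apply: freealgP => B p v; rewrite [RHS]foppE !feval_pi.
- rewrite (_ : fpi (Mul e f) = fpi e * fpi f); first exact: hM.
  by apply: freealgP => B p v; rewrite [RHS]fmulE !feval_pi.
Qed.

End FreeAlgebra.

Section TowerEval.
Variables (A : comNzRingType) (T : eqType).

(** A name outside [s] is sent to 0, which makes the map from the free algebra to a tower total. It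
    can be undone on a given element once [s] contains the names that occur in it. *)
Fixpoint var (s : seq T) (t : T) : tw A s :=
  match s return tw A s with
  | [::] => 0
  | x :: s' => if t == x then 'X else (var s' t)%:P
  end.

Lemma commr_all (D C : comNzRingType) (f : {rmorphism D -> C}) u : commr_rmorph f u.
Proof. by move=> x; exact: mulrC. Qed.

Variables (C : comNzRingType) (phi : {rmorphism A -> C}) (v : T -> C).

Fixpoint teval s : {rmorphism tw A s -> C} :=
  match s return {rmorphism tw A s -> C} with
  | [::] => phi
  | x :: s' => (horner_morph (commr_all (teval s') (v x)) : {rmorphism {poly tw A s'} -> C})
  end.

Lemma teval_cst s a : teval s (cst A s a) = phi a.
Proof. by elim: s => [|x s IH] //=; rewrite horner_morphC. Qed.
Lemma teval_var s t : t \in s -> teval s (var s t) = v t.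
Proof.
elim: s => [|x s IH] //=; rewrite in_cons; case: eqP => [->|_ /= /IH]; first by rewrite horner_morphX.
by rewrite horner_morphC.
Qed.
End TowerEval.

Lemma is_ideal_preim (D E : comPzRingType) (f : {rmorphism D -> E}) (I : set E) :
  is_ideal I -> is_ideal [set x | I (f x)].
Proof.
move=> iI; apply: is_idealI => /=; first by rewrite rmorph0; exact: ideal0.
  by move=> x y ? ?; rewrite rmorphD; exact: idealD.
by move=> a x ?; rewrite rmorphM; exact: idealM.
Qed.

Section Presentation.
Variables (A S : comNzRingType) (m : set A) (n : set S) (phi : {rmorphism A -> S}).
Hypotheses (nA : noetherian_ring A) (mm : maximal_ideal m) (ln : locr n).
Hypotheses (phim : forall a, m a -> n (phi a)) (phin : n `<=` idl (phi @` m)).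

Let P : comNzRingType := freealg A S.
Let C : {rmorphism A -> P} := @fcon A S.
Let X : S -> P := @fvar A S.
Let ev : {rmorphism P -> S} := feval phi id.
Let Q : set P := [set x | n (ev x)].
Let im : is_ideal m. Proof. by case: mm. Qed.
Let evC a : ev (C a) = phi a. Proof. exact: feval_con. Qed.
Let evX t : ev (X t) = t. Proof. exact: feval_var. Qed.

Let phimn c : n (phi c) <-> m c.
Proof.
split=> [nc|]; last exact: phim.
have [_ _ mx] := mm; have [iN n1 _] := ln.
rewrite -(mx [set a | n (phi a)]) //=; last by rewrite rmorph1.
apply: (is_ideal_preim phi iN).
Qed.

Let pQ : prime_ideal Q.
Proof.
have [iN n1 pn] := locr_prime ln; split; rewrite /Q /= ?rmorph1 //.
  apply: (is_ideal_preim ev iN).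
by move=> x y; rewrite rmorphM => /pn.
Qed.
Let iQ : is_ideal Q. Proof. by case: pQ. Qed.

Let mP : set P := idl (C @` m).
Let imP : is_ideal mP. Proof. exact: idl_ideal. Qed.
Let Q2 : set P := addm (R := P) (M := P^o) mP (ideal_pow Q 2).
Let iQ2 : is_ideal Q2. Proof. by apply: submodule_addm => //; exact: ideal_pow_ideal. Qed.
Let QQ x y : Q x -> Q y -> Q2 (x * y).
Proof.
move=> qx qy; apply: (addmr imP); apply: sub_idl; exists x, y; split=> //.
by apply: sub_idl; exists y, 1; rewrite mulr1.
Qed.

(** For elements of [Q] this is linear independence over the residue field [P / Q] in [Q / Q2]. *)
Definition indep (B : set P) := forall s : seq P, uniq s -> (forall b, b \in s -> B b) ->
  forall c : P -> P, Q2 (\sum_(b <- s) c b * b) -> forall b, b \in s -> Q (c b).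

Lemma maximal_indep : exists B : set P, [/\ (forall b, B b -> ev b = 0), indep B &
  forall w, ev w = 0 -> ~ B w -> ~ indep (B `|` [set w])].
Proof.
have [|B [[Bev Bind] Bmax]] := @Zorn_bigcup P [set B | (forall b, B b -> ev b = 0) /\ indep B].
- move=> F FP Ftot; split=> [b [B /FP[hB _] /hB] //|s us hs c hc b bs].
  have [B0 FB0 hB0] : exists2 B0, (exists2 b0, b0 \in s & F B0) & forall b, b \in s -> B0 b.
    elim: (s) (b) (bs) hs => [|b1 s1 IH] // b2 _ hs.
    have [B1 FB1 B1b] := hs b1 (mem_head _ _).
    case: s1 IH hs => [_ _|b3 s1 IH hs].
      by exists B1 => [|b']; [exists b1|rewrite mem_seq1 => /eqP->]; rewrite ?mem_head.
    have [|B2 [_ _ FB2] hB2] := IH b3 (mem_head _ _); first by move=> b' hb'; apply: hs; rewrite in_cons hb' orbT.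
    have [le|le] := Ftot _ _ FB1 FB2.
      exists B2; first by exists b1; rewrite ?mem_head.
      by move=> b'; rewrite in_cons => /orP[/eqP->|/hB2 //]; exact: le.
    exists B1; first by exists b1; rewrite ?mem_head.
    by move=> b'; rewrite in_cons => /orP[/eqP-> //|/hB2]; exact: le.
  by case: FB0 => b0 _ /FP[_ hB]; apply: (hB s us hB0 c hc).
exists B; split=> // w ew Bw h; apply: (Bmax (B `|` [set w])).
  by split=> [x Bx|/(_ w)]; [left|move=> /(_ (or_intror erefl))].
by split=> // b [/Bev //|->].
Qed.

(** By maximality a new element [w] of the kernel depends on [B] modulo [Q2], with a coefficient
    outside [Q]; an inverse of it modulo [Q] is the variable named by the inverse of its value. The
    rest of [Q] comes from [m], whose image generates [n]. *)
Lemma indep_generates (B : set P) : (forall b, B b -> ev b = 0) -> indep B ->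
  (forall w, ev w = 0 -> ~ B w -> ~ indep (B `|` [set w])) ->
  Q `<=` addm (R := P) (M := P^o) mP (addm (R := P) (M := P^o) (idl B) (ideal_pow Q 2)).
Proof.
move=> Bev Bind Bmax; set G := addm _ _.
have iQp := ideal_pow_ideal Q 2; have iBQ := submodule_addm (idl_ideal B) iQp.
have iG : is_ideal G by apply: submodule_addm.
have mG : mP `<=` G by exact: (addml iBQ).
have BG : idl B `<=` G by apply: subset_trans (addmr imP); exact: (addml iQp).
have Q2G : Q2 `<=` G.
  by apply: (addm_min iG) => //; apply: subset_trans (addmr imP); exact: (addmr (idl_ideal B)).
have kerG w : ev w = 0 -> G w.
  move=> ew; case: (pselect (B w)) => [Bw|Bw]; first by apply: BG; exact: sub_idl.
  have /existsNP[s /not_implyP[us /not_implyP[hs /existsNP[c /not_implyP[hc]]]]] := Bmax w ew Bw.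
  move=> /existsNP[b0 /not_implyP[b0s nQ]].
  have Qw : Q w by rewrite /Q /= ew; case: ln => iN _ _; exact: ideal0.
  have hrem b : b \in rem w s -> B b.
    by rewrite mem_rem_uniq // inE => /andP[/eqP bw /hs[|]].
  have ws : w \in s.
    apply: contrapT => ws; apply: nQ; apply: (Bind s us _ c hc) => // b bs.
    by case: (hs b bs) => // bw; case: ws; rewrite -bw.
  have sumE : \sum_(b <- s) c b * b = c w * w + \sum_(b <- rem w s) c b * b.
    by rewrite (perm_big _ (perm_to_rem ws)) big_cons.
  have nQw : ~ Q (c w).
    move=> Qcw; have h b : b \in rem w s -> Q (c b).
      apply: (Bind (rem w s) (rem_uniq _ us) hrem c).
      by apply: (ideal_addr iQ2 (QQ Qcw Qw)); rewrite addrC -sumE.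
    by move: b0s; rewrite (perm_mem (perm_to_rem ws)) in_cons => /orP[/eqP b0w|/h //]; apply: nQ; rewrite b0w.
  have [_ _ un] := ln; have [y cy] := un _ nQw.
  have Gc : G (c w * w).
    have hr : G (\sum_(b <- rem w s) c b * b).
      rewrite big_seq; apply: ideal_sum => // b /hrem Bb; apply: idealM => //.
      by apply: BG; exact: sub_idl.
    by apply: (ideal_addr iG hr); rewrite -sumE; exact: Q2G.
  have -> : w = X y * (c w * w) - (X y * c w - 1) * w by rewrite mulrBl mul1r mulrA opprB addrC subrK.
  apply: idealB => //; first exact: idealM.
  apply: Q2G; apply: QQ => //; rewrite /Q /= rmorphB rmorph1 rmorphM evX mulrC cy subrr.
  by case: ln => iN _ _; exact: ideal0.
move=> x Qx.
suff [y my exy] : exists2 y, mP y & ev y = ev x.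
  by rewrite -(subrK y x); apply: idealD => //; [apply: kerG; rewrite rmorphB exy subrr|exact: mG].
move: (phin Qx); move: (ev x) => z; apply: (idl_min (I := [set z | exists2 y, mP y & ev y = z])).
  apply: is_idealI => /=; first by exists 0; [exact: (ideal0 imP)|rewrite rmorph0].
    move=> _ _ [a ma <-] [b mb <-]; exists (a + b); [exact: (idealD imP)|exact: rmorphD].
  by move=> a _ [b mb <-]; exists (X a * b); [exact: (idealM _ imP)|rewrite rmorphM evX].
move=> _ [a ma <-]; exists (C a); last exact: evC.
by apply: sub_idl; exists a.
Qed.

(** The free algebra is the union of its towers: a finite computation takes place in every tower
    with enough variables. *)
Definition evl (Phi : seq S -> Prop) := exists s0 : seq S, forall s, {subset s0 <= s} -> Phi s.

Lemma evl_and Phi Psi : evl Phi -> evl Psi -> evl (fun s => Phi s /\ Psi s).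
Proof.
move=> [s1 h1] [s2 h2]; exists (s1 ++ s2) => s hs; split; [apply: h1|apply: h2] => x hx;
  by apply: hs; rewrite mem_cat hx ?orbT.
Qed.
Lemma evl_imp (Phi Psi : seq S -> Prop) : (forall s, Phi s -> Psi s) -> evl Phi -> evl Psi.
Proof. by move=> h [s0 hs]; exists s0 => s /hs/h. Qed.
Lemma evl_all (K : eqType) (w : seq K) (Phi : K -> seq S -> Prop) :
  (forall x, x \in w -> evl (Phi x)) -> evl (fun s => forall x, x \in w -> Phi x s).
Proof.
elim: w => [|x w IH] h; first by exists [::].
have h1 : evl (fun s => forall y, y \in w -> Phi y s).
  by apply: IH => y yw; apply: h; rewrite in_cons yw orbT.
apply: evl_imp (evl_and (h x (mem_head _ _)) h1) => s [h2 h3] y.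
by rewrite in_cons => /orP[/eqP->|/h3].
Qed.

(** [eta s] kills the variables outside [s], and [th s] maps the tower back to the free algebra. *)
Let eta s : {rmorphism P -> tw A s} := feval (cst A s) (var A s).
Let th s : {rmorphism tw A s -> P} := teval C X s.
Let q s : set (tw A s) := [set y | Q (th s y)].
Arguments q : clear implicits.
Let eC s a : eta s (C a) = cst A s a. Proof. exact: feval_con. Qed.
Let eX s t : eta s (X t) = var A s t. Proof. exact: feval_var. Qed.
Let tC s a : th s (cst A s a) = C a. Proof. exact: teval_cst. Qed.

Let th_eta x : evl (fun s => th s (eta s x) = x).
Proof.
move: x; apply: freealg_ind.
- by move=> a; exists [::] => s _; rewrite eC tC.
- by move=> t; exists [:: t] => s hs; rewrite eX; apply: teval_var; apply: hs; exact: mem_head.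
- by move=> x y hx hy; apply: evl_imp (evl_and hx hy) => s [ex ey]; rewrite !rmorphD ex ey.
- by move=> x; apply: evl_imp => s ex; rewrite !rmorphN ex.
- by move=> x y hx hy; apply: evl_imp (evl_and hx hy) => s [ex ey]; rewrite !rmorphM ex ey.
Qed.

Let pq s : prime_ideal (q s).
Proof.
have [_ q1 pr] := pQ; split; rewrite /q /= ?rmorph1 //.
  apply: (is_ideal_preim (th s) iQ).
by move=> x y; rewrite rmorphM => /pr.
Qed.
Let qm s c : q s (cst A s c) <-> m c.
Proof. by rewrite /q /= tC /Q /= evC phimn. Qed.

Let Qpow N x : ideal_pow Q N x -> evl (fun s => ideal_pow (q s) N (eta s x)).
Proof.
elim: N x => [|N IH] x; first by move=> _; exists [::].
move: x; apply: idl_min.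
  apply: is_idealI => /=.
  - by exists [::] => s _; rewrite rmorph0; exact: idl0.
  - move=> x y hx hy; apply: evl_imp (evl_and hx hy) => s [ex ey]; rewrite rmorphD.
    exact: idlD.
  - by move=> a x; apply: evl_imp => s ex; rewrite rmorphM; exact: idlM.
move=> _ [a [b [Qa /IH hb ->]]] /=; apply: evl_imp (evl_and (th_eta a) hb) => s [ea eb].
by rewrite rmorphM; apply: sub_idl; exists (eta s a), (eta s b); split=> //; rewrite /q /= ea.
Qed.

Let thpow s N y : ideal_pow (q s) N y -> ideal_pow Q N (th s y).
Proof.
elim: N y => [|N IH] y //; move: y; apply: (idl_min (I := [set y | ideal_pow Q N.+1 (th s y)])).
  apply: is_idealI => /=.
  - by rewrite rmorph0; exact: idl0.
  - by move=> x y hx hy; rewrite rmorphD; exact: idlD.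
  - by move=> a x ex; rewrite rmorphM; exact: idlM.
by move=> _ [a [b [Qa /IH hb ->]]] /=; rewrite rmorphM; apply: sub_idl; exists (th s a), (th s b).
Qed.

Lemma idl_set_fin (B : set P) x : idl B x ->
  exists w : seq P, [/\ uniq w, forall b, b \in w -> B b & idl [set` w] x].
Proof.
move: x; apply: (idl_min (I := [set x | exists w : seq P, [/\ uniq w, forall b, b \in w -> B b & idl [set` w] x]])).
  apply: is_idealI => /=.
  - by exists [::]; split=> //; exact: idl0.
  - move=> x y [w [uw hw hx]] [w' [uw' hw' hy]]; exists (undup (w ++ w')); split; first exact: undup_uniq.
      by move=> b; rewrite mem_undup mem_cat => /orP[/hw|/hw'].
    apply: idlD; [move: hx|move: hy]; apply: idl_mono => b /= bw; by rewrite mem_undup mem_cat bw ?orbT.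
  - by move=> a x [w [uw hw hx]]; exists w; split=> //; exact: idlM.
move=> b Bb; exists [:: b]; split=> //; first by move=> c; rewrite mem_seq1 => /eqP->.
by apply: sub_idl; rewrite /= mem_head.
Qed.

(** The hypothesis involves finitely many variables and finitely many members of [B], so it can be
    read in a single tower, where [tower_nv] applies. *)
Lemma presentation_nv (B : set P) J N v p : (forall b, B b -> ev b = 0) -> indep B ->
  is_ideal J -> ideal_pow m N `<=` J -> ~ J v -> (forall a, m a -> J (a * v)) ->
  addm (R := P) (M := P^o) (idl (C @` J)) (addm (R := P) (M := P^o) (idl B) (ideal_pow Q N)) (C v * p) ->
  Q p.
Proof.
move=> Bev Bind iJ mJ Jv hv [j hj [_ [b hb [x hx ->]] E]].
have [w [uw Bw {}hb]] := idl_set_fin hb.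
have [s0 /(_ s0 (fun _ h => h)) [[ep ex] ew]] := evl_and (evl_and (th_eta p) (Qpow hx))
  (evl_all (fun b (_ : b \in w) => th_eta b)).
set s := s0 in ep ex ew.
suff : q s (eta s p) by rewrite /q /= ep.
pose ws j := eta s (nth 0 w j).
have wsE k : (k < size w)%N -> th s (ws k) = nth 0 w k by move=> kw; apply: ew; exact: mem_nth.
apply: (tower_nv nA mm (pq s) (qm s) (n := size w) (w := ws) _ _ iJ mJ Jv hv).
- move=> k kw; rewrite /q /= wsE // /Q /= Bev; last by apply: Bw; exact: mem_nth.
  by case: ln => iN _ _; exact: ideal0.
- move=> c [e he [f hf Ef]] k kw.
  suff : Q2 (\sum_(b <- w) th s (c (index b w)) * b).
    move/(Bind w uw Bw (fun b => th s (c (index b w))))/(_ (nth 0 w k) (mem_nth _ kw)).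
    by rewrite index_uniq.
  have -> : \sum_(b <- w) th s (c (index b w)) * b = th s (\sum_(j < size w) c j * ws j).
    rewrite (big_nth 0) big_mkord rmorph_sum; apply: eq_bigr => i _.
    by rewrite rmorphM wsE // index_uniq.
  rewrite Ef; exists (th s e); last by exists (th s f); [exact: thpow|rewrite rmorphD].
  move: e he {Ef}; apply: ext_min => [|a ma /=].
    apply: (is_ideal_preim (th s) imP).
  by rewrite tC; apply: sub_idl; exists a.
- exists (eta s j).
    move: j hj {E}; apply: idl_min => [|_ [a Ja <-] /=]; last by rewrite eC; exact: ext_cst.
    have iJe := ext_ideal s iJ; apply: (is_ideal_preim (eta s) iJe).
  exists (eta s (b + x)); last by rewrite -eC -rmorphM E rmorphD.
  rewrite rmorphD; exists (eta s b); last by exists (eta s x).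
  have iW := idl_ideal [set ws j | j in [set j | (j < size w)%N]].
  move: b hb {E}; apply: idl_min => [|b /= bw].
    apply: (is_ideal_preim (eta s) iW).
  by apply: sub_idl; exists (index b w); rewrite /= ?index_mem // /ws nth_index.
Qed.

End Presentation.

(** * Hilbert's basis theorem *)

Section RelIdeal.
Variables (D : comPzRingType) (I : set D).
Hypothesis iI : is_ideal I.

Definition idlp (s : seq D) : set D := addm (R := D) (M := D^o) I (idl [set` s]).

Lemma idlp_ideal s : is_ideal (idlp s).
Proof. by apply: submodule_addm => //; exact: idl_ideal. Qed.
Lemma sub_idlp s : I `<=` idlp s.
Proof. exact: (addml (idl_ideal [set` s])). Qed.
Lemma mem_idlp s x : x \in s -> idlp s x.
Proof. by move=> xs; apply: (addmr iI); exact: sub_idl. Qed.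
Lemma idlp_min s J : is_ideal J -> I `<=` J -> (forall x, x \in s -> J x) -> idlp s `<=` J.
Proof. by move=> iJ IJ sJ; apply: (addm_min iJ) => //; exact: idl_min. Qed.
Lemma idlp_mono s s' : {subset s <= s'} -> idlp s `<=` idlp s'.
Proof.
move=> ss'; apply: idlp_min; [exact: idlp_ideal|exact: sub_idlp|].
by move=> x /ss'; exact: mem_idlp.
Qed.
Lemma idlpP s x : idlp s x <-> exists2 i, I i & exists c : nat -> D, x = i + \sum_(j < size s) c j * s`_j.
Proof.
split=> [[i Ii [w /idl_seqP[c ->] ->]]|[i Ii [c ->]]]; first by exists i => //; exists c.
by exists i => //; exists (\sum_(j < size s) c j * s`_j) => //; apply/idl_seqP; exists c.
Qed.

(** Noetherianity of [D / I] expressed in [D]. The basis theorem will be applied over a complete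
    ring that, at that stage, is known to be noetherian only modulo its maximal ideal. *)
Definition noeth_over := forall K : set D, is_ideal K -> I `<=` K ->
  exists s : seq D, (forall x, x \in s -> K x) /\ K `<=` idlp s.

Lemma mkseq_sub (c : nat -> D) k k' : (k <= k')%N -> {subset mkseq c k <= mkseq c k'}.
Proof. by move=> kk' _ /mapP[i + ->]; rewrite !mem_iota => ?; apply: map_f; rewrite mem_iota; lia. Qed.

Lemma noeth_over_seq (c : nat -> D) : noeth_over -> exists k, idlp (mkseq c k) (c k).
Proof.
move=> nI; pose K x := exists k, idlp (mkseq c k) x.
have mono k k' : (k <= k')%N -> idlp (mkseq c k) `<=` idlp (mkseq c k').
  by move=> kk'; apply: idlp_mono; exact: mkseq_sub.
have iK : is_ideal K.
  apply: is_idealI; first by exists 0%N; exact: (ideal0 (idlp_ideal _)).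
    move=> a b [k ha] [k' hb]; exists (maxn k k'); apply: (idealD (idlp_ideal _)).
      by apply: mono ha; exact: leq_maxl.
    by apply: mono hb; exact: leq_maxr.
  by move=> a b [k hb]; exists k; exact: (idealM _ (idlp_ideal _)).
have Kc k : K (c k).
  by exists k.+1; apply: mem_idlp; apply: map_f; rewrite mem_iota /=; lia.
have [|s [sK Ks]] := nI K iK; first by move=> i Ii; exists 0%N; exact: sub_idlp.
have [k hk] : exists k, forall x, x \in s -> idlp (mkseq c k) x.
  elim: s sK {Ks} => [|x s IH] sK; first by exists 0%N.
  have [k hk] := sK x (mem_head _ _).
  have [|k' hk'] := IH; first by move=> y ys; apply: sK; rewrite in_cons ys orbT.
  exists (maxn k k') => y; rewrite in_cons => /orP[/eqP->|/hk' h].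
    by apply: mono hk; exact: leq_maxl.
  by apply: mono h; exact: leq_maxr.
exists k; apply: (idlp_min (idlp_ideal _) _ hk (Ks _ (Kc k))); exact: sub_idlp.
Qed.

End RelIdeal.

Section Hilbert.
Variables (D : comNzRingType) (I : set D).
Hypotheses (iI : is_ideal I) (nI : noeth_over I).

(** Each [f k] has least degree among the elements of [K] outside the ideal of its predecessors.
    Once a leading coefficient depends on the earlier ones modulo [I], subtracting the corresponding
    combination [g] lowers the degree, a contradiction. *)
Theorem hilbert_basis : noeth_over (pcoef I).
Proof.
move=> K iK IK; apply: contrapT => nfg.
have iI' := pcoef_ideal iI.
pose G s := idlp (pcoef I) s.
have iG s : is_ideal (G s) by exact: idlp_ideal.
pose Q s f := ((forall x, x \in s -> K x) ->
  [/\ K f, ~ G s f & forall p, K p -> ~ G s p -> (size (f : {poly D}) <= size p)%N]).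
have [f hf] : exists u : nat -> {poly D}, forall n, Q (mkseq u n) (u n).
  apply: prefix_choice => s; case: (pselect (forall x, x \in s -> K x)) => [sK|nsK]; last by exists 0 => /nsK.
  have /existsNP[p0 /not_implyP[Kp0 Gp0]] : ~ (K `<=` G s).
    by move=> KG; apply: nfg; exists s.
  pose Pn n := `[< exists p, [/\ K p, ~ G s p & size p = n] >].
  have exP : exists n, Pn n by exists (size p0); apply/asboolP; exists p0.
  case: (ex_minnP exP) => n /asboolP[p [Kp Gp sp]] pmin.
  exists p => _; split=> // p' Kp' Gp'; rewrite sp; apply: pmin; apply/asboolP.
  by exists p'.
have fK n x : x \in mkseq f n -> K x.
  elim: n x => [|n IH] x // /mapP[i]; rewrite mem_iota => /andP[_ ile] ->.
  move: ile; rewrite add0n ltnS leq_eqVlt => /orP[/eqP->|lt]; first by case: (hf n IH).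
  by apply: IH; apply: map_f; rewrite mem_iota.
have {}hf n := hf n (@fK n).
have szle i j : (i <= j)%N -> (size (f i) <= size (f j))%N.
  move=> ij; have [_ _ mi] := hf i; have [Kj Gj _] := hf j; apply: mi => // h; apply: Gj.
  by apply: idlp_mono h => //; exact: mkseq_sub.
have [k /(idlpP I)[i Ii [u lE]]] := noeth_over_seq iI (fun j => lead_coef (f j)) nI.
have [Kk Gk mink] := hf k.
have fk0 : f k != 0 by apply/eqP => h; apply: Gk; rewrite h; exact: ideal0.
have sk : (0 < size (f k))%N by rewrite size_poly_gt0.
pose d := (size (f k)).-1.
pose g := i%:P * 'X^d + \sum_(j < k) (u j)%:P * 'X^(d - (size (f j)).-1) * f j.
have Gg : G (mkseq f k) g.
  apply: idealD => //; first by apply: sub_idlp => j; rewrite coefCM; exact: idealMr.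
  apply: ideal_sum => // j _; apply: idealM => //; apply: mem_idlp => //.
  by apply: map_f; rewrite mem_iota /=.
have GK : G (mkseq f k) `<=` K by apply: idlp_min => // x; exact: fK.
have : (size (f k) <= size (f k - g)%R)%N.
  apply: mink; first by apply: idealB => //; exact: GK.
  by move=> h; apply: Gk; exact: (ideal_subr (iG _) Gg h).
rewrite leqNgt => /negP; apply.
rewrite -[X in (_ < X)%N](prednK sk) ltnS; apply/leq_sizeP => j; rewrite -/d => dj.
have dfj (l : 'I_k) : ((size (f l)).-1 <= d)%N by rewrite /d; have := szle l k (ltnW (ltn_ord l)); lia.
have cj (l : 'I_k) : ((u l)%:P * 'X^(d - (size (f l)).-1) * f l)`_j = if j == d then u l * lead_coef (f l) else 0.
  rewrite -mulrA coefCM coefXnM /lead_coef; have := dfj l.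
  case: ltnP => [jl|jl] dl; first by rewrite mulr0; case: eqP => //; lia.
  case: eqP => [->|jd]; first by rewrite subKn.
  rewrite nth_default ?mulr0 //; apply: leq_trans (leqSpred _) _.
  by move: ((size (f l)).-1) (d) dl dj jd {jl} => a e; lia.
rewrite /g coefB coefD coefCM coefXn coef_sum (eq_bigr _ (fun l _ => cj l)).
case: (eqVneq j d) => [->|jd].
  rewrite mulr1 -/(lead_coef (f k)) lE size_mkseq.
  by apply/eqP; rewrite subr_eq0; apply/eqP; congr (_ + _); apply: eq_bigr => l _; rewrite nth_mkseq.
rewrite mulr0 big1 // addr0 subr0 nth_default //; apply: leq_trans (leqSpred _) _.
by rewrite ltn_neqAle eq_sym jd.
Qed.
End Hilbert.

Lemma noeth_over0 (D : comPzRingType) : noetherian_ring D <-> noeth_over [set (0 : D)].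
Proof.
have i0 : is_ideal [set (0 : D)] by apply: is_idealI => [|x y -> ->|a x ->] //=; rewrite ?addr0 ?mulr0.
split=> nD K iK.
  move=> _; have [s Ks] := nD K iK; exists s; split; first by move=> x xs; rewrite Ks; exact: sub_idl.
  by rewrite Ks; exact: (addmr i0).
have [|s [sK Ks]] := nD K iK; first by move=> _ ->; exact: ideal0.
exists s; apply/seteqP; split; last exact: idl_min.
by move=> x /Ks[_ -> [y hy ->]]; rewrite add0r.
Qed.

Lemma noeth_over_tw (A : comNzRingType) (T : eqType) (s : seq T) (I : set A) :
  is_ideal I -> noeth_over I -> noeth_over (@ext A T s I).
Proof.
move=> iI nI; elim: s => [|x s IH] //=.
by apply: hilbert_basis => //; exact: ext_ideal.
Qed.

Lemma noetherian_tw (A : comNzRingType) (T : eqType) (s : seq T) :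
  noetherian_ring A -> noetherian_ring (tw A s).
Proof.
move=> /noeth_over0 nA; apply/noeth_over0.
have -> : [set (0 : tw A s)] = @ext A T s [set 0].
  elim: s => [|x s IH] //=; rewrite -IH; apply/seteqP; split=> [_ -> i|p hp] /=; first by rewrite coef0.
  by apply/polyP => i; rewrite coef0; exact: hp.
by apply: noeth_over_tw => //; apply: is_idealI => [|x y -> ->|a x ->] //=; rewrite ?addr0 ?mulr0.
Qed.

(** * Complete local rings over a given local ring *)

Section QuotLift.
Variables (R S : comPzRingType) (A : set R) (f : {rmorphism R -> S}).
Hypothesis fA : forall a, A a -> f a = 0.

Lemma idl_ker x : idl A x -> f x = 0.
Proof.
have i0 : is_ideal [set y : S | y = 0].
  by apply: is_idealI => [|y z /= -> ->|a y /= ->] //=; rewrite ?addr0 ?mulr0.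
by move: x; apply: idl_min => //; exact: (is_ideal_preim f i0).
Qed.

Definition quot_liftf (_ : forall a, A a -> f a = 0) (u : quot_ring A) : S := f (repr u).

Lemma quot_liftfE x : quot_liftf fA (quot_pi A x) = f x.
Proof. by apply/eqP; rewrite -subr_eq0 -rmorphB; apply/eqP; apply: idl_ker; exact: idl_repr. Qed.

Let liftf_zmod : zmod_morphism (quot_liftf fA).
Proof.
move=> u v; have [x <-] := quot_pi_surj u; have [y <-] := quot_pi_surj v.
by rewrite -rmorphB !quot_liftfE rmorphB.
Qed.
HB.instance Definition _ := GRing.isZmodMorphism.Build (quot_ring A) S (quot_liftf fA) liftf_zmod.
Let liftf_monoid : monoid_morphism (quot_liftf fA).
Proof.
split=> [|u v]; first by rewrite -(rmorph1 (quot_pi A)) quot_liftfE rmorph1.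
have [x <-] := quot_pi_surj u; have [y <-] := quot_pi_surj v.
by rewrite -rmorphM !quot_liftfE rmorphM.
Qed.
HB.instance Definition _ := GRing.isMonoidMorphism.Build (quot_ring A) S (quot_liftf fA) liftf_monoid.

Lemma quot_lift : exists g : {rmorphism quot_ring A -> S}, forall x, g (quot_pi A x) = f x.
Proof. by exists (quot_liftf fA) => x; exact: quot_liftfE. Qed.
End QuotLift.

Lemma idl_image (P T : comPzRingType) (f : {rmorphism P -> T}) (fs : forall t, exists p, f p = t)
  (X : set T) (Y : set P) t : (forall x, X x -> exists2 y, idl Y y & f y = x) -> idl X t -> exists2 y, idl Y y & f y = t.
Proof.
move=> h; move: t; apply: (idl_min (I := [set t | exists2 y, idl Y y & f y = t])); last exact: h.
apply: is_idealI.
- by exists 0; [exact: idl0|rewrite rmorph0].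
- by move=> _ _ [a ha <-] [b hb <-]; exists (a + b); [exact: idlD|rewrite rmorphD].
- by move=> u _ [b hb <-]; have [p <-] := fs u; exists (p * b); [exact: idlM|rewrite rmorphM].
Qed.

Lemma idl_push (P T : comPzRingType) (f : {rmorphism P -> T}) (X : set P) (Y : set T) t :
  (forall x, X x -> idl Y (f x)) -> idl X t -> idl Y (f t).
Proof. by move=> h; move: t; apply: idl_min => //; exact: (is_ideal_preim f (idl_ideal Y)). Qed.

Lemma pow_image (P T : comPzRingType) (f : {rmorphism P -> T}) (fs : forall t, exists p, f p = t)
  (I : set T) N t : ideal_pow I N t -> exists2 y, ideal_pow [set x | I (f x)] N y & f y = t.
Proof.
elim: N t => [|N IH] t; first by move=> _; have [p <-] := fs t; exists p.
apply: idl_image => // _ [a [b [Ia /IH[y hy <-] ->]]]; have [p pa] := fs a.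
exists (p * y); last by rewrite rmorphM pa.
by apply: sub_idl; exists p, y; split=> //=; rewrite pa.
Qed.
Lemma pow_push (P T : comPzRingType) (f : {rmorphism P -> T}) (I : set P) (K : set T) N t :
  (forall x, I x -> K (f x)) -> ideal_pow I N t -> ideal_pow K N (f t).
Proof.
move=> h; elim: N t => [|N IH] t //; apply: idl_push => _ [a [b [Ia /IH hb ->]]].
by rewrite rmorphM; apply: sub_idl; exists (f a), (f b); split=> //; exact: h.
Qed.

Definition addi (D : comPzRingType) (I J : set D) : set D := addm (R := D) (M := D^o) I J.

(** [T] is the free algebra modulo a maximal independent family. Maximality makes [m] generate [I]
    modulo its square; independence gives the last clause, the germ of flatness: a socle element of
    [A / J] is killed only by elements of [I]. *)
Theorem cohen_presentation (A S : comNzRingType) (m : set A) (n : set S) (phi : {rmorphism A -> S}) :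
  noetherian_ring A -> maximal_ideal m -> locr n ->
  (forall a, m a -> n (phi a)) -> n `<=` idl (phi @` m) ->
  exists (T : comPzRingType) (cT : {rmorphism A -> T}) (eT : {rmorphism T -> S}),
  let I := [set t | n (eT t)] in
  [/\ forall a, eT (cT a) = phi a, forall s, exists t, eT t = s,
    I `<=` addi (idl (cT @` m)) (ideal_pow I 2)
  & forall J N v t, is_ideal J -> ideal_pow m N `<=` J -> ~ J v -> (forall a, m a -> J (a * v)) ->
    addi (idl (cT @` J)) (ideal_pow I N) (cT v * t) -> I t].
Proof.
move=> nA mm ln phim phin; have [B [Bev Bind Bmax]] := maximal_indep m n phi.
have gB := indep_generates ln phin Bev Bind Bmax.
pose pi := quot_pi B : {rmorphism _ -> _}.
have [eT eTE] := quot_lift Bev.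
exists (quot_ring B), (pi \o @fcon A S), eT => I.
have pis t : exists p, pi p = t by exact: quot_pi_surj.
have pi0 p : pi p = 0 -> idl B p by rewrite -(rmorph0 pi) => /quot_piP; rewrite subr0.
have QI : [set x | I (pi x)] = [set x | n (feval phi id x)].
  by apply/seteqP; split=> x; rewrite /I /= eTE.
have lift X p : addi (idl ((pi \o @fcon A S) @` X)) (ideal_pow I p) `<=`
    [set t | exists x, addi (idl (@fcon A S @` X)) (ideal_pow [set x | n (feval phi id x)] p) x /\ pi x = t].
  move=> _ [j hj [x /(pow_image pis)[y + <-] ->]]; rewrite QI => hy.
  have [|k hk <-] := @idl_image _ _ pi pis _ (@fcon A S @` X) _ _ hj.
    by move=> _ [a Xa <-]; exists (fcon S a) => //; apply: sub_idl; exists a.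
  by exists (k + y); split; [exists k => //; exists y|rewrite rmorphD].
split.
- by move=> a; rewrite (eTE (fcon S a)); exact: feval_con.
- by move=> s; exists (pi (fvar A s)); rewrite eTE; exact: feval_var.
- move=> t; have [x <-] := pis t; rewrite /I /= eTE => /gB[j hj [_ [b hb [y hy ->]] ->]].
  exists (pi j); first by apply: idl_push hj => _ [a ma <-]; apply: sub_idl; exists a.
  exists (pi y); first by apply: pow_push hy => z; rewrite /= eTE.
  rewrite !rmorphD; congr (_ + _); rewrite (_ : pi b = 0) ?add0r //.
  by rewrite -(rmorph0 pi); apply/quot_piP; rewrite subr0.
move=> J N v t iJ mJ Jv hv; have [p <-] := pis t.
rewrite (_ : _ * pi p = pi (fcon S v * p)); last by rewrite rmorphM.
move=> /lift[x [hx /eqP]]; rewrite eq_sym -subr_eq0 -rmorphB => /eqP/pi0 hb.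
suff : n (feval phi id p) by rewrite /I /= eTE.
apply: (presentation_nv nA mm ln phim Bev Bind iJ mJ Jv hv).
have [j hj [y hy E]] := hx; exists j => //; exists (fcon S v * p - x + y).
  by exists (fcon S v * p - x) => //; exists y.
by rewrite addrCA -E subrK.
Qed.

(** A complete separated filtration. It is kept abstract because, for a ring not yet known to be
    noetherian, the kernels of the projections of a completion may differ from the powers of its
    maximal ideal. *)
Record cfilt (R : comPzRingType) (V : nat -> set R) : Prop := Cfilt {
  cf_ideal : forall N, is_ideal (V N);
  cf0 : forall x, V 0%N x;
  cfS : forall N, V N.+1 `<=` V N;
  cfM : forall N M x y, V N x -> V M y -> V (N + M)%N (x * y);
  cf_sep : forall x, (forall N, V N x) -> x = 0;
  cf_lim : forall x : nat -> R, (forall k, V k (x k.+1 - x k)) -> exists y, forall k, V k (y - x k) }.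

Section PowLemmas.
Variables (D : comPzRingType) (I : set D).
Lemma ideal_powS N : is_ideal I -> ideal_pow I N.+1 `<=` ideal_pow I N.
Proof.
move=> iI; apply: idl_min; first exact: ideal_pow_ideal.
by move=> _ [a [b [Ia hb ->]]]; apply: idealM => //; exact: ideal_pow_ideal.
Qed.
Lemma ideal_pow_le N M : is_ideal I -> (N <= M)%N -> ideal_pow I M `<=` ideal_pow I N.
Proof.
move=> iI; elim: M => [|M IH]; first by rewrite leqn0 => /eqP->.
by rewrite leq_eqVlt => /orP[/eqP->//|/IH]; apply: subset_trans; exact: ideal_powS.
Qed.
Lemma ideal_powD N M x y : ideal_pow I N x -> ideal_pow I M y -> ideal_pow I (N + M) (x * y).
Proof.
elim: N x y => [|N IH] x y; first by move=> _ hy; apply: idealM => //; exact: ideal_pow_ideal.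
move=> hx hy; have iK := ideal_pow_ideal I (N + M).+1.
move: x hx; apply: (idl_min (I := [set x | ideal_pow I (N + M).+1 (x * y)])).
  apply: is_idealI => /=; first by rewrite mul0r; exact: (ideal0 iK).
    by move=> a b ? ?; rewrite mulrDl; exact: (idealD iK).
  by move=> a b ?; rewrite -mulrA; exact: (idealM _ iK).
move=> _ [a [b [Ia hb ->]]] /=; apply: sub_idl; exists a, (b * y); split=> //; last by rewrite mulrA.
exact: IH.
Qed.
Lemma ideal_pow1 : is_ideal I -> ideal_pow I 1 = I.
Proof.
move=> iI; apply/seteqP; split; last first.
  by move=> x Ix; apply: sub_idl; exists x, 1; rewrite mulr1.
by apply: idl_min => // _ [a [b [Ia _ ->]]]; exact: idealMr.
Qed.
Lemma idl_id N : idl (ideal_pow I N) = ideal_pow I N.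
Proof. exact: (@span_id D D^o _ (ideal_pow_ideal I N)). Qed.
End PowLemmas.

Lemma idl_imageM (A T : comPzRingType) (c : {rmorphism A -> T}) (J K L : set A) x y :
  (forall a b, J a -> K b -> L (a * b)) ->
  idl (c @` J) x -> idl (c @` K) y -> idl (c @` L) (x * y).
Proof.
move=> h hx hy; have icol z : is_ideal [set t | idl (c @` L) (z * t)].
  apply: is_idealI => /=; first by rewrite mulr0; exact: idl0.
    by move=> a b ? ?; rewrite mulrDr; exact: idlD.
  by move=> a b ?; rewrite mulrCA; exact: idlM.
rewrite mulrC; move: x hx; apply: idl_min; first exact: icol.
move=> _ [a Ja <-] /=; rewrite mulrC; move: y hy; apply: idl_min; first exact: icol.
by move=> _ [b Kb <-] /=; rewrite -rmorphM; apply: sub_idl; exists (a * b) => //; exact: h.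
Qed.

Section CompletionFacts.
Variables (T : comPzRingType) (I : set T).
Hypothesis iI : is_ideal I.
Let R' := completion I.

Definition cproj N (x : completion I) := compl_proj x N.
Arguments cproj : simpl never.
Let cproj_zmod N : zmod_morphism (cproj N). Proof. by []. Qed.
HB.instance Definition _ N := GRing.isZmodMorphism.Build (completion I) _ (cproj N) (cproj_zmod N).
Let cproj_monoid N : monoid_morphism (cproj N). Proof. by split. Qed.
HB.instance Definition _ N := GRing.isMonoidMorphism.Build (completion I) _ (cproj N) (cproj_monoid N).

Definition cV N : set (completion I) := [set x | cproj N x = 0].

Lemma quot_pi0 N t : quot_pi (ideal_pow I N) t = 0 <-> ideal_pow I N t.
Proof. by rewrite -(rmorph0 (quot_pi (ideal_pow I N))) quot_piP subr0 idl_id. Qed.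
Lemma cV_of N t : cV N (compl_of I t) <-> ideal_pow I N t.
Proof. exact: quot_pi0. Qed.

Lemma cV_ideal N : is_ideal (cV N).
Proof.
have i0 : is_ideal [set (0 : quot_ring (ideal_pow I N))].
  by apply: is_idealI => [|x y -> ->|a x ->] //=; rewrite ?addr0 ?mulr0.
exact: (is_ideal_preim (cproj N) i0).
Qed.

Lemma compl_approx (x : completion I) N : exists t, forall i, (i <= N)%N -> cV i (x - compl_of I t).
Proof.
have [t xt] := quot_pi_surj (cproj N x); exists t.
suff H k : (k <= N)%N -> cV (N - k) (x - compl_of I t).
  by move=> i iN; rewrite -(subKn iN); apply: H; exact: leq_subr.
elim: k => [|k IH] kN; first by rewrite subn0 /cV /= rmorphB /= -xt subrr.
have := IH (ltnW kN); rewrite (_ : (N - k = (N - k.+1).+1)%N); last lia.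
move: (N - k.+1)%N => i; rewrite /cV /= !rmorphB /= => /eqP; rewrite subr_eq0 => /eqP hi.
have [s [e1 e2]] := compl_coherent x i.
have e3 : quot_pi (ideal_pow I i.+1) s = quot_pi _ t by rewrite -e2; exact: hi.
have hs : ideal_pow I i (s - t).
  by apply: ideal_powS => //; move/quot_piP: e3; rewrite idl_id.
have e4 : quot_pi (ideal_pow I i) s = quot_pi _ t by apply/quot_piP; exact: sub_idl.
by apply/eqP; rewrite subr_eq0; apply/eqP; rewrite /cproj e1.
Qed.

Lemma cVS N : cV N.+1 `<=` cV N.
Proof.
move=> x hx; have [t ht] := compl_approx x N.+1.
have ht' : ideal_pow I N.+1 t.
  by apply/cV_of; rewrite -(subKr x (compl_of I t)); apply: (idealB (cV_ideal _)) => //; exact: ht.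
rewrite -(subrK (compl_of I t) x); apply: (idealD (cV_ideal _)); first exact: ht.
by apply/cV_of; exact: ideal_powS.
Qed.
Lemma cV_approx x N t : cV N x -> cV N (x - compl_of I t) -> ideal_pow I N t.
Proof.
by move=> hx ht; apply/cV_of; rewrite -(subKr x (compl_of I t)); apply: (idealB (cV_ideal _)).
Qed.

Lemma completion_cfilt : cfilt cV.
Proof.
split.
- exact: cV_ideal.
- move=> x; have [t xt] := quot_pi_surj (cproj 0 x); rewrite /cV /= -xt; exact: (quot_pi0 0 t).2.
- exact: cVS.
- move=> N M x y hx hy; have [t ht] := compl_approx x (N + M); have [u hu] := compl_approx y (N + M).
  have it := cV_approx hx (ht N (leq_addr _ _)); have iu := cV_approx hy (hu M (leq_addl _ _)).
  have iV := cV_ideal (N + M).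
  rewrite -(subrK (compl_of I (t * u)) (x * y)); apply: (idealD iV); last first.
    by apply/cV_of; exact: ideal_powD.
  rewrite rmorphM (_ : _ - _ = (x - compl_of I t) * y + compl_of I t * (y - compl_of I u)); last first.
    by rewrite mulrBl mulrBr addrA subrK.
  by apply: (idealD iV); [apply: (idealMr _ iV)|apply: (idealM _ iV)]; [exact: ht|exact: hu].
- by move=> x hx; apply: completionP => i; have := hx i.
- move=> x hx; have eqx i : cproj i (x i.+1) = cproj i (x i).
    by apply/eqP; rewrite -subr_eq0 -rmorphB; apply/eqP; exact: hx.
  have co : coherent (fun i => cproj i (x i)).
    move=> i; have [s [e1 e2]] := compl_coherent (x i.+1) i; exists s.
    by rewrite -[cproj i (x i)]eqx.
  by exists (Completion co) => k; rewrite /cV /= rmorphB /= {1}/cproj /= subrr.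
Qed.
End CompletionFacts.

(** [R'] is the completion of [T] along [I], and its map to [S] factors through [T / I^h] because
    [n^h = 0]. The properties of [T] pass to [R'] by approximating with elements of [T] one order
    further than the statement requires. *)
Theorem cohen_ring (A S : comNzRingType) (m : set A) (n : set S) (phi : {rmorphism A -> S}) h :
  noetherian_ring A -> maximal_ideal m -> locr n -> (forall u, ideal_pow n h u -> u = 0) ->
  (forall a, m a -> n (phi a)) -> n `<=` idl (phi @` m) ->
  exists (R' : comPzRingType) (V : nat -> set R') (c : {rmorphism A -> R'}) (g : {rmorphism R' -> S}),
  [/\ cfilt V, (forall a, g (c a) = phi a) /\ (forall s, exists x, g x = s),
    forall x, V 1%N x <-> n (g x),
    forall N, V N `<=` addi (idl (c @` ideal_pow m N)) (V N.+1)
  & forall J N v x, is_ideal J -> ideal_pow m N `<=` J -> ~ J v -> (forall a, m a -> J (a * v)) ->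
    idl (c @` J) (c v * x) -> V 1%N x].
Proof.
move=> nA mm ln nh phim phin.
have [T [cT [eT [eTc eTs gI NV]]]] := cohen_presentation nA mm ln phim phin.
set I := [set t | _] in gI NV.
have [iN n1 _] := ln; have im : is_ideal m by case: mm.
have iI : is_ideal I by exact: is_ideal_preim.
have Ih a : ideal_pow I h a -> eT a = 0 by move=> ha; apply: nh; exact: pow_push ha.
have [g0 g0E] := quot_lift Ih.
pose c : {rmorphism A -> completion I} := compl_of I \o cT.
pose g : {rmorphism completion I -> S} := g0 \o cproj (I := I) h.
have gof t : g (compl_of I t) = eT t by exact: g0E.
have Vg x : cV h x -> g x = 0 by rewrite /cV /= => e; rewrite /g /= e rmorph0.
have gV x t : cV h (x - compl_of I t) -> g x = eT t.
  by move/Vg; rewrite rmorphB gof => /eqP; rewrite subr_eq0 => /eqP.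
exists (completion I), (cV (I := I)), c, g; split.
- exact: completion_cfilt.
- split=> [a|s]; first by rewrite -(eTc a); exact: gof.
  by have [t <-] := eTs s; exists (compl_of I t); exact: gof.
- move=> x; have [t ht] := compl_approx iI x h.+1.
  rewrite (gV x t); last by apply: ht; exact: leqnSn.
  split=> [hx|nt].
    by have := cV_approx hx (ht 1%N isT); rewrite ideal_pow1.
  rewrite -(subrK (compl_of I t) x); apply: (idealD (cV_ideal _ _)); first exact: ht.
  by apply/cV_of; rewrite ideal_pow1.
- have gIN N : ideal_pow I N `<=` addi (idl (cT @` ideal_pow m N)) (ideal_pow I N.+1).
    have iK M L : is_ideal (addi (idl (cT @` ideal_pow m M)) (ideal_pow I L)).
      by apply: submodule_addm; [exact: idl_ideal|exact: ideal_pow_ideal].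
    elim: N => [|N IH].
      move=> x _; exists x; last by exists 0; [exact: (ideal0 (ideal_pow_ideal I 1))|rewrite addr0].
      by rewrite -[x]mulr1 -(rmorph1 cT); apply: idlM; apply: sub_idl; exists 1.
    apply: idl_min; first exact: (iK N.+1 N.+2).
    move=> _ [a [b [/gI[j hj [i hi ->]] hb ->]]].
    have Ij : I j by move: j hj; apply: idl_min => // _ [a' ma' <-]; rewrite /I /= eTc; exact: phim.
    rewrite mulrDl; apply: (idealD (iK _ _)); last first.
      by apply: (addmr (idl_ideal _)); exact: (ideal_powD hi hb).
    have [j' hj' [i' hi' ->]] := IH b hb; rewrite mulrDr; apply: (idealD (iK _ _)).
      apply: (addml (ideal_pow_ideal I N.+2)); apply: idl_imageM hj hj'.
      by move=> a' b' ma' hb'; apply: sub_idl; exists a', b'.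
    by apply: (addmr (idl_ideal _)); apply: sub_idl; exists j, i'.
  move=> N x hx; have [t ht] := compl_approx iI x N.+1.
  have [j hj [i hi tE]] := gIN N t (cV_approx hx (ht N (leqnSn N))).
  exists (compl_of I j).
    by apply: idl_push hj => _ [a ma <-]; apply: sub_idl; exists a.
  exists (x - compl_of I t + compl_of I i).
    by apply: (idealD (cV_ideal _ _)); [exact: ht|exact/cV_of].
  by rewrite addrCA -rmorphD -tE subrK.
- move=> J N v x iJ mJ Jv hv hx; have [t ht] := compl_approx iI x N.+1.
  have [j hj hxj] : exists2 j, idl (cT @` J) j & cV N.+1 (c v * x - compl_of I j).
    move: (c v * x) hx; apply: (idl_min (I := [set y | exists2 j, idl (cT @` J) j & cV N.+1 (y - compl_of I j)])).
      apply: is_idealI => /=.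
      - by exists 0; [exact: idl0|rewrite rmorph0 subr0; exact: (ideal0 (cV_ideal _ _))].
      - move=> a b [j hj ha] [k hk hb]; exists (j + k); first exact: idlD.
        by rewrite rmorphD opprD addrACA; exact: (idealD (cV_ideal _ _)).
      - move=> a b [k hk hb]; have [u hu] := compl_approx iI a N.+1; exists (u * k); first exact: idlM.
        rewrite rmorphM (_ : _ - _ = (a - compl_of I u) * b + compl_of I u * (b - compl_of I k)); last first.
          by rewrite mulrBl mulrBr addrA subrK.
        apply: (idealD (cV_ideal _ _)); last exact: (idealM _ (cV_ideal _ _)).
        by apply: (idealMr _ (cV_ideal _ _)); exact: hu.
    move=> _ [a Ja <-]; exists (cT a); first by apply: sub_idl; exists a.
    by rewrite /c /= subrr; exact: (ideal0 (cV_ideal _ _)).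
  have It : I t.
    apply: (NV J N.+1 v t iJ _ Jv hv); first exact: (subset_trans (ideal_powS im)).
    exists j => //; exists (cT v * t - j); last by rewrite addrC subrK.
    apply/cV_of; rewrite rmorphB rmorphM.
    have -> : compl_of I (cT v) * compl_of I t - compl_of I j =
        (c v * x - compl_of I j) - c v * (x - compl_of I t) by rewrite /c /=; ring.
    apply: (idealB (cV_ideal _ _)) => //; apply: (idealM _ (cV_ideal _ _)); exact: ht.
  rewrite -(subrK (compl_of I t) x); apply: (idealD (cV_ideal _ _)); first exact: ht.
  by apply/cV_of; rewrite ideal_pow1.
Qed.

(** * Rings complete for a filtration *)

Section CompleteFiltered.
Variables (R : comPzRingType) (V : nat -> set R).
Hypothesis cV : cfilt V.
Let iV := cf_ideal cV.

Lemma cf_le N M : (N <= M)%N -> V M `<=` V N.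
Proof.
elim: M => [|M IH]; first by rewrite leqn0 => /eqP->.
by rewrite leq_eqVlt => /orP[/eqP->//|/IH]; apply: subset_trans; exact: cfS.
Qed.

Lemma cf_unit x : V 1%N x -> exists y, (1 - x) * y = 1.
Proof.
move=> x1; have xk k : V k (x ^+ k).
  by elim: k => [|k IH]; [exact: cf0|rewrite exprS -add1n; exact: cfM].
have [|y hy] := cf_lim cV (x := fun k => \sum_(i < k) x ^+ i).
  by move=> k /=; rewrite big_ord_recr /= addrAC subrr add0r.
exists y; apply/eqP; rewrite -subr_eq0; apply/eqP; apply: (cf_sep cV) => k.
have -> : (1 - x) * y - 1 = (1 - x) * (y - \sum_(i < k) x ^+ i) - x ^+ k.
  have E : (1 - x) * (\sum_(i < k) x ^+ i) = 1 - x ^+ k by rewrite -opprB mulNr -subrX1 opprB.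
  by rewrite mulrBr E; ring.
by apply: idealB => //; exact: idealM.
Qed.

(** Successive approximation. The corrections at stage [N] lie in [V (N - k)], so their sums
    converge; the delay [k] allows for generators [f j] that lie deep in the filtration. *)
Lemma cf_solve (J : finType) (K : set R) (f : J -> R) k : is_ideal K -> (forall j, K (f j)) ->
  (forall N y, K y -> V N y ->
     exists2 h : J -> R, forall j, V (N - k)%N (h j) & V N.+1 (y - \sum_j f j * h j)) ->
  forall y, K y -> exists h : J -> R, y = \sum_j f j * h j.
Proof.
move=> iK Kf step y Ky.
have /choice[F hF] (Nz : nat * R) : exists h : J -> R, K Nz.2 -> V Nz.1 Nz.2 ->
    (forall j, V (Nz.1 - k)%N (h j)) /\ V Nz.1.+1 (Nz.2 - \sum_j f j * h j).
  case: (pselect (K Nz.2 /\ V Nz.1 Nz.2)) => [[h1 h2]|h]; last by exists (fun=> 0) => h1 h2; case: h.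
  by have [h ? ?] := step _ _ h1 h2; exists h.
pose rm := fix rm N := if N is N'.+1 then rm N' - \sum_j f j * F (N', rm N') j else y.
have Krm N : K (rm N).
  elim: N => [|N IH] //=; apply: idealB => //; apply: ideal_sum => // j _; exact: idealMr.
have Vrm N : V N (rm N).
  by elim: N => [|N IH] /=; [exact: cf0|have [_] := hF (N, rm N) (Krm N) IH].
have hd N j : V (N - k)%N (F (N, rm N) j) by have [] := hF (N, rm N) (Krm N) (Vrm N).
pose H N j := \sum_(i < N) F (i : nat, rm i) j.
have rmE N : rm N = y - \sum_j f j * H N j.
  elim: N => [|N IH] /=; first by rewrite /H big1 ?subr0 // => j _; rewrite big_ord0 mulr0.
  rewrite {1}IH -addrA -opprD -big_split /=; congr (_ - _); apply: eq_bigr => j _.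
  by rewrite -mulrDr /H big_ord_recr.
have /choice[z hz] j : exists z, forall i, V i (z - H (i + k)%N j).
  apply: (cf_lim cV) => i; rewrite addSn /H big_ord_recr /= addrAC subrr add0r.
  by have := hd (i + k)%N j; rewrite addnK.
exists z; apply/eqP; rewrite -subr_eq0; apply/eqP; apply: (cf_sep cV) => i.
have -> : y - \sum_j f j * z j = rm (i + k)%N - \sum_j f j * (z j - H (i + k)%N j).
  rewrite rmE -addrA -opprD -big_split /=; congr (_ - _); apply: eq_bigr => j _.
  by rewrite -mulrDr addrC subrK.
apply: idealB => //; first by apply: cf_le (Vrm _); exact: leq_addr.
by apply: ideal_sum => // j _; apply: idealM.
Qed.

Variables (A : comPzRingType) (m : set A) (c : {rmorphism A -> R}) (a : nat) (mu0 : 'I_a -> A).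
Hypotheses (mE : m = idl (range mu0)) (cm : forall x, m x -> V 1%N (c x)).
Hypothesis hV : forall N, V N `<=` addi (idl (c @` ideal_pow m N)) (V N.+1).

Lemma cf_pow N x : ideal_pow m N x -> V N (c x).
Proof.
elim: N x => [|N IH] x; first by move=> _; exact: cf0.
move: x; apply: idl_min; first exact: (is_ideal_preim c (iV N.+1)).
by move=> _ [x [y [mx /IH hy ->]]] /=; rewrite rmorphM -add1n; apply: (cfM cV) => //; exact: cm.
Qed.

Lemma cf_step N y : V N.+1 y ->
  exists2 h : 'I_a -> R, forall j, V N (h j) & V N.+2 (y - \sum_j c (mu0 j) * h j).
Proof.
move=> /hV[t ht [w hw ->]].
suff [h hh ->] : exists2 h : 'I_a -> R, forall j, V N (h j) & t = \sum_j c (mu0 j) * h j.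
  by exists h => //; rewrite addrC addKr.
move: t ht {w hw}; apply: (idl_min (I := [set t | exists2 h : 'I_a -> R, forall j, V N (h j) & t = \sum_j c (mu0 j) * h j])).
  apply: is_idealI.
  - by exists (fun=> 0) => [j|]; [exact: ideal0|rewrite big1 // => j _; rewrite mulr0].
  - move=> _ _ [h hh ->] [h' hh' ->]; exists (fun j => h j + h' j) => [j|]; first exact: idealD.
    by rewrite -big_split; apply: eq_bigr => j _; rewrite mulrDr.
  - move=> b _ [h hh ->]; exists (fun j => b * h j) => [j|]; first exact: idealM.
    by rewrite mulr_sumr; apply: eq_bigr => j _; rewrite mulrCA.
move=> _ [x hx <-]; move: x hx.
apply: (idl_min (I := [set x | exists2 h : 'I_a -> R, forall j, V N (h j) & c x = \sum_j c (mu0 j) * h j])).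
  apply: is_idealI => /=.
  - by exists (fun=> 0) => [j|]; [exact: ideal0|rewrite rmorph0 big1 // => j _; rewrite mulr0].
  - move=> x x' [h hh e] [h' hh' e']; exists (fun j => h j + h' j) => [j|]; first exact: idealD.
    by rewrite rmorphD e e' -big_split; apply: eq_bigr => j _; rewrite mulrDr.
  - move=> b x [h hh e]; exists (fun j => c b * h j) => [j|]; first exact: idealM.
    by rewrite rmorphM e mulr_sumr; apply: eq_bigr => j _; rewrite mulrCA.
move=> _ [x [y0 [mx hy ->]]] /=.
move: mx; rewrite mE => /(@spanP A A^o)[u ->].
exists (fun j => c (u j) * c y0) => [j|]; first by apply: idealM => //; exact: cf_pow.
rewrite rmorphM rmorph_sum mulr_suml; apply: eq_bigr => j _.
by rewrite (rmorphM c (u j)); ring.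
Qed.

Lemma cf_max_ideal : V 1%N = idl (c @` m).
Proof.
have mmu j : m (mu0 j) by rewrite mE; apply: sub_idl; exists j.
apply/seteqP; split; last by apply: idl_min => // _ [x mx <-]; exact: cm.
move=> y hy; have Kf j : V 1%N (c (mu0 j)) by exact: cm.
have st N z : V 1%N z -> V N z -> exists2 h : 'I_a -> R, forall j, V (N - 1)%N (h j) &
    V N.+1 (z - \sum_j c (mu0 j) * h j).
  case: N => [|N] z1 zN; last by have [h hh hz] := cf_step zN; exists h => // j; rewrite subn1.
  by have [h hh hz] := cf_step z1; exists h => //; exact: (cfS cV).
have [h ->] := cf_solve (iV 1) Kf st hy.
by apply: ideal_sum => [|j _]; [exact: idl_ideal|rewrite mulrC; apply: idlM; apply: sub_idl; exists (mu0 j)].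
Qed.
End CompleteFiltered.

Lemma teval_in (A C : comNzRingType) (T : eqType) (phi : {rmorphism A -> C}) (v : T -> C) (K : set C) :
  (forall b, K (phi b)) -> (forall t, K (v t)) -> (forall x y, K x -> K y -> K (x + y)) ->
  (forall x y, K x -> K y -> K (x * y)) -> forall s x, K (teval phi v s x).
Proof.
move=> hp hv hD hM; have K0 : K 0 by rewrite -(rmorph0 phi).
have K1 : K 1 by rewrite -(rmorph1 phi).
elim=> [|t s IH] x //; rewrite [x]poly_sumX rmorph_sum; apply: big_ind => // i _.
rewrite rmorphM rmorphXn /= horner_morphX horner_morphC; apply: (hM) => //.
by elim: (i : nat) => [|k IHk]; rewrite ?expr0 // exprS; exact: hM.
Qed.

Section CompleteNoetherian.
Variables (R : comNzRingType) (V : nat -> set R).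
Hypotheses (cV : cfilt V) (lV : locr (V 1%N)).
Variables (a : nat) (mu0 : 'I_a -> R).
Hypothesis mu1 : forall j, V 1%N (mu0 j).
Hypothesis step : forall N y, V N.+1 y ->
  exists2 h : 'I_a -> R, forall j, V N (h j) & V N.+2 (y - \sum_j mu0 j * h j).
Let iV := cf_ideal cV.
Let s := enum 'I_a.
(* [psi F] collects the values at [mu0] of the homogeneous parts of [F]. *)
Let psi : {rmorphism tw R s -> {poly R}} := teval polyC (fun j : 'I_a => (mu0 j)%:P * 'X) s.

Let psi_rees F N : V N (psi F)`_N.
Proof.
suff : [set p : {poly R} | forall N, V N p`_N] (psi F) by [].
apply: teval_in => /= {N F} [b|j|x y hx hy|x y hx hy] N.
- by rewrite coefC; case: eqP => [->|_]; [exact: cf0|exact: ideal0].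
- rewrite coefMX coefC; case: N => [|[|N]] /=; [exact: cf0|exact: mu1|exact: ideal0].
- by rewrite coefD; exact: idealD.
- rewrite coefM; apply: ideal_sum => // i _.
  by rewrite -{1}(subnKC (n := N) (m := i)); [exact: cfM|case: i => i /=; lia].
Qed.

Let psi_cst b : psi (cst R s b) = b%:P. Proof. exact: teval_cst. Qed.
Let psi_var j : psi (var R s j) = (mu0 j)%:P * 'X.
Proof. by apply: teval_var; rewrite mem_enum. Qed.

Let psi_filt (W : nat -> set R) : (forall N, is_ideal (W N)) ->
  (forall i N x y, V i x -> W N y -> W (i + N)%N (x * y)) ->
  is_ideal [set F | forall N, W N (psi F)`_N].
Proof.
move=> iW hW; apply: is_idealI => /=.
- by move=> N; rewrite rmorph0 coef0; exact: ideal0.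
- by move=> x y hx hy N; rewrite rmorphD coefD; exact: idealD.
move=> x y hy N; rewrite rmorphM coefM; apply: ideal_sum => // i _.
by rewrite -{1}(subnKC (n := N) (m := i)); [exact: hW|case: i => i /=; lia].
Qed.

Let psi_form N y : V N y -> exists2 F, forall k, k != N -> (psi F)`_k = 0 & V N.+1 (y - (psi F)`_N).
Proof.
elim: N y => [|N IH] y hy.
  exists (cst R s y) => [k k0|]; rewrite psi_cst coefC ?(negbTE k0) // subrr; exact: ideal0.
have [h hh hy'] := step hy.
have /choice[F hF] j : exists F, (forall k, k != N -> (psi F)`_k = 0) /\ V N.+1 (h j - (psi F)`_N).
  by have [F ? ?] := IH _ (hh j); exists F.
have E k : (psi (\sum_j var R s j * F j))`_k.+1 = \sum_j mu0 j * (psi (F j))`_k.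
  rewrite rmorph_sum coef_sum; apply: eq_bigr => j _.
  by rewrite rmorphM psi_var -mulrA coefCM mulrC coefXM /= mulrC.
exists (\sum_j var R s j * F j).
  case=> [_|k kN]; last by rewrite E big1 // => j _; have [h0 _] := hF j; rewrite (h0 k kN) mulr0.
  rewrite rmorph_sum coef_sum big1 // => j _.
  by rewrite rmorphM psi_var -mulrA coefCM coefXM mulr0.
rewrite E.
have -> : y - \sum_j mu0 j * (psi (F j))`_N =
    (y - \sum_j mu0 j * h j) + \sum_j mu0 j * (h j - (psi (F j))`_N).
  rewrite [X in _ = _ + X](eq_bigr (fun j => mu0 j * h j - mu0 j * (psi (F j))`_N)) => [|j _]; last by rewrite mulrBr.
  by rewrite sumrB addrA subrK.
apply: idealD => //; apply: ideal_sum => // j _; rewrite -[X in V X]add1n.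
by apply: cfM => //; case: (hF j).
Qed.

(** The associated graded ring is a quotient of a polynomial ring over [R / V 1], hence noetherian.
    [Hh] collects the polynomials whose homogeneous values are initial forms of elements of [K].
    Finitely many generate it modulo the extension of [V 1], and elements of [K] with the same
    initial forms generate [K] by [cf_solve]. *)
Theorem complete_noetherian : noetherian_ring R.
Proof.
move=> K iK; have [_ V1 Vu] := lV; have iV1 := iV 1.
have nV1 : noeth_over (V 1%N).
  move=> L iL VL; case: (pselect (L `<=` V 1%N)) => [LV|/existsNP[x /not_implyP[Lx /Vu[y xy]]]].
    by exists [::]; split=> // x /LV; exact: sub_idlp.
  exists [:: 1]; split.
    by move=> z; rewrite mem_seq1 => /eqP->; rewrite -xy; exact: idealMr.
  by move=> z _; apply: (ideal1 _ (idlp_ideal iV1 _)); apply: mem_idlp => //; rewrite mem_head.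
pose W N := addi K (V N.+1).
have iW N : is_ideal (W N) by exact: (submodule_addm iK (iV _)).
pose Hh := [set F | forall N, W N (psi F)`_N].
have iH : is_ideal Hh.
  apply: psi_filt => // i N x _ hx [y Ky [z hz ->]]; rewrite mulrDr; apply: idealD => //.
    by apply: (addml (iV _)); exact: idealM.
  by apply: (addmr iK); rewrite -addnS; exact: cfM.
pose W1 N := V N.+1.
have iE : is_ideal [set F | forall N, W1 N (psi F)`_N].
  by apply: psi_filt => [N|i N x y hx hy]; rewrite /W1 -?addnS; [exact: iV|exact: cfM].
have extE : @ext R _ s (V 1%N) `<=` [set F | forall N, W1 N (psi F)`_N].
  apply: ext_min => // b Vb /= N; rewrite psi_cst coefC /W1.
  by case: eqP => [->|_] //; exact: ideal0.
have [|s0 [s0H Hs0]] := @noeth_over_tw R _ s _ iV1 nV1 Hh iH.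
  by move=> F /extE hF N; apply: (addmr iK); exact: hF.
(* [d] exceeds the degrees of all homogeneous parts of the generators; it is the delay granted in
   [cf_solve]. *)
pose d := \max_(F <- s0) size (psi F).
have dF F : F \in s0 -> (size (psi F) <= d)%N.
  rewrite /d; elim: (s0) => [|x l IH] //; rewrite in_cons big_cons leq_max.
  by move=> /orP[/eqP->|/IH->]; rewrite ?leqnn ?orbT.
pose I0 : finType := ('I_(size s0) * 'I_d)%type.
have /choice[y hy] (jk : I0) : exists y, K y /\ V jk.2.+1 ((psi s0`_jk.1)`_jk.2 - y).
  have [x Kx [v hv E]] := s0H _ (mem_nth 0 (ltn_ord jk.1)) jk.2.
  by exists x; rewrite E addrC addKr.
have hsol z : K z -> exists h : I0 -> R, z = \sum_jk y jk * h jk.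
  move: z; apply: (cf_solve cV (k := d) iK (fun jk => (hy jk).1)) => N z Kz zN.
  have [F F0 FN] := psi_form zN.
  have HF : Hh F.
    move=> k; case: (eqVneq k N) => [->|/F0->]; last exact: ideal0.
    exists z => //; exists ((psi F)`_N - z); last by rewrite addrC subrK.
    by rewrite -opprB; exact: idealN.
  have [e he [G FE]] := (idlpP _ _ _).1 (Hs0 F HF).
  pose h (jk : I0) := if (jk.2 <= N)%N then (psi (G jk.1))`_(N - jk.2) else 0.
  exists h => [[j k]|].
    rewrite /h; case: ifP => _ /=; last exact: ideal0.
    by apply: cf_le (psi_rees _ _) => //; apply: leq_sub2l; exact: ltnW.
  have cE : (psi F)`_N = (psi e)`_N + \sum_(jk : I0) (psi s0`_jk.1)`_jk.2 * h jk.
    rewrite FE rmorphD coefD rmorph_sum coef_sum; congr (_ + _).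
    rewrite -(pair_bigA _ (fun (j : 'I_(size s0)) (k : 'I_d) => (psi s0`_j)`_k * h (j, k))) /=.
    apply: eq_bigr => j _; rewrite rmorphM coefMr.
    pose t k := if (k <= N)%N then (psi s0`_j)`_k * (psi (G j))`_(N - k) else 0.
    have sd : (size (psi (s0`_j)%R) <= d)%N by apply: dF; exact: mem_nth.
    transitivity (\sum_(k < N.+1 + d) t k).
      rewrite big_split_ord /= [X in _ = _ + X]big1 ?addr0 => [|k _]; last by rewrite /t leqNgt leq_addr.
      by apply: eq_bigr => k _; rewrite /t -ltnS ltn_ord mulrC.
    rewrite addnC big_split_ord /= [X in _ + X]big1 ?addr0 => [|k _]; last first.
      by rewrite /t nth_default ?mul0r ?if_same //; apply: leq_trans sd _; exact: leq_addr.
    by apply: eq_bigr => k _; rewrite /t /h /=; case: ifP => // _; rewrite mulr0.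
  have -> : z - \sum_jk y jk * h jk = (z - (psi F)`_N) + (psi e)`_N +
      \sum_(jk : I0) ((psi s0`_jk.1)`_jk.2 - y jk) * h jk.
    rewrite cE [X in _ = _ + X](eq_bigr (fun jk : I0 => (psi s0`_jk.1)`_jk.2 * h jk - y jk * h jk)) => [|jk _]; last by rewrite mulrBl.
    by rewrite sumrB; ring.
  apply: idealD => //; first by apply: idealD => //; exact: extE.
  apply: ideal_sum => // jk _; rewrite /h; case: ifP => kN; last by rewrite mulr0; exact: ideal0.
  have := cfM cV (hy jk).2 (psi_rees (G jk.1) (N - jk.2)); congr (V _ _); lia.
exists [seq y jk | jk <- enum I0]; apply/seteqP; split=> [z /hsol[h ->]|].
  apply: ideal_sum => [|jk _]; first exact: idl_ideal.
  by rewrite mulrC; apply: idlM; apply: sub_idl => /=; apply: map_f; rewrite mem_enum.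
by apply: idl_min => // _ /= /mapP[jk _ ->]; case: (hy jk).
Qed.
End CompleteNoetherian.

(** * Artin-Rees and a local criterion of flatness *)

Section Lin.
Variables (R : comPzRingType) (M : lmodType R).
Implicit Types (q : set R) (U : set M).

Definition lin q U : set M := [set v | exists n (a : 'I_n -> R) (u : 'I_n -> M),
  (forall i, q (a i) /\ U (u i)) /\ v = \sum_i a i *: u i].

Lemma lin_submodule q U : is_ideal q -> submodule (lin q U).
Proof.
move=> iq; split.
- by exists 0%N, (fun=> 0), (fun=> 0); split; [case|rewrite big_ord0].
- move=> _ _ [n [a [u [h ->]]]] [n' [a' [u' [h' ->]]]].
  exists (n + n')%N, (fun i => match split i with inl j => a j | inr j => a' j end),
    (fun i => match split i with inl j => u j | inr j => u' j end).
  split=> [i|]; first by case: (split i).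
  rewrite big_split_ord /=; congr (_ + _); apply: eq_bigr => i _; by rewrite ?split_l ?split_r.
- move=> b _ [n [a [u [h ->]]]]; exists n, (fun i => b * a i), u; split=> [i|].
    by have [? ?] := h i; split=> //; exact: idealM.
  by rewrite scaler_sumr; apply: eq_bigr => i _; rewrite scalerA.
Qed.
Lemma mem_lin q U a u : q a -> U u -> lin q U (a *: u).
Proof. by move=> qa Uu; exists 1%N, (fun=> a), (fun=> u); rewrite big_ord1. Qed.
Lemma lin_min q U (N : set M) : submodule N -> (forall a u, q a -> U u -> N (a *: u)) -> lin q U `<=` N.
Proof. by move=> sN h _ [n [a [u [hu ->]]]]; apply: submod_sum => // i _; have [? ?] := hu i; exact: h. Qed.

Variable nR : noetherian_ring R.

(** The ideal quotients [C j] of [K] by [q^j] become constant at some [k]. If [C k] were proper,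
    multiplying 1 by suitable powers of the generators of [q] would give an [r] outside [C k] with
    [q r] inside, against constancy. *)
Lemma pow_nil (q K : set R) : is_ideal q -> is_ideal K -> (forall x, q x -> exists i, K (x ^+ i)) ->
  exists N, ideal_pow q N `<=` K.
Proof.
move=> iq iK hx; pose C j := [set r | forall t, ideal_pow q j t -> K (r * t)].
have iC j : is_ideal (C j).
  apply: is_idealI => [t _|x y hx' hy t ht|a x hx' t ht]; first by rewrite mul0r; exact: ideal0.
    by rewrite mulrDl; apply: idealD; [|exact: hx'|exact: hy].
  by rewrite -mulrA; apply: idealM => //; exact: hx'.
have Cup j : C j `<=` C j.+1 by move=> r hr t /(ideal_powS iq); exact: hr.
have [k hk] := noeth_chain ((noethR R).1 nR) iC Cup.
have Cq r : (forall x, q x -> C k (x * r)) -> C k r.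
  move=> hr; apply: (hk k.+1) => t; move: t; apply: (idl_min (I := [set t | K (r * t)])).
    apply: is_idealI => /=; first by rewrite mulr0; exact: ideal0.
      by move=> x y ? ?; rewrite mulrDr; exact: idealD.
    by move=> a x ?; rewrite mulrCA; exact: idealM.
  by move=> _ [a [b [qa hb ->]]] /=; rewrite mulrA [r * a]mulrC; exact: (hr a qa b hb).
exists k; suff C1 : C k 1 by move=> t /C1; rewrite mul1r.
apply: contrapT => C1; have [s qE] := nR iq.
have [r Cr hr] : exists2 r, ~ C k r & forall x, x \in s -> C k (x * r).
  have qs x : x \in s -> q x by move=> xs; rewrite qE; exact: sub_idl.
  elim: (s) qs => [|x l IH] qs; first by exists 1.
  have [|r Cr hr] := IH; first by move=> y yl; apply: qs; rewrite in_cons yl orbT.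
  have [i Ki] := hx x (qs x (mem_head _ _)).
  have exP : exists i, `[< C k (x ^+ i * r) >].
    by exists i; apply/asboolP => t _; rewrite -mulrA; exact: idealMr.
  case: (ex_minnP exP) => j /asboolP hj jmin.
  case: j hj jmin => [|j] hj jmin; first by case: Cr; rewrite expr0 mul1r in hj.
  exists (x ^+ j * r); first by move=> h; have := jmin j (asboolT h); rewrite ltnn.
  move=> y; rewrite in_cons => /orP[/eqP->|/hr h]; first by rewrite mulrA -exprS.
  by rewrite mulrCA; exact: (idealM _ (iC k)).
apply: Cr; apply: Cq => x; rewrite qE; move: x; apply: (idl_min (I := [set x | C k (x * r)])) => //.
apply: is_idealI => /=; first by rewrite mul0r; exact: (ideal0 (iC k)).
  by move=> x y ? ?; rewrite mulrDl; exact: (idealD (iC k)).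
by move=> a x ?; rewrite -mulrA; exact: (idealM _ (iC k)).
Qed.

Variable nM : noeth M.

(** Take [L] maximal among the submodules that contain [q W] and meet [W] in it. For [x] in [q] the
    quotients of [L] by powers of [x] become constant, and maximality then yields [x^i M] inside
    [L]; hence a power of [q] sends [M] into [L]. *)
Lemma artin_rees q (W : set M) : is_ideal q -> submodule W ->
  exists N, forall e, lin (ideal_pow q N) setT e -> W e -> lin q W e.
Proof.
move=> iq sW; have sq := lin_submodule W iq.
have [||L [sL LW qL] Lmax] := noeth_max nM (F := [set L | [/\ submodule L,
    forall x, L x -> W x -> lin q W x & lin q W `<=` L]]).
- by move=> L [].
- by exists (lin q W); split.
have nil x : q x -> exists i, forall e, L (x ^+ i *: e).
  move=> qx; pose U i := [set e | L (x ^+ i *: e)].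
  have sU i : submodule (U i).
    split; rewrite /U /= ?scaler0; first exact: submod0.
      by move=> a b ? ?; rewrite scalerDr; exact: submodD.
    by move=> a b ?; rewrite scalerA mulrC -scalerA; exact: submodZ.
  have Uup i : U i `<=` U i.+1 by move=> e; rewrite /U /= exprS -scalerA; exact: submodZ.
  have [k hk] := noeth_chain nM sU Uup; exists k => e.
  pose X : set M := [set v | exists e : M, v = x ^+ k *: e].
  have sX : submodule X.
    split; first by exists 0; rewrite scaler0.
      by move=> _ _ [a ->] [b ->]; exists (a + b); rewrite scalerDr.
    by move=> a _ [b ->]; exists (a *: b); rewrite !scalerA mulrC.
  apply: (Lmax (addm L X)); last 1 first.
  - by apply: (addmr sL); exists e.
  - split; [exact: submodule_addm| |by apply: subset_trans (addml sX)].
    move=> _ [l Ll [_ [f ->] ->]] Ww; apply: LW => //; apply: submodD => //.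
    apply: (hk k.+1); rewrite /U /= exprS -scalerA; apply: (submod_addr (y := x *: l) sL); first exact: submodZ.
    by rewrite addrC -scalerDr; apply: qL; apply: mem_lin.
  - exact: addml.
have iL : is_ideal [set r | forall e, L (r *: e)].
  apply: is_idealI => [e|x y hx hy e|a x hx e]; first by rewrite scale0r; exact: submod0.
    by rewrite scalerDl; apply: submodD; [|exact: hx|exact: hy].
  by rewrite -scalerA; apply: submodZ => //; exact: hx.
have [N hN] := pow_nil iq iL nil.
exists N => e he We; apply: LW => //; move: e he {We}; apply: lin_min => // a u /hN h _; exact: h.
Qed.

Lemma krull_inter q (W : set M) x : locr q -> submodule W ->
  (forall k, addm W (lin (ideal_pow q k) setT) x) -> W x.
Proof.
move=> lq sW hx; have [iq _ _] := lq.
have sk k : submodule (addm W (lin (ideal_pow q k) setT)).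
  by apply: submodule_addm => //; apply: lin_submodule; exact: ideal_pow_ideal.
pose W' := [set x | forall k, addm W (lin (ideal_pow q k) setT) x].
have sW' : submodule W'.
  split; first by move=> k; exact: submod0.
    by move=> a b ha hb k; exact: submodD.
  by move=> a b hb k; exact: submodZ.
have WW' : W `<=` W'.
  by move=> w Ww k; apply: addml => //; apply: lin_submodule; exact: ideal_pow_ideal.
have [N hN] := artin_rees iq sW'.
apply: (nakayama lq (nM sW') sW) hx => u hu; have [w Ww [e he ue]] := hu N.
have [|n [a [v [hv eE]]]] := hN e he.
  by rewrite (_ : e = u - w); [exact: (submodB sW' hu (WW' _ Ww))|rewrite ue addrC addKr].
by exists n, a, v; split=> //; rewrite -eE ue addrK.
Qed.
End Lin.

Lemma ideal_powD_sub (D : comPzRingType) (I : set D) k N :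
  ideal_pow I (k + N) `<=` idl [set x | exists a b, [/\ ideal_pow I k a, ideal_pow I N b & x = a * b]].
Proof.
elim: k => [|k IH] x; first by move=> hx; apply: sub_idl; exists 1, x; rewrite mul1r.
move: x; apply: idl_min; first exact: idl_ideal.
move=> _ [a [b [Ia /IH hb ->]]]; move: b hb.
apply: (idl_min (I := [set b | idl _ (a * b)])).
  apply: is_idealI => /=; first by rewrite mulr0; exact: idl0.
    by move=> x y ? ?; rewrite mulrDr; exact: idlD.
  by move=> e x ?; rewrite mulrCA; exact: idlM.
move=> _ [b [d [hb hd ->]]] /=; apply: sub_idl; exists (a * b), d; rewrite mulrA; split=> //.
by apply: sub_idl; exists a, b.
Qed.
Lemma ideal_pow_pow (D : comPzRingType) (I : set D) k N : ideal_pow I (k * N) `<=` ideal_pow (ideal_pow I k) N.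
Proof.
elim: N => [|N IH] //; rewrite mulnS => x /ideal_powD_sub; apply: idl_mono => _ [a [b [ha /IH hb ->]]].
by exists a, b.
Qed.

Section FlatCriterion.
Variables (A : comNzRingType) (R : comPzRingType) (m : set A) (c : {rmorphism A -> R}) (m' : set R).
Hypotheses (nA : noetherian_ring A) (mm : maximal_ideal m) (nR : noetherian_ring R) (lR : locr m').
Hypotheses (cm : forall x, m x -> m' (c x)) (mE : m' = idl (c @` m)).
Hypothesis NV : forall J N v x, is_ideal J -> ideal_pow m N `<=` J -> ~ J v -> (forall a, m a -> J (a * v)) ->
    idl (c @` J) (c v * x) -> m' x.
Let im : is_ideal m. Proof. by case: mm. Qed.

Lemma maximal_inv x : ~ m x -> exists y, m (y * x - 1).
Proof.
move=> nx; have [_ m1 mx] := mm; apply: contrapT => h.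
have iJ := is_ideal_principal_add x im; apply: nx.
rewrite -(mx _ iJ); first by exists 0; [exact: ideal0|exists 1; rewrite mul1r add0r].
  by move=> [i mi [y E]]; apply: h; exists y; rewrite E opprD addrCA subrr addr0; exact: idealN.
by move=> z mz; exists z => //; exists 0; rewrite mul0r addr0.
Qed.

Section OneEquation.
Variables (p : nat) (a : 'I_p -> A).
Let E : lmodType R := {ffun 'I_p -> R^o}.
Definition Rel (J : set A) : set {ffun 'I_p -> A} := [set b | J (\sum_i a i * b i)].
Definition emb (b : {ffun 'I_p -> A}) : E := [ffun i => c (b i)].
(** The solutions over [R] that come from solutions over [A], to be compared with all solutions of
    the equation modulo [J R]. *)
Definition RelR (J : set A) : set E := lin setT (emb @` Rel J).
Let sRel J : submodule (RelR J). Proof. exact: lin_submodule. Qed.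
Let dot (x : E) : R := \sum_i c (a i) * x i.
Let dotD x y : dot (x + y) = dot x + dot y.
Proof. by rewrite /dot -big_split; apply: eq_bigr => i _; rewrite ffunE mulrDr. Qed.
Let dotZ t x : dot (t *: x) = t * dot x.
Proof. by rewrite /dot mulr_sumr; apply: eq_bigr => i _; rewrite ffunE mulrCA. Qed.
Let dot_emb b : dot (emb b) = c (\sum_i a i * b i).
Proof. by rewrite rmorph_sum; apply: eq_bigr => i _; rewrite ffunE rmorphM. Qed.
Let dotRel J x : is_ideal J -> RelR J x -> idl (c @` J) (dot x).
Proof.
move=> iJ; move: x; apply: (lin_min (N := [set x | idl (c @` J) (dot x)])).
  split=> /=; first by rewrite -(scale0r 0) dotZ mul0r; exact: idl0.
    by move=> x y ? ?; rewrite dotD; exact: idlD.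
  by move=> t x ?; rewrite dotZ; exact: idlM.
move=> t _ _ [b hb <-] /=; rewrite dotZ dot_emb; apply: idlM; apply: sub_idl; by exists (\sum_i a i * b i).
Qed.
Let dota (b b' : {ffun 'I_p -> A}) r : \sum_i a i * (b - r *: (b' : {ffun 'I_p -> A^o})) i =
   \sum_i a i * b i - r * \sum_i a i * b' i.
Proof.
rewrite mulr_sumr -sumrB; apply: eq_bigr => i _; rewrite !ffunE mulrBr; congr (_ - _).
by rewrite mulrCA.
Qed.

(** Noetherian induction. When a socle element [v] is adjoined to [K], a solution takes the form
    [z + t b0], with [z] from solutions modulo [K] and one new solution [b0]. By [NV] the factor [t]
    lies in [m'], which [m] generates, and the multiples of [b0] by [m] are solutions modulo [K]. *)
Lemma rel_primary J N x : is_ideal J -> ideal_pow m N `<=` J -> idl (c @` J) (dot x) -> RelR J x.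
Proof.
move=> iJ0 mJ0; apply: contrapT.
pose F := [set J | [/\ is_ideal J, ideal_pow m N `<=` J & exists x, idl (c @` J) (dot x) /\ ~ RelR J x]].
move=> bad; have [||K [iK mK [y [hy Ky]]] Kmax] := noeth_ideal_max nA (F := F).
- by move=> K [].
- exists J; split=> //; exists x; apply: contrapT => h; apply: bad => hx; apply: contrapT => h'.
  by apply: h.
case: (pselect (K 1)) => [K1|K1].
  apply: Ky; have -> : y = \sum_i y i *: emb [ffun j => (j == i)%:R].
    apply/ffunP => k; rewrite sum_ffunE (bigD1 k) //= !ffunE eqxx rmorph1 big1 ?addr0 ?[_ *: _]mulr1 // => i ik.
    by rewrite !ffunE eq_sym (negbTE ik) rmorph0; exact: mulr0.
  apply: submod_sum => // i _; apply: mem_lin => //; exists [ffun j => (j == i)%:R] => //.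
  exact: ideal1.
have [v Kv hv] := socle_ideal iK mK K1.
pose K' := [set z | exists2 i, K i & exists r, z = i + r * v].
have iK' : is_ideal K' by exact: is_ideal_principal_add.
have KK' : K `<=` K' by move=> z Kz; exists z => //; exists 0; rewrite mul0r addr0.
have hK' z : idl (c @` K') (dot z) -> RelR K' z.
  move=> hz; apply: contrapT => nz; apply: Kv; apply: (Kmax K') => //.
    by split=> //; [exact: subset_trans KK'|exists z].
  by exists 0; [exact: ideal0|exists 1; rewrite mul1r add0r].
have yK' : RelR K' y by apply: hK'; apply: idl_mono hy => _ [z Kz <-]; exists z => //; exact: KK'.
apply: Ky; case: (pselect (Rel K' `<=` Rel K)) => [RR|].
  by apply: lin_min yK' => // t _ _ [b /RR hb <-]; apply: mem_lin => //; exists b.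
move=> /existsNP[b0 /not_implyP[[j0 Kj0 [c0 E0]] nb0]].
have mc0 : ~ m c0.
  by move=> mc0; apply: nb0; rewrite /Rel /= E0; apply: idealD => //; exact: hv.
have [w hw] := maximal_inv mc0.
have dec b : Rel K' b -> exists r, RelR K (emb b - r *: emb b0).
  move=> [j Kj [cb Eb]]; exists (c (w * cb)).
  have -> : emb b - c (w * cb) *: emb b0 = emb (b - (w * cb) *: (b0 : {ffun 'I_p -> A^o})).
    by apply/ffunP => i; rewrite !ffunE rmorphB; congr (_ - _); exact: (esym (rmorphM c _ _)).
  rewrite -[emb _]scale1r; apply: mem_lin => //; exists (b - (w * cb) *: (b0 : {ffun 'I_p -> A^o})) => //.
  rewrite /Rel /= dota E0 Eb.
  have -> : j + cb * v - w * cb * (j0 + c0 * v) = j - w * cb * j0 - cb * ((w * c0 - 1) * v) by ring.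
  by apply: idealB => //; [apply: idealB => //; exact: idealM|apply: idealM => //; exact: hv].
have [z hz [t yE]] : exists2 z, RelR K z & exists t, y = z + t *: emb b0.
  move: y yK' {hy}; apply: (lin_min (N := [set y | exists2 z, RelR K z & exists t, y = z + t *: emb b0])).
    split; first by exists 0; [exact: submod0|exists 0; rewrite scale0r addr0].
      move=> _ _ [z hz [t ->]] [z' hz' [t' ->]]; exists (z + z'); first exact: submodD.
      by exists (t + t'); rewrite scalerDl addrACA.
    move=> r _ [z hz [t ->]]; exists (r *: z); first exact: submodZ.
    by exists (r * t); rewrite scalerDr scalerA.
  move=> s _ _ [b /dec[r hr] <-]; exists (s *: (emb b - r *: emb b0)); first exact: submodZ.
  by exists (s * r); rewrite scalerBr scalerA subrK.
have m't : m' (c c0 * t).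
  apply: (NV iK mK Kv hv).
  have -> : c v * (c c0 * t) = dot y - dot z - t * c j0.
    by rewrite yE dotD dotZ dot_emb E0 rmorphD rmorphM; ring.
  have iI := idl_ideal (c @` K).
  apply: (idealB iI); first by apply: (idealB iI) => //; exact: dotRel.
  by apply: idlM; apply: sub_idl; exists j0.
have {}m't : m' t.
  have [i' _ _] := lR; rewrite (_ : t = c w * (c c0 * t) - c (w * c0 - 1) * t).
    by apply: idealB => //; [exact: idealM|apply: idealMr => //; exact: cm].
  by rewrite rmorphB rmorph1 rmorphM; ring.
rewrite yE; apply: submodD => //; move: t m't {yE}; rewrite mE.
apply: (idl_min (I := [set t | RelR K (t *: emb b0)])).
  apply: is_idealI => /=; first by rewrite scale0r; exact: submod0.
    by move=> s t ? ?; rewrite scalerDl; exact: submodD.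
  by move=> s t ?; rewrite -scalerA; exact: submodZ.
move=> _ [mu mmu <-] /=.
have -> : c mu *: emb b0 = emb (mu *: (b0 : {ffun 'I_p -> A^o})).
  by apply/ffunP => i; rewrite !ffunE; exact: (esym (rmorphM c _ _)).
rewrite -[emb _]scale1r; apply: mem_lin => //; exists (mu *: (b0 : {ffun 'I_p -> A^o})) => //.
rewrite /Rel /= (_ : \sum_i _ = mu * \sum_i a i * b0 i).
  rewrite E0 (_ : mu * (j0 + c0 * v) = mu * j0 + c0 * (mu * v)); last by ring.
  by apply: idealD => //; apply: idealM => //; exact: hv.
by rewrite mulr_sumr; apply: eq_bigr => i _; rewrite !ffunE mulrCA.
Qed.

(** By Artin-Rees in [A], a solution modulo a deep power of [m] is a true solution plus a vector
    with entries in [m^k]. Krull's intersection theorem over [R] removes the error. *)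
Lemma rel_zero x : dot x = 0 -> RelR [set 0] x.
Proof.
move=> hx; have nE : noeth E by exact: noeth_ffun.
apply: (krull_inter nR nE lR (sRel _)) => k.
have iq := ideal_pow_ideal m k; pose W := idl (range a).
have [N hN] := artin_rees nA ((noethR A).1 nA) iq (idl_ideal (range a)).
have [] := @rel_primary (ideal_pow (ideal_pow m k) N) (k * N) x.
- exact: ideal_pow_ideal.
- exact: ideal_pow_pow.
- by rewrite hx; exact: idl0.
move=> n [r [u [hu ->]]].
have sk : submodule (addm (RelR [set 0]) (lin (ideal_pow m' k) setT)).
  by apply: submodule_addm => //; apply: lin_submodule; exact: ideal_pow_ideal.
apply: submod_sum => // i _; apply: submodZ => //; have [_ [b hb <-]] := hu i.
have : lin (ideal_pow m k) (idl (range a) : set A^o) (\sum_i a i * b i).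
  apply: hN; first by rewrite -[\sum_i _]mulr1; apply: (mem_lin (M := A^o)).
  by apply: ideal_sum => [|l _]; [exact: idl_ideal|rewrite mulrC; apply: idlM; apply: sub_idl; exists l].
have sI := idl_ideal.
move=> hlin; have [b' qb' Eb'] : exists2 b' : {ffun 'I_p -> A}, forall l, ideal_pow m k (b' l) &
    \sum_i a i * b i = \sum_i a i * b' i.
  move: (\sum_i a i * b i) hlin.
  apply: (lin_min (M := A^o) (N := [set s | exists2 b' : {ffun 'I_p -> A}, forall l, ideal_pow m k (b' l) & s = \sum_i a i * b' i])).
    split.
    - by exists [ffun=> 0] => [l|]; [rewrite ffunE; exact: ideal0|rewrite big1 // => l _; rewrite ffunE mulr0].
    - move=> _ _ [b1 h1 ->] [b2 h2 ->]; exists [ffun l => b1 l + b2 l] => [l|]; first by rewrite ffunE; exact: idealD.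
      by rewrite -big_split; apply: eq_bigr => l _; rewrite ffunE mulrDr.
    - move=> s _ [b1 h1 ->]; exists [ffun l => s * b1 l] => [l|]; first by rewrite ffunE; exact: idealM.
      by rewrite scaler_sumr; apply: eq_bigr => l _; rewrite ffunE; exact: mulrCA.
  move=> s w qs /(@spanP A A^o)[g ->]; exists [ffun l => s * g l] => [l|]; first by rewrite ffunE; exact: idealMr.
  by rewrite scaler_sumr; apply: eq_bigr => l _; rewrite ffunE mulrCA [RHS]mulrA -mulrA [a l * _]mulrC.
exists (emb (b - b')).
  rewrite -[emb _]scale1r; apply: mem_lin => //; exists (b - b') => //.
  have := dota b b' 1; rewrite scale1r mul1r Eb' subrr => h; exact: h.
exists (emb b'); last by apply/ffunP => l; rewrite !ffunE rmorphB subrK.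
have -> : emb b' = \sum_l c (b' l) *: emb [ffun j => (j == l)%:R].
  apply/ffunP => l; rewrite sum_ffunE (bigD1 l) //= !ffunE eqxx rmorph1 big1 ?addr0 ?[_ *: _]mulr1 // => i' ik.
  by rewrite !ffunE eq_sym (negbTE ik) rmorph0; exact: mulr0.
apply: submod_sum => [|l _]; first by apply: lin_submodule; exact: ideal_pow_ideal.
by apply: mem_lin => //; apply: pow_push (qb' l).
Qed.
End OneEquation.

(** Equations are solved one at a time: the solutions of the first are parametrized by solutions
    over [A], and the others become equations in the parameters. *)
Theorem flat_criterion : eqflat (restrict c R^o).
Proof.
move=> n k; elim: k n => [|k IH] n D x.
  move=> _; exists n, 1%:M, x; split; last by rewrite act1.
  by apply/matrixP => i [].
rewrite -[k.+1]/(1 + k)%N in D *; move=> hx.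
have hx1 : act x (lsubmx D) = 0.
  apply/ffunP => j; have := congr1 (fun v : {ffun _} => v (lshift k j)) hx; rewrite !ffunE => {2}<-.
  by apply: eq_bigr => i _; rewrite mxE.
have [] := @rel_zero n (fun i => lsubmx D i 0) x.
  have := congr1 (fun v : {ffun _} => v 0) hx1; rewrite !ffunE => {2}<-.
  by apply: eq_bigr => i _.
move=> r [t [u [hu xE]]].
have /choice[b hb] i : exists b : {ffun 'I_n -> A}, \sum_j lsubmx D j 0 * b j = 0 /\ u i = [ffun j => c (b j)].
  by have [_ [b hb <-]] := hu i; exists b.
pose B : 'M[A]_(r, n) := \matrix_(i, j) b i j.
pose y : {ffun 'I_r -> restrict c R^o} := [ffun i => t i].
have xB : x = act y B.
  rewrite xE; apply/ffunP => j; rewrite sum_ffunE ffunE; apply: eq_bigr => i _.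
  by rewrite !ffunE mxE; have [_ ->] := hb i; rewrite ffunE; exact: mulrC.
have B1 : B *m lsubmx D = 0.
  apply/matrixP => i j; rewrite ord1 [RHS]mxE; have [e _] := hb i; rewrite -[RHS]e mxE.
  by apply: eq_bigr => l _; rewrite mxE mulrC.
have [|q [C [z [CB yC]]]] := IH r (B *m rsubmx D) y.
  rewrite actM -xB; apply/ffunP => j.
  have := congr1 (fun v : {ffun _} => v (rshift 1 j)) hx; rewrite !ffunE => {2}<-.
  by apply: eq_bigr => i _; rewrite mxE.
exists q, (C *m B), z; split; last by rewrite actM -yC.
by rewrite -[D]hsubmxK mul_mx_row -!mulmxA B1 mulmx0 CB row_mx0.
Qed.
End FlatCriterion.

(** * Prime chains and heights *)

Section PrimeChains.
Variable R : comPzRingType.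
Hypothesis nR : noetherian_ring R.
Implicit Types (p q r P Q I J K : set R).

Lemma prime_disjoint I (S0 : set R) : is_ideal I -> S0 1 -> (forall x y, S0 x -> S0 y -> S0 (x * y)) ->
  (forall x, I x -> ~ S0 x) -> exists P, [/\ prime_ideal P, I `<=` P & forall x, P x -> ~ S0 x].
Proof.
move=> iI S1 SM IS; have [||P [iP IP PS] Pmax] := noeth_ideal_max nR
  (F := [set P | [/\ is_ideal P, I `<=` P & forall x, P x -> ~ S0 x]]).
- by move=> P [].
- by exists I; split.
exists P; split=> //; split=> //; first by move=> /PS.
have H x : ~ P x -> exists i a, P i /\ S0 (i + a * x).
  move=> Px; apply: contrapT => no; have iP' := is_ideal_principal_add x iP.
  have PJ : P `<=` [set y | exists2 i, P i & exists a, y = i + a * x].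
    by move=> z Pz; exists z => //; exists 0; rewrite mul0r addr0.
  apply: Px; apply: (Pmax _ _ PJ); last by exists 0; [exact: ideal0|exists 1; rewrite mul1r add0r].
  split=> //; first exact: subset_trans PJ.
  by move=> _ [i Pi [a ->]] h; apply: no; exists i, a.
move=> x y Pxy; apply: contrapT => /not_orP[/H[i [a [Pi hi]]] /H[j [b [Pj hj]]]].
apply: (PS _ _ (SM _ _ hi hj)).
have -> : (i + a * x) * (j + b * y) = i * (j + b * y) + (a * x * j + a * b * (x * y)) by ring.
by apply: idealD => //; [exact: idealMr|apply: idealD => //; exact: idealM].
Qed.

Lemma sat_sat q J : prime_ideal q -> sat q (sat q J) `<=` sat q J.
Proof.
move=> [_ _ pq] x [u qu [v qv h]]; exists (v * u); last by rewrite -mulrA.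
by move=> /pq[].
Qed.
Lemma satS q J K : J `<=` K -> sat q J `<=` sat q K.
Proof. by move=> JK x [u qu /JK h]; exists u. Qed.
Lemma prime_exp p x k : prime_ideal p -> p (x ^+ k) -> p x.
Proof. by move=> [_ p1 pp]; elim: k => [|k IH] //; rewrite exprS => /pp[|/IH]. Qed.
Lemma mem_pow q x k : q x -> ideal_pow q k (x ^+ k).
Proof. by move=> qx; elim: k => [|k IH] //; rewrite exprS; apply: sub_idl; exists x, (x ^+ k). Qed.

(** The ring modulo [K] is artinian at [r]. [Lo] is maximal among the ideals on which the trace of
    the chain becomes constant; adjoining a socle element enlarges it, since in the one-dimensional
    layer thus added the chain is either eventually zero or always everything. *)
Lemma dcc_sat r K N (L : nat -> set R) : prime_ideal r -> is_ideal K -> ideal_pow r N `<=` sat r K ->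
  (forall i, [/\ is_ideal (L i), K `<=` L i, sat r (L i) `<=` L i & L i.+1 `<=` L i]) ->
  exists k, L k `<=` L k.+1.
Proof.
move=> pr0 iK rK hL; have [ir r1 pr] := pr0.
have Lle i j : (i <= j)%N -> L j `<=` L i.
  elim: j => [|j IH]; first by rewrite leqn0 => /eqP->.
  rewrite leq_eqVlt => /orP[/eqP->//|/IH]; apply: subset_trans; by case: (hL j).
pose F := [set Lo | [/\ is_ideal Lo, K `<=` Lo, sat r Lo `<=` Lo &
  exists i0, forall i j, (i0 <= i)%N -> (i0 <= j)%N -> forall x, L i x -> Lo x -> L j x]].
have [||Lo [iLo KLo sLo [i0 hi0]] Lomax] := noeth_ideal_max nR (F := F).
- by move=> Lo [].
- exists (sat r K); split; [exact: sat_ideal|exact: sub_sat|exact: sat_sat|].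
  exists 0%N => i j _ _ x _ hx; have [_ KL sL _] := hL j; apply: sL; exact: satS hx.
case: (pselect (Lo 1)) => [Lo1|Lo1].
  exists i0 => x hx; apply: hi0 hx _ => //; exact: ideal1.
have [|v Lov hv] := socle_ideal iLo (N := N) (m := r) _ Lo1.
  by move=> x /rK h; apply: sLo; exact: satS h.
pose V := [set z | exists2 l, Lo l & exists b, z = l + b * v].
have iV : is_ideal V by exact: is_ideal_principal_add.
have LoV : Lo `<=` V by move=> z Lz; exists z => //; exists 0; rewrite mul0r addr0.
case: Lov; apply: (Lomax (sat r V)); last 1 first.
- by apply: sub_sat => //; exists 0; [exact: ideal0|exists 1; rewrite mul1r add0r].
- split; [exact: sat_ideal|by move=> z /KLo/LoV; exact: sub_sat|exact: sat_sat|].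
  case: (pselect (exists2 i1, (i0 <= i1)%N & forall x, L i1 x -> sat r V x -> Lo x)) => [[i1 i01 hi1]|no].
    exists i1 => i j i1i i1j x Lx Vx; apply: (hi0 i j _ _ x Lx); [lia|lia|].
    by apply: hi1 => //; exact: Lle Lx.
  exists i0 => i j i0i i0j x Lx [s rs [l Ll [a E]]].
  have [z [Lz [t rt [l' Ll' [b E']]] Loz]] : exists z, [/\ L (maxn i j) z, sat r V z & ~ Lo z].
    apply: contrapT => no'; apply: no; exists (maxn i j); first by rewrite leq_max i0i.
    by move=> z Lz Vz; apply: contrapT => Loz; apply: no'; exists z.
  have rb : ~ r b.
    move=> rb; apply: Loz; apply: sLo; exists t => //; rewrite E'; apply: idealD => //; exact: hv.
  have [iLi _ _ _] := hL i; have [iLj _ sLj _] := hL j.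
  have Liz : L i z by apply: Lle Lz; exact: leq_maxl.
  have Ljz : L j z by apply: Lle Lz; exact: leq_maxr.
  have h : L j (b * s * x - a * t * z).
    apply: (hi0 i j i0i i0j); first by apply: idealB => //; exact: idealM.
    have -> : b * s * x - a * t * z = b * l - a * l' by rewrite -!mulrA E E'; ring.
    by apply: idealB => //; exact: idealM.
  apply: sLj; exists (b * s); first by move=> /pr[].
  by apply: (ideal_subr iLj _ h); exact: idealM.
- by move=> z /LoV; exact: sub_sat.
Qed.

(** Krull's argument with the symbolic powers [Qk] of [q] modulo [p]. The ring modulo [p] and [e] is
    artinian at [r], so at [r] some [Qk k] lies in [Qk k.+1] plus multiples of [e]. Nakayama's lemma
    at [r] gives [Qk k = Qk k.+1], and at [q] it gives [q^k] inside [p]. *)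
Lemma principal_ideal_theorem p q r e : prime_ideal p -> prime_ideal q -> prime_ideal r ->
  p `<` q -> q `<` r -> r e -> ~ q e ->
  (forall Q, prime_ideal Q -> p `<=` Q -> Q e -> Q `<=` r -> r `<=` Q) -> False.
Proof.
move=> pp0 pq0 pr0 [pq nqp] [qr nrq] re qe rmin.
have [ip p1 pp] := pp0; have [iq q1 pq'] := pq0; have [ir r1 pr] := pr0.
pose U (J : set R) := [set y | exists2 i, J i & exists a, y = i + a * e].
have iU J : is_ideal J -> is_ideal (U J) by exact: is_ideal_principal_add.
have UJ J : J `<=` U J by move=> z Jz; exists z => //; exists 0; rewrite mul0r addr0.
have Ue J : is_ideal J -> U J e by move=> iJ; exists 0; [exact: ideal0|exists 1; rewrite mul1r add0r].
have rnil x : r x -> exists i, sat r (U p) (x ^+ i).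
  move=> rx; apply: contrapT => no.
  have [||||Q [pQ UQ QS]] := @prime_disjoint (U p) [set y | exists s i, ~ r s /\ y = s * x ^+ i].
  - exact: iU.
  - by exists 1, 0%N; rewrite mulr1.
  - move=> _ _ [s [i [rs ->]]] [t [j [rt ->]]]; exists (s * t), (i + j)%N.
    by split; [move=> /pr[]|rewrite exprD mulrACA].
  - move=> y Uy [s [i [rs E]]]; apply: no; exists i; exists s => //; by rewrite -E.
  apply: (QS x); last by exists 1, 1%N; rewrite mul1r.
  apply: (rmin Q pQ) => //; [exact: subset_trans UQ|by apply: UQ; exact: Ue|].
  by move=> y Qy; apply: contrapT => ry; apply: (QS y Qy); exists y, 0%N; rewrite mulr1.
have [N hN] := pow_nil nR ir (sat_ideal pr0 (iU p ip)) rnil.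
pose Qk k := sat q (addi (ideal_pow q k) p).
have iA k : is_ideal (addi (ideal_pow q k) p) by apply: (submodule_addm _ ip); exact: ideal_pow_ideal.
have iQ k : is_ideal (Qk k) by exact: sat_ideal.
have pQ k : p `<=` Qk k.
  by move=> x px; apply: sub_sat => //; apply: (addmr (ideal_pow_ideal q k)).
have QS k : Qk k.+1 `<=` Qk k.
  apply: satS; apply: (addm_min (iA k)); last exact: (addmr (ideal_pow_ideal q k)).
  by apply: subset_trans (addml ip); exact: ideal_powS.
have US J J' : J `<=` J' -> U J `<=` U J'.
  by move=> h _ [i /h Ji [a ->]]; exists i => //; exists a.
have [|k hk] := @dcc_sat r (U p) N (fun k => sat r (U (Qk k))) pr0 (iU p ip) hN.
  move=> i; split; [by apply: sat_ideal => //; exact: iU| |exact: sat_sat|by apply: satS; apply: US].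
  by move=> x hx; apply: sub_sat => //; apply: US hx.
have nf J : is_ideal J -> fg (M := R^o) J by exact: ((noethR R).1 nR).
have Qeq : Qk k `<=` Qk k.+1.
  have [|||||||s rs hs] := @nakayama_mult R R^o (fun s => ~ r s) r (Qk k) (Qk k.+1) => //.
  - by move=> s t rs rt /pr[].
  - by move=> s a rs ra h; apply: rs; exact: (ideal_subr ir ra h).
  - exact: nf.
  - exact: iQ.
  - move=> u Qu; have [|s rs [y Qy [al E]]] := hk u; first by apply: sub_sat => //; exact: UJ.
    exists s => //; exists 1%N, (fun=> e), (fun=> al); rewrite big_ord1; split=> [_|]; last first.
      have E2 : s * u - e * al = y by rewrite E mulrC addrK.
      by rewrite [X in Qk _ X](E2 : s *: u - e *: (al : R^o) = y).
    split=> //; apply: (sat_sat pq0); exists e => //; rewrite mulrC.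
    apply: (ideal_addr (iQ k) (QS k _ Qy)); rewrite addrC -E; exact: idealM.
  - move=> u /hs h; apply: (sat_sat pq0); exists s => //; by move=> /qr.
have qkp : ideal_pow q k `<=` p.
  have [|||||||s qs hs] := @nakayama_mult R R^o (fun s => ~ q s) q (ideal_pow q k) p => //.
  - by move=> s t rs rt /pq'[].
  - by move=> s a rs ra h; apply: rs; exact: (ideal_subr iq ra h).
  - by apply: nf; exact: ideal_pow_ideal.
  - move=> u hu; have [|s qs [y hy [z pz E]]] := Qeq u.
      by apply: sub_sat => //; exact: (addml ip).
    exists s => //; have [n [a [v [hv yE]]]] : lin (M := R^o) q (ideal_pow q k) y.
      move: y hy {E}; apply: idl_min; first exact: lin_submodule.
      by move=> _ [a [b [qa hb ->]]]; apply: (mem_lin (M := R^o)).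
    exists n, a, v; split=> //; rewrite -yE [s *: u](E : s *: u = y + z :> R^o) addrC addKr; exact: pz.
  - by move=> u /hs h; case: (pp s u) => // /pq.
apply: nqp => x qx; apply: (prime_exp (k := k) pp0); apply: qkp; exact: mem_pow.
Qed.

Definition chain_to n (p : nat -> set R) :=
  (forall i, (i <= n)%N -> prime_ideal (p i)) /\ (forall i, (i < n)%N -> p i `<` p i.+1).

Lemma chain_sub n (p : nat -> set R) i j : chain_to n p -> (i <= j)%N -> (j <= n)%N -> p i `<=` p j.
Proof.
move=> [_ hp]; elim: j => [|j IH]; first by rewrite leqn0 => /eqP-> _.
rewrite leq_eqVlt => /orP[/eqP-> _ //|ij] jn; apply: (subset_trans (IH ij (ltnW jn))).
by case: (hp j jn).
Qed.

(** By the principal ideal theorem, if [e] lies in a prime of the chain but not in the next one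
    below, the latter can be exchanged for a prime containing [e]. Thus [e] is pushed down to the
    second member, both ends staying fixed. *)
Lemma chain_move n (p : nat -> set R) e : chain_to n.+1 p -> p n.+1 e ->
  exists p' : nat -> set R, [/\ chain_to n.+1 p', p' 0%N = p 0%N, p' n.+1 = p n.+1 & p' 1%N e].
Proof.
move=> cp pe; suff H k : (k <= n)%N -> exists p' : nat -> set R, [/\ chain_to n.+1 p', p' 0%N = p 0%N, p' n.+1 = p n.+1 & p' (n.+1 - k)%N e].
  by have [p' [? ? ? h]] := H n (leqnn n); exists p'; split=> //; rewrite subSnn in h.
elim: k => [|k IH] kn; first by exists p.
have [p' [cp' e0 en hk]] := IH (ltnW kn); have [pr st] := cp'.
have [i iE] : exists i, (n.+1 - k.+1 = i.+1)%N by exists (n - k.+1)%N; lia.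
have iE2 : (n.+1 - k = i.+2)%N by lia.
rewrite iE2 in hk; rewrite iE.
case: (pselect (p' i.+1 e)) => [he|he]; first by exists p'.
have [Q [pQ pQi Qe Qs nQ]] : exists Q, [/\ prime_ideal Q, p' i `<=` Q, Q e, Q `<=` p' i.+2 & ~ (p' i.+2 `<=` Q)].
  apply: contrapT => no; apply: (@principal_ideal_theorem (p' i) (p' i.+1) (p' i.+2) e) => //.
  - by apply: pr; lia.
  - by apply: pr; lia.
  - by apply: pr; lia.
  - by apply: st; lia.
  - by apply: st; lia.
  - by move=> Q pQ h1 h2 h3; apply: contrapT => h4; apply: no; exists Q.
exists (fun j => if j == i.+1 then Q else p' j); rewrite eqxx; split=> //; last by case: eqP => // h; lia.
split=> j jn; first by case: eqP => // _; exact: pr.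
case: (eqVneq j i.+1) => [->|ji]; first by rewrite -[i.+2 == _]/(i.+1 == i) (gtn_eqF (ltnSn i)).
case: eqP => [[jE]|_]; last exact: st.
rewrite jE; split=> // h; apply: he; apply: (chain_sub cp' (leqnSn i)); [lia|exact: h].
Qed.

(** Stated relative to [I] for the induction: after [chain_move] the bottom prime is dropped and [e]
    joins [I]. *)
Lemma height_bound (l : seq R) I n (p : nat -> set R) : is_ideal I -> chain_to n p -> I `<=` p 0%N ->
  (forall x, x \in l -> p n x) ->
  (forall Q, prime_ideal Q -> I `<=` Q -> (forall x, x \in l -> Q x) -> Q `<=` p n -> p n `<=` Q) ->
  (n <= size l)%N.
Proof.
elim: l I n p => [|e l IH] I [|n] p iI cp Ip lp pmin //.
  have [pr st] := cp; have [_ h] := st 0%N isT; case: h; apply: subset_trans (pmin _ (pr 0%N isT) Ip _ _) => //.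
    by apply: (chain_sub cp) => //; lia.
  by apply: (chain_sub cp).
have [|p' [[pr st] e0 en pe1]] := chain_move (e := e) cp; first by apply: lp; exact: mem_head.
have iI' := is_ideal_principal_add e iI.
rewrite /= ltnS; apply: (IH _ n (fun i => p' i.+1) iI').
- by split=> i hi; [exact: pr|exact: st].
- have [ip1 _ _] := pr 1%N isT; move=> _ [i Ii [a ->]]; apply: idealD => //; last exact: idealM.
  have [h _] := st 0%N isT; by apply: h; rewrite e0; exact: Ip.
- by move=> x xl; rewrite en; apply: lp; rewrite in_cons xl orbT.
- move=> Q pQ IQ lQ Qs; rewrite en in Qs *; have [iQ _ _] := pQ; apply: pmin => //.
    by move=> z Iz; apply: IQ; exists z => //; exists 0; rewrite mul0r addr0.
  move=> x; rewrite in_cons => /orP[/eqP->|/lQ //]; apply: IQ.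
  by exists 0; [exact: ideal0|exists 1; rewrite mul1r add0r].
Qed.

Lemma dim_le m (l : seq R) N n : locr m -> ideal_pow m N `<=` idl [set` l] -> (forall x, x \in l -> m x) ->
  prime_chain R n -> (n <= size l)%N.
Proof.
move=> lm mN lm' [p cp]; have [im m1 mu] := lm; have pm := locr_prime lm.
have pin i : (i <= n)%N -> p i `<=` m.
  move=> /(cp.1)[ip p1 _] x px; apply: contrapT => /mu[y xy]; apply: p1; rewrite -xy; exact: idealMr.
have mmin Q : prime_ideal Q -> (forall x, x \in l -> Q x) -> m `<=` Q.
  move=> pQ lQ x mx; apply: (prime_exp (k := N) pQ); have [iQ _ _] := pQ.
  by apply: (idl_min iQ (A := [set` l])) => //; apply: mN; exact: mem_pow.
have [i0 z0] : is_ideal [set (0 : R)] /\ [set (0 : R)] `<=` p 0%N.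
  split; first by apply: is_idealI => [|x y -> ->|a x ->] //=; rewrite ?addr0 ?mulr0.
  by move=> _ ->; have [ip _ _] := cp.1 0%N isT; exact: ideal0.
case: (pselect (m `<=` p n)) => [mp|nmp].
  apply: (height_bound i0 cp z0) => [x xl|Q pQ _ lQ _]; first by apply: mp; exact: lm'.
  by apply: subset_trans (mmin Q pQ lQ); exact: pin.
(* A chain that does not end in [m] is prolonged by [m]. *)
apply: ltnW; apply: (@height_bound l _ n.+1 (fun i => if (i <= n)%N then p i else m) i0) => //.
- split=> i hi; first by case: leqP => // h; exact: (cp.1).
  case: (ltnP i n) => h; first by rewrite (ltnW h); exact: (cp.2).
  have -> : i = n by lia.
  by rewrite leqnn; split=> //; exact: pin.
- by move=> x xl; rewrite ltnn; exact: lm'.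
- by move=> Q pQ _ lQ _; rewrite ltnn; exact: mmin.
Qed.

Definition regular (l : seq R) := forall i, (i < size l)%N -> forall y : R,
  idl [set` take i l] (l`_i * y) -> idl [set` take i l] y.

Lemma regular_rcons l e : regular (rcons l e) <-> regular l /\ forall y, idl [set` l] (e * y) -> idl [set` l] y.
Proof.
split=> [h|[h1 h2] i].
  split=> [i il y|y].
    by have := h i; rewrite size_rcons nth_rcons il -cats1 take_cat il; apply; exact: ltnW.
  by have := h (size l); rewrite size_rcons nth_rcons ltnn eqxx -cats1 take_size_cat //; exact.
rewrite size_rcons ltnS leq_eqVlt => /orP[/eqP->|il] y.
  by rewrite nth_rcons ltnn eqxx -cats1 take_size_cat //; exact: h2.
by rewrite nth_rcons il -cats1 take_cat il; exact: h1.
Qed.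

(** As [e] is regular modulo the ideal of [l], no product [s e^i] with [s] outside [P] lies in that
    ideal. A prime over the ideal avoiding these products lies in [P] and misses [e], so the chain
    grows by one. *)
Lemma regular_chain l P : regular l -> prime_ideal P -> (forall x, x \in l -> P x) ->
  exists p : nat -> set R, chain_to (size l) p /\ p (size l) = P.
Proof.
elim/last_ind: l P => [|l e IH] P; first by move=> _ pP _; exists (fun=> P); split=> //; split.
move=> /regular_rcons[rl re] pP lP; have [iP P1 pP'] := pP.
have lP' x : x \in l -> P x by move=> xl; apply: lP; rewrite mem_rcons in_cons xl orbT.
have Pe : P e by apply: lP; rewrite mem_rcons mem_head.
have [||||Q [pQ lQ QS]] := @prime_disjoint (idl [set` l]) [set y | exists s i, ~ P s /\ y = s * e ^+ i].
- exact: idl_ideal.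
- by exists 1, 0%N; rewrite mulr1.
- move=> _ _ [s [i [rs ->]]] [t [j [rt ->]]]; exists (s * t), (i + j)%N.
  by split; [move=> /pP'[]|rewrite exprD mulrACA].
- move=> y ly [s [i [Ps E]]]; apply: Ps; apply: (idl_min iP lP'); move: ly; rewrite {}E.
  by elim: i => [|i IHi]; rewrite ?mulr1 // exprS mulrCA => /re.
have QP : Q `<=` P.
  by move=> y Qy; apply: contrapT => ry; apply: (QS y Qy); exists y, 0%N; rewrite mulr1.
have [|p [[pr st] pE]] := IH Q rl pQ; first by move=> x xl; apply: lQ; exact: sub_idl.
exists (fun i => if (i <= size l)%N then p i else P); rewrite size_rcons ltnn; split=> //.
split=> i hi; first by case: leqP => // h; exact: pr.
case: (ltnP i (size l)) => h; first by rewrite (ltnW h); exact: st.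
have -> : i = size l by lia.
rewrite leqnn pE; split=> // PQ; apply: (QS e (PQ _ Pe)); by exists 1, 1%N; rewrite mul1r.
Qed.
End PrimeChains.

(** * Koszul complexes *)

Lemma act_row (R : comPzRingType) p q r (A : 'M[R]_(p, q)) (D : 'M_(q, r)) s t :
  act ([ffun k => A s k] : {ffun 'I_q -> R^o}) D t = (A *m D) s t.
Proof. by rewrite ffunE mxE; apply: eq_bigr => i _; rewrite ffunE; exact: mulrC. Qed.

Lemma ffun_scaleE (R : pzRingType) (V : lmodType R) (I : finType) a (u : {ffun I -> V}) t :
  (a *: u) t = a *: u t.
Proof. exact: ffunE. Qed.

Section Koszul.
Variables (R : comPzRingType).

Definition point_cpx : cpx R := @Cpx R 1 (fun=> 0%N) 0.
(** The head of the list is coned last, which is why regularity is stated for [rev l]. *)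
Fixpoint kos (l : seq R) : cpx R := if l is y :: l' then cone (kos l') y else point_cpx.
Fixpoint kos_o (l : seq R) : 'I_(rk (kos l)) :=
  match l return 'I_(rk (kos l)) with
  | [::] => ord0
  | y :: l' => lshift _ (kos_o l')
  end.

Lemma okc_kos l : okc (kos l).
Proof. by elim: l => [|y l IH]; [split=> [|s t _] /=; rewrite ?mulmx0 ?mxE|exact: okc_cone]. Qed.
Lemma dg_kos l (t : 'I_(rk (kos l))) : (dg t <= size l)%N.
Proof.
elim: l t => [|y l IH] // t; rewrite /= /dg /=.
by case: (split_ordP t) => k _; [apply: leqW; exact: IH|rewrite ltnS; exact: IH].
Qed.
Lemma kos_dg0 l (t : 'I_(rk (kos l))) : dg t = 0%N <-> t = kos_o l.
Proof.
elim: l t => [|y l IH] t; first by split=> // _; rewrite /= [t]ord1.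
rewrite /= {1}/dg /=; case: (split_ordP t) => k ->; split.
- by move/IH->.
- by move/lshift_inj/IH.
- by [].
- by move/eqP; rewrite eq_rlshift.
Qed.
Lemma kos_df_o l s : idl [set` l] (df (kos l) s (kos_o l)).
Proof.
elim: l s => [|y l IH] s; first by rewrite /= mxE; exact: idl0.
rewrite /=; case: (split_ordP s) => k ->.
  rewrite block_mxEul; apply: idl_mono (IH k) => x /= xl; by rewrite in_cons xl orbT.
rewrite block_mxEdl mxE -mulr_natr mulrC; apply: idlM; apply: sub_idl; exact: mem_head.
Qed.

Lemma kos_homotopy l r : idl [set` l] r -> exists H : 'M[R]_(rk (kos l)),
  H *m df (kos l) + df (kos l) *m H = r%:M /\ forall s t, dg t <> (dg s).+1 -> H s t = 0.
Proof.
elim: l r => [|y l IH] r.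
  have z : [set` ([::] : seq R)] `<=` [set (0 : R)] by move=> x.
  have i0 : is_ideal [set (0 : R)] by apply: is_idealI => [|u v -> ->|u v ->] //=; rewrite ?addr0 ?mulr0.
  move=> /(idl_min i0 z)->; exists 0; rewrite !(mul0mx, mulmx0) addr0 raddf0; split=> // s t _; exact: mxE.
pose Q := [set r | exists H : 'M[R]_(rk (kos (y :: l))),
  H *m df (kos (y :: l)) + df (kos (y :: l)) *m H = r%:M /\ forall s t, dg t <> (dg s).+1 -> H s t = 0].
move: r; apply: (idl_min (I := Q)); rewrite /Q.
  apply: is_idealI => /=.
  - exists 0; rewrite !(mul0mx, mulmx0) addr0 raddf0; split=> // s t _; exact: mxE.
  - move=> r r' [H [e h]] [H' [e' h']]; exists (H + H'); split=> [|s t st]; last by rewrite mxE h ?h' ?addr0.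
    by rewrite mulmxDl mulmxDr addrACA e e' raddfD.
  - move=> b r [H [e h]]; exists (b *: H); split=> [|s t st]; last by rewrite mxE h ?mulr0.
    by rewrite -scalemxAl -scalemxAr -scalerDr e scale_scalar_mx.
move=> r /=; rewrite in_cons => /orP[/eqP->|rl].
  exists (block_mx 0 1%:M 0 0); split.
    rewrite /= !mulmx_block !mul0mx !mulmx0 !mul1mx !mulmx1 !addr0 !add0r add_block_mx addr0 add0r.
    by rewrite addNr add0r -scalar_mx_block.
  move=> s t; rewrite /dg /=; case: (split_ordP s) => i ->; case: (split_ordP t) => j -> h;
    rewrite ?block_mxEul ?block_mxEur ?block_mxEdl ?block_mxEdr ?mxE //.
  by case: eqP => // E; case: h; rewrite E.
have [H [e h]] : exists H : 'M[R]_(rk (kos l)), H *m df (kos l) + df (kos l) *m H = r%:M /\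
    forall s t, dg t <> (dg s).+1 -> H s t = 0 by apply: IH; exact: sub_idl.
exists (block_mx H 0 0 (- H)); split.
  rewrite /= !mulmx_block !mul0mx !mulmx0 !addr0 !add0r add_block_mx addr0 e.
  rewrite mul_mx_scalar mul_scalar_mx scalerN addNr mulNmx mulmxN mulmxN mulNmx !opprK e.
  by rewrite -scalar_mx_block.
move=> s t; rewrite /dg /=; case: (split_ordP s) => i ->; case: (split_ordP t) => j -> st;
  rewrite ?block_mxEul ?block_mxEur ?block_mxEdl ?block_mxEdr ?mxE //; first exact: h.
by rewrite h ?oppr0 // => E; apply: st; exact: (congr1 S E).
Qed.

Lemma kos_act_homotopy l r i (v : {ffun 'I_(rk (kos l)) -> R^o}) : idl [set` l] r -> hmg i v ->
  exists (w w' : {ffun 'I_(rk (kos l)) -> R^o}), hmg i.+1 w /\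
    (exists H, w' = act (act v (df (kos l))) H) /\ act w (df (kos l)) = r *: v - w'.
Proof.
move=> /kos_homotopy[H [e h]] hv; exists (act v H), (act (act v (df (kos l))) H); split; last first.
  split; first by exists H.
  by rewrite -!actM -act_scalar -e actDr addrK.
move=> t ti; rewrite ffunE big1 // => s _; case: (eqVneq (dg s) i) => [si|/eqP si].
  by rewrite h ?scale0r // si.
by rewrite hv ?scaler0.
Qed.

Definition kos_e l (r : R) : {ffun 'I_(rk (kos l)) -> R^o} := [ffun t => r * (t == kos_o l)%:R].
Lemma hmg_kos_e l r : hmg 0 (kos_e l r).
Proof. by move=> t t0; rewrite ffunE; case: eqP => [/kos_dg0//|_]; rewrite mulr0. Qed.
Lemma kos_hmg0 l (v : {ffun 'I_(rk (kos l)) -> R^o}) : hmg 0 v -> v = kos_e l (v (kos_o l)).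
Proof.
move=> h; apply/ffunP => t; rewrite ffunE; case: eqP => [->|t0]; first by rewrite mulr1.
by rewrite mulr0; apply: h => /kos_dg0.
Qed.
Lemma kos_bound0 l r : idl [set` l] r -> exists2 w : {ffun 'I_(rk (kos l)) -> R^o}, hmg 1 w &
  act w (df (kos l)) = kos_e l r.
Proof.
move=> lr; have [w [w' [hw [[H ->] e]]]] := kos_act_homotopy lr (hmg_kos_e (l := l) 1).
exists w => //; rewrite e hmg0_act //; last 2 first; [exact: okc_kos|exact: hmg_kos_e|].
rewrite act0l subr0; apply/ffunP => t; rewrite !ffunE; exact: (congr1 _ (mul1r _)).
Qed.
Lemma kos_act_o l (w : {ffun 'I_(rk (kos l)) -> R^o}) : idl [set` l] (act w (df (kos l)) (kos_o l)).
Proof.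
rewrite ffunE; apply: ideal_sum => [|s _]; first exact: idl_ideal.
by rewrite [_ *: _]mulrC; apply: idlM; exact: kos_df_o.
Qed.

Lemma kos_exact l : regular (rev l) -> forall i, (0 < i)%N -> exact_at (kos l) R^o i.
Proof.
elim: l => [|y l IH].
  move=> _ i i0; apply/exact_atP => v hv _; exists 0; first by move=> t _; rewrite ffunE.
  rewrite act0l; apply/ffunP => t; rewrite [RHS]ffunE; apply: hv => /= h; by rewrite -h in i0.
rewrite rev_cons => /regular_rcons[/IH{}IH ry] [|i] // _.
have s0 := submodule0 R^o; have sT := submoduleT (R^o : lmodType R).
case: i => [|i]; last by apply: exq_cone => //; [exact: okc_kos|exact: IH|exact: IH].
apply/exact_atP => v hv; rewrite /= => dv.
have du := congr1 (fun z => fl z) dv; have dr := congr1 (fun z => fr z) dv.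
rewrite fl_act act_scalar in du.
pose u := fl v; pose v0 := fr v.
have hu : @hmg _ (kos l) R^o 1 u by exact: hmg_mconel hv.
have hv0 : @hmg _ (kos l) R^o 0 v0 by exact: hmg_mconer hv.
have Eu : act u (df (kos l)) = - (y *: v0).
  by apply/eqP; rewrite -addr_eq0; apply/eqP; rewrite du; apply/ffunP => t; rewrite !ffunE.
have lv : idl [set` l] (v0 (kos_o l)).
  suff : idl [set` rev l] (v0 (kos_o l)) by apply: idl_mono => x /=; rewrite mem_rev.
  apply: ry; have := kos_act_o u; rewrite Eu !ffunE => /idlN; rewrite opprK.
  by apply: idl_mono => x /=; rewrite mem_rev.
have [w hw Ew] := kos_bound0 lv; rewrite -(kos_hmg0 hv0) in Ew.
have /exact_atP/(_ (u + y *: w)) [||w' hw' Ew'] := IH 1%N isT.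
- by move=> t t1; rewrite ffunE hu // add0r ffunE hw // scaler0.
- by rewrite actDl actZl Eu Ew addNr.
exists (fcat w' (- w)); first by apply: hmg_mcone => //; exact: hmgN.
apply: flr_eq; rewrite ?fl_act ?fr_act fl_cat fr_cat.
  by rewrite act_scalar -Ew' scalerN addrK.
by rewrite act0r add0r actNr actNl opprK Ew.
Qed.

(** Each member of a regular sequence in the ideal of [l] removes homology in one more degree,
    counted from the top. In the induction [pre] is the part already divided out: a cycle times [r]
    bounds by homotopy, the bounding chain is a cycle modulo [r], and dividing by [r] bounds the
    original cycle. *)
Lemma kos_depth l rho pre : regular (pre ++ rho) -> (forall x, x \in rho -> idl [set` l] x) ->
  forall i, (size l - size rho < i)%N -> exq (kos l) (setT : set R^o) (idl [set` pre]) i.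
Proof.
elim: rho pre => [|r rho IH] pre reg rl i hi v _ hv dv.
  exists 0; split=> // [t _|t]; first by rewrite ffunE.
  rewrite act0l subr0 hv; first exact: idl0.
  by move=> ti; move: (dg_kos t) hi; rewrite ti subn0 leqNgt => /negP h /h.
have regr y : idl [set` pre] (r * y) -> idl [set` pre] y.
  have := reg (size pre); rewrite size_cat /= take_size_cat // nth_cat ltnn subnn /=.
  by apply; lia.
have ipre := idl_ideal [set` pre].
have [w [w' [hw [[H w'E] E]]]] := kos_act_homotopy (rl r (mem_head _ _)) hv.
have hw' t : idl [set` pre] (w' t).
  by rewrite w'E; apply: (act_in (M := R^o) _ ipre).
have hE t : act w (df (kos l)) t = r * v t - w' t by rewrite E !ffunE.
have sub : idl [set` pre] `<=` idl [set` rcons pre r].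
  by apply: idl_mono => x /=; rewrite mem_rcons in_cons => ->; rewrite orbT.
have ex1 : exq (kos l) (setT : set R^o) (idl [set` rcons pre r]) i.+1.
  apply: IH => [|x xrho|]; first by rewrite cat_rcons.
    by apply: rl; rewrite in_cons xrho orbT.
  by move: hi => /=; lia.
have [|y [_ hy ye]] := ex1 w (fun _ => I) hw.
  move=> t; rewrite hE; apply: idlD; last by apply: idlN; exact: sub.
  by rewrite mulrC; apply: idlM; apply: sub_idl; rewrite /= mem_rcons mem_head.
have dec x : idl [set` rcons pre r] x -> exists t, idl [set` pre] (x - r * t).
  move: x; apply: (idl_min (I := [set x | exists t, idl [set` pre] (x - r * t)])).
    apply: is_idealI => /=; first by exists 0; rewrite mulr0 subr0; exact: idl0.
      by move=> a b [t ht] [t' ht']; exists (t + t'); rewrite mulrDr opprD addrACA; exact: idlD.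
    by move=> a b [t ht]; exists (a * t); rewrite mulrCA -mulrBr; exact: idlM.
  move=> x /=; rewrite mem_rcons in_cons => /orP[/eqP->|xp].
    by exists 1; rewrite mulr1 subrr; exact: idl0.
  by exists 0; rewrite mulr0 subr0; exact: sub_idl.
have /choice[z hz] t : exists z, idl [set` pre] ((w - act y (df (kos l))) t - r * z) by exact: dec.
pose z' : {ffun 'I_(rk (kos l)) -> R^o} := hproj i.+1 [ffun t => z t].
have hz' t : idl [set` pre] ((w - act y (df (kos l)) - r *: z') t).
  have z'E : z' t = if dg t == i.+1 then z t else 0 by rewrite !ffunE.
  have rzE : (r *: z') t = r * z' t by rewrite ffunE.
  rewrite ffun_subE rzE z'E; case: (eqVneq (dg t) i.+1) => [_|/eqP ti]; first exact: hz.
  rewrite mulr0 subr0 ffun_subE hw // sub0r.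
  have hdy : hmg i.+1 (act y (df (kos l))) by apply: hmg_act => //; exact: okc_kos.
  by rewrite hdy // oppr0; exact: idl0.
exists z'; split=> //; [exact: hmg_hproj|move=> t; apply: regr].
have : idl [set` pre] (act (w - act y (df (kos l)) - r *: z') (df (kos l)) t).
  exact: (act_in (M := R^o) _ ipre).
rewrite !actBl actdd ?subr0; last exact: okc_kos.
rewrite ffun_subE hE actZl ffun_scaleE => h.
have -> : r * (v - act z' (df (kos l))) t = r * v t - w' t - r *: (act z' (df (kos l)) t : R^o) + w' t.
  by rewrite ffun_subE mulrBr addrAC subrK.
exact: idlD.
Qed.

Variables (m : set R) (nR : noetherian_ring R) (lm : locr m).

(** Exactness of the cone makes multiplication by [y] surjective on the homology of the smaller
    complex, which vanishes by Nakayama's lemma. Degree 1 of the cone then says that [y] is regular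
    modulo the ideal of [l]. *)
Lemma kos_regular l : (forall x, x \in l -> m x) -> (forall i, (0 < i)%N -> exact_at (kos l) R^o i) ->
  regular (rev l).
Proof.
elim: l => [|y l IH] lm' ex; first by move=> i.
have my : m y by apply: lm'; exact: mem_head.
rewrite rev_cons; apply/regular_rcons; split.
  apply: IH => [x xl|i i0]; first by apply: lm'; rewrite in_cons xl orbT.
  apply/exact_atP.
  pose Z := [set v : {ffun 'I_(rk (kos l)) -> R^o} | hmg i v /\ act v (df (kos l)) = 0].
  pose B := [set v : {ffun 'I_(rk (kos l)) -> R^o} | exists2 w : {ffun 'I_(rk (kos l)) -> R^o}, hmg i.+1 w & v = act w (df (kos l))].
  have hZ (b : R) v : @hmg _ (kos l) R^o i v -> hmg i (b *: v).
    by move=> h t ti; rewrite ffunE h // scaler0.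
  have sZ : submodule Z.
    split; first by split; [move=> t _; rewrite ffunE|exact: act0l].
      by move=> u v [hu eu] [hv ev]; split; [exact: hmgD|rewrite actDl eu ev addr0].
    by move=> b v [hv ev]; split; [exact: hZ|rewrite actZl ev scaler0].
  have sB : submodule B.
    split; first by exists 0; [move=> t _; rewrite ffunE|rewrite act0l].
      by move=> _ _ [w hw ->] [w' hw' ->]; exists (w + w'); [exact: hmgD|rewrite actDl].
    move=> b _ [w hw ->]; exists (b *: w); last by rewrite actZl.
    by move=> t ti; rewrite ffunE hw // scaler0.
  suff ZB : Z `<=` B by move=> v hv ev; apply: ZB.
  apply: (nakayama lm (noeth_ffun nR sZ) sB) => u [hu eu].
  have /exact_atP/(_ (fcat u 0)) [||w hw E] := ex i i0.
  - case: i i0 hu {Z B hZ sZ sB eu} => // i _ hu; apply: hmg_mcone => //.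
    by move=> t _; rewrite ffunE.
  - apply: flr_eq; rewrite ?fl_act ?fr_act fl_cat fr_cat; apply/ffunP => t.
      by rewrite act0l addr0 eu !ffunE.
    by rewrite act0l act0r addr0 !ffunE.
  have e1 := congr1 (fun z => fl z) E; have e2 := congr1 (fun z => fr z) E.
  rewrite fl_cat /= fl_act act_scalar in e1; rewrite fr_cat /= fr_act act0r add0r actNr in e2.
  exists 1%N, (fun=> y), (fun=> fr w); rewrite big_ord1; split=> [_|].
    split=> //; split; first exact: hmg_mconer hw.
    by apply/eqP; rewrite -oppr_eq0 -e2.
  exists (fl w); first exact: hmg_mconel hw.
  by rewrite e1 addrK.
move=> r yr; have {}yr : idl [set` l] (y * r) by apply: idl_mono yr => x /=; rewrite mem_rev.
suff : idl [set` l] r by apply: idl_mono => x /=; rewrite mem_rev.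
have [w hw E] := kos_bound0 yr.
have ew : act (kos_e l r) (df (kos l)) = 0 by apply: hmg0_act; [exact: okc_kos|exact: hmg_kos_e].
have /exact_atP/(_ (fcat w (- kos_e l r))) [||z hz Ez] := ex 1%N isT.
- by apply: hmg_mcone => //; apply: hmgN; exact: hmg_kos_e.
- apply: flr_eq; rewrite ?fl_act ?fr_act fl_cat fr_cat; apply/ffunP => t.
    rewrite act_scalar E scalerN !ffunE; apply/eqP; rewrite subr_eq0; apply/eqP; exact: (esym (mulrA _ _ _)).
  by rewrite act0r add0r actNr actNl opprK ew !ffunE.
have e2 := congr1 (fun z => fr z) Ez.
rewrite fr_cat /= fr_act act0r add0r actNr in e2.
have := kos_act_o (fr z); rewrite -[act _ _]opprK -e2 !ffunE eqxx mulr1 opprK; exact.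
Qed.

Variables (C : cpx R) (o : 'I_(rk C)) (N : lmodType R) (c L : nat).
Hypotheses (mC : minres m L o) (tN : torvan c N) (cL : (c.+1 <= L)%N).

(** Multiplication by [u] embeds [R / m] in [R / (z)] and lifts to a map [Psi] from the resolution
    to the Koszul complex. Its cone resolves the cokernel, so over [N] it is exact in degree [c.+1];
    as the Koszul complex stops below degree [c], the resolution would be exact over [N] in degree
    [c]. *)
Lemma socle_of_torvan (z : seq R) u : (size z < c)%N -> regular (rev z) -> ~ exact_at C N c ->
  ~ idl [set` z] u -> (forall r, m r -> idl [set` z] (r * u)) -> False.
Proof.
move=> zc reg nex zu hu; have [okC dg0 mdf exC him] := mC.
have okK := okc_kos z; have exK := kos_exact reg.
pose n := (\max_(s : 'I_(rk C)) dg s).+1.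
have red s t x : (0 : 'M[R]_(rk C, rk (kos z))) s t + 1 * x = x by rewrite mxE add0r mul1r.
have [|Psi sP mP] := @build_map R C (kos z) 0 0 1 (fun s rho => s = o -> rho = kos_e z u) okC.2 n.
  move=> i Psi i_n sP mP s si.
  case: i i_n mP si => [|[|i]] i_n mP si.
  - have so : s = o by apply/dg0.
    exists (kos_e z u); split=> [|//|t]; first by rewrite addn0; exact: hmg_kos_e.
    rewrite hmg0_act ?addn0 //; last exact: hmg_kos_e.
    rewrite red [LHS]ffunE mxE big1 // => k _; rewrite okC.2 ?mul0r //; rewrite si; by [].
  - have [_ /(_ erefl) Po] := mP o (eq_leq (congr1 S ((dg0 o).2 erefl))).
    have [w hw E] := kos_bound0 (hu _ (mdf s o)).
    exists w; split=> [||t]; [by rewrite addn0|by move=> so; move: si; rewrite so ((dg0 o).2 erefl)|].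
    rewrite red E ffunE mxE (bigD1 o) //= big1 ?addr0 => [|k ko]; last first.
      rewrite okC.2 ?mul0r // si => -[k0]; move/eqP: ko; apply; apply/dg0; by rewrite k0.
    have := congr1 (fun v : {ffun _} => v t) Po; rewrite !ffunE => ->; exact: (esym (mulrA _ _ _)).
  - have := exK i.+1 isT; move/exact_atP/(_ [ffun t => (df C *m Psi) s t]) => [t ti||w hw E].
    + rewrite ffunE mxE big1 // => k _; case: (eqVneq (dg s) (dg k).+1) => [e|/eqP e].
        by rewrite sP ?mulr0 // addn0 => e'; apply: ti; rewrite e'; move: e; rewrite si => -[].
      by rewrite okC.2 ?mul0r.
    + apply/ffunP => t; rewrite act_row -mulmxA [RHS]ffunE.
      transitivity ((df C *m (df C *m Psi)) s t); last by rewrite mulmxA okC.1 mul0mx mxE.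
      rewrite [LHS]mxE [RHS]mxE; apply: eq_bigr => k _.
      case: (eqVneq (dg s) (dg k).+1) => [e|/eqP e]; last by rewrite okC.2 ?mul0r.
      have dk : (dg k < i.+2)%N by move: e; rewrite si => -[<-].
      by have [hk _] := mP k dk; rewrite hk red.
    exists w; split=> [|so|t]; [by rewrite addn0|by move: si; rewrite so ((dg0 o).2 erefl)|].
    by rewrite red -E ffunE.
have sn (s : 'I_(rk C)) : (dg s < n)%N by rewrite ltnS (bigD1 s) //= leq_maxl.
have cm : chain_map Psi.
  split; first by apply/matrixP => s t; have [-> _] := mP s (sn s); exact: red.
  by move=> s t st; apply: sP; rewrite addn0 => e; apply: st.
have Po : [ffun t => Psi o t] = kos_e z u by have [_] := mP o (sn o); exact.
have okM := okc_mcone okC okK cm.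
have s0 := submodule0 R^o; have sT := submoduleT (R^o : lmodType R).
have ho (v : {ffun 'I_(rk C) -> R^o}) : hmg 0 v -> act v Psi = kos_e z (v o * u).
  move=> hv; apply/ffunP => t; rewrite ffunE (bigD1 o) //= big1 ?addr0 => [|k ko]; last first.
    by rewrite hv ?scaler0 // => /dg0 e; rewrite e eqxx in ko.
  have := congr1 (fun v : {ffun _} => v t) Po; rewrite !ffunE => ->.
  by rewrite -[_ *: _]/(_ * _) mulrC mulrA.
have exM : exact_to (mcone Psi) L.
  case=> [|[|i]] // /andP[_ iL]; last first.
    by apply: exq_mcone => //; [apply: exC; lia|exact: exK].
  apply/exact_atP => v hv dv.
  have e1 := congr1 (fun z => fl z) dv; rewrite /= fl_act in e1.
  have hv0 : @hmg _ C R^o 0 (fr v) by exact: hmg_mconer hv.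
  have hv1 : @hmg _ (kos z) R^o 1 (fl v) by exact: hmg_mconel hv.
  have mvo : m (fr v o).
    apply: contrapT => /(let: And3 _ _ h := lm in h)[b vb]; apply: zu.
    have := kos_act_o (fl v); rewrite (_ : act (fl v) _ = - act (fr v) Psi); last first.
      by apply/eqP; rewrite -addr_eq0; apply/eqP; rewrite e1; apply/ffunP => t; rewrite !ffunE.
    rewrite ho // ffunE ffunE eqxx mulr1 => /idlN; rewrite opprK => /(idlM b).
    by rewrite mulrA [b * _]mulrC vb mul1r.
  have [w hw Ew] := him _ mvo.
  have Ew' : act w (df C) = fr v.
    apply/ffunP => t; rewrite Ew; case: eqP => [->|to]; first by rewrite mulr1.
    by rewrite mulr0; apply/esym; apply: hv0 => /dg0.
  have /exact_atP/(_ (fl v + act w Psi)) [||w' hw' Ew2] := exK 1%N isT.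
  - apply: hmgD => // t t1; rewrite ffunE big1 // => k _.
    case: (eqVneq (dg k) 1%N) => [k1|/eqP k1]; last by rewrite hw ?scaler0.
    by rewrite cm.2 ?scale0r // k1 => e; apply: t1.
  - rewrite actDl -actM cm.1 actM Ew' e1; apply/ffunP => t; by rewrite !ffunE.
  exists (fcat w' (- w)); first by apply: hmg_mcone => //; exact: hmgN.
  apply: flr_eq; rewrite ?fl_act ?fr_act fl_cat fr_cat.
    by rewrite -Ew2 actNl addrK.
  by rewrite act0r add0r actNr actNl opprK Ew'.
have /exact_atP exN : exact_at (mcone Psi) N c.+1.
  by apply: (tN okM (ltnSn c)) => s /andP[s1 s2]; apply: exM; rewrite s1; exact: leq_trans s2 cL.
apply: nex; apply/exact_atP => v hv dv.
have [||w hw E] := exN (fcat 0 v).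
- by apply: hmg_mcone => // t _; rewrite ffunE.
- apply: flr_eq; rewrite ?fl_act ?fr_act fl_cat fr_cat; apply/ffunP => t.
    rewrite act0l add0r [RHS]ffunE [RHS]ffunE ffunE big1 // => k _.
    case: (eqVneq (dg k) c) => [kc|/eqP kc]; last by rewrite hv ?scaler0.
    rewrite cm.2 ?scale0r // kc => e; have := dg_kos t; rewrite -e; lia.
  by rewrite act0l add0r actNr dv !ffunE oppr0.
have e2 := congr1 (fun z => fr z) E; rewrite fr_cat /= fr_act act0r add0r actNr in e2.
exists (- fr w); last by rewrite actNl.
by apply: hmgN; exact: hmg_mconer hw.
Qed.
End Koszul.

(** * Existence of regular sequences *)

Section RegularElements.
Variables (R : comPzRingType) (m : set R).
Hypotheses (nR : noetherian_ring R) (lm : locr m).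

Lemma noeth_over_any (I : set R) : is_ideal I -> noeth_over I.
Proof.
move=> iI K iK IK; have [s Ks] := nR iK; exists s; split; first by move=> x xs; rewrite Ks; exact: sub_idl.
by rewrite {1}Ks => x hx; apply: (addmr iI).
Qed.

Definition colon (I : set R) u : set R := [set x | I (x * u)].
Lemma colon_ideal I u : is_ideal I -> is_ideal (colon I u).
Proof.
move=> iI; apply: is_idealI => [|x y hx hy|a x hx]; rewrite /colon /= ?mul0r; first exact: ideal0.
  by rewrite mulrDl; exact: idealD.
by rewrite -mulrA; exact: idealM.
Qed.

(** [colon I u] is maximal among the annihilators of nonzero classes modulo [I], hence an associated
    prime. *)
Definition maxcolon I u := ~ I u /\ forall v, ~ I v -> colon I u `<=` colon I v -> colon I v `<=` colon I u.

Lemma maxcolon_exists I r : is_ideal I -> ~ I r -> exists2 u, maxcolon I u & colon I r `<=` colon I u.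
Proof.
move=> iI nr; have [||J [u [nu ru] <-] Jmax] := noeth_ideal_max nR
  (F := [set J | exists2 u, ~ I u /\ colon I r `<=` colon I u & colon I u = J]).
- by move=> J [u _ <-]; exact: colon_ideal.
- by exists (colon I r); exists r => //; split.
exists u => //; split=> // v nv uv; apply: Jmax => //; exists v => //; split=> //.
exact: subset_trans uv.
Qed.

Lemma maxcolon_prime I u : is_ideal I -> maxcolon I u -> prime_ideal (colon I u).
Proof.
move=> iI [nu umax]; split; [exact: colon_ideal|by rewrite /colon /= mul1r|].
move=> x y hxy; case: (pselect (colon I u y)) => [|ny]; [by right|left].
apply: (umax (y * u) ny); last by rewrite /colon /= mulrA.
by move=> z hz; rewrite /colon /= mulrCA; exact: idealM.
Qed.

(** Primes are added one at a time: an element falling into the new prime is corrected by one that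
    lies in all the other primes but not in the new one. *)
Lemma avoidance (J : set R) (l : seq (set R)) : is_ideal J -> (forall i, (i < size l)%N -> prime_ideal (nth J l i)) ->
  (forall i j, (i < size l)%N -> (j < size l)%N -> nth J l i `<=` nth J l j -> nth J l j `<=` nth J l i) ->
  (forall i, (i < size l)%N -> ~ (J `<=` nth J l i)) ->
  exists2 y, J y & forall i, (i < size l)%N -> ~ nth J l i y.
Proof.
move=> iJ; elim: l => [|P l IH] pl inc nJ; first by exists 0; [exact: ideal0|].
have [|||y Jy ny] := IH.
- by move=> i il; exact: (pl i.+1).
- by move=> i j il jl; exact: (inc i.+1 j.+1).
- by move=> i il; exact: (nJ i.+1).
case: (pselect (P y)) => [Py|nPy]; last by exists y => // -[_|i il] //; exact: (ny i il).
have pP : prime_ideal P := pl 0%N isT; have [iP P1 pP'] := pP.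
have [w [Jw nPw lw]] : exists w, [/\ J w, ~ P w & forall i, (i < size l)%N -> nth J l i w].
  suff H k : (k <= size l)%N -> exists w, [/\ J w, ~ P w & forall i, (i < k)%N -> nth J l i w] by apply: H.
  elim: k => [|k IHk] kl.
    by have /existsNP[w /not_implyP[Jw Pw]] := nJ 0%N isT; exists w.
  have [w [Jw nPw lw]] := IHk (ltnW kl).
  have /existsNP[t /not_implyP[kt nPt]] : ~ (nth J l k `<=` P).
    by move=> h; apply: (ny k kl); apply: (inc k.+1 0%N) => //; exact: Py.
  exists (t * w); split; [exact: idealM|by move=> /pP'[]|].
  move=> i; rewrite ltnS leq_eqVlt => /orP[/eqP->|ik].
    by have [ik _ _] := pl k.+1 kl; exact: idealMr.
  by have [ii _ _] := pl i.+1 (ltn_trans ik kl); apply: idealM => //; exact: lw.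
exists (y + w); first exact: idealD.
case=> [_|i il] /=; first by rewrite addrC => h; apply: nPw; exact: (ideal_addr iP Py h).
have [ii _ _] := pl i.+1 il; move=> h; apply: (ny i il); exact: (ideal_addr ii (lw i il) h).
Qed.

(** If no single [u] served, prime avoidance would give an infinite sequence of maximal
    annihilators, each with an element outside all the earlier ones. Some [u k] is a combination of
    its predecessors modulo [I]; a product of elements taken from their annihilators, outside that
    of [u k], kills the combination but not [u k]. *)
Lemma zero_divisors (I J : set R) : is_ideal I -> is_ideal J ->
  (forall y, J y -> exists2 r, ~ I r & I (y * r)) -> exists2 u, ~ I u & J `<=` colon I u.
Proof.
move=> iI iJ zd; apply: contrapT => no.
have noJ u : ~ I u -> ~ (J `<=` colon I u) by move=> nu h; apply: no; exists u.
pose Q (s : seq R) (u : R) := (forall x, x \in s -> maxcolon I x) ->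
  maxcolon I u /\ exists2 y, colon I u y & forall x, x \in s -> ~ colon I x y.
have [u hu] : exists u : nat -> R, forall k, Q (mkseq u k) (u k).
  apply: prefix_choice => s; case: (pselect (forall x, x \in s -> maxcolon I x)) => [sm|ns]; last by exists 0.
  have nthE i : (i < size s)%N -> nth J (map (colon I) s) i = colon I s`_i by move=> h; rewrite (nth_map 0).
  have [|||y Jy ny] := @avoidance J (map (colon I) s) iJ.
  - by move=> i; rewrite size_map => il; rewrite nthE //; apply: maxcolon_prime => //; apply: sm; exact: mem_nth.
  - move=> i j; rewrite size_map => il jl; rewrite !nthE //.
    by have [_ +] := sm _ (mem_nth 0 il); apply; case: (sm _ (mem_nth 0 jl)).
  - move=> i; rewrite size_map => il; rewrite nthE //; apply: noJ.
    by case: (sm _ (mem_nth 0 il)).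
  have [r nr yr] := zd y Jy; have [v mv rv] := maxcolon_exists iI nr.
  exists v => _; split=> //; exists y; first exact: rv.
  move=> x xs; have := ny (index x s); rewrite size_map nthE ?index_mem // nth_index //; exact.
have um k x : x \in mkseq u k -> maxcolon I x.
  elim: k x => [|k IH] x // /mapP[i]; rewrite mem_iota => /andP[_ ile] ->.
  move: ile; rewrite add0n ltnS leq_eqVlt => /orP[/eqP->|lt]; first by case: (hu k IH).
  by apply: IH; apply: map_f; rewrite mem_iota.
have {}hu k := hu k (@um k).
have [k /(idlpP I)[i Ii [w uE]]] := noeth_over_seq iI u (noeth_over_any iI).
have [mk [y ky ny]] := hu k; have pk := maxcolon_prime iI mk; have [ik k1 pk'] := pk.
have mem (j : nat) : (j < k)%N -> u j \in mkseq u k by move=> jk; apply: map_f; rewrite mem_iota.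
have H j : (j <= k)%N -> exists2 t, ~ colon I (u k) t & forall i, (i < j)%N -> colon I (u i) t.
  elim: j => [|j IH] jk; first by exists 1.
  have [t nt ht] := IH (ltnW jk).
  have /existsNP[e /not_implyP[je nke]] : ~ (colon I (u j) `<=` colon I (u k)).
    move=> h; apply: (ny _ (mem j jk)); have [_ jm] := um _ _ (mem j jk).
    by apply: (jm (u k)) => //; case: mk.
  exists (e * t); first by move=> /pk'[].
  move=> i0; have iu := colon_ideal (u i0) iI; rewrite ltnS leq_eqVlt => /orP[/eqP i0j|/ht h].
    by apply: (idealMr _ iu); rewrite i0j.
  exact: (idealM _ iu).
have [t nt ht] := H k (leqnn k); apply: nt; rewrite /colon /= uE mulrDr.
apply: idealD => //; first exact: idealM.
rewrite size_mkseq mulr_sumr; apply: ideal_sum => // j _; rewrite nth_mkseq // mulrCA; apply: idealM => //.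
exact: (ht j).
Qed.

(** When [m^h] has no regular element modulo [z], it is annihilated by one [u] outside the ideal,
    and a multiple of [u] is a socle element, which the hypothesis forbids for sequences shorter
    than [c]. *)
Lemma regular_exists c h : (0 < h)%N ->
  (forall z u, (size z < c)%N -> regular (rev z) -> (forall x, x \in z -> m x) -> ~ idl [set` z] u ->
     (forall r, m r -> idl [set` z] (r * u)) -> False) ->
  exists z, [/\ size z = c, regular (rev z) & forall x, x \in z -> ideal_pow m h x].
Proof.
have [im m1 _] := lm.
move=> h0 soc; suff H j : (j <= c)%N -> exists z, [/\ size z = j, regular (rev z) & forall x, x \in z -> ideal_pow m h x].
  exact: H.
elim: j => [|j IH] jc; first by exists [::]; split.
have [z [sz rz zh]] := IH (ltnW jc).
have zm x : x \in z -> m x.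
  by move=> /zh; rewrite -(prednK h0) => hx; rewrite -(ideal_pow1 im); exact: (ideal_pow_le im _ hx).
have iI := idl_ideal [set` z]; have iJ := ideal_pow_ideal m h.
suff [y hy ry] : exists2 y, ideal_pow m h y & forall r, idl [set` z] (y * r) -> idl [set` z] r.
  exists (y :: z); split=> [/=||x]; [by rewrite sz| |by rewrite in_cons => /orP[/eqP->|/zh]].
  rewrite rev_cons; apply/regular_rcons; split=> // r hr.
  have e : idl [set` rev z] = idl [set` z].
    by apply/seteqP; split; apply: idl_mono => x /=; rewrite mem_rev.
  by rewrite e in hr *; exact: ry.
apply: contrapT => no.
have [|u nu hu] := zero_divisors iI iJ.
  move=> y hy; apply: contrapT => no'; apply: no; exists y => // r hr; apply: contrapT => nr.
  by apply: no'; exists r.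
have [|v nv hv] := @socle_ideal R m (colon (idl [set` z]) u) h (colon_ideal u iI) hu.
  by rewrite /colon /= mul1r.
by apply: (soc z (v * u) _ rz zm nv) => [|r mr]; rewrite ?sz // mulrA; exact: hv.
Qed.
End RegularElements.

(** * Regular sequences under polynomial and flat extensions and quotients *)

Definition regp (R : comPzRingType) (pre l : seq R) := forall i, (i < size l)%N -> forall y : R,
  idl [set` pre ++ take i l] (l`_i * y) -> idl [set` pre ++ take i l] y.

Lemma regular_cat (R : comPzRingType) (pre l : seq R) : regular pre -> regp pre l -> regular (pre ++ l).
Proof.
move=> h1 h2 i; rewrite size_cat take_cat nth_cat => hi y.
case: (ltnP i (size pre)) => il; first exact: (h1 i il y).
have il' : (i - size pre < size l)%N by lia.
exact: (h2 _ il' y).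
Qed.
Lemma regp_rcons (R : comPzRingType) (pre l : seq R) e : regp pre l ->
  (forall y, idl [set` pre ++ l] (e * y) -> idl [set` pre ++ l] y) -> regp pre (rcons l e).
Proof.
move=> h1 h2 i; rewrite size_rcons ltnS leq_eqVlt => /orP[/eqP->|il] y.
  by rewrite nth_rcons ltnn eqxx -cats1 take_size_cat //; exact: h2.
by rewrite nth_rcons il -cats1 take_cat il; exact: (h1 i il y).
Qed.

Section PolyLists.
Variables (R : comNzRingType).

Lemma idl_polyC (l : seq R) (p : {poly R}) : idl [set` map polyC l] p <-> forall i, idl [set` l] p`_i.
Proof.
split=> [|h].
  move: p; apply: (idl_min (I := pcoef (idl [set` l]))); first exact: pcoef_ideal (idl_ideal _).
  move=> _ /= /mapP[x xl ->] i; rewrite coefC; case: eqP => _; [exact: sub_idl|exact: idl0].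
rewrite [p]poly_sumX; apply: ideal_sum => [|i _]; first exact: idl_ideal.
apply: idlM; apply: (idl_push (f := polyC)) (h i) => x xl; apply: sub_idl; exact: map_f.
Qed.
Lemma idl_polyC_X (l : seq R) k (p : {poly R}) :
  idl [set` rcons (map polyC l) 'X^k] p <-> forall i, (i < k)%N -> idl [set` l] p`_i.
Proof.
split=> [|h].
  move: p; apply: (idl_min (I := [set p : {poly R} | forall i, (i < k)%N -> idl [set` l] p`_i])).
    apply: is_idealI => /= [i _|x y hx hy i ik|a x hx i ik]; first by rewrite coef0; exact: idl0.
      by rewrite coefD; apply: idlD; [exact: hx|exact: hy].
    rewrite coefM; apply: ideal_sum => [|j _]; first exact: idl_ideal.
    by apply: idlM; apply: hx; apply: leq_ltn_trans ik; exact: leq_subr.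
  move=> p /=; rewrite mem_rcons in_cons => /orP[/eqP->|/mapP[x xl ->]] i ik.
    by rewrite coefXn (ltn_eqF ik); exact: idl0.
  by rewrite coefC; case: eqP => _; [exact: sub_idl|exact: idl0].
rewrite [p]poly_sumX; apply: ideal_sum => [|i _]; first exact: idl_ideal.
case: (ltnP i k) => ik.
  apply: idlM; apply: (idl_push (f := polyC)) (h i ik) => x xl; apply: sub_idl => /=.
  by rewrite mem_rcons in_cons map_f ?orbT.
rewrite -(subnK ik) exprD mulrC; apply: idlM; apply: idlM; apply: sub_idl => /=.
by rewrite mem_rcons mem_head.
Qed.
Lemma regp_polyC (pre l : seq R) : regp pre l -> regp (map polyC pre) (map polyC l).
Proof.
move=> h i; rewrite size_map => il y; rewrite -map_take -map_cat (nth_map 0) //.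
by move=> /idl_polyC hy; apply/idl_polyC => j; apply: (h i il); have := hy j; rewrite coefCM.
Qed.

End PolyLists.

Section TowerLists.
Variables (R : comNzRingType) (T : eqType).
(** The [k]-th powers of the variables. The variables themselves serve for maximal ideals, for the
    closed fibre and for prime chains, high powers to reach the kernel of the map to [S]. *)
Fixpoint ys (s : seq T) k : seq (tw R s) :=
  match s return seq (tw R s) with
  | [::] => [::]
  | x :: s' => rcons (map polyC (ys s' k)) 'X^k
  end.
Lemma size_ys s k : size (ys s k) = size s.
Proof. by elim: s => [|x s IH] //=; rewrite size_rcons size_map IH. Qed.
Lemma cat_ys x s k (pre : seq R) : map (cst R (x :: s)) pre ++ ys (x :: s) k =
  rcons (map polyC (map (cst R s) pre ++ ys s k)) 'X^k.
Proof. by rewrite /= map_cat -map_comp rcons_cat. Qed.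
Lemma regp_ys (s : seq T) k pre : regp (map (cst R s) pre) (ys s k).
Proof.
elim: s => [|x s IH]; first by move=> i.
have e : map (cst R (x :: s)) pre = map polyC (map (cst R s) pre) by rewrite -map_comp.
rewrite e; refine (regp_rcons (regp_polyC IH) _).
move=> y; rewrite -map_cat => /idl_polyC hy; apply/idl_polyC => i.
by have := hy (k + i)%N; rewrite coefXnM ltnNge leq_addr /= addKn.
Qed.
Lemma regular_cst (s : seq T) (zs : seq R) : regular zs -> regular (map (cst R s) zs).
Proof.
move=> h; elim: s => [|x s IH]; first by rewrite map_id.
rewrite (_ : map _ zs = map polyC (map (cst R s) zs)); last by rewrite -map_comp.
exact: (@regp_polyC _ [::] _ IH).
Qed.
Lemma colon_ys (s : seq T) k (pre : seq R) a : (forall y, idl [set` pre] (a * y) -> idl [set` pre] y) ->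
  forall y, idl [set` map (cst R s) pre ++ ys s k] (cst R s a * y) -> idl [set` map (cst R s) pre ++ ys s k] y.
Proof.
move=> h; elim: s => [|x s IH] y; first by rewrite cats0 map_id; exact: h.
rewrite cat_ys => /idl_polyC_X hy; apply/idl_polyC_X => i ik; apply: IH.
by have := hy i ik; rewrite coefCM.
Qed.
Lemma ys_const s (p : tw R s) : exists r, idl [set` ys s 1] (p - cst R s r).
Proof.
elim: s p => [|x s IH] p; first by exists p; rewrite subrr; exact: idl0.
have [r hr] := IH p`_0; exists r; apply/idl_polyC_X => -[|i] // _.
by rewrite coefB /= coefC.
Qed.
Lemma ys_mem s k e : uniq s -> e \in ys s k -> exists2 t, t \in s & e = var R s t ^+ k.
Proof.
elim: s e => [|x s IH] e //= /andP[xs us]; rewrite mem_rcons in_cons => /orP[/eqP->|/mapP[e' /(IH _ us)[t ts ->] ->]].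
  by exists x; rewrite ?mem_head // eqxx.
exists t; first by rewrite in_cons ts orbT.
by case: eqP => [tx|_]; [rewrite tx (negbTE xs) in ts|rewrite rmorphXn].
Qed.
End TowerLists.

Section FlatPush.
Variables (A B : comPzRingType) (c : {rmorphism A -> B}).
Hypothesis cflat : eqflat (restrict c B^o).

(** By flatness a relation between the images of [s] and [l] is a combination of relations over [A],
    and in those the coefficient of [s] already lies in the ideal of [l]. *)
Lemma colon_push (l : seq A) s : (forall y, idl [set` l] (s * y) -> idl [set` l] y) ->
  forall x, idl [set` map c l] (c s * x) -> idl [set` map c l] x.
Proof.
move=> h x /idl_seqP[e]; rewrite size_map => E; pose k := size l.
pose D : 'M[A]_(1 + k, 1) := col_mx s%:M (\col_(j < k) l`_j).
pose v : {ffun 'I_(1 + k) -> restrict c B^o} := fcat [ffun=> x : restrict c B^o] [ffun j : 'I_k => (- e j : restrict c B^o)].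
have [|q [b [y [bD vE]]]] := @cflat _ _ D v.
  apply/ffunP => t; rewrite !ffunE big_split_ord big_ord1 /= !ffunE split_l col_mxEu mxE !ord1 eqxx mulr1n ffunE.
  rewrite -[s *: _]/(c s * x) E -big_split big1 // => j _ /=.
  rewrite !ffunE split_r col_mxEd mxE ffunE -[_ *: _]/(c l`_j * - e j) (nth_map 0) //; ring.
have xE : x = \sum_i c (b i (lshift k 0)) * (y i : B).
  by have := congr1 (fun w : {ffun _} => w (lshift k 0)) vE; rewrite /v !ffunE split_l ffunE.
rewrite xE; apply: ideal_sum => [|i _]; first exact: idl_ideal.
rewrite mulrC; apply: idlM.
apply: (idl_push (f := c) (X := [set` l])); first by move=> z zl; apply: sub_idl; exact: map_f.
apply: h; have := congr1 (fun M : 'M[A]_(q, 1) => M i 0) bD.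
rewrite [RHS]mxE mxE big_split_ord big_ord1 /= col_mxEu [(s%:M) 0 0]mxE eqxx mulr1n => /eqP.
rewrite addr_eq0 mulrC => /eqP ->; apply: idlN; apply: ideal_sum => [|j _]; first exact: idl_ideal.
by rewrite col_mxEd mxE; apply: idlM; apply: sub_idl; exact: mem_nth.
Qed.

Lemma regp_push (pre l : seq A) : regp pre l -> regp (map c pre) (map c l).
Proof.
move=> h i; rewrite size_map => il y; rewrite -map_take -map_cat (nth_map 0) //.
by apply: colon_push => z; exact: (h i il z).
Qed.
Lemma regular_push (l : seq A) : regular l -> regular (map c l).
Proof. exact: (@regp_push [::]). Qed.

Variables (R : comPzRingType) (phi : {rmorphism R -> A}).
Hypothesis pflat : eqflat (restrict phi A^o).

Lemma eqflat_rows q n k (D : 'M[R]_(n, k)) (M : 'M[A]_(q, n)) : M *m map_mx phi D = 0 ->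
  exists r (C : 'M[R]_(r, n)) (Z : 'M[A]_(q, r)), C *m D = 0 /\ M = Z *m map_mx phi C.
Proof.
elim: q M => [|q IH] M hM.
  exists 0%N, 0, 0; split; first exact: mul0mx.
  by apply/matrixP => -[].
pose M' : 'M[A]_(1 + q, n) := M.
have hM' : M' *m map_mx phi D = 0 by [].
have eu : usubmx M' *m map_mx phi D = 0 by rewrite mul_usub_mx hM' linear0.
have ed : dsubmx M' *m map_mx phi D = 0 by rewrite mul_dsub_mx hM' linear0.
have [r2 [C2 [Z2 [CD2 E2]]]] := IH _ ed.
have [|r1 [C1 [y [CD1 E1]]]] := @pflat _ _ D [ffun j => usubmx M' 0 j : restrict phi A^o].
  apply/ffunP => j; rewrite !ffunE; have := congr1 (fun N : 'M[A]__ => N 0 j) eu.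
  rewrite [RHS]mxE mxE => e0; rewrite -[RHS]e0; apply: eq_bigr => i _; rewrite ffunE [map_mx _ _ _ _]mxE; exact: mulrC.
exists (r1 + r2)%N, (col_mx C1 C2), (block_mx (\row_i (y i : A)) 0 0 Z2); split.
  by rewrite mul_col_mx CD1 CD2 col_mx0.
suff : M' = block_mx (\row_i (y i : A)) 0 0 Z2 *m map_mx phi (col_mx C1 C2) by [].
rewrite (@map_col_mx _ _ phi) mul_block_col !mul0mx addr0 add0r -E2 -[LHS](vsubmxK M'); congr col_mx.
apply/matrixP => i j; rewrite ord1; have := congr1 (fun w : {ffun _} => w j) E1; rewrite !ffunE => ->.
by rewrite mxE; apply: eq_bigr => t _; rewrite !mxE; exact: mulrC.
Qed.

Lemma eqflat_comp : eqflat (restrict (c \o phi) B^o).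
Proof.
move=> n k D x hx; have [|q [M [y [MD xE]]]] := @cflat n k (map_mx phi D) x.
  by rewrite -hx; apply/ffunP => j; rewrite !ffunE; apply: eq_bigr => i _; rewrite mxE.
have [r [C [Z [CD E]]]] := eqflat_rows MD.
exists r, C, (act y Z : {ffun 'I_r -> B}); split=> //.
rewrite xE E actM; apply/ffunP => j; rewrite !ffunE; apply: eq_bigr => i _; by rewrite mxE.
Qed.
End FlatPush.

Lemma eqflat_id (R : comPzRingType) : eqflat (restrict (idfun : {rmorphism R -> R}) R^o).
Proof.
move=> n k D x hx; exists 1%N, (\row_j (x j : R)), [ffun=> (1 : R)]; split.
  apply/matrixP => i j; rewrite mxE [RHS]mxE; have := congr1 (fun w : {ffun _} => w j) hx; rewrite !ffunE => e0; rewrite -[RHS]e0.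
  by apply: eq_bigr => l _; rewrite mxE; exact: mulrC.
by apply/ffunP => j; rewrite ffunE big_ord1 mxE ffunE; exact: (esym (mulr1 _)).
Qed.

Lemma eqflat_polyC (R : comNzRingType) : eqflat (restrict (polyC : {rmorphism R -> {poly R}}) {poly R}^o).
Proof.
move=> n k D x hx; pose N := (\max_(j < n) size (x j : {poly R}))%N.
exists N, (\matrix_(i, j) (x j : {poly R})`_i), [ffun i : 'I_N => ('X^i : restrict (polyC : {rmorphism R -> {poly R}}) {poly R}^o)]; split.
  apply/matrixP => i j; rewrite mxE [RHS]mxE.
  have := congr1 (fun w : {ffun _} => (w j : {poly R})`_i) hx; rewrite !ffunE coef0 => e0; rewrite -[RHS]e0.
  rewrite coef_sum; apply: eq_bigr => l _; rewrite mxE.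
  by rewrite -[_ *: _]/((D l j)%:P * (x l : {poly R})) coefCM mulrC.
apply/ffunP => j; rewrite ffunE; have sx : (size (x j : {poly R}) <= N)%N by rewrite /N (bigD1 j) //= leq_maxl.
transitivity (\poly_(i < N) (x j : {poly R})`_i).
  apply/polyP => i; rewrite coef_poly; case: ltnP => // h; by rewrite nth_default // (leq_trans sx).
rewrite poly_def; apply: eq_bigr => i _; rewrite mxE ffunE -mul_polyC; by [].
Qed.

Lemma eqflat_tw (R : comNzRingType) (T : eqType) (s : seq T) : eqflat (restrict (cst R s) (tw R s)^o).
Proof.
elim: s => [|x s IH]; first exact: eqflat_id.
exact: (eqflat_comp (@eqflat_polyC (tw R s)) IH).
Qed.

Section QuotientFacts.
Variables (R : comPzRingType) (X : set R).
Let pi := quot_pi X : {rmorphism R -> quot_ring X}.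
Lemma pi_surj u : exists x, pi x = u. Proof. exact: quot_pi_surj. Qed.
Lemma pi_eq0 x : pi x = 0 <-> idl X x.
Proof. by rewrite -(rmorph0 pi) quot_piP subr0. Qed.

Lemma quot_noeth : noetherian_ring R -> noetherian_ring (quot_ring X).
Proof.
move=> nR I iI; have [s Js] := nR _ (is_ideal_preim pi iI); exists (map pi s).
apply/seteqP; split=> [u Iu|].
  have [x xu] := pi_surj u; have : idl [set` s] x by rewrite -Js /= xu.
  by rewrite -xu; apply: idl_push => z zs; apply: sub_idl; exact: map_f.
apply: idl_min => // _ /= /mapP[x xs ->].
by suff : [set x | I (pi x)] x by []; rewrite Js; exact: sub_idl.
Qed.

Lemma quot_locr m : locr m -> X `<=` m -> locr (pi @` m).
Proof.
move=> [im m1 mu] Xm; have Xm' : idl X `<=` m by exact: idl_min.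
split.
- apply: is_idealI; first by exists 0; [exact: ideal0|exact: rmorph0].
    by move=> _ _ [x mx <-] [y my <-]; exists (x + y); [exact: idealD|exact: rmorphD].
  by move=> u _ [y my <-]; have [x <-] := pi_surj u; exists (x * y); [exact: idealM|exact: rmorphM].
- move=> [x mx /eqP]; rewrite -(rmorph1 pi) eq_sym -subr_eq0 -rmorphB => /eqP/pi_eq0/Xm' h; apply: m1.
  exact: (ideal_subr im mx h).
- move=> u hu; have [x xu] := pi_surj u; have [|y xy] := mu x; first by move=> mx; apply: hu; exists x.
  by exists (pi y); rewrite -xu -rmorphM xy rmorph1.
Qed.

Lemma quot_regular pre l : idl X = idl [set` pre] -> regp pre l -> regular (map pi l).
Proof.
move=> XE h i; rewrite size_map => il u; have [y <-] := pi_surj u; rewrite (nth_map 0) // -rmorphM -map_take.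
have pull z : idl [set` map pi (take i l)] (pi z) -> idl [set` pre ++ take i l] z.
  move=> /(@idl_image _ _ pi pi_surj _ [set` take i l])[_ /= /mapP[w wl ->]|w hw /eqP].
    by exists w => //; exact: sub_idl.
  rewrite eq_sym -subr_eq0 -rmorphB => /eqP/pi_eq0; rewrite XE => hz.
  rewrite -(subrK w z); apply: idlD; [apply: idl_mono hz|apply: idl_mono hw] => t /= tl; by rewrite mem_cat tl ?orbT.
move=> /pull/(h i il); move=> hy.
have : idl [set` map pi (take i l)] (pi y); last by [].
move: hy; apply: idl_push => z /=; rewrite mem_cat => /orP[zp|zl]; last by apply: sub_idl; exact: map_f.
by rewrite (pi_eq0 z).2; [exact: idl0|rewrite XE; exact: sub_idl].
Qed.
End QuotientFacts.

Lemma krull_dimE (R : comPzRingType) d : prime_chain R d -> (forall n, prime_chain R n -> (n <= d)%N) ->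
  krull_dim R = (Posz d)%:E.
Proof.
move=> hd hmax; rewrite /krull_dim asboolT; last by exists d.
have [k [hk -> kmin]] := @inf_natP (fun N => forall n, prime_chain R n -> (n <= N)%N) d hmax.
by congr (Posz _)%:E; apply/eqP; rewrite eqn_leq (kmin d hmax) (hk d hd).
Qed.

Lemma num_gensE (R : comPzRingType) (M : lmodType R) (N : set M) b (x : 'I_b -> M) : N = span (range x) ->
  (forall k (z : 'I_k -> M), N = span (range z) -> (b <= k)%N) -> num_gens N = (Posz b)%:E.
Proof.
move=> Nx bmin; rewrite /num_gens.
have [|k [[z hz] -> kmin]] := @inf_natP (fun n => exists x : 'I_n -> M, N = span (range x)) b; first by exists x.
congr (Posz _)%:E; apply/eqP; rewrite eqn_leq (bmin k z hz) kmin //; by exists x.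
Qed.

Lemma exact_retract (R : comPzRingType) (N N' : lmodType R) (e : {linear N -> N'}) (p : {linear N' -> N}) C i :
  cancel e p -> exact_at C N' i -> exact_at C N i.
Proof.
move=> ep /exact_atP h; apply/exact_atP => v hv dv.
have [||w hw E] := h [ffun t => e (v t)].
- by move=> t ti; rewrite ffunE hv // linear0.
- by rewrite -act_linear dv; apply/ffunP => t; rewrite !ffunE linear0.
exists [ffun t => p (w t)]; first by move=> t ti; rewrite ffunE hw // linear0.
rewrite -act_linear -E; apply/ffunP => t; by rewrite !ffunE ep.
Qed.
Lemma torvan_retract (R : comPzRingType) (N N' : lmodType R) (e : {linear N -> N'}) (p : {linear N' -> N}) c :
  cancel e p -> torvan c N' -> torvan c N.
Proof. by move=> ep h C okC i ci exC; apply: (exact_retract ep); exact: h. Qed.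

(** If [c + b] were less than [a], or if the resolution were exact over [M] in a positive degree
    [c], the total complex would be exact over [M] in degree [a], against [not_exact]. The length
    [a.+1 + b] is what [not_ymul] consumes. *)
Theorem free_and_codim (R S : comPzRingType) (m : set R) (n : set S) (f : {rmorphism R -> S})
    a (x : 'I_a -> R) b (y : nat -> S) (M : lmodType S) c :
  noetherian_ring R -> locr m -> m = idl (range x) ->
  (forall e : 'I_a -> R, \sum_i e i * x i = 0 -> forall i, m (e i)) ->
  noetherian_ring S -> locr n -> (forall r, m r -> n (f r)) -> (forall j, n (y j)) ->
  (forall r, n r -> exists e : 'I_b -> S, r = \sum_j e j * y j) ->
  dcc (setT : set M) -> (exists u : M, u <> 0) -> torvan c (restrict f M) -> (c + b <= a)%N ->
  [/\ (c + b)%N = a,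
    exists r (nu : 'I_r.+1 -> M) h, [/\ forall u, exists e : 'I_r.+1 -> S, u = \sum_i e i *: nu i,
      forall e : 'I_r.+1 -> S, \sum_i e i *: nu i = 0 -> forall i, e i = 0
      & forall u, ideal_pow n h u -> u = 0]
  & (0 < c)%N -> exists C o, @minres R m (a.+1 + b) C o /\ ~ exact_at C (restrict f M) c].
Proof.
move=> nR lm mx xmin nS ln fmn ny ngen dM [u0 u00] tM cba; pose L := (a.+1 + b)%N.
have [idn _ _] := ln; have [C [o mC]] := minres_exists nR lm mx xmin L.
have sT := submoduleT M.
have N0 : ~ ([set: M] `<=` [set 0]) by move=> h; apply: u00; exact: h.
have aL : (a <= L.+1)%N by rewrite /L; lia.
have [T [tT exT]] := totc_exists lm mx xmin idn fmn ny ngen aL mC.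
have exM i : (c < i <= L)%N -> exact_at C (restrict f M) i.
  move=> /andP[ci iL]; have [okC _ _ exC _] := mC; apply: tM => // s /andP[s0 si]; apply: exC.
  by rewrite s0; exact: leq_trans si iL.
have exTi := exT M c exM.
have exT' i : (a < i <= a.+1 + b)%N -> exq T [set: M] [set 0] i.
  by move=> /andP[ai iL]; apply: exTi; rewrite /L iL andbT; exact: leq_ltn_trans cba ai.
have nex := not_exact nS ln ny ngen sT dM N0 tT exT'.
have ca : (c + b)%N = a.
  apply/eqP; rewrite eqn_leq cba leqNgt; apply/negP => h; apply: nex; apply: exTi; rewrite h /L; lia.
split=> //.
  have [r [nu [h [_ gen ind pow]]]] := free_of_exact nS ln ny ngen sT dM N0 tT exT'.
  by exists r, nu, h; split=> // u; apply/spanP; exact: gen.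
move=> c0; exists C, o; split=> // ex; apply: nex; apply: (exT M c.-1) => [i /andP[ci iL]|].
  case: (eqVneq i c) => [->//|ic]; apply: exM; lia.
by rewrite /L; lia.
Qed.

(** * The complete intersection property *)

Section NilpotentCompletion.
Variables (S : comPzRingType) (n : set S) (h : nat).
Hypotheses (ln : locr n) (nh : forall u, ideal_pow n h u -> u = 0).

Lemma compl_of_inj s : compl_of n s = 0 -> s = 0.
Proof. have [idn _ _] := ln; move=> e; apply: nh; apply/cV_of; rewrite e; exact: (ideal0 (cV_ideal n h)). Qed.

(** As [n^h = 0], an approximation to order [h] is already correct to every order. *)
Lemma compl_of_surj (x : completion n) : exists s, compl_of n s = x.
Proof.
have [idn _ _] := ln; have [t ht] := compl_approx idn x h; exists t.
apply/esym/eqP; rewrite -subr_eq0; apply/eqP; apply: (cf_sep (completion_cfilt idn)) => i.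
case: (leqP i h) => [/ht //|hi]; have [t' ht'] := compl_approx idn x i.
suff -> : t = t' by exact: ht'.
apply/eqP; rewrite -subr_eq0; apply/eqP; apply: nh; apply/cV_of; rewrite rmorphB.
have := idealB (cV_ideal n h) (ht' h (ltnW hi)) (ht h (leqnn h)).
by rewrite opprB addrC addrA subrK.
Qed.

Lemma compl_locr : locr (compl_of n @` n).
Proof.
have [idn n1 un] := ln; split.
- apply: is_idealI; first by exists 0; [exact: ideal0|exact: rmorph0].
    by move=> _ _ [x mx <-] [y my <-]; exists (x + y); [exact: idealD|exact: rmorphD].
  by move=> u _ [y my <-]; have [x <-] := compl_of_surj u; exists (x * y); [exact: idealM|exact: rmorphM].
- move=> [x nx /eqP]; rewrite -(rmorph1 (compl_of n)) -subr_eq0 -rmorphB => /eqP/compl_of_inj/eqP.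
  by rewrite subr_eq0 => /eqP x1; apply: n1; rewrite -x1.
- move=> u hu; have [x xu] := compl_of_surj u; have [|y xy] := un x; first by move=> nx; apply: hu; exists x.
  by exists (compl_of n y); rewrite -xu -rmorphM xy rmorph1.
Qed.
End NilpotentCompletion.

Lemma idl_range (R : comPzRingType) (l : seq R) : idl [set` l] = idl (range (fun i : 'I_(size l) => l`_i)).
Proof.
congr idl; apply/seteqP; split=> [x /= xs|_ [i _ <-]]; last exact: mem_nth.
by move/(nthP 0): (xs) => [i hi <-]; exists (Ordinal hi).
Qed.
Lemma idl_codom (R : comPzRingType) k (x : 'I_k -> R) : idl [set` codom x] = idl (range x).
Proof. by congr idl; apply/seteqP; split=> [_ /= /codomP[i ->]|_ [i _ <-]]; [exists i|exact: codom_f]. Qed.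
Lemma idl_rev (R : comPzRingType) (l : seq R) : idl [set` rev l] = idl [set` l].
Proof. by apply/seteqP; split; apply: idl_mono => x /=; rewrite mem_rev. Qed.
Lemma idl_map_image (A B : comPzRingType) (c : {rmorphism A -> B}) (l : seq A) :
  idl (c @` idl [set` l]) = idl [set` map c l].
Proof.
apply/seteqP; split; apply: idl_min; try exact: idl_ideal.
  by move=> _ [x hx <-]; apply: idl_push hx => y yl; apply: sub_idl; exact: map_f.
by move=> _ /= /mapP[x xl ->]; apply: sub_idl; exists x => //; exact: sub_idl.
Qed.
Lemma idl_nil (R : comPzRingType) : idl [set` ([::] : seq R)] = [set 0].
Proof.
apply/seteqP; split=> [|_ ->]; last exact: idl0.
by apply: idl_min => //; apply: is_idealI => [|u v -> ->|u v ->] //=; rewrite ?addr0 ?mulr0.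
Qed.

Lemma complete_noetherian_pz (R : comPzRingType) (V : nat -> set R) k (mu0 : 'I_k -> R) :
  cfilt V -> locr (V 1%N) -> (forall j, V 1%N (mu0 j)) ->
  (forall N y, V N.+1 y -> exists2 h : 'I_k -> R, forall j, V N (h j) & V N.+2 (y - \sum_j mu0 j * h j)) ->
  noetherian_ring R.
Proof.
move=> cV lV h1 h2; have R1 : (1 : R) <> 0 by case: lV => i1 n1 _ e; apply: n1; rewrite e; exact: ideal0.
move: R R1 V mu0 cV lV h1 h2; apply: (comNz_ind (P := fun R => forall V (mu0 : 'I_k -> R), cfilt V -> locr (V 1%N) ->
  (forall j, V 1%N (mu0 j)) -> (forall N y, V N.+1 y -> exists2 h : 'I_k -> R, forall j, V N (h j) & V N.+2 (y - \sum_j mu0 j * h j)) ->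
  noetherian_ring R)) => R V mu0 cV lV h1 h2.
exact: (complete_noetherian cV lV h1 h2).
Qed.

Section CohenCI.
Variables (R S : comNzRingType) (m : set R) (n : set S) (f : {rmorphism R -> S}).
Hypotheses (nR : noetherian_ring R) (lm : locr m) (ln : locr n) (fmn : forall r, m r -> n (f r)).
Variables (a b c h : nat) (x : 'I_a -> R) (y : 'I_b -> S) (zs : seq R).
Hypotheses (mx : m = idl (range x)) (ny : n = idl (range y)).
Hypotheses (nh : forall u, ideal_pow n h u -> u = 0).
Hypotheses (szs : size zs = c) (cba : (c + b)%N = a) (rzs : regular zs) (zm : forall z, z \in zs -> m z).
Hypothesis fz : forall z, z \in zs -> f z = 0.
(** A ring [L] between [R] and [S] whose maximal ideal has [b] generators is [S] itself. It will
    follow from the freeness of [M] over [L], and is assumed here so that the module stays out of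
    this section. *)
Hypothesis ker_inj : forall (L : comPzRingType) (mL : set L) (fL : {rmorphism R -> L}) (gL : {rmorphism L -> S})
  (yL : 'I_b -> L), noetherian_ring L -> locr mL -> (forall r, m r -> mL (fL r)) -> (forall j, mL (yL j)) ->
  (forall r, mL r -> exists e : 'I_b -> L, r = \sum_j e j * yL j) ->
  (forall r, gL (fL r) = f r) -> (forall s, exists t, gL t = s) -> forall t, gL t = 0 -> t = 0.

Let s := enum 'I_b.
Let A := tw R s.
Let cs : {rmorphism R -> A} := cst R s.
Let vr (j : 'I_b) : A := var R s j.
Let phi : {rmorphism A -> S} := teval f y s.
(** The Cohen ring is built over the polynomial ring [A] rather than over [R]: the image of [m0]
    generates [n], since each variable maps to a generator [y j]. *)
Let m0 : set A := [set p | n (phi p)].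
Let idn : is_ideal n. Proof. by case: ln. Qed.
Let idm : is_ideal m. Proof. by case: lm. Qed.
Let phi_cs r : phi (cs r) = f r. Proof. exact: teval_cst. Qed.
Let phi_vr j : phi (vr j) = y j. Proof. by apply: teval_var; rewrite mem_enum. Qed.
Let nyj j : n (y j). Proof. by rewrite ny; apply: sub_idl; exists j. Qed.
Let ysE k e : e \in ys R s k -> exists j, e = vr j ^+ k.
Proof. by move/(ys_mem (enum_uniq _)) => [j _ ->]; exists j. Qed.
Let fn r : n (f r) -> m r.
Proof.
have [_ n1 _] := ln; have [_ _ um] := lm; move=> nfr; apply: contrapT => /um[r' rr]; apply: n1.
by rewrite -(rmorph1 f) -rr rmorphM; exact: idealMr.
Qed.
Let xs := codom x.
Let mxs : m = idl [set` xs]. Proof. by rewrite mx idl_codom. Qed.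
Let l0 := map cs xs ++ ys R s 1.
Let im0 : is_ideal m0. Proof. exact: is_ideal_preim. Qed.

Let m0E : m0 = idl [set` l0].
Proof.
apply/seteqP; split=> [p hp|].
  have [r hr] := ys_const p.
  have mr : m r.
    apply: fn; rewrite -phi_cs -(subKr (phi p) (phi (cs r))) -rmorphB; apply: idealB => //.
    have : m0 (p - cs r) by move: hr; apply: idl_min => // e /ysE[j ->]; rewrite /m0 /= expr1 phi_vr.
    by [].
  rewrite -(subrK (cs r) p); apply: idlD.
    by apply: idl_mono hr => e /= he; rewrite mem_cat he orbT.
  rewrite mxs in mr; apply: idl_push mr => e he; apply: sub_idl; by rewrite /= mem_cat map_f.
apply: idl_min => // e /=; rewrite mem_cat => /orP[/mapP[r rx ->]|/ysE[j ->]]; rewrite /m0 /=.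
  by rewrite phi_cs; apply: fmn; rewrite mxs; exact: sub_idl.
by rewrite expr1 phi_vr.
Qed.

Let mm0 : maximal_ideal m0.
Proof.
have [_ n1 _] := ln; have [_ _ um] := lm; split=> //; first by rewrite /m0 /= rmorph1.
move=> J iJ J1 m0J; apply/seteqP; split=> // p Jp; have [r hr] := ys_const p.
have hpr : m0 (p - cs r) by move: hr; apply: idl_min => // e /ysE[j ->]; rewrite /m0 /= expr1 phi_vr.
have Jr : J (cs r) by rewrite -(subKr p (cs r)); apply: idealB => //; exact: m0J.
have mr : m r.
  apply: contrapT => /um[r' rr]; apply: J1; by rewrite -(rmorph1 cs) -rr rmorphM; exact: idealMr.
rewrite -(subrK (cs r) p); apply: idealD => //; by rewrite /m0 /= phi_cs; exact: fmn.
Qed.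

Theorem cohen_ci : complete_intersection_map m n f /\ krull_dim R = (Posz c)%:E.
Proof.
have [_ n1 un] := ln; have [_ m1 um] := lm.
have nA : noetherian_ring A by exact: noetherian_tw.
have phin : n `<=` idl (phi @` m0).
  rewrite {1}ny; apply: idl_min; first exact: idl_ideal.
  by move=> _ [j _ <-]; rewrite -phi_vr; apply: sub_idl; exists (vr j) => //; rewrite /m0 /= phi_vr.
have [R' [V [cc [g [cV [gc gs] V1g hV NV]]]]] := cohen_ring nA mm0 ln nh (fun _ h => h) phin.
have iV := cf_ideal cV.
have lV : locr (V 1%N).
  split=> [||t ht]; [exact: iV|by move/V1g; rewrite rmorph1|].
  have [w gw] : exists w, g t * w = 1 by apply: un => ht'; apply: ht; apply/V1g.
  have [t' gt'] := gs w; have [|u hu] := @cf_unit _ _ cV (1 - t * t').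
    by apply/V1g; rewrite rmorphB rmorph1 rmorphM gt' gw subrr; exact: ideal0.
  by exists (t' * u); rewrite mulrA; move: hu; rewrite subKr.
have [_ V1 uV] := lV.
have cm p : m0 p -> V 1%N (cc p) by move=> hp; apply/V1g; rewrite gc.
have [k [mu0 mu0E]] := (noethR A).1 nA m0 im0.
have nR' : noetherian_ring R'.
  apply: (complete_noetherian_pz (mu0 := cc \o mu0) cV lV) => [j|N t tN].
    by apply: cm; rewrite mu0E; apply: sub_span; exists j.
  exact: (cf_step cV mu0E cm hV tN).
have V1E : V 1%N = idl (cc @` m0) by exact: (cf_max_ideal cV mu0E cm hV).
have V1l : V 1%N = idl [set` map cc l0] by rewrite V1E m0E idl_map_image.
have cflat : eqflat (restrict cc R'^o) by exact: (flat_criterion nA mm0 nR' lV cm V1E NV).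
pose f1 : {rmorphism R -> R'} := cc \o cs.
have f1flat : eqflat (restrict f1 R'^o) by exact: (@eqflat_comp _ _ cc cflat R cs (@eqflat_tw R _ s)).
have gf1 r : g (f1 r) = f r by rewrite /f1 /= gc phi_cs.
have f1m r : m r -> V 1%N (f1 r) by move=> mr; apply/V1g; rewrite gf1; exact: fmn.
pose Y j := cc (vr j); have gY j : g (Y j) = y j by rewrite /Y gc phi_vr.
have VY j : V 1%N (Y j) by apply/V1g; rewrite gY.
(* A regular sequence of length [a], by flatness over the tower. With [kk = h] it lies in the kernel
   of [g], as [f] kills [zs] and [n^h = 0]; with [kk = 1] it serves to build prime chains. *)
have reg kk : regular (map cc (map cs zs ++ ys R s kk)).
  apply: (regular_push cflat); apply: regular_cat; [exact: regular_cst|exact: regp_ys].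
have size_rho kk : size (map cc (map cs zs ++ ys R s kk)) = a.
  by rewrite size_map size_cat size_map szs size_ys size_enum_ord.
(* The [X i] generate the kernel of [g]: apply [ker_inj] to the quotient of [R'] by them. *)
have /choice[d hd] i : exists d : 'I_b -> S, f (x i) = \sum_j d j * y j.
  have : n (f (x i)) by apply: (fmn); rewrite mx; apply: sub_idl; exists i.
  by rewrite ny => /(@spanP S S^o)[d E]; exists d.
have /choice[D hD] (ij : 'I_a * 'I_b) : exists t, g t = d ij.1 ij.2 by exact: gs.
pose X i := f1 (x i) - \sum_j D (i, j) * Y j.
have gX i : g (X i) = 0.
  rewrite rmorphB gf1 hd rmorph_sum; apply/eqP; rewrite subr_eq0; apply/eqP; apply: eq_bigr => j _.
  by rewrite rmorphM hD gY.
pose lX := codom X; have szX : size lX = a by rewrite size_codom card_ord.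
have gl t : t \in lX -> g t = 0 by move=> /codomP[i ->].
have VX t : t \in lX -> V 1%N t by move=> /gl e; apply/V1g; rewrite e; exact: ideal0.
have kerg t : g t = 0 <-> idl [set` lX] t.
  split; last by move=> ht; apply: (idl_ker (A := [set` lX])) ht.
  have [gL gLE] := quot_lift (A := [set` lX]) gl.
  pose pi := quot_pi [set` lX] : {rmorphism _ -> _}.
  have piX i : pi (X i) = 0 by apply/pi_eq0; apply: sub_idl; exact: codom_f.
  move=> gt; apply/pi_eq0; apply: (@ker_inj _ (pi @` V 1%N) (pi \o f1) gL (pi \o Y)).
  - exact: quot_noeth.
  - by apply: quot_locr.
  - by move=> r mr; exists (f1 r) => //; exact: f1m.
  - by move=> j; exists (Y j).
  - move=> _ [v + <-]; rewrite V1l; move: v.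
    apply: (idl_min (I := [set v | exists e : 'I_b -> quot_ring [set` lX], pi v = \sum_j e j * (pi \o Y) j])).
      apply: is_idealI.
      - by exists (fun=> 0); rewrite rmorph0 big1 // => j _; rewrite mul0r.
      - move=> u v [e E] [e' E']; exists (fun j => e j + e' j); rewrite rmorphD E E' -big_split.
        by apply: eq_bigr => j _; rewrite mulrDl.
      - move=> u v [e E]; exists (fun j => pi u * e j); rewrite rmorphM E mulr_sumr.
        by apply: eq_bigr => j _; rewrite mulrA.
    move=> v /= /mapP[w]; rewrite mem_cat => /orP[/mapP[r /codomP[i ->] ->]|/ysE[j ->]] ->.
      exists (fun j => pi (D (i, j))); apply/eqP; rewrite -subr_eq0; apply/eqP.
      rewrite -[RHS](piX i) rmorphB; congr (_ - _); rewrite rmorph_sum; apply: eq_bigr => j _.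
      by rewrite rmorphM.
    exists (fun i => (i == j)%:R); rewrite expr1 (bigD1 j) //= eqxx mul1r big1 ?addr0 // => i /negbTE->.
    by rewrite mul0r.
  - by move=> r; rewrite [LHS]gLE.
  - by move=> u; have [t' <-] := gs u; exists (pi t'); rewrite gLE.
  - by rewrite gLE.
have rhoX t : t \in map cc (map cs zs ++ ys R s h) -> idl [set` lX] t.
  move=> /mapP[w]; rewrite mem_cat => hw ->; apply/kerg; rewrite gc.
  case/orP: hw => [/mapP[z /fz zz ->]|/ysE[j ->]]; first by rewrite phi_cs.
  by rewrite rmorphXn phi_vr; apply: nh; exact: mem_pow.
(* The ideal of [lX] contains a regular sequence of the same length as [lX], so the Koszul complex
   of [lX] is exact in positive degrees. *)
have regX : regular (rev lX).
  apply: (kos_regular nR' lV VX) => i i0.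
  have := kos_depth (l := lX) (pre := [::]) (reg h) rhoX (i := i).
  by rewrite size_rho szX subnn idl_nil; exact.
have dimR' N : prime_chain R' N -> (N <= a)%N.
  rewrite -szX; apply: (dim_le nR' (N := h) lV) => // v hv; apply/kerg; apply: nh.
  by apply: pow_push hv => t /V1g.
have prV := locr_prime lV.
have inV P : prime_ideal P -> P `<=` V 1%N.
  move=> [iP P1 _] t Pt; apply: contrapT => /uV[t' tt]; apply: P1; rewrite -tt; exact: idealMr.
have dimR : krull_dim R = (Posz c)%:E.
  apply: krull_dimE.
    have [|p [cp _]] := regular_chain nR rzs (locr_prime lm) => //.
    by exists p; rewrite -szs.
  (* If [r] were not nilpotent modulo [zs], a prime over [zs] missing [r] would yield a prime of
     [R'] that misses [f1 r] and contains a regular sequence of length [a]. With the maximal ideal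
     on top this makes a chain of length [a.+1], too long for [R']. *)
  have nil r : m r -> exists i, idl [set` zs] (r ^+ i).
    move=> mr; apply: contrapT => no.
    have [||||p [pp zp pr]] := @prime_disjoint R nR (idl [set` zs]) [set t | exists i, t = r ^+ i].
    - exact: idl_ideal.
    - by exists 0%N.
    - by move=> _ _ [i ->] [j ->]; exists (i + j)%N; rewrite exprD.
    - by move=> t ht [i E]; apply: no; exists i; rewrite -E.
    have [ip p1 pM] := pp; have [pl plE] := @nR _ ip.
    pose lp := map cc (map cs pl ++ ys R s 1).
    have colr t : idl [set` lp] (f1 r * t) -> idl [set` lp] t.
      apply: (colon_push cflat) => u; apply: colon_ys => w; rewrite -plE => /pM[] // h'.
      by case: (pr r h'); exists 1%N; rewrite expr1.
    have lpV : idl [set` lp] `<=` V 1%N.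
      apply: idl_min; first exact: iV.
      move=> _ /= /mapP[w + ->]; rewrite mem_cat => /orP[/mapP[q qp ->]|/ysE[j ->]].
        apply: f1m; apply: contrapT => /um[q' qq]; apply: p1; rewrite -qq; apply: idealMr => //.
        by rewrite plE; exact: sub_idl.
      by rewrite expr1; exact: VY.
    have [||||P [pP lP Pr]] := @prime_disjoint R' nR' (idl [set` lp]) [set t | exists i, t = f1 r ^+ i].
    - exact: idl_ideal.
    - by exists 0%N.
    - by move=> _ _ [i ->] [j ->]; exists (i + j)%N; rewrite exprD.
    - move=> t + [i E]; rewrite {}E => ht; apply: V1; apply: lpV.
      by elim: i ht => [|i IH]; rewrite ?expr0 // exprS => /colr.
    have [iP P1 _] := pP.
    have [|q [[qp qi] qE]] := regular_chain nR' (reg 1%N) pP.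
      move=> _ /mapP[w + ->]; rewrite mem_cat => /orP[/mapP[z zz ->]|wy].
        apply: lP; have : p z by apply: zp; exact: sub_idl.
        rewrite plE; apply: (idl_push (f := f1)) => t tp; apply: sub_idl; apply/mapP; exists (cs t) => //.
        by rewrite mem_cat map_f.
      by apply: lP; apply: sub_idl; apply: map_f; rewrite mem_cat wy orbT.
    rewrite size_rho in qp qi qE; suff /dimR' : prime_chain R' a.+1 by rewrite ltnn.
    exists (fun i => if (i <= a)%N then q i else V 1%N); split=> i hi; first by case: leqP => // h'; exact: qp.
    case: (ltnP i a) => h'; first by rewrite (ltnW h'); exact: qi.
    have -> : i = a by lia.
    rewrite leqnn qE; split; first exact: inV.
    by move=> VP; apply: (Pr (f1 r)); [apply: VP; exact: f1m|exists 1%N; rewrite expr1].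
  have [N hN] := pow_nil nR idm (idl_ideal [set` zs]) nil.
  by move=> i; rewrite -szs; exact: (dim_le nR lm hN zm).
split=> //; pose f2 : {rmorphism R' -> completion n} := compl_of n \o g.
have f20 t : f2 t = 0 <-> g t = 0.
  by split=> [/(compl_of_inj ln nh)|e] //; rewrite /f2 /= e rmorph0.
exists R', f1, f2; split; last first.
  exists (rev lX); split.
    split; first exact: regX.
    by rewrite idl_rev => h'; apply: V1; move: h'; apply: idl_min => //; exact: iV.
  by apply/seteqP; split=> t; rewrite idl_rev => h'; [apply/kerg/f20|apply/f20/kerg].
split; first by move=> r; rewrite /f2 /= gf1.
exists (V 1%N), (compl_of n @` n); split.
- by split=> //; exact: locr_local.
- by apply: locr_local; exact: (compl_locr ln nh).
- split=> [_ [r mr <-]|_ [t ht <-]]; first exact: f1m.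
  by exists (g t) => //; apply/V1g.
- split; first exact: eqflat_flat.
  (* The closed fibre is regular of dimension [b]: the images of the [b] variables are a regular
     sequence generating its maximal ideal, and Krull's height theorem shows that fewer generators
     cannot do. *)
  have X0V : f1 @` m `<=` V 1%N by move=> _ [r mr <-]; exact: f1m.
  have nD := quot_noeth (X := f1 @` m) nR'.
  have lD := quot_locr lV X0V; pose pi := quot_pi (f1 @` m) : {rmorphism _ -> _}.
  have X0E : idl (f1 @` m) = idl [set` map cc (map cs xs)] by rewrite mxs (idl_map_image f1) -map_comp.
  pose lY := map pi (map cc (ys R s 1)).
  have rY : regular lY by exact: (quot_regular X0E (regp_push cflat (@regp_ys R _ s 1 xs))).
  have szY : size lY = b by rewrite !size_map size_ys size_enum_ord.
  have mDE : pi @` V 1%N = idl [set` lY].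
    have [iD _ _] := lD; apply/seteqP; split.
      move=> _ [v + <-]; rewrite V1l; apply: idl_push => v0 /= /mapP[w]; rewrite mem_cat => hw ->.
      case/orP: hw => [hw|hw]; last by apply: sub_idl; apply: map_f; exact: map_f.
      have -> : pi (cc w) = 0; last exact: idl0.
      by apply/pi_eq0; rewrite X0E; apply: sub_idl; exact: map_f.
    apply: idl_min => // _ /= /mapP[_ /mapP[w /ysE[j ->] ->] ->]; exists (cc (vr j ^+ 1)) => //.
    by rewrite expr1; exact: VY.
  have inD t : t \in lY -> (pi @` V 1%N) t by move=> ht; rewrite mDE; exact: sub_idl.
  have dimD : krull_dim (quot_ring (f1 @` m)) = (Posz b)%:E.
    apply: krull_dimE.
      have [p [cp _]] := regular_chain nD rY (locr_prime lD) inD.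
      by exists p; rewrite -szY.
    move=> N; rewrite -szY; apply: (dim_le nD (N := 1%N) lD) => //.
    by have [iD _ _] := lD; rewrite ideal_pow1 // mDE.
  split=> //; exists (pi @` V 1%N); split; first exact: locr_local.
  rewrite dimD; have szY' := szY; rewrite /edim.
  have -> : (Posz b)%:E = (Posz (size lY))%:E :> \bar int by rewrite szY.
  apply: (@num_gensE _ (quot_ring (f1 @` m))^o (pi @` V 1%N) (size lY) (fun i => lY`_i)); first by rewrite mDE idl_range.
  move=> kk z zE; have [p [cp _]] := regular_chain nD rY (locr_prime lD) inD.
  have -> : kk = size (codom z) by rewrite size_codom card_ord.
  apply: (dim_le nD (N := 1%N) lD); last by exists p.
    by have [iD _ _] := lD; rewrite ideal_pow1 // idl_codom zE.
  by move=> t /codomP[i ->]; rewrite zE; apply: sub_span; exists i.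
apply/seteqP; split=> // u _; have [w <-] := compl_of_surj ln nh u; have [t gt] := gs w.
by exists t => //; rewrite /f2 /= gt.
Qed.
End CohenCI.

(** * Transfer along bases and restrictions, and conclusion *)

Lemma inf_nat_le (P : nat -> Prop) (z : int) : (inf_nat P <= z%:E)%E ->
  exists k, [/\ P k, inf_nat P = (Posz k)%:E, forall k', P k' -> (k <= k')%N & (Posz k <= z)%R].
Proof.
case: (pselect (exists k, P k)) => [[k0 h0]|no].
  have [k [Pk e kmin]] := inf_natP h0; rewrite e lee_fin => kz; by exists k.
have -> : inf_nat P = +oo%E; last by [].
by rewrite /inf_nat; case: pselect => // h; case: no; have [k /asboolP hk] := h; exists k.
Qed.

Lemma nat_family (S : comPzRingType) (n : set S) b (y : 'I_b -> S) : is_ideal n -> (forall j, n (y j)) ->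
  exists y' : nat -> S, (forall j, n (y' j)) /\ forall j : 'I_b, y' j = y j.
Proof.
move=> idn ny; exists (fun j => if insub j is Some i then y i else 0); split=> j; last by rewrite valK.
by case: insub => [i|]; [exact: ny|exact: ideal0].
Qed.

Lemma mk_linear (R : pzRingType) (U V : lmodType R) (h : U -> V) :
  (forall a u v, h (a *: u + v) = a *: h u + h v) -> exists g : {linear U -> V}, forall u, g u = h u.
Proof.
move=> hl; pose H := GRing.isLinear.Build R U V *:%R h hl.
by exists (HB.pack h H : {linear U -> V}).
Qed.

(** Both modules have the same elements and scalings that agree only by the equation on the ring
    maps; the identity functions make each a retract of the other. *)
Lemma torvan_restrict (R S L : comPzRingType) (f : {rmorphism R -> S}) (fL : {rmorphism R -> L})
  (gL : {rmorphism L -> S}) (M : lmodType S) c : (forall r, gL (fL r) = f r) ->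
  torvan c (restrict f M) -> torvan c (restrict fL (restrict gL M)).
Proof.
move=> gf; have [|e he] := @mk_linear R (restrict fL (restrict gL M)) (restrict f M) id.
  by move=> r u v; rewrite -[r *: u]/(gL (fL r) *: (u : M)) gf.
have [|p hp] := @mk_linear R (restrict f M) (restrict fL (restrict gL M)) id.
  by move=> r u v; rewrite -[RHS]/(gL (fL r) *: (u : M) + v) gf.
by apply: (@torvan_retract _ _ _ e p) => u; rewrite hp he.
Qed.

Lemma dcc_restrict (L S : comPzRingType) (gL : {rmorphism L -> S}) (M : lmodType S) :
  (forall s, exists t, gL t = s) -> dcc (setT : set M) -> dcc (setT : set (restrict gL M)).
Proof.
move=> gs dM U sU _ dU; apply: (dM U) => // i; have [U0 UD UZ] := sU i; split=> // s u hu.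
by have [t <-] := gs s; exact: (UZ t u hu).
Qed.

Section Basis.
Variables (S : comNzRingType) (M : lmodType S) (r : nat) (nu : 'I_r.+1 -> M).
Hypotheses (gen : forall u, exists e : 'I_r.+1 -> S, u = \sum_i e i *: nu i).
Hypothesis ind : forall e : 'I_r.+1 -> S, \sum_i e i *: nu i = 0 -> forall i, e i = 0.

Lemma basis_coord : exists co : M -> 'I_r.+1 -> S,
  [/\ forall u, u = \sum_i co u i *: nu i, forall e i, co (\sum_i e i *: nu i) i = e i
    & forall s u v i, co (s *: u + v) i = s * co u i + co v i].
Proof.
have /choice[co hco] := gen; exists co.
have uniq e u i : \sum_i e i *: nu i = u -> co u i = e i.
  move=> E; apply/eqP; rewrite -subr_eq0; apply/eqP; apply: (ind (e := fun i => co u i - e i)).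
  under eq_bigr => j _ do rewrite scalerBl.
  by rewrite sumrB -hco E subrr.
split=> [//|e i|s u v i]; first exact: uniq.
apply: (uniq (fun i => s * co u i + co v i)); rewrite [in RHS](hco u) [in RHS](hco v) scaler_sumr -big_split.
by apply: eq_bigr => j _; rewrite scalerDl scalerA.
Qed.

Lemma mu_basis : mu M = (Posz r.+1)%:E.
Proof.
apply: (num_gensE (x := nu)).
  by apply/seteqP; split=> // u _; apply/spanP; exact: gen.
move=> k z zT; have [co [coE coK coL]] := basis_coord.
have co0 i : co 0 i = 0.
  by have := coL (-1) 0 0 i; rewrite scaler0 addr0 mulN1r addNr.
have coS (c : 'I_k -> S) i : co (\sum_j c j *: z j) i = \sum_j c j * co (z j) i.
  by apply: (big_rec2 (fun u s => co u i = s)) => // j s u _ <-; rewrite coL.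
have /choice[A hA] i : exists c : 'I_k -> S, nu i = \sum_j c j *: z j by apply/spanP; rewrite -zT.
(* Expressing the basis through [z] and taking coordinates of [z] gives two matrices with product
   the identity of size [r.+1], which bounds [k] from below. *)
apply: (@mulmx1_min _ _ _ (\matrix_(i, j) A i j) (\matrix_(j, i) co (z j) i)).
apply/matrixP => i i'; rewrite !mxE; under eq_bigr => j _ do rewrite !mxE.
rewrite -coS -hA -(coK (fun i' => (i == i')%:R) i'); congr (co _ i').
by rewrite (bigD1 i) //= eqxx scale1r big1 ?addr0 // => t /negbTE; rewrite eq_sym => ->; rewrite scale0r.
Qed.

Lemma basis_row : exists phi : {linear M -> 'rV[S]_r.+1}, bijective phi.
Proof.
have [co [coE coK coL]] := basis_coord.
have [|phi hphi] := @mk_linear S M 'rV[S]_r.+1 (fun u => \row_i co u i).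
  by move=> s u v; apply/rowP => i; rewrite !mxE coL.
exists phi, (fun w : 'rV_r.+1 => \sum_i w 0 i *: nu i) => [u|w]; rewrite hphi.
  by rewrite [RHS]coE; apply: eq_bigr => i _; rewrite mxE.
by apply/rowP => i; rewrite mxE (coK (fun i => w 0 i)).
Qed.

(** [S] is a retract of [M], through the first basis vector and the first coordinate. *)
Lemma basis_torvan (R : comPzRingType) (f : {rmorphism R -> S}) c :
  torvan c (restrict f M) -> torvan c (restrict f S^o).
Proof.
have [co [coE coK coL]] := basis_coord.
have [|e he] := @mk_linear R (restrict f S^o) (restrict f M) (fun s => (s : S) *: nu 0).
  by move=> q u v; rewrite -[LHS]/((f q * (u : S) + (v : S)) *: nu 0) scalerDl -scalerA.
have [|p hp] := @mk_linear R (restrict f M) (restrict f S^o) (fun u => co u 0).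
  by move=> q u v; exact: coL.
apply: (@torvan_retract _ _ _ e p) => s; rewrite hp he.
rewrite -[RHS](coK (fun i => if i == 0 then s else 0) 0); congr (co _ 0).
by rewrite (bigD1 0) //= big1 ?addr0 // => i /negbTE->; rewrite scale0r.
Qed.

Lemma basis_dcc : dcc (setT : set M) -> dcc (setT : set S^o).
Proof.
have [co [coE coK coL]] := basis_coord.
move=> dM U sU _ dU; have co0 : co 0 0 = 0.
  by have := coL (-1) 0 0 0; rewrite scaler0 addr0 mulN1r addNr.
have [|//||i hi] := dM (fun i => [set u | U i (co u 0)]).
- move=> i; have [U0 UD UZ] := sU i; split=> [|u v hu hv|s u hu] /=; first by rewrite co0.
    by rewrite -(scale1r u) coL mul1r; exact: UD.
  by rewrite -(addr0 (s *: u)) coL co0 addr0; exact: (UZ s _ hu).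
- by move=> i u /dU.
exists i => j ij s Us; have cs : co (s *: nu 0) 0 = s.
  rewrite -[RHS](coK (fun i => if i == 0 then s else 0) 0); congr (co _ 0).
  by rewrite (bigD1 0) //= big1 ?addr0 // => t /negbTE->; rewrite scale0r.
by have := hi j ij (s *: nu 0); rewrite /= cs; apply.
Qed.
End Basis.

(* A predicate of the two rings only, so that [comNz_ind] lets both be nonzero. *)
Definition corollary_for (R S : comPzRingType) : Prop :=
  forall (m : set R) (n : set S) (f : {rmorphism R -> S}) (M : lmodType S),
  noetherian_ring R -> local_ring m -> noetherian_ring S -> local_ring n -> f @` m `<=` n ->
  artinian M -> (exists x : M, x <> 0) ->
  (flat_dim (restrict f M) <= edim m - edim n)%E ->
  [/\ exists2 r : nat, mu M = (Posz r)%:E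
        & exists phi : {linear M -> 'rV[S]_r}, bijective phi,
      exceptional_complete_intersection_map m n f,
      flat_dim (restrict f M) = (edim m - edim n)%E /\
      (edim m - edim n)%E = flat_dim (restrict f S^o)
    & flat (restrict f M) -> edim m = edim n /\ flat_morphism f].

Lemma corollary_nonzero (R S : comNzRingType) : corollary_for R S.
Proof.
move=> m n f M nR lR nS lS fmn0 aM M0 fd.
have lm := local_locr nR lR; have ln := local_locr nS lS.
have [idm _ _] := lm; have [idn n1 _] := ln.
have fmn r : m r -> n (f r) by move=> mr; apply: fmn0; exists r.
have [a [x [mx ea xmin]]] := mingen lm ((noethR R).1 nR m idm).
have [b [y [ny eb _]]] := mingen ln ((noethR S).1 nS n idn).
have em : edim m = (Posz a)%:E by exact: ea.
have en : edim n = (Posz b)%:E by exact: eb.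
move: fd; rewrite em en -EFinB => fd.
have [k [hk ek kmin kab]] := inf_nat_le fd.
have kb : (k + b <= a)%N by move: kab; lia.
have tM : torvan k (restrict f M) by exact: flat_res_torvan hk.
have dM : dcc (setT : set M).
  by move=> U sU _ dU; have [i hi] := aM U sU dU; exists i => j ij; rewrite (hi j ij).
have nyj j : n (y j) by rewrite ny; apply: sub_span; exists j.
have [yn [nyn ynE]] := nat_family idn nyj.
have ngen r : n r -> exists e : 'I_b -> S, r = \sum_j e j * yn j.
  rewrite {1}ny => /(@spanP S S^o)[e E]; exists e; rewrite E; by apply: eq_bigr => j _; rewrite ynE.
have [kba [r [nu [h0 [gen ind pow0]]]] soc] := free_and_codim nR lm mx xmin nS ln fmn nyn ngen dM M0 tM kb.
(* The exponent is made positive so that [m^h] lies in [m]. *)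
pose h := h0.+1; have pow u : ideal_pow n h u -> u = 0 by move=> /(ideal_powS idn)/pow0.
have [|z [sz rz zmh]] := @regular_exists R m nR lm k h isT.
  move=> z u zk rz zm zu hu; have k0 : (0 < k)%N by lia.
  have [C [o [mC nex]]] := soc k0.
  have cL : (k.+1 <= a.+1 + b)%N by lia.
  exact: (socle_of_torvan lm mC tM cL zk rz nex zu hu).
have fz t : t \in rev z -> f t = 0.
  by rewrite mem_rev => /zmh ht; apply: pow; exact: (pow_push fmn ht).
have zm t : t \in rev z -> m t.
  by rewrite mem_rev => /zmh; rewrite -{2}(ideal_pow1 idm); exact: (@ideal_pow_le _ m 1 h idm).
have szr : size (rev z) = k by rewrite size_rev.
have [ci dimR] : complete_intersection_map m n f /\ krull_dim R = (Posz k)%:E.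
  (* Over an intermediate ring [L] the module [M] is again free, by the same bound on flat
     dimension; an element of the kernel of [L -> S] kills the basis vector [nu' 0], so it is
     zero. *)
  apply: (cohen_ci nR lm ln fmn mx ny pow szr kba rz zm fz) => L mL fL gL yL nL lL fLm yLm Lgen gf gs t gt.
  have [idL _ _] := lL; have [yl [yln ylE]] := nat_family idL yLm.
  have [|_ [r' [nu' [h' [_ ind' _]]]] _] := free_and_codim (M := restrict gL M) nR lm mx xmin nL lL fLm yln _
    (dcc_restrict gs dM) M0 (torvan_restrict gf tM) kb.
    by move=> w /Lgen[e ->]; exists e; apply: eq_bigr => j _; rewrite ylE.
  have := ind' (fun i => if i == 0 then t else 0); move=> /(_ _ 0); apply.
  rewrite (bigD1 0) //= big1 ?addr0; last by move=> i /negbTE->; rewrite scale0r.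
  by rewrite -[LHS]/(gL t *: (nu' 0 : M)) gt scale0r.
have dimS : krull_dim S = (Posz 0)%:E.
  apply: krull_dimE; first by exists (fun=> n); split=> // i _; exact: locr_prime.
  by move=> N; apply: (dim_le nS (l := [::]) (N := h) ln) => // v /pow->; exact: idl0.
have tS : torvan k (restrict f S^o) by exact: (basis_torvan gen ind tM).
have [k' [hk' ek' kmin']] := inf_natP (torvan_flat_res nR tS).
have dS : dcc (setT : set S^o) by exact: (basis_dcc gen ind dM).
(* As a retract of [M], [S] has flat dimension at most [k], so the numerical equality holds for [S]
   too: [k' + b = a = k + b]. *)
have kk' : k' = k.
  have k'k : (k' <= k)%N by apply: kmin'; exact: (torvan_flat_res nR tS).
  have [|||k'ba _ _] := free_and_codim (M := S^o) (c := k') nR lm mx xmin nS ln fmn nyn ngen dS.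
  - by exists 1; apply/eqP; exact: oner_neq0.
  - exact: flat_res_torvan.
  - lia.
  by lia.
have kE : (Posz k)%:E = (Posz a - Posz b)%:E :> \bar int by congr _%:E; lia.
split.
- by exists r.+1; [exact: mu_basis gen ind|exact: basis_row gen ind].
- by split=> //; rewrite em en dimR dimS -!EFinB; congr _%:E; lia.
- by split; rewrite -kE //; rewrite -kk'; exact: esym.
- move=> fM; have k0 : k = 0%N by apply/eqP; rewrite -leqn0; apply: kmin; apply: flat_res0; exact: flat_eqflat.
  split; first by congr (Posz _)%:E; lia.
  by apply: eqflat_flat; apply: (torvan0_eqflat nR); rewrite -k0.
Qed.

Theorem corollary3p13 (R S : comPzRingType) (m : set R) (n : set S)
    (f : {rmorphism R -> S}) (M : lmodType S) :
  noetherian_ring R -> local_ring m ->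
  noetherian_ring S -> local_ring n ->
  f @` m `<=` n ->
  artinian M -> (exists x : M, x <> 0) ->
  (flat_dim (restrict f M) <= edim m - edim n)%E ->
  [/\ exists2 r : nat, mu M = (Posz r)%:E
        & exists phi : {linear M -> 'rV[S]_r}, bijective phi,
      exceptional_complete_intersection_map m n f,
      flat_dim (restrict f M) = (edim m - edim n)%E /\
      (edim m - edim n)%E = flat_dim (restrict f S^o)
    & flat (restrict f M) -> edim m = edim n /\ flat_morphism f].
Proof.
(* Local rings are nonzero, so both rings may be given the structure over which polynomials are
   available. *)
move=> nR lR nS lS; have n1 (A : comPzRingType) (I : set A) : noetherian_ring A -> local_ring I -> (1 : A) <> 0.
  by move=> nA /(local_locr nA)[iI I1 _] e; apply: I1; rewrite e; exact: ideal0.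
have R1 := n1 _ _ nR lR; have S1 := n1 _ _ nS lS; move: m n f M nR lR nS lS.
suff : corollary_for R S by [].
apply: (comNz_ind (P := fun R => corollary_for R S)) R1 => {}R; move: S S1.
by apply: (comNz_ind (P := fun S => corollary_for R S)) => S; exact: corollary_nonzero.
Qed.
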